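(* Let $\mathcal{H}\subseteq\mathcal{M}_d$ be a hyperbolic component, let $[f_n]\in\mathcal{H}$ be a degenerating sequence with markings $\phi_n$, and let $F$ be the associated limiting map on ${}^r\mathbb{H}^3$. If $C\in\mathscr{S}$ is a periodic cycle, then $$L(C,F)=\lim_\omega \frac{L(C,[f_n])}{r([f_n])}.$$ Moreover, every cycle of repelling periodic ends of $F$ is represented by some cycle $C\in\mathscr{S}$, i.e. equals $\phi(C)$ for some $C\in\mathscr{S}$.
   Context: Here $d\ge2$, $\omega$ is a fixed non-principal ultrafilter on $\mathbb{N}$, and $\mathcal{M}_d=\mathrm{Rat}_d(\mathbb{C})/\mathrm{PSL}_2(\mathbb{C})$ (conjugacy classes of degree $d$ rational maps). A sequence in $\mathcal{M}_d$ is degenerating if it leaves every compact set. Hyperbolic components and lengths. $[f]$ is hyperbolic if every critical point of $f$ converges to an attracting periodic cycle; a hyperbolic component $\mathcal{H}$ is a connected component of the set of hyperbolic classes. There is a topological dynamical system $\sigma:J\to J$ (the topological model) such that for each $[f]\in\mathcal{H}$ there is a homeomorphism $\phi(f):J\to J(f)$ conjugating $\sigma$ to $f$; a choice of such a homeomorphism is a marking. $\mathscr{S}$ is the set of periodic cycles of $\sigma$. For $C\in\mathscr{S}$ with $|C|=q$ and marking $\phi$, $L(C,[f])=\log|(f^q)'(z)|$ for $z\in\phi(C)$. Barycentric extension. $\mathbb{H}^3$ is hyperbolic 3-space (ball model with centre $\mathbf 0$, ideal boundary $S^2=\hat{\mathbb{C}}$). A probability measure $\mu$ on $S^2$ without atoms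 of mass $\ge1/2$ has a unique barycenter $y\in\mathbb{H}^3$, characterized by $\int_{S^2}\zeta\,dM_*\mu(\zeta)=0$ for $M\in\mathrm{PSL}_2(\mathbb{C})$ with $M(y)=\mathbf 0$. $\mathscr{E}f:\mathbb{H}^3\to\mathbb{H}^3$ sends $x$ to the barycenter of $f_*(M_x)_*\mu_{S^2}$, where $M_x\in\mathrm{PSL}_2(\mathbb{C})$, $M_x(\mathbf 0)=x$, and $\mu_{S^2}$ is the normalized spherical measure. It is $Cd$-Lipschitz with $C$ universal. Limiting map. Let $r([f])=\inf_{x\in\mathbb{H}^3}\max_{y\in(\mathscr{E}f)^{-1}(x)}d_{\mathbb{H}^3}(x,y)$; for a degenerating sequence $r_n:=r([f_n])\to\infty$. Choose representatives $f_n$ with $\max_{y\in(\mathscr{E}f_n)^{-1}(\mathbf 0)}d_{\mathbb{H}^3}(\mathbf 0,y)\le r_n+1$. ${}^r\mathbb{H}^3=\lim_\omega(\mathbb{H}^3,\mathbf 0,d_{\mathbb{H}^3}/r_n)$ is the asymptotic cone: points are classes $[(x_n)]$ of sequences with $d_{\mathbb{H}^3}(\mathbf 0,x_n)/r_n$ bounded, with distance $d([(x_n)],[(y_n)])=\lim_\omega d_{\mathbb{H}^3}(x_n,y_n)/r_n$ (sequences at distance $0$ identified), base point $x^0=[(\mathbf 0)]$. It is an $\mathbb{R}$-tree. $F([(x_n)])=[(\mathscr{E}f_n(x_n))]$. Ends. A ray is an isometric embedding of $[0,\infty)$ into ${}^r\mathbb{H}^3$; two rays are equivalent if their images intersect in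 a ray; ends are equivalence classes. A sequence of points $x_i$ converges to an end $\alpha$ if for every ray $\beta$ representing $\alpha$, $x_i\in\beta$ for all large $i$. A sequence $z_n\in\hat{\mathbb{C}}$ defines the end of the ray $t\mapsto[(\gamma(tr_n,z_n))]$, where $\gamma(s,z)$ is the point at distance $s$ from $\mathbf 0$ in the direction of $z$. For every ray $\alpha$, $F$ is, far enough along $\alpha$, a homeomorphism onto a ray expanding distances by a constant positive integer factor, so $F$ acts on ends. The translation length of an end is $L(\alpha,F)=\lim_{x_i\to\alpha}\bigl(d(x_i,x^0)-d(F(x_i),x^0)\bigr)\in[-\infty,\infty)$. For a cycle of periodic ends $\alpha_1,\dots,\alpha_q$, the translation length of the cycle is $\sum_i L(\alpha_i,F)$; the cycle is repelling if this is $>0$. Marking of ends. For $t\in J$ let $\phi(t)$ be the end defined by the sequence $(\phi_n(t))$, where $\phi_n:J\to J(f_n)$. For $C\in\mathscr{S}$, $\phi(C)$ is a cycle of periodic ends and $L(C,F)=\sum_{t\in C}L(\phi(t),F)$. *)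

(* Defs.v *)
From HB Require Import structures.
From mathcomp Require Import all_boot all_order all_algebra.
From mathcomp Require Import all_classical all_reals all_analysis.
From mathcomp Require Import complex.
From mathcomp Require Import ring.
Set Implicit Arguments.
Unset Strict Implicit.
Unset Printing Implicit Defensive.
Import Order.TTheory GRing.Theory Num.Theory numFieldNormedType.Exports.
Local Open Scope classical_set_scope.
Local Open Scope ring_scope.

(* R[i], presented as a numClosedFieldType so that it carries the topology and
   the normed structure of MathComp-Analysis; `derive1` over it is the complex
   derivative. *)
Definition Cplx (R : realType) : numClosedFieldType := R[i].

(* The Riemann sphere; `None` is the point at infinity. *)
Notation Chat R := (one_point_compactification (Cplx R)).

Section Sphere.
Context {R : realType}.
Local Notation C := (Cplx R).
Local Notation Ch := (Chat R).

(* The point of the sphere with homogeneous coordinates [a : b]. *)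
Definition hquo (a b : C) : Ch := if b == 0 then None else Some (a / b).

(* SL_2 represents PSL_2: M and - M induce the same map. *)
Definition SL2 : set 'M[C]_2 := [set M | \det M = 1].

Definition mobius (M : 'M[C]_2) (z : Ch) : Ch :=
  if z is Some z then hquo (M 0 0 * z + M 0 1) (M 1 0 * z + M 1 1)
  else hquo (M 0 0) (M 1 0).

Definition normR (z : C) : R := complex.Re `|z|.

(* Inverse stereographic projection onto the unit sphere of R^3. *)
Definition stereo (z : Ch) : 'rV[R]_3 :=
  if z is Some z then
    (1 + normR z ^+ 2)^-1 *:
      \row_i [:: 2 * complex.Re z; 2 * complex.Im z; normR z ^+ 2 - 1]`_i
  else \row_i [:: 0; 0; 1]`_i.

Definition sqnorm3 (x : 'rV[R]_3) : R := \sum_i x 0 i ^+ 2.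

Definition chordal (z w : Ch) : R := Num.sqrt (sqnorm3 (stereo z - stereo w)).

(* Local coordinate at p: z if p is finite, 1/z if p is infinity. *)
Definition sinv (z : Ch) : Ch := if z is Some z then hquo 1 z else Some 0.
Definition chart (p z : Ch) : C :=
  odflt 0 (if p is Some _ then z else sinv z).
Definition unchart (p : Ch) (u : C) : Ch :=
  if p is Some _ then Some u else sinv (Some u).

(* Derivative of g at p, from the chart at p to the chart at g p. If g p = p
   the two charts agree and this is the multiplier of g at p. *)
Definition sphere_deriv (g : Ch -> Ch) (p : Ch) : C :=
  derive1 (fun u : C => chart (g p) (g (unchart p u))) (chart p p).

End Sphere.

Section RationalMaps.
Context {R : realType}.
Local Notation C := (Cplx R).
Local Notation Ch := (Chat R).

Definition numer d (A : 'M[C]_(2, d.+1)) : {poly C} := rVpoly (row 0 A).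
Definition denom d (A : 'M[C]_(2, d.+1)) : {poly C} := rVpoly (row 1 A).

(* Coefficients of pairs (P, Q) with P / Q a rational map of degree d. Unlike
   elements of Rat_d, such pairs are not identified up to scaling; since
   proportional pairs induce the same map of the sphere, the quotient by
   conjugacy below is nevertheless Rat_d / PSL_2, with its quotient topology. *)
Definition Ratd (d : nat) : set 'M[C]_(2, d.+1) :=
  [set A | coprimep (numer A) (denom A) &&
           (maxn (size (numer A)) (size (denom A)) == d.+1)].
Arguments Ratd d : clear implicits.

Definition ratfun d (f : Ratd d) (z : Ch) : Ch :=
  let P := numer (\val f) in let Q := denom (\val f) in
  if z is Some z then hquo P.[z] Q.[z] else hquo P`_d Q`_d.

Definition conjugate d (f g : Ratd d) : Prop :=
  exists2 M : 'M[C]_2, SL2 M &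
    forall z, mobius M (ratfun f z) = ratfun g (mobius M z).

Lemma hquoZ (c a b : C) : c != 0 -> hquo (c * a) (c * b) = hquo a b.
Proof.
move=> c0; rewrite /hquo mulf_eq0 (negbTE c0) /=.
by case: eqP => // /eqP b0; rewrite -mulf_div divff // mul1r.
Qed.

Lemma mobius_hquo (M : 'M[C]_2) (a b : C) : (a != 0) || (b != 0) ->
  mobius M (hquo a b) = hquo (M 0 0 * a + M 0 1 * b) (M 1 0 * a + M 1 1 * b).
Proof.
rewrite {1}/hquo; have [->|b0 _] := eqVneq b 0 => /=.
  by rewrite orbF => a0; rewrite !mulr0 !addr0 ![_ * a]mulrC hquoZ.
rewrite -(hquoZ _ _ b0); congr hquo; rewrite mulrDr [b * _]mulrC -mulrA.
  by rewrite divfK // [b * _]mulrC.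
by rewrite divfK // [b * _]mulrC.
Qed.

Lemma det2E (M : 'M[C]_2) : \det M = M 0 0 * M 1 1 - M 0 1 * M 1 0.
Proof.
rewrite (expand_det_row M 0) !big_ord_recl big_ord0 addr0 /cofactor !det_mx11.
rewrite !mxE expr0 expr1 mul1r mulN1r mulrN.
by congr (_ * M _ _ - M _ _ * M _ _); apply: val_inj.
Qed.

Lemma mulmx2E (M N : 'M[C]_2) i j :
  (M *m N) i j = M i 0 * N 0 j + M i 1 * N 1 j.
Proof.
rewrite mxE !big_ord_recl big_ord0 addr0.
by congr (_ + M i _ * N _ j); apply: val_inj.
Qed.

Lemma mobius1 (z : Ch) : mobius 1%:M z = z.
Proof.
case: z => [z|] /=; rewrite !mxE /= /hquo ?mul0r ?mul1r ?add0r ?addr0.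
  by rewrite oner_eq0 divr1.
by rewrite eqxx.
Qed.

Lemma mobiusM (M N : 'M[C]_2) (z : Ch) : SL2 N ->
  mobius (M *m N) z = mobius M (mobius N z).
Proof.
rewrite /SL2 /= det2E => N1; case: z => [z|] /=; rewrite mobius_hquo ?mulmx2E.
- by congr hquo; ring.
- apply: contra_eqT N1; rewrite negb_or !negbK => /andP[/eqP p /eqP q].
  have -> : N 0 0 * N 1 1 - N 0 1 * N 1 0 =
    N 0 0 * (N 1 0 * z + N 1 1) - N 1 0 * (N 0 0 * z + N 0 1) by ring.
  by rewrite p q !mulr0 subrr eq_sym oner_neq0.
- by [].
- apply: contra_eqT N1; rewrite negb_or !negbK => /andP[/eqP p /eqP q].
  by rewrite p q mul0r mulr0 subrr eq_sym oner_neq0.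
Qed.

Lemma conjugate_refl d (f : Ratd d) : conjugate f f.
Proof. by exists 1%:M => [|z]; [exact: det1|rewrite !mobius1]. Qed.

Lemma conjugate_sym d (f g : Ratd d) : conjugate f g -> conjugate g f.
Proof.
case=> M M1 fg.
have uM : M \in unitmx by rewrite unitmxE M1 unitr1.
have V1 : SL2 (invmx M) by rewrite /SL2 /= det_inv M1 invr1.
exists (invmx M) => // z.
have Kz w : mobius (invmx M) (mobius M w) = w.
  by rewrite -mobiusM // mulVmx // mobius1.
rewrite -[RHS]Kz fg -mobiusM // mulmxV // mobius1 //.
Qed.

Lemma conjugate_trans d (f g h : Ratd d) :
  conjugate f g -> conjugate g h -> conjugate f h.
Proof.
case=> M M1 fg [N N1 gh]; exists (N *m M) => [|z].
  by rewrite /SL2 /= det_mulmx M1 N1 mulr1.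
by rewrite !mobiusM // fg gh.
Qed.

Definition conjb d : rel (Ratd d) := fun f g => `[< conjugate f g >].

Lemma conjb_refl d : reflexive (@conjb d).
Proof. by move=> f; apply/asboolP/conjugate_refl. Qed.
Lemma conjb_sym d : symmetric (@conjb d).
Proof. by move=> f g; apply/asboolP/asboolP; apply: conjugate_sym. Qed.
Lemma conjb_trans d : transitive (@conjb d).
Proof.
by move=> g f h /asboolP fg /asboolP gh; apply/asboolP/(conjugate_trans fg gh).
Qed.

Definition conj_equiv d : equiv_rel (Ratd d) :=
  EquivRel (@conjb d) (@conjb_refl d) (@conjb_sym d) (@conjb_trans d).

End RationalMaps.
Arguments Ratd R d : clear implicits.
Arguments conj_equiv R d : clear implicits.

Definition Moduli (R : realType) (d : nat) : Type :=
  quotient_topology {eq_quot conj_equiv R d}%qT.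
HB.instance Definition _ R d := Topological.on (Moduli R d).

Section Hyperbolicity.
Context {R : realType}.
Local Notation Ch := (Chat R).

Definition cls d (f : Ratd R d) : Moduli R d :=
  (\pi_(quotient_topology {eq_quot conj_equiv R d}) f)%qT.

Definition critical_point (g : Ch -> Ch) (c : Ch) := sphere_deriv g c = 0.

Definition attracts_to_cycle (g : Ch -> Ch) (c : Ch) : Prop :=
  exists (q : nat) (p : Ch), [/\ (0 < q)%N, iter q g p = p,
    `|sphere_deriv (iter q g) p| < 1 &
    (fun n => iter (n * q) g c) @ \oo --> p].

Definition hyperbolic_map (g : Ch -> Ch) : Prop :=
  forall c, critical_point g c -> attracts_to_cycle g c.

Definition hyperbolic_classes d : set (Moduli R d) :=
  [set x | exists2 f : Ratd R d, x = cls f & hyperbolic_map (ratfun f)].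

Definition hyperbolic_component d (H : set (Moduli R d)) : Prop :=
  exists2 x, hyperbolic_classes x &
    H = connected_component (@hyperbolic_classes d) x.

Definition degenerating d (x : nat -> Moduli R d) : Prop :=
  forall K : set (Moduli R d), compact K -> \forall n \near \oo, ~ K (x n).

(* The Fatou set is the largest open set on which the iterates are
   equicontinuous for the chordal metric. *)
Definition fatou (g : Ch -> Ch) : set Ch :=
  [set z | exists2 U : set Ch, open U /\ U z &
    forall x, U x -> forall e : R, 0 < e ->
      \forall y \near x, forall n, chordal (iter n g x) (iter n g y) < e].

Definition julia (g : Ch -> Ch) : set Ch := ~` fatou g.

(* phi is a homeomorphism from J onto the Julia set, conjugating sigma to g. *)
Definition marking (J : topologicalType) (sigma : J -> J) (g : Ch -> Ch)
    (phi : J -> Ch) : Prop :=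
  [/\ continuous phi, range phi = julia g,
    exists2 psi : Ch -> J, {within julia g, continuous psi} & cancel phi psi &
    forall t, phi (sigma t) = g (phi t)].

Definition topological_model d (H : set (Moduli R d)) (J : topologicalType)
    (sigma : J -> J) : Prop :=
  continuous sigma /\ forall f : Ratd R d, H (cls f) ->
    exists phi, marking sigma (ratfun f) phi.

(* A periodic cycle is listed in dynamical order, starting at any of its
   points. *)
Definition periodic_cycle (J : eqType) (sigma : J -> J) (C : seq J) : Prop :=
  [/\ C != [::], uniq C & fcycle sigma C].

(* The value does not depend on the point of the cycle listed first. *)
Definition cycle_length (J : eqType) (g : Ch -> Ch) (phi : J -> Ch)
    (C : seq J) : R :=
  if C is t :: _ then ln (normR (sphere_deriv (iter (size C) g) (phi t)))
  else 0.

End Hyperbolicity.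

Section Barycentric.
Context {R : realType}.
Local Notation C := (Cplx R).
Local Notation Ch := (Chat R).

Definition ball3 : set 'rV[R]_3 := [set x | sqnorm3 x < 1].

Definition arcosh (t : R) : R := ln (t + Num.sqrt (t ^+ 2 - 1)).

(* Hyperbolic distance of the ball model, of curvature - 1. *)
Definition hdist (x y : 'rV[R]_3) : R :=
  arcosh (1 + 2 * sqnorm3 (x - y) / ((1 - sqnorm3 x) * (1 - sqnorm3 y))).

(* The point at distance s from the center in the direction of z: its
   Euclidean norm is tanh (s / 2). *)
Definition hgeod (s : R) (z : Ch) : 'rV[R]_3 :=
  ((expR s - 1) / (expR s + 1)) *: stereo z.

(* The isometric action of SL_2(C) on the ball, through the isometry of the
   ball with the positive definite Hermitian matrices of determinant 1, on which
   M acts by X |-> M X M^*. On the boundary, (1 - |x|^2) herm x tends to a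
   multiple of v v^* with v = (z, 1) and x tending to stereo z, so this action
   extends continuously by mobius M. *)
Definition herm (x : 'rV[R]_3) : 'M[C]_2 :=
  let u : C := Complex (x 0 0) (x 0 1) in
  let w : C := Complex (x 0 2) 0 in
  let s : C := Complex (sqnorm3 x) 0 in
  (1 - s)^-1 *: \matrix_(i, j)
    (nth [::] [:: [:: 1 + s + 2 * w; 2 * u];
                  [:: 2 * Num.conj u; 1 + s - 2 * w]] i)`_j.

Definition moves (M : 'M[C]_2) (x y : 'rV[R]_3) : Prop :=
  herm y = M *m herm x *m (map_mx Num.conj M)^T.

Local Notation Sph := (g_sigma_algebraType (@open Ch)).

(* Normalized spherical measure: it has density 1 / (pi (1 + |z|^2)^2) on C. *)
Definition sph_measure (A : set Sph) : \bar R :=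
  \int[(@lebesgue_measure R \x @lebesgue_measure R)%E]_(p in
      [set p | A (Some (Complex p.1 p.2 : C))])
    ((pi * (1 + p.1 ^+ 2 + p.2 ^+ 2) ^+ 2)^-1)%:E.

Definition push (g : Ch -> Ch) (mu : set Sph -> \bar R) : set Sph -> \bar R :=
  pushforward mu (g : Sph -> Sph).

Definition is_barycenter (mu : set Sph -> \bar R) (y : 'rV[R]_3) : Prop :=
  ball3 y /\ forall M : 'M[C]_2, SL2 M -> moves M y 0 ->
    forall i, (\int[push (mobius M) mu]_z (stereo z 0 i)%:E = 0)%E.

Definition bary_ext (g : Ch -> Ch) (x : 'rV[R]_3) : 'rV[R]_3 :=
  xget 0 [set y | forall M : 'M[C]_2, SL2 M -> moves M 0 x ->
    is_barycenter (push g (push (mobius M) sph_measure)) y].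

(* max of d(x, y) over the preimages y of x *)
Definition preim_radius (g : Ch -> Ch) (x : 'rV[R]_3) : R :=
  sup [set hdist x y | y in ball3 `&` [set y | bary_ext g y = x]].

Definition rescaling (g : Ch -> Ch) : R := inf (preim_radius g @` ball3).

End Barycentric.

(* The asymptotic cone of the ball with base point 0, distances divided by r n,
   along the ultrafilter omega. Points are classes of sequences, i.e. sets of
   sequences. *)
Section Cone.
Context {R : realType}.
Local Notation Ch := (Chat R).
Local Notation pt := (set (nat -> 'rV[R]_3)).
Variables (omega : set_system nat) (r : nat -> R).

Definition admissible : set (nat -> 'rV[R]_3) :=
  [set x | (forall n, ball3 (x n)) /\
           exists B, forall n, hdist 0 (x n) / r n <= B].

Definition cone_class (x : nat -> 'rV[R]_3) : pt :=
  [set y | admissible y /\ (fun n => hdist (x n) (y n) / r n) @ omega --> 0].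

Definition cone : set pt := cone_class @` admissible.

Definition cone_base : pt := cone_class (fun=> 0).

Definition cone_repr (X : pt) : nat -> 'rV[R]_3 := xget (fun=> 0) X.

Definition cone_dist (X Y : pt) : R :=
  lim ((fun n => hdist (cone_repr X n) (cone_repr Y n) / r n) @ omega).

Definition limit_map (g : nat -> Ch -> Ch) (X : pt) : pt :=
  cone_class (fun n => bary_ext (g n) (cone_repr X n)).

(* Rays are parametrized by [0, +oo[; values at negative times are
   irrelevant. *)
Definition is_ray (a : R -> pt) : Prop :=
  (forall t, 0 <= t -> cone (a t)) /\
  (forall s t, 0 <= s -> 0 <= t -> cone_dist (a s) (a t) = `|s - t|).

Definition ray_image (a : R -> pt) : set pt := a @` [set t | 0 <= t].

Definition ray_equiv (a b : R -> pt) : Prop :=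
  exists2 c, is_ray c & ray_image c = ray_image a `&` ray_image b.

(* The end of the ray a; ends are classes of rays, i.e. sets of rays. *)
Definition end_of (a : R -> pt) : set (R -> pt) :=
  [set b | is_ray b /\ ray_equiv a b].

Definition cone_end : set (set (R -> pt)) := end_of @` is_ray.

Definition cvg_end (x : nat -> pt) (e : set (R -> pt)) : Prop :=
  forall b, e b -> \forall i \near \oo, ray_image b (x i).

Definition end_of_seq (z : nat -> Ch) : set (R -> pt) :=
  end_of (fun t => cone_class (fun n => hgeod (t * r n) (z n))).

(* A map F of the cone sends the end e to the end of b when F maps some ray of
   e (starting far enough) onto b, expanding distances by a positive integer
   factor k. *)
Definition end_map (F : pt -> pt) (e : set (R -> pt)) : set (R -> pt) :=
  xget set0 [set e' | exists a b, [/\ e a, is_ray b, e' = end_of b &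
    exists2 k, (0 < k)%N & forall t, 0 <= t -> F (a t) = b (k%:R * t)]].

Definition is_end_length (F : pt -> pt) (e : set (R -> pt)) (l : \bar R) :
    Prop :=
  forall x : nat -> pt, (forall i, cone (x i)) -> cvg_end x e ->
    (fun i => (cone_dist (x i) cone_base - cone_dist (F (x i)) cone_base)%:E)
      @ \oo --> l.

(* The family A of ends has total translation length l: every end of A has a
   translation length, and these sum to l. *)
Definition is_total_length (F : pt -> pt) (A : seq (set (R -> pt)))
    (l : \bar R) : Prop :=
  exists2 L, {in A, forall e, is_end_length F e (L e)} &
    l = (\sum_(e <- A) L e)%E.

Definition cycle_of_ends (F : pt -> pt) (A : seq (set (R -> pt))) : Prop :=
  {in A, forall e, cone_end e} /\ periodic_cycle (end_map F) A.

Definition repelling_cycle (F : pt -> pt) (A : seq (set (R -> pt))) : Prop :=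
  cycle_of_ends F A /\ exists2 l, is_total_length F A l & (0 < l)%E.

End Cone.

(* Main.v *)
(** In homogeneous coordinates a map is a pair W of binary forms, and the barycentric extension
    becomes a balancing condition on W: M represents the barycenter when it minimizes a geodesically
    convex functional on SL_2, so that quantitative non-degeneracy of W controls the barycenter up
    to a bounded distance.  The normalization of f_n bounds the preimages of the origin, and a degree
    (winding number) argument then bounds log |f_n| below by - C r_n on unit vectors.  Dividing by
    r_n, the extensions act on the rays of the cone as piecewise affine maps whose slope and offset
    are read off the coefficients of f_n in charts centred at the end.  The offset of a finite end is
    the limit of log |f_n'| / r_n; by the chain rule the offsets along a cycle add up to the
    multiplier.  Conversely, a repelling cycle of ends makes f_n^q expanding near an approximate
    periodic point, and a contraction argument yields a genuine repelling periodic point nearby. *)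
Require Import Defs.
From HB Require Import structures.
From mathcomp Require Import all_boot all_order all_algebra.
From mathcomp Require Import all_classical all_reals all_analysis.
From mathcomp Require Import measurable_realfun complex ring lra.
Set Implicit Arguments.
Unset Strict Implicit.
Unset Printing Implicit Defensive.
Import Order.TTheory GRing.Theory Num.Theory numFieldNormedType.Exports.
Local Open Scope classical_set_scope.
Local Open Scope ring_scope.

(** All uniformity in n comes from one elementary fact, [nonconc]: a binary form of degree d, being
    a product of d linear forms, is small relative to its coefficients only on a set of small
    spherical area. Its constants depend on d alone, so they survive the degeneration of f_n and
    take the place of weak limits of measures. The obstacle is the lower bound on f_n. A value much
    too small at a point makes, at some scale near that point, one monomial of degree m >= 1
    dominate, so the map winds m times there; this forces a preimage of the origin farther away than
    the normalization allows. The winding is read off a discrete curvature with values in 2 pi Z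
    that varies continuously. In the cone every ray eventually agrees with a limit of radial
    geodesics. Ends are therefore sequences of points of the sphere, up to distances decaying faster
    than every exp(- B r_n); super-exponential closeness is exactly what beats the exponential
    constants in the contraction argument. Both halves need a selection: multipliers of modulus at
    least 1 keep every factor of the chain rule from collapsing, and finiteness of the fixed points
    lets the ultrafilter single out one point of J. *)

Section LimitingMap.
Context {R : realType}.
Local Notation C := (Cplx R).
Local Notation Ch := (Chat R).
Local Notation vec := ('I_3 -> R).
Local Notation polpair := ({poly C} * {poly C})%type.
Local Notation mR := (measurableTypeR R).
Local Notation mC := (mR * mR)%type.
Local Notation Sph := (g_sigma_algebraType (@open Ch)).
Local Notation L1 := (@lebesgue_measure R).
Local Notation pt := (set (nat -> 'rV[R]_3)).
Local Notation Re := complex.Re.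
Local Notation Im := complex.Im.
Local Notation rC x := (Complex x 0).
Implicit Types (M N : 'M[C]_2) (W : polpair).
Local Notation measT := (measurable_fun setT).

(** * Linear changes of variable for Lebesgue measure on the line and on the complex plane *)

Section LebesgueAffine.

(** Both sides are measures, so it suffices to compare them on half-open intervals. For [c < 0] the
    preimage of such an interval is closed at its other end, which leaves the length unchanged. *)
Lemma leb_affine_measure (c t : R) : c != 0 ->
 forall A : set mR, measurable A ->
 (lebesgue_measure A = `|c|%:E * pushforward L1 (fun x : mR => (c * x + t)%R : mR) A)%E.
move=> c0 A mA.
have c1 : 0 < `|c| by rewrite normr_gt0.
have mphi : measurable_fun [set: mR] (fun x : mR => (c * x + t : mR)).
 by apply: measurable_funD => //; exact: mulrl_measurable.
pose m' := mscale (NngNum (ltW c1)) (pushforward L1 (fun x : mR => (c * x + t)%R : mR)).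
rewrite -[RHS]/(m' mphi A); apply: (@lebesgue_measure_unique R (m' mphi : {measure set mR -> \bar R})) => // X [[a b] _ <-] /=.
rewrite /m' /mscale /= /pushforward.
have [cgt|cle] := ltP 0 c.
 have -> : (fun x : R => c * x + t) @^-1` `]a, b] = `](a - t) / c, (b - t) / c]%classic.
  apply/seteqP; split => x /=; rewrite !in_itv /= ltr_pdivrMr // ler_pdivlMr //;
  by move=> /andP[? ?]; apply/andP; split; lra.
 rewrite !lebesgue_measure_itv /= !lte_fin ltr_pM2r ?invr_gt0// ltrD2r.
 case: ifP => _; last by rewrite mule0.
 rewrite -!EFinB -EFinM gtr0_norm //; congr EFin; field; exact: lt0r_neq0.
have clt : c < 0 by rewrite lt_neqAle c0.
have -> : (fun x : R => c * x + t) @^-1` `]a, b] = `[(b - t) / c, (a - t) / c[%classic.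
 apply/seteqP; split => x /=; rewrite !in_itv /= ltr_ndivlMr // ler_ndivrMr //;
 by move=> /andP[? ?]; apply/andP; split; lra.
rewrite !lebesgue_measure_itv /= !lte_fin ltr_nM2r ?invr_lt0// ltrD2r.
case: ifP => _; last by rewrite mule0.
rewrite ltr0_norm //; congr EFin; by field.
Qed.

Lemma leb_affine (c t : R) (f : mR -> \bar R) : c != 0 ->
 measT f -> (forall x, 0 <= f x)%E ->
 (\int[L1]_x f (c * x + t)%R = (`|c|^-1)%:E * \int[L1]_x f x)%E.
move=> c0 mf f0.
have c1 : 0 < `|c| by rewrite normr_gt0.
have mphi : measurable_fun [set: mR] (fun x : mR => (c * x + t : mR)).
 by apply: measurable_funD => //; exact: mulrl_measurable.
have H := @ge0_integral_pushforward _ _ mR mR R _ mphi L1 setT f measurableT mf (fun y _ => f0 y).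
rewrite preimage_setT /= in H; rewrite -[LHS]H.
have E := @ge0_integral_mscale _ mR R (pushforward L1 (fun x : mR => (c * x + t)%R : mR)) setT measurableT (NngNum (ltW c1)) f mf (fun y _ => f0 y).
pose m' := mscale (NngNum (ltW c1)) (pushforward L1 (fun x : mR => (c * x + t)%R : mR)).
have -> := @eq_measure_integral _ mR R setT (m' mphi) L1 f (fun A mA _ => leb_affine_measure t c0 mA).
rewrite E muleA -EFinM mulVf ?mul1e //; exact: lt0r_neq0.
Qed.

(** A separate name for the product measure, so that sigma-finiteness becomes an instance and [leb2]
    can itself be a factor in Fubini's theorem, as happens in [JJ]. *)
Definition leb2 : set mC -> \bar R := (L1 \x L1)%E.
HB.instance Definition _ := Measure.copy leb2 (L1 \x L1)%E.

Let leb2_sigma_finite : sigma_finite setT leb2.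
have /sigma_finiteP[F [TF ndF Foo]] := sigma_finiteT L1.
exists (fun n => F n `*` F n).
 rewrite -setXTT TF predeqE => -[x y]; split.
  move=> [/= [n _ Fnx] [k _ Gky]]; exists (maxn n k) => //; split.
  - by move: x Fnx; exact/subsetPset/ndF/leq_maxl.
  - by move: y Gky; exact/subsetPset/ndF/leq_maxr.
 by move=> [n _ []/= ? ?]; split; exists n.
move=> k; have [? ?] := Foo k.
split; first exact: measurableX.
by rewrite [X in (X < _)%E]product_measure1E// lte_mul_pinfty// ge0_fin_numE.
Qed.

HB.instance Definition _ := Measure_isSigmaFinite.Build _ _ _ leb2 leb2_sigma_finite.

Lemma leb2_iter1 (f : mC -> \bar R) : measT f -> (forall x, 0 <= f x)%E ->
 (\int[leb2]_z f z = \int[L1]_x \int[L1]_y f (x, y))%E.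
by move=> mf f0; rewrite /leb2 fubini_tonelli1. Qed.

Lemma leb2_iter2 (f : mC -> \bar R) : measT f -> (forall x, 0 <= f x)%E ->
 (\int[leb2]_z f z = \int[L1]_y \int[L1]_x f (x, y))%E.
by move=> mf f0; rewrite leb2_iter1 // fubini_tonelli. Qed.

Lemma measurable_sect1 (f : mC -> \bar R) y : measT f ->
 measT (fun x : mR => f (x, y)).
by move=> mf; exact: measurable_fun_pair1. Qed.

Lemma measurable_sect2 (f : mC -> \bar R) x : measT f ->
 measT (fun y : mR => f (x, y)).
by move=> mf; exact: measurable_fun_pair2. Qed.

Ltac maff := by apply: measurableT_comp => //; apply: measurable_fun_pair => //;
 apply: measurable_funD => //; apply: measurable_funD; apply: measurable_funM.

Lemma leb2_shear1 (c s t : R) (f : mC -> \bar R) : c != 0 ->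
 measT f -> (forall x, 0 <= f x)%E ->
 (\int[leb2]_z f (c * z.1 + s * z.2 + t, z.2)%R = (`|c|^-1)%:E * \int[leb2]_z f z)%E.
move=> c0 mf f0.
have mg : measT (fun z : mC => f (c * z.1 + s * z.2 + t, z.2)%R).
 maff.
rewrite leb2_iter2 // [in RHS]leb2_iter2 // -ge0_integralZl //=; last 2 first.
 by have := @measurable_fun_fubini_tonelli_G _ _ _ _ R L1 f mf f0.
 by move=> y _; apply: integral_ge0.
apply: eq_integral => y _.
under eq_integral do rewrite -addrA.
by rewrite (@leb_affine c (s * y + t) (fun x => f (x, y))) //; exact: measurable_sect1.
Qed.

Lemma leb2_shear2 (c s t : R) (f : mC -> \bar R) : c != 0 ->
 measT f -> (forall x, 0 <= f x)%E ->
 (\int[leb2]_z f (z.1, c * z.2 + s * z.1 + t)%R = (`|c|^-1)%:E * \int[leb2]_z f z)%E.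
move=> c0 mf f0.
have mg : measT (fun z : mC => f (z.1, c * z.2 + s * z.1 + t)%R).
 maff.
rewrite leb2_iter1 // [in RHS]leb2_iter1 // -ge0_integralZl //=; last 2 first.
 by have := @measurable_fun_fubini_tonelli_F _ _ _ _ R L1 f mf f0.
 by move=> y _; apply: integral_ge0.
apply: eq_integral => y _.
under eq_integral do rewrite -addrA.
by rewrite (@leb_affine c (s * y + t) (fun x => f (y, x))) //; exact: measurable_sect2.
Qed.

Lemma leb2_translate (s t : R) (f : mC -> \bar R) :
 measT f -> (forall x, 0 <= f x)%E ->
 (\int[leb2]_z f (z.1 + s, z.2 + t)%R = \int[leb2]_z f z)%E.
move=> mf f0.
have := @leb2_shear1 1 0 s f (oner_neq0 _) mf f0.
rewrite normr1 invr1 mul1e => <-.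
have mg : measT (fun z : mC => f (1 * z.1 + 0 * z.2 + s, z.2)%R).
 maff.
have := @leb2_shear2 1 0 t _ (oner_neq0 _) mg (fun=> f0 _).
rewrite normr1 invr1 mul1e => <-.
by apply: eq_integral => -[x y] _; rewrite !mul1r !mul0r !addr0.
Qed.

Lemma leb2_swap (f : mC -> \bar R) : measT f -> (forall x, 0 <= f x)%E ->
 (\int[leb2]_z f (z.2, z.1) = \int[leb2]_z f z)%E.
move=> mf f0; rewrite leb2_iter1 //; last first.
 by apply: measurableT_comp => //; exact: measurable_swap.
by rewrite leb2_iter2.
Qed.

(* The real matrix of a complex multiplication is the product of the two shears
  below, unless its real part vanishes. *)
Lemma leb2_cmul (p q : R) (f : mC -> \bar R) : p ^+ 2 + q ^+ 2 != 0 ->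
 measT f -> (forall x, 0 <= f x)%E ->
 (\int[leb2]_z f (p * z.1 - q * z.2, q * z.1 + p * z.2)%R =
  ((p ^+ 2 + q ^+ 2)^-1)%:E * \int[leb2]_z f z)%E.
move=> pq mf f0.
have [p0|p0] := eqVneq p 0.
 move: pq; rewrite p0 expr0n add0r sqrf_eq0 => q0.
 have q0' : - q != 0 by rewrite oppr_eq0.
 have mg : measT (fun z : mC => f (z.2, z.1)).
  by apply: measurableT_comp => //; exact: measurable_swap.
 have mh : measT (fun z : mC => f (z.2, q * z.1 + 0 * z.2 + 0)).
  maff.
 transitivity (\int[leb2]_z (fun z : mC => f (z.2, q * z.1 + 0 * z.2 + 0)%R) (z.1, (- q) * z.2 + 0 * z.1 + 0)%R)%E.
  by apply: eq_integral => -[x y] _ /=; congr (f (_, _)); ring.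
 rewrite (leb2_shear2 _ _ q0' mh) // (leb2_shear1 _ _ q0 mg) // leb2_swap //.
 rewrite muleA -EFinM normrN -invfM -expr2; congr ((_^-1)%:E * _)%E.
 by rewrite real_normK // num_real.
have k0 : (p ^+ 2 + q ^+ 2) / p != 0 by rewrite mulf_neq0 // invr_eq0.
have mg : measT (fun z : mC => f (z.1, (p ^+ 2 + q ^+ 2) / p * z.2 + q / p * z.1 + 0)%R).
 maff.
transitivity (\int[leb2]_z (fun z : mC => f (z.1, (p ^+ 2 + q ^+ 2) / p * z.2 + q / p * z.1 + 0)%R) (p * z.1 + (- q) * z.2 + 0, z.2)%R)%E.
 by apply: eq_integral => -[x y] _ /=; congr (f (_, _)); field.
rewrite (leb2_shear1 _ _ p0 mg) // (leb2_shear2 _ _ k0 mf) // muleA -EFinM; congr (_%:E * _)%E.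
rewrite -invfM -normrM mulrCA divff // mulr1 ger0_norm //.
by rewrite addr_ge0 // sqr_ge0.
Qed.
End LebesgueAffine.

(** * Complex arithmetic through real and imaginary parts *)

Lemma eqR_le (x y : R) : x = y -> x <= y.
by move=> ->. Qed.

Lemma ReM (z w : C) : Re (z * w) = Re z * Re w - Im z * Im w.
by case: z w => [? ?] [? ?]. Qed.
Lemma ImM (z w : C) : Im (z * w) = Re z * Im w + Im z * Re w.
by case: z w => [? ?] [? ?]. Qed.
Lemma ReD (z w : C) : Re (z + w) = Re z + Re w.
by case: z w => [? ?] [? ?]. Qed.
Lemma ImD (z w : C) : Im (z + w) = Im z + Im w.
by case: z w => [? ?] [? ?]. Qed.
Lemma ReN (z : C) : Re (- z) = - Re z. by case: z. Qed.
Lemma ImN (z : C) : Im (- z) = - Im z. by case: z. Qed.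
Lemma Re_conj (z : C) : Re (z^*) = Re z. by case: z. Qed.
Lemma Im_conj (z : C) : Im (z^*) = - Im z. by case: z. Qed.
Lemma ReC (x y : R) : Re (Complex x y : C) = x. by []. Qed.
Lemma ImC (x y : R) : Im (Complex x y : C) = y. by []. Qed.
Lemma Re1 : Re (1 : C) = 1. by []. Qed.
Lemma Im1 : Im (1 : C) = 0. by []. Qed.
Lemma Re0 : Re (0 : C) = 0. by []. Qed.
Lemma Im0 : Im (0 : C) = 0. by []. Qed.
Definition reim := (ReM, ImM, ReD, ImD, ReN, ImN, Re_conj, Im_conj, ReC, ImC, Re1, Im1, Re0, Im0).

Lemma complexP (z w : C) : Re z = Re w -> Im z = Im w -> z = w.
by case: z w => [? ?] [? ?] /= -> ->. Qed.

Ltac creim := apply: complexP; rewrite !reim.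
Ltac cring := creim; ring.

Section ComplexNorm.
Implicit Types z w : C.

Definition nsq (z : C) : R := Re z ^+ 2 + Im z ^+ 2.

Lemma nsq_ge0 z : 0 <= nsq z.
by rewrite addr_ge0 // sqr_ge0. Qed.

Lemma normRE z : normR z = Num.sqrt (nsq z).
by case: z. Qed.

Lemma normC_E (z : C) : `|z| = rC (normR z).
by case: z. Qed.

Lemma normR_ge0 z : 0 <= normR z.
by rewrite normRE. Qed.

Lemma normR_sqr z : normR z ^+ 2 = nsq z.
by rewrite normRE sqr_sqrtr // nsq_ge0. Qed.

Lemma normRM z w : normR (z * w) = normR z * normR w.
have := normrM z w; rewrite !normC_E => /(congr1 (@Re R)) /= ->.
by rewrite mulr0 subr0.
Qed.

Lemma normRD z w : normR (z + w) <= normR z + normR w.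
by have := ler_normD z w; rewrite /= => /andP[_]. Qed.

Lemma normRN z : normR (- z) = normR z.
by rewrite /normR normrN. Qed.

Lemma normRB z w : normR (z - w) = normR (w - z).
by rewrite -normRN opprB. Qed.

Lemma normR0 : normR (0 : C) = 0.
by rewrite /normR normr0. Qed.

Lemma normR1 : normR (1 : C) = 1.
by rewrite /normR normr1. Qed.

Lemma normR_eq0 z : (normR z == 0) = (z == 0).
rewrite -[in RHS]normr_eq0 normC_E.
by apply/eqP/eqP => [->|/(congr1 (@Re R))].
Qed.

Lemma normR_gt0 z : (0 < normR z) = (z != 0).
by rewrite lt_neqAle normR_ge0 andbT eq_sym normR_eq0. Qed.

Lemma normRX z n : normR (z ^+ n) = normR z ^+ n.
by elim: n => [|n IH]; rewrite ?normR1 // !exprS normRM IH. Qed.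

Lemma normRV z : normR z^-1 = (normR z)^-1.
have [->|z0] := eqVneq z 0; first by rewrite invr0 normR0 invr0.
apply: (mulIf (_ : normR z != 0)); first by rewrite normR_eq0.
by rewrite mulVf ?normR_eq0 // -normRM mulVf // normR1.
Qed.

Lemma normR_div z w : normR (z / w) = normR z / normR w.
by rewrite normRM normRV. Qed.

Lemma normR_real (x : R) : normR (rC x) = `|x|.
by rewrite normRE /nsq expr0n addr0 sqrtr_sqr. Qed.

Lemma normR_conj z : normR (z^*) = normR z.
by rewrite !normRE; congr Num.sqrt; case: z => a b; rewrite /nsq sqrrN. Qed.

Lemma normRB_ge z w : normR z - normR w <= normR (z - w).
by rewrite lerBlDr; have := normRD (z - w) w; rewrite subrK. Qed.

Lemma normR_sum n (F : 'I_n -> C) : normR (\sum_i F i) <= \sum_i normR (F i).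
elim: n F => [F|n IH F]; first by rewrite !big_ord0 normR0.
by rewrite !big_ord_recr (le_trans (normRD _ _)) // lerD2r.
Qed.

Lemma Re_le_normR z : `|Re z| <= normR z.
by rewrite normRE -sqrtr_sqr ler_wsqrtr // lerDl sqr_ge0. Qed.

Lemma Im_le_normR z : `|Im z| <= normR z.
by rewrite normRE -sqrtr_sqr ler_wsqrtr // lerDr sqr_ge0. Qed.

Lemma nsqM z w : nsq (z * w) = nsq z * nsq w.
by rewrite -!normR_sqr normRM exprMn. Qed.

Lemma nsqX z n : nsq (z ^+ n) = nsq z ^+ n.
by rewrite -!normR_sqr normRX -!exprM mulnC. Qed.

Lemma nsqN z : nsq (- z) = nsq z.
by rewrite -!normR_sqr normRN. Qed.

Lemma nsqV z : nsq z^-1 = (nsq z)^-1.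
by rewrite -!normR_sqr normRV exprVn. Qed.

Lemma nsq_eq0 z : (nsq z == 0) = (z == 0).
by rewrite -normR_sqr sqrf_eq0 normR_eq0. Qed.

Lemma nsq_gt0 z : (0 < nsq z) = (z != 0).
by rewrite lt_neqAle nsq_ge0 andbT eq_sym nsq_eq0. Qed.

Lemma nsq0 : nsq (0 : C) = 0.
by apply/eqP; rewrite nsq_eq0. Qed.

Lemma nsq1 : nsq (1 : C) = 1.
by rewrite -normR_sqr normR1 expr1n. Qed.

Lemma nsq_conj z : nsq (z^*) = nsq z.
by rewrite -!normR_sqr normR_conj. Qed.

Lemma nsq_real (x : R) : nsq (rC x) = x ^+ 2.
by rewrite /nsq expr0n addr0. Qed.

Lemma nsqD_le z w : nsq (z + w) <= 2 * nsq z + 2 * nsq w.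
case: z w => [a b] [c e]; rewrite /nsq /=.
by have := sqr_ge0 (a - c); have := sqr_ge0 (b - e); lra.
Qed.

Lemma real_mulC (x : R) (z : C) : rC x * z = Complex (x * Re z) (x * Im z).
by case: z => a b; cring. Qed.

Lemma conj_mulC (z : C) : z * z^* = rC (nsq z).
by case: z => a b; apply/eqP; rewrite eq_complex /nsq /=; apply/andP; split; apply/eqP; ring. Qed.

Lemma nsq_sum n (F : 'I_n -> C) : nsq (\sum_i F i) <= n%:R * \sum_i nsq (F i).
elim: n F => [F|n IH F]; first by rewrite !big_ord0 nsq0.
rewrite !big_ord_recr /=; set S := \sum_i _; set T := \sum_i _.
have := IH (fun i => F (widen_ord (leqnSn n) i)); rewrite -/S -/T => h.
set z := F ord_max.
have T0 : 0 <= T by apply: sumr_ge0 => i _; exact: nsq_ge0.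
rewrite -addn1 natrD mulrDr.
case: n IH F @S @T h @z T0 => [|n] IH F S T h z T0.
 have -> : S = 0 by rewrite /S big_ord0.
 have -> : T = 0 by rewrite /T big_ord0.
 by rewrite !add0r mulr0 mul1r add0r.
have n0 : 0 < (n.+1%:R : R) by rewrite ltr0n.
move: h; rewrite -(ler_pdivrMl _ _ n0) => h.
suff : nsq (S + z) <= (n.+1%:R + 1) * (nsq S / n.+1%:R + nsq z).
 move/le_trans; apply; rewrite -mulrDr ler_pM2l ?addr_gt0//.
 by rewrite lerD2r mulrC.
rewrite -subr_ge0; move: n0; set k : R := n.+1%:R; move=> k0.
case: S z {h} => [a b] [c e]; rewrite /nsq /=.
have -> : (k + 1) * ((a ^+ 2 + b ^+ 2) / k + (c ^+ 2 + e ^+ 2)) - ((a + c) ^+ 2 + (b + e) ^+ 2)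
  = ((a - k * c) ^+ 2 + (b - k * e) ^+ 2) / k.
 by field; exact: lt0r_neq0.
by apply: divr_ge0; [rewrite addr_ge0 // sqr_ge0|exact: ltW].
Qed.

End ComplexNorm.

Ltac nneg := repeat first [ done | exact: nsq_ge0 | exact: normR_ge0 | exact: sqrtr_ge0
 | exact: sqr_ge0 | exact: ler0n | exact: expR_ge0 | apply: addr_ge0 | apply: mulr_ge0
 | apply: exprn_ge0 | apply: divr_ge0 | rewrite invr_ge0 | (apply: ltW; done) ].

Lemma sum_const_ord n (x : R) : n%:R * x = \sum_(i < n) x.
by rewrite sumr_const card_ord mulr_natl. Qed.

(** * Homogeneous coordinates and the chordal metric *)

Lemma hquo_some (z : C) : hquo z 1 = Some z.
by rewrite /hquo oner_eq0 divr1. Qed.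

Lemma hquo_none (a : C) : hquo a 0 = None.
by rewrite /hquo eqxx. Qed.

Lemma vn_gt0 (a b : C) : (0 < nsq a + nsq b) = (a != 0) || (b != 0).
have [->|a0] := eqVneq a 0 => /=; first by rewrite nsq0 add0r nsq_gt0.
by rewrite ltr_wpDr ?nsq_ge0 // nsq_gt0.
Qed.

(** This is the Hopf map. In homogeneous coordinates the stereographic projection has no separate
    case at infinity, so identities on the sphere become polynomial identities in the lifts. *)
Lemma stereo_hquo (a b : C) : (a != 0) || (b != 0) ->
 stereo (hquo a b) = (nsq a + nsq b)^-1 *:
  \row_i [:: 2 * Re (a * b^*); 2 * Im (a * b^*); nsq a - nsq b]`_i.
rewrite /hquo; have [-> |b0 _] := eqVneq b 0 => /=.
 rewrite orbF => a0; apply/rowP => i; rewrite !mxE.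
 rewrite nsq0 subr0 addr0 [Num.conj 0]rmorph0 !mulr0.
 by case: i => [[|[|[|]]]] //= _; rewrite ?mulr0 // mulVf // nsq_eq0.
have b1 : nsq b != 0 by rewrite nsq_eq0.
have n0 : nsq a + nsq b != 0 by rewrite lt0r_neq0 // vn_gt0 b0 orbT.
have n1 : 1 + nsq (a / b) != 0 by rewrite lt0r_neq0 // ltr_wpDr ?nsq_ge0.
have E : a / b = rC (nsq b)^-1 * (a * b^*).
 apply: (mulIf b0); rewrite divfK // -!mulrA [_ * b]mulrC conj_mulC.
 rewrite [a * _]mulrC mulrA [X in X * a](_ : _ = 1) ?mul1r //.
 by apply/eqP; rewrite eq_complex /= mulVf // !mulr0 mul0r subr0 addr0 !eqxx.
apply/rowP => i; rewrite !mxE normR_sqr.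
have -> : nsq (a / b) = nsq a / nsq b by rewrite nsqM nsqV.
have n2 : 1 + nsq a / nsq b != 0 by move: n1; rewrite nsqM nsqV.
have [-> ->] : Re (a / b) = (nsq b)^-1 * Re (a * b^*) /\
  Im (a / b) = (nsq b)^-1 * Im (a * b^*) by rewrite E real_mulC.
by case: i => [[|[|[|]]]] //= _; field; rewrite n0.
Qed.

Definition lift1 (z : Ch) : C := if z is Some z then z else 1.
Definition lift2 (z : Ch) : C := if z is Some _ then 1 else 0.

Lemma hquo_lift z : hquo (lift1 z) (lift2 z) = z.
by case: z => [z|]; rewrite ?hquo_some ?hquo_none. Qed.

Lemma lift_neq0 z : (lift1 z != 0) || (lift2 z != 0).
by case: z => [z|]; rewrite ?oner_eq0 ?orbT. Qed.

Lemma hquo_surj (z : Ch) : exists a b : C, [/\ (a != 0) || (b != 0), hquo a b = z & nsq a + nsq b = 1].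
have n0 : 0 < nsq (lift1 z) + nsq (lift2 z) by rewrite vn_gt0 lift_neq0.
pose s : C := rC (Num.sqrt (nsq (lift1 z) + nsq (lift2 z)))^-1.
have s0 : s != 0 by rewrite -nsq_gt0 nsq_real exprn_even_gt0 //= invr_eq0 sqrtr_eq0 -ltNge.
have E : nsq (s * lift1 z) + nsq (s * lift2 z) = 1.
 rewrite !nsqM -mulrDr nsq_real exprVn sqr_sqrtr ?ltW // mulVf //.
 exact: lt0r_neq0.
exists (s * lift1 z), (s * lift2 z); split => //; last by rewrite hquoZ // hquo_lift.
by rewrite -vn_gt0 E.
Qed.

Lemma sqnorm3E (x : 'rV[R]_3) : sqnorm3 x = x 0 0 ^+ 2 + x 0 1 ^+ 2 + x 0 2 ^+ 2.
rewrite /sqnorm3 !big_ord_recl big_ord0 addr0 addrA.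
by congr (_ + x _ _ ^+ _ + x _ _ ^+ _); apply: val_inj.
Qed.

Lemma stereo_norm (z : Ch) : sqnorm3 (stereo z) = 1.
have [a [b [ab <- n1]]] := hquo_surj z; rewrite stereo_hquo // n1 invr1 scale1r sqnorm3E !mxE /=.
transitivity ((nsq a + nsq b) ^+ 2); last by rewrite n1 expr1n.
by case: a b {ab n1} => [a b] [c e]; rewrite /nsq /=; ring.
Qed.

(** The numerator is the determinant of the two lifts, which matrices of determinant 1 preserve;
    only the two norms in the denominator react to a Möbius map. *)
Lemma chordal_hquo (a b c e : C) : (a != 0) || (b != 0) -> (c != 0) || (e != 0) ->
 chordal (hquo a b) (hquo c e) ^+ 2 =
 4 * nsq (a * e - b * c) / ((nsq a + nsq b) * (nsq c + nsq e)).
move=> ab ce; rewrite /chordal sqr_sqrtr; last by apply: sumr_ge0 => i _; exact: sqr_ge0.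
rewrite !stereo_hquo // sqnorm3E !mxE /=.
have := vn_gt0 a b; have := vn_gt0 c e; rewrite ab ce.
case: a b c e {ab ce} => [a1 a2] [b1 b2] [c1 c2] [e1 e2]; rewrite /nsq /= => /lt0r_neq0 n1 /lt0r_neq0 n2.
by field; rewrite n1.
Qed.

Lemma chordal_ge0 (z w : Ch) : 0 <= chordal z w.
exact: sqrtr_ge0. Qed.

Lemma chordal_sym (z w : Ch) : chordal z w = chordal w z.
rewrite /chordal; congr Num.sqrt; rewrite !sqnorm3E !mxE.
by ring.
Qed.

Lemma chordal_hquo1 (a b c e : C) : nsq a + nsq b = 1 -> nsq c + nsq e = 1 ->
 chordal (hquo a b) (hquo c e) = 2 * normR (a * e - b * c).
move=> ab ce; have n0 := @normR_ge0 (a * e - b * c).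
apply/eqP; rewrite -(@eqrXn2 _ 2) ?chordal_ge0 ?mulr_ge0 //.
rewrite chordal_hquo -?vn_gt0 ?ab ?ce // mulr1 divr1 exprMn normR_sqr.
by rewrite -natrX.
Qed.

Lemma chordal_le2 (z w : Ch) : chordal z w <= 2.
have [a [b [ab <- n1]]] := hquo_surj z; have [c [e [ce <- n2]]] := hquo_surj w.
rewrite -ler_sqr ?nnegrE ?chordal_ge0 //.
rewrite chordal_hquo // n1 n2 mulr1 divr1.
have : nsq (a * e - b * c) <= (nsq a + nsq b) * (nsq c + nsq e).
 case: a b c e {ab ce n1 n2} => [a1 a2] [b1 b2] [c1 c2] [e1 e2]; rewrite /nsq /= -subr_ge0.
 suff -> : forall x, x = (a1 * c1 + a2 * c2 + b1 * e1 + b2 * e2) ^+ 2 + (a1 * c2 - a2 * c1 + b1 * e2 - b2 * e1) ^+ 2 -> 0 <= x.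
 - by [].
 - by ring.
 - by move=> x ->; rewrite addr_ge0 // sqr_ge0.
by rewrite n2; lra.
Qed.

Lemma hquo_eqP (a b c e : C) : (a != 0) || (b != 0) -> (c != 0) || (e != 0) ->
 (hquo a b == hquo c e) = (a * e == b * c).
rewrite /hquo; have [-> |b0 _] := eqVneq b 0; have [-> |e0] := eqVneq e 0 => //=.
- by rewrite mulr0 mul0r !eqxx.
- by rewrite orbF => a0 _; rewrite mul0r mulf_eq0 (negbTE a0) (negbTE e0).
- by rewrite orbF => c0; rewrite mulr0 [0 == _]eq_sym mulf_eq0 (negbTE b0) (negbTE c0).
by move=> _; rewrite -[LHS]/(a / b == c / e) eqr_div // [c * b]mulrC.
Qed.

Lemma chordal_eq0 (z w : Ch) : chordal z w = 0 -> z = w.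
have [a [b [ab <- n1]]] := hquo_surj z; have [c [e [ce <- n2]]] := hquo_surj w.
rewrite chordal_hquo1 // => /eqP; rewrite mulf_eq0 pnatr_eq0 /= normR_eq0 subr_eq0 => h.
by apply/eqP; rewrite hquo_eqP.
Qed.

Lemma chordalxx (z : Ch) : chordal z z = 0.
by rewrite /chordal subrr sqnorm3E !mxE expr0n !addr0 sqrtr0. Qed.

Lemma sqrt_tri3 (x y : 'rV[R]_3) :
 Num.sqrt (sqnorm3 (x + y)) <= Num.sqrt (sqnorm3 x) + Num.sqrt (sqnorm3 y).
have n0 (u : 'rV[R]_3) : 0 <= sqnorm3 u by apply: sumr_ge0 => i _; exact: sqr_ge0.
rewrite -ler_sqr ?nnegrE // sqrrD !sqr_sqrtr // -sqrtrM //.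
suff : (sqnorm3 (x + y) - sqnorm3 x - sqnorm3 y) / 2 <= Num.sqrt (sqnorm3 x * sqnorm3 y).
 by rewrite -mulr_natr; lra.
apply: le_trans (ler_norm _) _; rewrite -sqrtr_sqr ler_wsqrtr //.
rewrite !sqnorm3E !mxE -subr_ge0.
set a := x 0 0; set b := x 0 1; set c := x 0 2; set e := y 0 0; set f := y 0 1; set g := y 0 2.
suff -> : forall t, t = (a * f - b * e) ^+ 2 + (a * g - c * e) ^+ 2 + (b * g - c * f) ^+ 2 -> 0 <= t => //.
 by field.
by move=> t ->; rewrite !addr_ge0 // sqr_ge0.
Qed.

Lemma chordal_triangle (x y z : Ch) : chordal x z <= chordal x y + chordal y z.
by rewrite /chordal -[stereo x - stereo z](subrKA (stereo y)) sqrt_tri3. Qed.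

(** * Binary forms, linear substitution and the coefficient norm *)

Section HomogeneousForms.
Implicit Types (p q : {poly C}) (a b u v : C) (K S : R).

(** The degree [d] is a parameter rather than the degree of [p]: when the leading coefficients of
    [p] vanish, the form has zeros at infinity. *)
Definition hev d p a b : C := \sum_(j < d.+1) p`_j * a ^+ j * b ^+ (d - j).

Lemma hevE d p a b : b != 0 -> (size p <= d.+1)%N -> hev d p a b = b ^+ d * p.[a / b].
move=> b0 sp; rewrite (horner_coef_wide _ sp) mulr_sumr; apply: eq_bigr => j _.
have jd : (j <= d)%N by rewrite -ltnS.
move: {j} (nat_of_ord j) jd => j jd.
have -> : b ^+ d = b ^+ (d - j) * b ^+ j by rewrite -exprD subnK.
by rewrite exprMn exprVn; field; rewrite expf_neq0.
Qed.

Lemma hev_inf d p a : hev d p a 0 = p`_d * a ^+ d.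
rewrite /hev big_ord_recr /= subnn expr0 mulr1 big1 ?add0r // => j _.
by rewrite expr0n subn_eq0 leqNgt ltn_ord mulr0.
Qed.

Lemma hev_zero d p b : hev d p 0 b = p`_0 * b ^+ d.
rewrite /hev big_ord_recl /= subn0 expr0 mulr1 big1 ?addr0 // => j _.
by rewrite expr0n mulr0 mul0r.
Qed.

Lemma hev_one d p a : (size p <= d.+1)%N -> hev d p a 1 = p.[a].
by move=> sp; rewrite hevE // expr1n mul1r divr1. Qed.

Lemma hevZ d p (c a b : C) : hev d p (c * a) (c * b) = c ^+ d * hev d p a b.
rewrite mulr_sumr; apply: eq_bigr => j _.
have jd : (j <= d)%N by rewrite -ltnS.
move: {j} (nat_of_ord j) jd => j jd.
have -> : c ^+ d = c ^+ (d - j) * c ^+ j by rewrite -exprD subnK.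
by rewrite !exprMn; ring.
Qed.

Lemma hevD d p q a b : hev d (p + q) a b = hev d p a b + hev d q a b.
by rewrite -big_split; apply: eq_bigr => j _; rewrite coefD !mulrDl. Qed.

Lemma hevS d (c : C) p a b : hev d (c *: p) a b = c * hev d p a b.
by rewrite mulr_sumr; apply: eq_bigr => j _; rewrite coefZ !mulrA. Qed.

Lemma hev_lin d (c e : C) p q a b :
 hev d (c *: p + e *: q) a b = c * hev d p a b + e * hev d q a b.
by rewrite hevD !hevS. Qed.

Lemma hev_sum d n (F : 'I_n -> {poly C}) a b :
 hev d (\sum_i F i) a b = \sum_i hev d (F i) a b.
elim: n F => [|n IH] F; last by rewrite !big_ord_recr hevD IH.
by rewrite !big_ord0 /hev big1 // => j _; rewrite coef0 !mul0r.
Qed.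

Lemma top_coefM i k p q : (size p <= i.+1)%N -> (size q <= k.+1)%N ->
 (p * q)`_(i + k) = p`_i * q`_k.
move=> sp sq; rewrite coefM.
have ii : (i < (i + k).+1)%N by rewrite leq_addr.
rewrite (bigD1 (Ordinal ii)) //= addKn big1 ?addr0 // => j ji.
have [ij|ij] := ltnP i j; first by rewrite nth_default ?mul0r // (leq_trans sp).
have {}ij : (j < i)%N by rewrite ltn_neqAle ij andbT; apply: contra ji => /eqP e; apply/eqP/val_inj.
rewrite [X in _ * X]nth_default ?mulr0 // (leq_trans sq) //.
by rewrite -addnBAC ?(ltnW ij) // -[X in (X < _)%N]add0n ltn_add2r subn_gt0.
Qed.

Lemma size_mul_le i k p q : (size p <= i.+1)%N -> (size q <= k.+1)%N ->
 (size (p * q)%R <= (i + k).+1)%N.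
move=> sp sq; apply: leq_trans (size_polyMleq _ _) _.
by rewrite -subn1 leq_subLR add1n -addSn -addnS leq_add.
Qed.

Lemma hevM i k p q a b : (size p <= i.+1)%N -> (size q <= k.+1)%N ->
 hev (i + k) (p * q) a b = hev i p a b * hev k q a b.
move=> sp sq; have [->|b0] := eqVneq b 0.
 by rewrite !hev_inf top_coefM // exprD; ring.
rewrite !hevE ?size_mul_le // hornerM exprD; ring.
Qed.

Definition linp (a b : C) : {poly C} := a *: 'X + b%:P.

Lemma size_linp a b : (size (linp a b) <= 2)%N.
rewrite /linp (leq_trans (size_polyD _ _)) // geq_max; apply/andP; split.
 by rewrite (leq_trans (size_scale_leq _ _)) // size_polyX.
by rewrite (leq_trans (size_polyC_leq1 _)).
Qed.

Lemma size_linpX a b n : (size (linp a b ^+ n) <= n.+1)%N.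
elim: n => [|n IH]; first by rewrite size_poly1.
by rewrite exprSr -addn1; apply: size_mul_le => //; exact: size_linp.
Qed.

Lemma hev_linp a b u v : hev 1 (linp a b) u v = a * u + b * v.
rewrite /hev /linp !big_ord_recl big_ord0 !coefD !coefZ !coefX !coefC /=.
by rewrite /bump; ring.
Qed.

Lemma hev_linpX a b u v n : hev n (linp a b ^+ n) u v = (a * u + b * v) ^+ n.
elim: n => [|n IH]; first by rewrite /hev big_ord1 coef1 !mulr1.
rewrite exprSr -addn1 hevM ?size_linpX ?size_linp // IH hev_linp.
by rewrite addn1 exprSr.
Qed.

(** Substitution of the linear map [M] into the form of degree [d]. It is a right action, see
    [hcompM]. *)
Definition hcomp d M p : {poly C} :=
 \sum_(j < d.+1) p`_j *: (linp (M 0 0) (M 0 1) ^+ j * linp (M 1 0) (M 1 1) ^+ (d - j)).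

Lemma size_hcomp d M p : (size (hcomp d M p) <= d.+1)%N.
apply: (big_ind (fun q : {poly C} => (size q <= d.+1)%N)).
- by rewrite size_poly0.
- by move=> x y hx hy; rewrite (leq_trans (size_polyD _ _)) // geq_max hx.
move=> j _; apply: leq_trans (size_scale_leq _ _) _.
have jd : (j <= d)%N by rewrite -ltnS.
move: {j} (nat_of_ord j) jd => j jd.
by rewrite -{2}(subnKC jd) size_mul_le // size_linpX.
Qed.

Lemma hev_hcomp d M p a b :
 hev d (hcomp d M p) a b = hev d p (M 0 0 * a + M 0 1 * b) (M 1 0 * a + M 1 1 * b).
rewrite hev_sum; apply: eq_bigr => j _; rewrite hevS -mulrA; congr (_ * _).
have jd : (j <= d)%N by rewrite -ltnS.
move: {j} (nat_of_ord j) jd => j jd.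
by rewrite -{1}(subnKC jd) hevM ?size_linpX // !hev_linpX.
Qed.

Lemma hcomp_lin d M (c e : C) p q :
 hcomp d M (c *: p + e *: q) = c *: hcomp d M p + e *: hcomp d M q.
rewrite !scaler_sumr -big_split; apply: eq_bigr => j _.
by rewrite coefD !coefZ scalerDl !scalerA.
Qed.

Lemma poly_infinite p q : (forall x, p.[x] = q.[x]) -> p = q.
move=> pq; apply/eqP; rewrite -subr_eq0; apply/negP => /negP r0.
have := @max_poly_roots _ (p - q) [seq (i%:R : C) | i <- iota 0 (size (p - q)%R)] r0.
rewrite size_map size_iota ltnn => h; suff: false by []; apply: h.
 by apply/allP => x _; rewrite rootE hornerD hornerN pq subrr.
rewrite map_inj_uniq ?iota_uniq // => m n /eqP; rewrite eqr_nat => /eqP //.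
Qed.

Lemma hev_inj d p q : (size p <= d.+1)%N -> (size q <= d.+1)%N ->
 (forall a b, hev d p a b = hev d q a b) -> p = q.
by move=> sp sq h; apply: poly_infinite => x; rewrite -!(@hev_one d). Qed.

Lemma hcompM d M N p : hcomp d N (hcomp d M p) = hcomp d (M *m N) p.
apply: (@hev_inj d); rewrite ?size_hcomp // => a b; rewrite !hev_hcomp !mulmx2E.
by congr (hev _ _ _ _); ring.
Qed.

Lemma hcomp1 d p : (size p <= d.+1)%N -> hcomp d 1%:M p = p.
move=> sp; apply: (@hev_inj d); rewrite ?size_hcomp // => a b.
by rewrite hev_hcomp !mxE !mul1r !mul0r add0r addr0.
Qed.

Lemma coef_linpX_le p a b K S n : 0 <= K -> normR a + normR b <= S ->
 (forall i, normR p`_i <= K) -> forall i, normR (p * linp a b ^+ n)`_i <= K * S ^+ n.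
move=> K0 abS pK; have S0 : 0 <= S by rewrite (le_trans _ abS) ?addr_ge0 ?normR_ge0.
elim: n => [|n IH] i; first by rewrite !mulr1.
rewrite exprSr mulrA /linp mulrDr coefD -scalerAr coefZ coefMX coefMC.
apply: le_trans (normRD _ _) _; rewrite !normRM exprSr mulrA.
apply: (@le_trans _ _ (K * S ^+ n * (normR a + normR b))); last first.
 by rewrite ler_wpM2l // mulr_ge0 // exprn_ge0.
rewrite mulrDr lerD //.
 rewrite mulrC ler_wpM2r ?normR_ge0 //; case: ifP => _ //.
 by rewrite normR0 mulr_ge0 // exprn_ge0.
by rewrite ler_wpM2r ?normR_ge0.
Qed.

Lemma coef_hcomp_le d M p K S : 0 <= K ->
 normR (M 0 0) + normR (M 0 1) <= S -> normR (M 1 0) + normR (M 1 1) <= S ->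
 (forall i, normR p`_i <= K) ->
 forall i, normR (hcomp d M p)`_i <= d.+1%:R * K * S ^+ d.
move=> K0 h1 h2 pK i; have S0 : 0 <= S by rewrite (le_trans _ h1) ?addr_ge0 ?normR_ge0.
rewrite coef_sum; apply: le_trans (normR_sum _) _.
rewrite -mulrA sum_const_ord; apply: ler_sum => j _.
have jd : (j <= d)%N by rewrite -ltnS.
move: {j} (nat_of_ord j) jd => j jd.
have -> : S ^+ d = S ^+ j * S ^+ (d - j) by rewrite -exprD subnKC.
rewrite coefZ normRM.
apply: ler_pM; rewrite ?normR_ge0 //.
apply: coef_linpX_le => //; first by rewrite exprn_ge0.
move=> k; rewrite -[linp _ _ ^+ _]mul1r -[S ^+ j]mul1r; apply: coef_linpX_le => // l.
by rewrite coef1; case: eqP => _; rewrite ?normR1 ?normR0.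
Qed.

Definition cn d p : R := \sum_(j < d.+1) nsq p`_j.

Lemma cn_ge0 d p : 0 <= cn d p.
by apply: sumr_ge0 => j _; exact: nsq_ge0. Qed.

Lemma nsq_le_cn d p (i : nat) : (i <= d)%N -> nsq p`_i <= cn d p.
rewrite -ltnS => id; rewrite /cn (bigD1 (Ordinal id)) //= lerDl.
by apply: sumr_ge0 => j _; exact: nsq_ge0.
Qed.

Lemma coef_le_cn d p i : (size p <= d.+1)%N -> normR p`_i <= Num.sqrt (cn d p).
move=> sp; have [id|id] := leqP i d; first by rewrite normRE ler_wsqrtr // nsq_le_cn.
by rewrite nth_default ?normR0 // (leq_trans sp).
Qed.

Lemma cn_eq0 d p : (size p <= d.+1)%N -> (cn d p == 0) = (p == 0).
move=> sp; apply/eqP/eqP => [|->]; last by rewrite /cn big1 // => j _; rewrite coef0 nsq0.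
move=> c0; apply/polyP => i; rewrite coef0; apply/eqP.
rewrite -normR_eq0 eq_le normR_ge0 andbT.
by apply: le_trans (coef_le_cn i sp) _; rewrite c0 sqrtr0.
Qed.

Lemma cn_le d p K : (forall i, normR p`_i <= K) -> cn d p <= d.+1%:R * K ^+ 2.
move=> pK; rewrite sum_const_ord; apply: ler_sum => j _.
have K0 : 0 <= K by rewrite (le_trans _ (pK 0%N)) ?normR_ge0.
by rewrite -normR_sqr ler_sqr ?nnegrE ?normR_ge0.
Qed.

Lemma cnZ d (c : C) p : cn d (c *: p) = nsq c * cn d p.
by rewrite mulr_sumr; apply: eq_bigr => j _; rewrite coefZ nsqM. Qed.

Definition mn M : R :=
 nsq (M 0 0) + nsq (M 0 1) + nsq (M 1 0) + nsq (M 1 1).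

Lemma mn_ge0 M : 0 <= mn M.
by rewrite /mn; nneg. Qed.

Lemma row_le_mn M i : normR (M i 0) + normR (M i 1) <= 2 * Num.sqrt (mn M).
have h (z : C) : nsq z <= mn M -> normR z <= Num.sqrt (mn M).
 by move=> zM; rewrite normRE ler_wsqrtr.
have ge := @nsq_ge0.
have a := ge (M 0 0); have b := ge (M 0 1); have c := ge (M 1 0); have e := ge (M 1 1).
have [->|->] : i = 0 \/ i = 1.
 by case: i => [[|[|]]] //= i; [left|right]; exact: val_inj.
 by rewrite mulr_natl lerD // h /mn; lra.
by rewrite mulr_natl lerD // h /mn; lra.
Qed.

(** The constant of [cn_hcomp]: one factor [d + 1] from summing the squared coefficients, two from
    squaring the number of terms of the substitution, and [4 ^ d] from [row_le_mn]. *)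
Definition chc d : R := d.+1%:R ^+ 3 * 4 ^+ d.

Lemma chc_gt0 d : 0 < chc d.
by rewrite mulr_gt0. Qed.

Lemma cn_hcomp d M p : (size p <= d.+1)%N ->
 cn d (hcomp d M p) <= chc d * mn M ^+ d * cn d p.
move=> sp; set K := Num.sqrt (cn d p).
have K0 : 0 <= K by exact: sqrtr_ge0.
have := @cn_le d _ _ (@coef_hcomp_le d M p K _ K0 (row_le_mn M 0) (row_le_mn M 1) (fun i => coef_le_cn i sp)).
move/le_trans; apply.
rewrite !exprMn sqr_sqrtr ?cn_ge0 // -!exprM.
rewrite ![(d * 2)%N]mulnC !exprM sqr_sqrtr ?mn_ge0 //.
have -> : 2 ^+ 2 = 4 :> R by rewrite -natrX.
rewrite /chc le_eqVlt; apply/orP; left; apply/eqP; ring.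
Qed.

Lemma hev_le d p a b : (size p <= d.+1)%N ->
 nsq (hev d p a b) <= d.+1%:R * cn d p * (nsq a + nsq b) ^+ d.
move=> sp; apply: le_trans (nsq_sum _) _; rewrite -mulrA ler_pM2l //.
rewrite mulr_suml; apply: ler_sum => j _; rewrite !nsqM -mulrA ler_wpM2l ?nsq_ge0 //.
have jd : (j <= d)%N by rewrite -ltnS.
move: {j} (nat_of_ord j) jd => j jd.
have -> : (nsq a + nsq b) ^+ d = (nsq a + nsq b) ^+ j * (nsq a + nsq b) ^+ (d - j) by rewrite -exprD subnKC.
rewrite !nsqX.
apply: ler_pM; nneg; apply: lerXn2r; rewrite ?nnegrE; nneg; rewrite ?lerDl ?lerDr; nneg.
Qed.

End HomogeneousForms.

Ltac pos := solve [ repeat first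
 [ done | exact: sqr_ge0 | exact: nsq_ge0 | exact: normR_ge0 | exact: mn_ge0 | exact: cn_ge0 | exact: chc_gt0
 | exact: expR_gt0 | exact: pi_gt0 | exact: chordal_ge0 | exact: sqrtr_ge0 | exact: ler0n | by rewrite ltr0n
 | apply: mulr_gt0 | apply: exprn_gt0 | rewrite invr_gt0 | apply: mulr_ge0 | apply: exprn_ge0 | rewrite invr_ge0
 | apply: addr_ge0 | by apply: ltr_wpDr; pos | by apply: ltr_wpDl; pos | rewrite sqrtr_gt0 | apply: ltW ] ].

Ltac nonneg := lazymatch goal with
 | |- is_true (@Order.le _ _ _ (@normR _ _)) => exact: normR_ge0
 | |- is_true (@Order.le _ _ _ (nsq _)) => exact: nsq_ge0
 | |- is_true (@Order.le _ _ _ (@chordal _ _ _)) => exact: chordal_ge0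
 | |- is_true (@Order.le _ _ _ (mn _)) => exact: mn_ge0
 | |- is_true (@Order.le _ _ _ (cn _ _)) => exact: cn_ge0
 | |- is_true (@Order.le _ _ _ (@expR _ _)) => exact: expR_ge0
 end.
#[local] Hint Extern 0 (is_true (@Order.le _ _ _ _)) => nonneg : core.
#[local] Hint Resolve expR_gt0 : core.

(** * The topology of the sphere through the chordal metric; Lipschitz bounds for rational maps *)

Lemma normC_lt (z : C) (e : R) : (`|z| < rC e :> C) = (normR z < e).
by rewrite ltcE eqxx. Qed.

Lemma nbhsC_P (z : C) (A : set C) :
 nbhs z A <-> exists2 e : R, 0 < e & forall w, normR (w - z) < e -> A w.
split=> [/nbhs_ballP[e /= e0 h]|[e e0 h]].
 have [e1 e2] : 0 < Re e /\ Im e = 0.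
  by move: e0; rewrite ltcE => /andP[/eqP -> ?].
 exists (Re e) => // w zw; apply: h; rewrite -ball_normE /=.
 rewrite (_ : e = rC (Re e)); first by rewrite normC_lt normRB.
 by case: e e1 e2 {e0 zw} => x y /= _ ->.
apply/nbhs_ballP; exists (rC e); first by rewrite /= ltcE eqxx.
by move=> w; rewrite -ball_normE /= normC_lt normRB; exact: h.
Qed.

Lemma cvgC_P (T : Type) (F : set_system T) {FF : Filter F} (f : T -> C) (l : C) :
 f @ F --> l <-> forall e : R, 0 < e -> \forall x \near F, normR (f x - l) < e.
split=> [h e e0|h A /nbhsC_P[e e0 eA]]; first by apply: (h [set w | normR (w - l) < e]); apply/nbhsC_P; exists e.
by near=> x; apply: eA; near: x; exact: h.
Unshelve. all: by end_near. Qed.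

Lemma cont_real (T : topologicalType) (f : T -> R) (x : T) :
 (forall e : R, 0 < e -> \forall y \near x, `|f x - f y| < e) -> f @ x --> f x.
by move=> h; apply/cvgrPdist_lt. Qed.

Lemma lip_continuousC (g : C -> R) : (forall z w, `|g w - g z| <= normR (w - z)) -> continuous g.
move=> h z; apply: cont_real => e e0; near=> w; rewrite distrC; apply: le_lt_trans (h z w) _.
by near: w; apply/nbhsC_P; exists e.
Unshelve. all: by end_near. Qed.

Lemma normR_continuous : continuous (@normR R).
apply: lip_continuousC => z w; rewrite ler_norml lerNl opprB.
by have := normRB_ge z w; have := normRB_ge w z; rewrite [normR (z - w)]normRB => -> ->.
Qed.

Lemma Re_continuous : continuous (@Re R : C -> R).
by apply: lip_continuousC => z w; have := Re_le_normR (w - z); case: (w) (z) => [a b] [c f]. Qed.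

Lemma Im_continuous : continuous (@Im R : C -> R).
by apply: lip_continuousC => z w; have := Im_le_normR (w - z); case: (w) (z) => [a b] [c f]. Qed.

Lemma nsq_continuous : continuous nsq.
move=> z; have h1 := @Re_continuous z; have h2 := @Im_continuous z.
exact: (cvgD (cvgM h1 h1) (cvgM h2 h2)).
Qed.

Lemma normR_leD (z : C) : normR z <= `|Re z| + `|Im z|.
case: z => x y /=; rewrite (_ : Complex x y = rC x + Complex 0 1 * rC y).
 rewrite (le_trans (normRD _ _)) // normRM !normR_real lerD2l -[leRHS]mul1r ler_wpM2r //.
 by rewrite normRE /nsq expr0n add0r expr1n sqrtr1.
cring.
Qed.

Lemma Complex_continuous : continuous (fun p : R * R => Complex p.1 p.2 : C).
move=> [x y]; apply/cvgC_P => e e0; near=> p.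
apply: le_lt_trans (normR_leD _) _ => /=.
rewrite [e]splitr ltrD //; near: p.
- have /cvgrPdist_lt h : (fun p : R * R => p.1) @ (x, y) --> x by exact: cvg_fst.
 have := h (e / 2); rewrite divr_gt0 // => /(_ isT); apply: filterS => p.
 by rewrite distrC.
have /cvgrPdist_lt h : (fun p : R * R => p.2) @ (x, y) --> y by exact: cvg_snd.
have := h (e / 2); rewrite divr_gt0 // => /(_ isT); apply: filterS => p.
by rewrite distrC.
Unshelve. all: by end_near. Qed.

Lemma hausdorffC : hausdorff_space C.
exact: norm_hausdorff. Qed.

Lemma compact_square (r : R) :
 compact [set z : C | `|Re z| <= r /\ `|Im z| <= r].
have -> : [set z : C | `|Re z| <= r /\ `|Im z| <= r] =
  (fun p : R * R => Complex p.1 p.2 : C) @` (`[- r, r] `*` `[- r, r]).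
 apply/seteqP; split=> [[x y] /= [hx hy]|_ [[x y] /= [hx hy] <-]] /=.
  by exists (x, y) => //=; rewrite !in_itv /= -!ler_norml.
 by move: hx hy; rewrite !in_itv /= -!ler_norml.
apply: continuous_compact; first by apply: continuous_subspaceT; exact: Complex_continuous.
by apply: compact_setX; exact: segment_compact.
Qed.

Lemma compact_disc (r : R) : compact [set z : C | normR z <= r].
apply: (@subclosed_compact _ _ [set z : C | `|Re z| <= r /\ `|Im z| <= r]).
- rewrite (_ : mkset _ = @normR R @^-1` [set x | x <= r]) //.
 by apply: closed_comp => [z _|]; [exact: normR_continuous|exact: closed_le].
- exact: compact_square.
by move=> z h; split; apply: le_trans h; [exact: Re_le_normR|exact: Im_le_normR].
Qed.

Lemma chordal_some (z w : C) :
 chordal (Some z : Ch) (Some w) ^+ 2 = 4 * nsq (z - w) / ((1 + nsq z) * (1 + nsq w)).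
rewrite -!hquo_some chordal_hquo ?oner_eq0 ?orbT // mulr1 mul1r !nsq1.
by rewrite ![_ + 1]addrC.
Qed.

Lemma chordal_some_none (z : C) : chordal (Some z : Ch) None ^+ 2 = 4 / (1 + nsq z).
rewrite -hquo_some -(hquo_none 1) chordal_hquo ?oner_eq0 ?orbT //.
by rewrite mulr0 sub0r mul1r nsqN nsq1 nsq0 addr0 !mulr1 addrC.
Qed.

Lemma chordal_some_le (z w : C) : chordal (Some z : Ch) (Some w) <= 2 * normR (z - w).
rewrite -ler_sqr ?nnegrE ?mulr_ge0 // chordal_some exprMn normR_sqr -natrX.
have hz := nsq_ge0 z; have hw := nsq_ge0 w.
rewrite ler_pdivrMr; last by rewrite mulr_gt0 // ltr_wpDr.
rewrite ler_peMr ?mulr_ge0 //.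
have h3 := mulr_ge0 hz hw; have : (1 + nsq z) * (1 + nsq w) = 1 + nsq z + nsq w + nsq z * nsq w by ring.
lra.
Qed.

(** Identifies the topology of the one-point compactification with that of the chordal metric, so
    that continuity on the sphere can be checked by estimates. *)
Lemma nbhs_chordal (x : Ch) (A : set Ch) :
 nbhs x A <-> exists2 e : R, 0 < e & forall y, chordal x y < e -> A y.
case: x => [z|].
 split=> [/nbhsC_P[e e0 h]|[e e0 h]]; last first.
  apply/nbhsC_P; exists (e / 2); first by pos.
  move=> w zw; apply: h; apply: le_lt_trans (chordal_some_le _ _) _.
  by rewrite normRB; lra.
 have hz := nsq_ge0 z; have e2 : 0 < e ^+ 2 by pos.
 (* [4 / D] is a lower bound for the squared chordal distance from [z] to every [w] with
    [|z - w| >= e], uniformly as [w] tends to infinity, and to the point at infinity itself. *)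
 pose D := (1 + nsq z) * ((1 + 2 * nsq z) / e ^+ 2 + 2).
 have q0 : 0 <= (1 + 2 * nsq z) / e ^+ 2 by apply: divr_ge0; [lra|exact: ltW].
 have D0 : 0 < D by apply: mulr_gt0; [lra|lra].
 exists (Num.sqrt (4 / D)); first by rewrite sqrtr_gt0 divr_gt0.
 have q1 : 0 <= 4 / D by apply: divr_ge0; [|exact: ltW].
 move=> y; rewrite -ltr_sqr ?nnegrE // (sqr_sqrtr q1).
 case: y => [w|]; last first.
  rewrite chordal_some_none ltr_pM2l // ltf_pV2 ?posrE //; last by lra.
  rewrite ltNge /D ler_peMr; lra.
 rewrite chordal_some ltNge => hlt; apply: h; rewrite ltNge; apply: contra hlt => ew.
 have hw := nsq_ge0 w.
 have E : e ^+ 2 <= nsq (z - w) by rewrite -normR_sqr normRB ler_sqr ?nnegrE // ltW.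
 rewrite ler_pdivrMr // mulrAC ler_pdivlMr; last by pos; lra.
 rewrite -!mulrA ler_pM2l // /D mulrCA ler_pM2l; last by lra.
 have W : nsq w <= 2 * nsq z + 2 * nsq (z - w).
  by have := nsqD_le z (- (z - w)); rewrite nsqN opprB addrCA subrr addr0.
 rewrite mulrDr; apply: le_trans (_ : 1 + (2 * nsq z + 2 * nsq (z - w)) <= _); first by lra.
 rewrite mulrCA -[X in _ <= X + _]mulrC.
 have : 1 <= nsq (z - w) / e ^+ 2 by rewrite ler_pdivlMr // mul1r.
 move=> h1; have : (1 + 2 * nsq z) * 1 <= (1 + 2 * nsq z) * (nsq (z - w) / e ^+ 2).
  by rewrite ler_wpM2l; lra.
 lra.
split=> [[U [cU _] UA]|[e e0 h]].
 have [M M0 MU] : exists2 M : R, 0 < M & forall z, U z -> normR z <= M.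
  have cn : compact (@normR R @` U).
   by apply: continuous_compact cU; apply: continuous_subspaceT; exact: normR_continuous.
  have [M [Mr h]] := compact_bounded cn.
  exists (`|M| + 1); first by pos.
  move=> z Uz; have := h (`|M| + 1); rewrite ltr_pwDr ?ler_norm // => /(_ isT (normR z)) /=.
  by rewrite ger0_norm // => h1; apply: h1; exists z.
 exists (Num.sqrt (4 / (1 + M ^+ 2))).
  by rewrite sqrtr_gt0 divr_gt0 // ltr_wpDr ?sqr_ge0.
 have M1 : 0 < 1 + M ^+ 2 by rewrite ltr_wpDr ?sqr_ge0.
 move=> [w|]; last by move=> _; apply: UA; right.
 have q1 : 0 <= 4 / (1 + M ^+ 2) by apply: divr_ge0; [|exact: ltW].
 rewrite chordal_sym -ltr_sqr ?nnegrE // (sqr_sqrtr q1).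
 have hw := nsq_ge0 w.
 rewrite chordal_some_none ltr_pM2l // ltf_pV2 ?posrE //; last by lra.
 move=> hlt; apply: UA; left; exists w => //= Uw; move: hlt; rewrite ltNge => /negP; apply.
 by rewrite lerD2l -normR_sqr ler_sqr ?nnegrE ?MU // ltW.
pose r := Num.sqrt (4 / e ^+ 2).
have q0 : 0 <= 4 / e ^+ 2 by rewrite divr_ge0 // sqr_ge0.
exists [set z : C | normR z <= r].
 split; first exact: compact_disc.
 by apply: compact_closed; [exact: hausdorffC|exact: compact_disc].
move=> y [[w /= nw <-]|/= ->]; last by apply: h; rewrite chordalxx.
apply: h; rewrite chordal_sym -ltr_sqr ?nnegrE ?(ltW e0) // chordal_some_none.
have hw := nsq_ge0 w.
rewrite ltr_pdivrMr; last by lra.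
move/negP: nw; rewrite -ltNge -ltr_sqr ?nnegrE ?sqrtr_ge0 // normR_sqr /r sqr_sqrtr //.
by rewrite ltr_pdivrMr ?exprn_gt0 // mulrC => h1; rewrite mulrDr mulr1 ltr_wpDl ?sqr_ge0.
Qed.

Lemma lipschitz_continuous (g : Ch -> Ch) (L : R) :
 (forall z w, chordal (g z) (g w) <= L * chordal z w) -> continuous g.
move=> h x A /nbhs_chordal[e e0 eA]; apply/nbhs_chordal.
pose L' := `|L| + 1.
have L0 : 0 < L' by rewrite ltr_wpDl.
exists (e / L'); first by pos.
move=> y xy; apply: eA; apply: le_lt_trans (h _ _) _.
apply: (@le_lt_trans _ _ (L' * chordal x y)).
 by rewrite ler_wpM2r ?chordal_ge0 /L'; have := ler_norm L; lra.
by rewrite mulrC -ltr_pdivlMr.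
Qed.

Lemma stereo_continuous i : continuous (fun z : Ch => stereo z 0 i).
move=> x; apply: cont_real => e e0; apply/nbhs_chordal; exists e => // y.
apply: le_lt_trans.
have -> : stereo x 0 i - stereo y 0 i = (stereo x - stereo y) 0 i by rewrite !mxE.
rewrite -sqrtr_sqr ler_wsqrtr // /sqnorm3 (bigD1 i) //= lerDl.
by apply: sumr_ge0 => j _; exact: sqr_ge0.
Qed.

Lemma compact_sphereC2 : compact [set p : C * C | nsq p.1 + nsq p.2 = 1].
apply: (@subclosed_compact _ _ ([set z : C | normR z <= 1] `*` [set z : C | normR z <= 1])).
- rewrite (_ : mkset _ = (fun p : C * C => nsq p.1 + nsq p.2) @^-1` [set 1]); last first.
  by apply/seteqP; split.
 apply: closed_comp => [p _|]; last exact: closed_eq.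
 have h1 : (fun p : C * C => nsq p.1) @ p --> nsq p.1.
  exact: (@continuous_comp _ _ _ (@fst C C) nsq p (@cvg_fst _ _ _ _ _) (@nsq_continuous _)).
 have h2 : (fun p : C * C => nsq p.2) @ p --> nsq p.2.
  exact: (@continuous_comp _ _ _ (@snd C C) nsq p (@cvg_snd _ _ _ _ _) (@nsq_continuous _)).
 exact: cvgD h1 h2.
- by apply: compact_setX; exact: compact_disc.
move=> [a b] /= h; have := nsq_ge0 a; have := nsq_ge0 b => hb ha.
by split; rewrite -(@ler_sqr _ _ 1) ?nnegrE // normR_sqr; lra.
Qed.

Lemma cvg_sum_ord (T : Type) (F : set_system T) (FF : Filter F) n (f : 'I_n -> T -> C) (l : 'I_n -> C) :
 (forall i, f i @ F --> l i) -> (fun x => \sum_i f i x) @ F --> \sum_i l i.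
elim: n f l => [|n IH] f l h.
 by rewrite big_ord0; under eq_fun do rewrite big_ord0; exact: cvg_cst.
rewrite big_ord_recr /=; under eq_fun do rewrite big_ord_recr /=.
exact: (cvgD (IH _ _ (fun i => h (widen_ord (leqnSn n) i))) (h ord_max)).
Qed.

Lemma hev_continuous d (p : {poly C}) : continuous (fun u : C * C => hev d p u.1 u.2).
move=> u; rewrite /hev; apply: cvg_sum_ord => j.
have h1 : (fun u : C * C => u.1) @ u --> u.1 by exact: cvg_fst.
have h2 : (fun u : C * C => u.2) @ u --> u.2 by exact: cvg_snd.
have hX (f : C * C -> C) (l : C) n : f @ u --> l -> (fun x => f x ^+ n) @ u --> l ^+ n.
 move=> h; elim: n => [|n IH]; first by under eq_fun do rewrite expr0; rewrite expr0; exact: cvg_cst.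
 by under eq_fun do rewrite exprS; rewrite exprS; exact: (cvgM h IH).
exact: (cvgM (cvgM (@cvg_cst _ _ _ _ _) (hX _ _ j h1)) (hX _ _ (d - j)%N h2)).
Qed.

(** Minimum over the compact unit sphere of C^2, then homogeneity. The constant depends on the pair;
    the uniform version is [value_lower]. *)
Lemma pair_lower_bound d (P Q : {poly C}) :
 (forall a b : C, (a != 0) || (b != 0) -> (hev d P a b != 0) || (hev d Q a b != 0)) ->
 exists2 e : R, 0 < e & forall a b,
  e * (nsq a + nsq b) ^+ d <= nsq (hev d P a b) + nsq (hev d Q a b).
move=> nz; pose F (u : C * C) := nsq (hev d P u.1 u.2) + nsq (hev d Q u.1 u.2).
have cF : continuous F.
 move=> u.
 have h1 : (fun u : C * C => nsq (hev d P u.1 u.2)) @ u --> nsq (hev d P u.1 u.2).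
  exact: (@continuous_comp _ _ _ (fun u : C * C => hev d P u.1 u.2) nsq u (@hev_continuous _ _ _) (@nsq_continuous _)).
 have h2 : (fun u : C * C => nsq (hev d Q u.1 u.2)) @ u --> nsq (hev d Q u.1 u.2).
  exact: (@continuous_comp _ _ _ (fun u : C * C => hev d Q u.1 u.2) nsq u (@hev_continuous _ _ _) (@nsq_continuous _)).
 exact: cvgD h1 h2.
have n0 : [set p : C * C | nsq p.1 + nsq p.2 = 1] !=set0.
 by exists (1, 0) => /=; rewrite nsq1 nsq0 addr0.
have [[a b]] := compact_EVT_min n0 (@compact_sphereC2) (continuous_subspaceT cF).
rewrite inE /= => ab1 hmin; exists (F (a, b)).
 by rewrite /F vn_gt0 nz // -vn_gt0 ab1.
move=> c e; have [ce|ce] := boolP ((c != 0) || (e != 0)); last first.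
 have /eqP -> : nsq c + nsq e == 0.
  by rewrite eq_le addr_ge0 // andbT leNgt vn_gt0.
 (* In degree 0 the power on the left is 1 even at the zero vector, but then the forms are constant
    and the value at [(1, 0)] settles the claim. *)
 case: d @F cF hmin nz => [|d] F cF hmin nz.
  rewrite expr0 mulr1; have := hmin (1, 0); rewrite inE /= nsq1 nsq0 addr0 => /(_ erefl).
  have h0 p x y x' y' : hev 0 p x y = hev 0 p x' y' :> C by rewrite /hev !big_ord1.
  by rewrite {2}/F (h0 P 1 0 c e) (h0 Q 1 0 c e).
 by rewrite expr0n mulr0 addr_ge0.
have n1 : 0 < nsq c + nsq e by rewrite vn_gt0.
pose s : C := rC (Num.sqrt (nsq c + nsq e))^-1.
have s2 : nsq s = (nsq c + nsq e)^-1 by rewrite nsq_real exprVn sqr_sqrtr // ltW.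
have := hmin (s * c, s * e); rewrite inE /= !nsqM -mulrDr s2 mulVf ?lt0r_neq0 // => /(_ erefl).
rewrite {2}/F !hevZ !nsqM -mulrDr nsqX s2 exprVn.
by rewrite mulrC ler_pdivlMr // exprn_gt0.
Qed.

Lemma unit_powB (n : nat) (u v : C) : normR u <= 1 -> normR v <= 1 ->
 normR (u ^+ n - v ^+ n) <= n%:R * normR (u - v).
move=> u1 v1; elim: n => [|n IH]; first by rewrite subrr normR0 mul0r.
have -> : u ^+ n.+1 - v ^+ n.+1 = u * (u ^+ n - v ^+ n) + (u - v) * v ^+ n by rewrite !exprS; ring.
apply: le_trans (normRD _ _) _; rewrite !normRM normRX -natr1 mulrDl mul1r; apply: lerD.
 by apply: le_trans IH; rewrite ler_piMl.
by rewrite ler_piMr // exprn_ile1.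
Qed.

Lemma hev_unit_lipschitz d (p : {poly C}) (K : R) (a b c e : C) : 0 <= K -> (forall i, normR p`_i <= K) ->
 normR a <= 1 -> normR b <= 1 -> normR c <= 1 -> normR e <= 1 ->
 normR (hev d p a b - hev d p c e) <= d.+1%:R ^+ 2 * K * (normR (a - c) + normR (b - e)).
move=> K0 pK a1 b1 c1 e1; rewrite /hev -sumrB; apply: le_trans (normR_sum _) _.
rewrite expr2 -!mulrA sum_const_ord; apply: ler_sum => -[j jd] _ /=.
have -> : p`_j * a ^+ j * b ^+ (d - j) - p`_j * c ^+ j * e ^+ (d - j) =
 p`_j * ((a ^+ j - c ^+ j) * b ^+ (d - j) + c ^+ j * (b ^+ (d - j) - e ^+ (d - j))) by ring.
rewrite normRM mulrCA; apply: ler_pM; rewrite //; apply: le_trans (normRD _ _) _.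
have h x y n m : normR x <= 1 -> normR y <= 1 -> (n <= d)%N -> normR (x ^+ n - y ^+ n) <= d.+1%:R * normR (x - y) :> R.
 move=> x1 y1 nd; apply: le_trans (unit_powB n x1 y1) _; rewrite ler_wpM2r // ler_nat; exact: leqW.
have q x n : normR x <= 1 -> normR (x ^+ n) <= 1 :> R by move=> x1; rewrite normRX exprn_ile1.
rewrite !normRM mulrDr; apply: lerD.
 by rewrite -[leRHS]mulr1; apply: ler_pM; rewrite //; [exact: h|exact: q].
by rewrite -[leRHS]mul1r; apply: ler_pM; rewrite //; [exact: q|apply: h => //; exact: leq_subr].
Qed.

(** Let [t] be the determinant and [s] the Hermitian product of two unit vectors. Then |t|^2 + |s|^2
    = 1, and after turning the second vector by the phase of [s] the squared distance is 2 - 2 |s|,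
    which is controlled by |t|^2. *)
Lemma phase_align (a b c e : C) : nsq a + nsq b = 1 -> nsq c + nsq e = 1 -> exists k : C, [/\ normR k = 1,
 normR (a - k * c) <= 2 * normR (a * e - b * c) & normR (b - k * e) <= 2 * normR (a * e - b * c)].
move=> ab ce; set t := a * e - b * c; pose s := c^* * a + e^* * b.
have st : nsq t + nsq s = 1.
 rewrite -[RHS](mulr1 1) -{1}ab -ce /t /s.
 by case: (a) (b) (c) (e) => [a1 a2] [b1 b2] [c1 c2] [f1 f2]; rewrite /nsq /=; ring.
have [k k1 ks] : exists2 k : C, normR k = 1 & rC (normR s) * k = s.
 have [->|s0] := eqVneq s 0; first by exists 1; rewrite ?normR1 // normR0 mul0r.
 have s1 : rC (normR s) != 0 :> C by rewrite negb_and normR_eq0 s0.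
 exists (s / rC (normR s)); last by rewrite mulrC divfK.
 by rewrite normR_div normR_real ger0_norm // divff // normR_eq0.
have nB (x y : C) : nsq (x - y) = nsq x + nsq y - 2 * Re (y^* * x).
 by case: x y => [x1 x2] [y1 y2]; rewrite /nsq /=; ring.
have k2 : nsq k = 1 by rewrite -normR_sqr k1 expr1n.
have sum : nsq (a - k * c) + nsq (b - k * e) = 2 - 2 * normR s.
 have e1 : (k * c)^* * a + (k * e)^* * b = rC (normR s).
  by rewrite !rmorphM -!mulrA -mulrDr -/s -[in LHS]ks mulrCA [_ * k]mulrC conj_mulC k2 mulr1.
 have := congr1 (@Re R) e1; rewrite !nB !nsqM k2 !mul1r /=.
 have -> (x y : C) : Re (x + y) = Re x + Re y by case: x y => [? ?] [].
 by move: ab ce; clear; lra.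
have s1 : normR s <= 1 by rewrite -(@expr_le1 _ 2) // normR_sqr -st lerDr.
have bnd : 2 - 2 * normR s <= 4 * normR t ^+ 2.
 have := sqr_ge0 (1 - normR s); move: st s1 (normR_ge0 s); rewrite -!normR_sqr; clear; nra.
exists k; split=> //; rewrite -ler_sqr ?nnegrE ?mulr_ge0 // exprMn normR_sqr -natrX;
 apply: le_trans bnd; rewrite -sum; [rewrite lerDl|rewrite lerDr]; exact: nsq_ge0.
Qed.

Lemma pair_lipschitz d (P Q : {poly C}) : (size P <= d.+1)%N -> (size Q <= d.+1)%N ->
 (forall a b : C, (a != 0) || (b != 0) -> (hev d P a b != 0) || (hev d Q a b != 0)) ->
 exists2 L : R, 0 <= L & forall a b c f : C, nsq a + nsq b = 1 -> nsq c + nsq f = 1 ->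
 chordal (hquo (hev d P a b) (hev d Q a b)) (hquo (hev d P c f) (hev d Q c f)) <= L * chordal (hquo a b) (hquo c f).
move=> sP sQ nz; have [m m0 low] := pair_lower_bound nz.
pose K := Num.sqrt (cn d P) + Num.sqrt (cn d Q); have K0 : 0 <= K by rewrite /K; nneg.
have PK i : normR P`_i <= K by apply: le_trans (coef_le_cn i sP) _; rewrite lerDl; nneg.
have QK i : normR Q`_i <= K by apply: le_trans (coef_le_cn i sQ) _; rewrite lerDr; nneg.
pose D : R := d.+1%:R ^+ 2; have D0 : 0 <= D by pos.
have L0 : 0 <= 8 * (D * K) ^+ 2 / m by rewrite divr_ge0 ?mulr_ge0 // ltW.
exists (8 * (D * K) ^+ 2 / m) => // a b c f ab cf.
have le1 (z w : C) : nsq z + nsq w = 1 -> normR z <= 1 /\ normR w <= 1.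
 have h (x y : C) : nsq x + nsq y = 1 -> normR x <= 1.
  by move=> xy; rewrite -(@ler_sqr _ _ 1) ?nnegrE // normR_sqr expr1n -xy lerDl.
 by move=> zw; split; [exact: h zw|apply: (h w z); rewrite addrC].
have [k [k1 h1 h2]] := phase_align ab cf; have k0 : k != 0 by rewrite -normR_gt0 k1.
have kcf : nsq (k * c) + nsq (k * f) = 1 by rewrite !nsqM -mulrDr cf mulr1 -normR_sqr k1 expr1n.
rewrite -(hquoZ (hev d P c f) (hev d Q c f) (expf_neq0 d k0)) -!hevZ (chordal_hquo1 ab cf).
have [a1 b1] := le1 _ _ ab; have [c1 f1] := le1 _ _ kcf.
have lP := hev_unit_lipschitz d K0 PK a1 b1 c1 f1; have lQ := hev_unit_lipschitz d K0 QK a1 b1 c1 f1.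
have bd (p : {poly C}) : (forall i, normR p`_i <= K) -> normR (hev d p a b) <= D * K.
 move=> pK; apply: le_trans (normR_sum _) _; apply: (@le_trans _ _ (\sum_(i < d.+1) K)).
  apply: ler_sum => j _; rewrite !normRM !normRX -[leRHS]mulr1 -[leRHS]mulr1.
  by apply: ler_pM; nneg; first apply: ler_pM; nneg => //; exact: exprn_ile1 (normR_ge0 _) _.
 by rewrite -sum_const_ord ler_wpM2r // /D ler_peMl // ler1n.
have n1 := low a b; have n2 := low (k * c) (k * f); rewrite ab kcf expr1n mulr1 in n1 n2.
move: (bd _ PK) (bd _ QK) lP lQ n1 n2; set A1 := hev d P a b; set B1 := hev d Q a b; set A2 := hev d P _ _; set B2 := hev d Q _ _.
move=> pA pB lP lQ n1 n2; set t := normR (a * f - b * c) in h1 h2 *; have t0 : 0 <= t := normR_ge0 _.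
have s4 : normR (a - k * c) + normR (b - k * f) <= 4 * t by move: h1 h2; clear; lra.
have DK : 0 <= D * K by pos.
have W : normR (A1 * B2 - B1 * A2) <= 8 * (D * K) ^+ 2 * t.
 (* The determinant of the two images is a combination of differences of values, to which the
    Lipschitz bounds of the two forms apply. *)
 have -> : A1 * B2 - B1 * A2 = B1 * (A1 - A2) - A1 * (B1 - B2) by ring.
 apply: le_trans (normRD _ _) _; rewrite normRN !normRM.
 have s5 := ler_wpM2l DK s4; have g1 := ler_pM (normR_ge0 _) (normR_ge0 _) pB (le_trans lP s5).
 have g2 := ler_pM (normR_ge0 _) (normR_ge0 _) pA (le_trans lQ s5); apply: le_trans (lerD g1 g2) _.
 by apply: eqR_le; ring.
have p1 : 0 < nsq A1 + nsq B1 by exact: lt_le_trans n1.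
have p2 : 0 < nsq A2 + nsq B2 by exact: lt_le_trans n2.
rewrite -ler_sqr ?nnegrE //; last by pos.
rewrite chordal_hquo -?vn_gt0 // ler_pdivrMr ?mulr_gt0 // -normR_sqr.
have X : 0 <= (8 * (D * K) ^+ 2 / m * (2 * t)) ^+ 2 := sqr_ge0 _.
apply: le_trans _ (ler_wpM2l X (ler_pM (ltW m0) (ltW m0) n1 n2)).
have -> : (8 * (D * K) ^+ 2 / m * (2 * t)) ^+ 2 * (m * m) = 4 * (8 * (D * K) ^+ 2 * t) ^+ 2.
 by field; exact: lt0r_neq0.
by rewrite ler_pM2l // ler_sqr ?nnegrE // mulr_ge0 // mulr_ge0 // sqr_ge0.
Qed.

Section Ratd.
Variables (d : nat) (f : Ratd R d).
Definition rP : {poly C} := numer (\val f).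
Definition rQ : {poly C} := denom (\val f).

Lemma size_rP : (size rP <= d.+1)%N. exact: size_poly. Qed.
Lemma size_rQ : (size rQ <= d.+1)%N. exact: size_poly. Qed.

Lemma rat_nz (a b : C) : (a != 0) || (b != 0) -> (hev d rP a b != 0) || (hev d rQ a b != 0).
have := set_valP f; rewrite /Ratd /= => /andP[cop /eqP sz].
have [-> /=|b0 _] := eqVneq b 0.
 rewrite orbF => a0; rewrite !hev_inf !mulf_eq0 !(negbTE (expf_neq0 _ a0)) !orbF.
 have /orP[/eqP h|/eqP h] : (size rP == d.+1) || (size rQ == d.+1).
  by move: sz; rewrite -/rP -/rQ /maxn; case: ifP => _ ->; rewrite eqxx ?orbT.
  by rewrite -[d]/(d.+1.-1) -h -/(lead_coef _) lead_coef_eq0 -size_poly_eq0 h.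
 by rewrite orbC -[d]/(d.+1.-1) -h -/(lead_coef _) lead_coef_eq0 -size_poly_eq0 h.
rewrite !hevE ?size_rP ?size_rQ // !mulf_eq0 !(negbTE (expf_neq0 _ b0)) /=.
rewrite -negb_and; apply/negP => /andP[r1 r2].
by move: (coprimep_root cop r1); rewrite -/rQ (eqP r2) eqxx.
Qed.

Lemma ratfun_hquo (a b : C) : (a != 0) || (b != 0) ->
 ratfun f (hquo a b) = hquo (hev d rP a b) (hev d rQ a b).
rewrite {1}/hquo; have [-> /=|b0 _] := eqVneq b 0.
 rewrite orbF => a0; rewrite !hev_inf ![_ * a ^+ d]mulrC hquoZ //.
 exact: expf_neq0.
by rewrite !hevE ?size_rP ?size_rQ // hquoZ // expf_neq0.
Qed.

Lemma rat_lower : exists2 e : R, 0 < e & forall a b,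
  e * (nsq a + nsq b) ^+ d <= nsq (hev d rP a b) + nsq (hev d rQ a b).
exact/pair_lower_bound/rat_nz. Qed.

Lemma ratfun_lipschitz : exists2 L : R, 0 <= L &
 forall z w, chordal (ratfun f z) (ratfun f w) <= L * chordal z w.
have [L L0 h] := pair_lipschitz size_rP size_rQ rat_nz; exists L => // z w.
have [a [b [ab <- n1]]] := hquo_surj z; have [c [g [cg <- n2]]] := hquo_surj w.
by rewrite !ratfun_hquo //; exact: h.
Qed.

Lemma ratfun_continuous : continuous (ratfun f).
by have [L _ h] := ratfun_lipschitz; exact: lipschitz_continuous h. Qed.
End Ratd.

Lemma SL2_inv_lift M (a b : C) : SL2 M ->
 a = M 1 1 * (M 0 0 * a + M 0 1 * b) - M 0 1 * (M 1 0 * a + M 1 1 * b) /\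
 b = M 0 0 * (M 1 0 * a + M 1 1 * b) - M 1 0 * (M 0 0 * a + M 0 1 * b).
rewrite /SL2 /= det2E => M1; split.
 transitivity ((M 0 0 * M 1 1 - M 0 1 * M 1 0) * a); last by ring.
 by rewrite M1 mul1r.
transitivity ((M 0 0 * M 1 1 - M 0 1 * M 1 0) * b); last by ring.
by rewrite M1 mul1r.
Qed.

Lemma SL2_nz M (a b : C) : SL2 M -> (a != 0) || (b != 0) ->
 (M 0 0 * a + M 0 1 * b != 0) || (M 1 0 * a + M 1 1 * b != 0).
move=> /(SL2_inv_lift a b)[Ea Eb]; apply: contraTT; rewrite !negb_or !negbK => /andP[/eqP h1 /eqP h2].
by apply/andP; split; [rewrite Ea|rewrite Eb]; rewrite h1 h2 !mulr0 subrr.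
Qed.

Lemma mobius_lipschitz M : SL2 M -> exists2 L : R, 0 <= L &
 forall z w, chordal (mobius M z) (mobius M w) <= L * chordal z w.
move=> M1.
have nz a b : (a != 0) || (b != 0) -> (hev 1 (linp (M 0 0) (M 0 1)) a b != 0) || (hev 1 (linp (M 1 0) (M 1 1)) a b != 0).
 by rewrite !hev_linp; exact: SL2_nz.
have [L L0 h] := pair_lipschitz (size_linp _ _) (size_linp _ _) nz; exists L => // z w.
have [a [b [ab <- n1]]] := hquo_surj z; have [c [g [cg <- n2]]] := hquo_surj w.
by rewrite !mobius_hquo // -!hev_linp; exact: h.
Qed.

Lemma mobius_continuous M : SL2 M -> continuous (mobius M).
by move=> /mobius_lipschitz[L _ h]; exact: lipschitz_continuous h. Qed.

(** * Measurability, and the spherical measure as a measure on the plane *)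

Section Measurability.
Context {d : measure_display} {T : measurableType d}.

Lemma measurable_invr (D : set T) (f : T -> R) : measurable_fun D f -> (forall x, 0 <= f x) ->
 measurable_fun D (fun x => (f x)^-1).
move=> mf f0; rewrite (_ : (fun x => (f x)^-1) = (fun x => f x `^ (-1))).
 apply: (@measurableT_comp _ _ _ _ _ _ (fun x : R => x `^ (-1)) D f _ mf); exact: measurable_powR.
by apply/funext => x; rewrite powR_inv1.
Qed.

Lemma measurable_sqrtr (D : set T) (f : T -> R) : measurable_fun D f -> (forall x, 0 <= f x) ->
 measurable_fun D (fun x => Num.sqrt (f x)).
move=> mf f0; rewrite (_ : (fun x => Num.sqrt (f x)) = (fun x => f x `^ (2^-1))).
 apply: (@measurableT_comp _ _ _ _ _ _ (fun x : R => x `^ (2^-1)) D f _ mf); exact: measurable_powR.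
by apply/funext => x; rewrite powR12_sqrt.
Qed.

Definition cmeas (F : T -> C) : Prop :=
 measT (fun x => Re (F x)) /\ measT (fun x => Im (F x)).

Lemma cmeas_cst c : cmeas (fun=> c). by split; exact: measurable_cst. Qed.

Lemma cmeasD F G : cmeas F -> cmeas G -> cmeas (fun x => F x + G x).
by move=> [? ?] [? ?]; split; under eq_fun do rewrite reim; exact: measurable_funD. Qed.

Lemma cmeasM F G : cmeas F -> cmeas G -> cmeas (fun x => F x * G x).
move=> [? ?] [? ?]; split; under eq_fun do rewrite reim.
 by apply: measurable_funB; exact: measurable_funM.
by apply: measurable_funD; exact: measurable_funM.
Qed.

Lemma cmeasX F n : cmeas F -> cmeas (fun x => F x ^+ n).
move=> mF; elim: n => [|n IH]; first by under eq_fun do rewrite expr0; exact: cmeas_cst.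
by under eq_fun do rewrite exprS; exact: cmeasM.
Qed.

Lemma cmeas_sum n (F : 'I_n -> T -> C) : (forall i, cmeas (F i)) -> cmeas (fun x => \sum_i F i x).
elim: n F => [|n IH] F mF; first by under eq_fun do rewrite big_ord0; exact: cmeas_cst.
by under eq_fun do rewrite big_ord_recr; apply: cmeasD => //; exact: IH.
Qed.

Lemma cmeas_conj F : cmeas F -> cmeas (fun x => (F x)^*).
by move=> [? ?]; split; under eq_fun do rewrite reim; [|exact: measurable_funN]. Qed.

Lemma measurable_nsq F : cmeas F -> measT (fun x => nsq (F x)).
by move=> [F1 F2]; apply: measurable_funD; apply: measurable_funX. Qed.

Lemma cmeas_hev n (p : {poly C}) F G : cmeas F -> cmeas G -> cmeas (fun x => hev n p (F x) (G x)).
move=> mF mG; apply: cmeas_sum => j; apply: cmeasM; last exact: cmeasX.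
by apply: cmeasM; [exact: cmeas_cst|exact: cmeasX].
Qed.

End Measurability.

Section SphereMeasure.

Definition toC (p : R * R) : C := Complex p.1 p.2.
Definition iota (p : mC) : Sph := (Some (toC p) : Ch).

Lemma cmeas_toC : cmeas (fun p : mC => toC p).
by split; [exact: measurable_fst|exact: measurable_snd]. Qed.

Lemma measurable_1nsq : measT (fun p : mC => 1 + nsq (toC p)).
by apply: measurable_funD => //; apply: measurable_nsq; exact: cmeas_toC. Qed.

Lemma nsq_toC p : nsq (toC p) = p.1 ^+ 2 + p.2 ^+ 2. by []. Qed.

(** The sigma-algebra on the sphere is generated by open sets, whereas measurability in the plane is
    known for chordal balls. Balls with rational centres and radii 1 / (n + 1) reduce the former to
    a countable union of the latter; a ball is encoded by an integer and kept only if it lies in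
    [O]. *)
Lemma open_countable_union (O : set Ch) : open O -> exists B : nat -> option (Ch * R),
 forall z : C, O (Some z) <-> exists k, if B k is Some (c, e) then chordal (Some z) c < e else False.
move=> oO; pose T := (rat * rat * nat)%type.
pose c (t : T) : Ch := Some (Complex (ratr t.1.1) (ratr t.1.2) : C).
pose e (t : T) : R := t.2.+1%:R^-1.
exists (fun k => if unpickle k is Some t then
  (if `[< forall y, chordal y (c t) < e t -> O y >] then Some (c t, e t) else None) else None) => z.
split=> [Oz|[k]]; last first.
 by case: (unpickle k) => // t; case: asboolP => // h; exact: h.
have [r r0 rO] : exists2 r : R, 0 < r & forall y, chordal (Some z) y < r -> O y.
 by move: oO; rewrite openE => /(_ _ Oz) /nbhs_chordal.
have [n hn] : exists n : nat, 2 / r < n.+1%:R.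
 exists (Num.truncn (2 / r)); exact: truncnS_gt.
have en : 2 * n.+1%:R^-1 < r by rewrite ltr_pdivrMr // mulrC -ltr_pdivrMr.
pose h : R := n.+1%:R^-1 / 8.
have i0 : 0 < n.+1%:R^-1 :> R by pos.
have h0 : 0 < h by pos.
have [x hx] : exists x : rat, Re z - h < ratr x < Re z + h.
 by have := @rat_in_itvoo R (Re z - h) (Re z + h); rewrite ltrD2l gtrN // => /(_ isT)[x]; rewrite /=; exists x.
have [y hy] : exists x : rat, Im z - h < ratr x < Im z + h.
 by have := @rat_in_itvoo R (Im z - h) (Im z + h); rewrite ltrD2l gtrN // => /(_ isT)[y]; rewrite /=; exists y.
pose t : T := ((x, y), n).
have zc : chordal (Some z : Ch) (c t) < e t.
 apply: le_lt_trans (chordal_some_le _ _) _; have := normR_leD (z - Complex (ratr x) (ratr y)).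
 rewrite /e /=; have : `|Re (z - Complex (ratr x) (ratr y))| < h.
  by rewrite ltr_norml; case: (z) hx => [a b] /= /andP[? ?]; apply/andP; split; lra.
 have : `|Im (z - Complex (ratr x) (ratr y))| < h.
  by rewrite ltr_norml; case: (z) hy => [a b] /= /andP[? ?]; apply/andP; split; lra.
 by rewrite /h; move: i0; set k := n.+1%:R^-1; lra.
exists (pickle t); rewrite pickleK; case: asboolP => //; apply => w wc; apply: rO.
apply: le_lt_trans (chordal_triangle _ (c t) _) _; rewrite [chordal (c t) w]chordal_sym.
by move: en zc wc; rewrite /e; set k := n.+1%:R^-1; lra.
Qed.

Lemma measurable_chordal (c : Ch) : measT (fun p : mC => chordal (iota p) c).
have [a [b [ab cE n1]]] := hquo_surj c.
have -> : (fun p : mC => chordal (iota p) c) =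
  fun p => Num.sqrt (4 * nsq (toC p * b - a) * (nsq (toC p) + 1)^-1).
 apply/funext => p; rewrite -[LHS](ger0_norm (chordal_ge0 _ _)) -sqrtr_sqr; congr Num.sqrt.
 rewrite /iota -hquo_some -cE chordal_hquo ?oner_eq0 ?orbT // nsq1 n1 mulr1 mul1r.
 by [].
have h0 p : 0 <= nsq (toC p) + 1 by pos.
apply: measurable_sqrtr => [|p]; last by apply: mulr_ge0; [apply: mulr_ge0 => //; exact: nsq_ge0|pos].
apply: measurable_funM.
 apply: measurable_funM => //; apply: measurable_nsq; apply: cmeasD; last exact: cmeas_cst.
 by apply: cmeasM; [exact: cmeas_toC|exact: cmeas_cst].
by apply: measurable_invr => //; apply: measurable_funD => //; apply: measurable_nsq; exact: cmeas_toC.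
Qed.

Lemma measurable_iota : measT iota.
apply: (@measurability _ _ mC Sph setT iota (@open Ch)) => //.
move=> ? [V oV <-]; rewrite setTI.
have [B hB] := open_countable_union oV.
have -> : iota @^-1` V = \bigcup_k (if B k is Some (c, e) then [set p : mC | chordal (iota p) c < e] else set0).
 apply/seteqP; split=> p /=; rewrite /iota.
  by move=> /hB[k hk]; exists k => //; case: (B k) hk => // -[c e].
 by move=> [k _ hk]; apply/hB; exists k; case: (B k) hk => // -[c e].
apply: bigcupT_measurable => k; case: (B k) => [[c e]|]; last exact: measurable0.
rewrite (_ : [set p | _] = (fun p : mC => chordal (iota p) c) @^-1` `]-oo, e[).
 by rewrite -[X in measurable X]setTI; exact: (measurable_chordal c measurableT).
by apply/seteqP; split=> p /=; rewrite in_itv.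
Qed.

Lemma continuous_measurable_Sph (g : Ch -> Ch) : continuous g ->
 measT (g : Sph -> Sph).
move=> cg; apply: (@measurability _ _ Sph Sph setT _ (@open Ch)) => //.
move=> ? [V oV <-]; rewrite setTI; apply: sub_sigma_algebra.
by move/continuousP : cg; apply.
Qed.

Lemma continuous_measurable_SphR (g : Ch -> R) : continuous g ->
 measT (g : Sph -> R).
move=> cg; apply: (measurability (@RGenOInfty.G R)); first exact: RGenOInfty.measurableE.
move=> ? [? [x ->] <-]; rewrite setTI; apply: sub_sigma_algebra.
by move/continuousP : cg; apply; rewrite set_itvoy; exact: open_gt.
Qed.

Definition rho (p : mC) : R := (pi * (1 + p.1 ^+ 2 + p.2 ^+ 2) ^+ 2)^-1.

Lemma rho_ge0 p : 0 <= rho p.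
by rewrite invr_ge0 mulr_ge0 ?pi_ge0 // sqr_ge0. Qed.

Lemma measurable_rho : measT rho.
apply: measurable_invr => [|p]; last by rewrite mulr_ge0 ?pi_ge0 // sqr_ge0.
apply: measurable_funM => //; apply: measurable_funX; apply: measurable_funD.
 by apply: measurable_funD => //; apply: measurable_funX; exact: measurable_fst.
by apply: measurable_funX; exact: measurable_snd.
Qed.

(** Has the density of [sph_measure], but is made a measure on the plane; its push-forward by [iota]
    is [sph_measure]. *)
Definition sph2 (A : set mC) : \bar R := (\int[leb2]_(p in A) (rho p)%:E)%E.

Let sph2_0 : sph2 set0 = 0%E. by rewrite /sph2 integral_set0. Qed.
Let sph2_ge0 A : (0 <= sph2 A)%E.
by apply: integral_ge0 => p _; rewrite lee_fin rho_ge0. Qed.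
Let sph2_sigma_additive : semi_sigma_additive sph2.
move=> F mF tF mUF; rewrite /sph2 ge0_integral_bigcup//=; last first.
- by move=> p _; rewrite lee_fin rho_ge0.
- by apply/measurable_EFinP; apply: measurable_funTS; exact: measurable_rho.
by apply: is_cvg_nneseries => n _ _; apply: integral_ge0 => p _; rewrite lee_fin rho_ge0.
Qed.
HB.instance Definition _ := isMeasure.Build _ _ _ sph2 sph2_0 sph2_ge0 sph2_sigma_additive.

End SphereMeasure.

(** * Rotation invariance of the spherical measure, by way of cones in C^2 *)

Definition ofC (z : C) : R * R := (Re z, Im z).
Lemma toCK z : toC (ofC z) = z. by case: z. Qed.
Lemma ofCK p : ofC (toC p) = p. by case: p. Qed.

Definition ract (a b c e : C) (p : mC * mC) : mC * mC :=
 (ofC (a * toC p.1 + b * toC p.2), ofC (c * toC p.1 + e * toC p.2)).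

Lemma cmeas_fst : cmeas (fun p : mC * mC => toC p.1).
by split; [apply: (@measurableT_comp _ _ _ _ _ _ fst setT fst) |
      apply: (@measurableT_comp _ _ _ _ _ _ snd setT fst)].
Qed.

Lemma cmeas_snd : cmeas (fun p : mC * mC => toC p.2).
by split; [apply: (@measurableT_comp _ _ _ _ _ _ fst setT snd) |
      apply: (@measurableT_comp _ _ _ _ _ _ snd setT snd)].
Qed.

Lemma measurable_ofC d (T : measurableType d) (F : T -> C) : cmeas F ->
 measT (fun x => ofC (F x) : mC).
by move=> [F1 F2]; exact: measurable_fun_pair. Qed.

Lemma measurable_ract a b c e : measT (ract a b c e).
apply: measurable_fun_pair; apply: measurable_ofC; apply: cmeasD; apply: cmeasM;
 by first [exact: cmeas_cst|exact: cmeas_fst|exact: cmeas_snd].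
Qed.

(** The Lebesgue integral over C^2. Invariance under SL_2 reduces to shears, and each shear is a
    translation in one variable when the other is frozen. *)
Definition JJ (G : mC * mC -> \bar R) : \bar R := (\int[leb2]_b \int[leb2]_a G (a, b))%E.

Lemma JJ_swap G : measT G -> (forall p, 0 <= G p)%E ->
 JJ G = (\int[leb2]_a \int[leb2]_b G (a, b))%E.
by move=> mG G0; rewrite /JJ (@fubini_tonelli _ _ _ _ R leb2 leb2). Qed.

Lemma JJ_shear1 G (t : C) : measT G -> (forall p, 0 <= G p)%E ->
 JJ (G \o ract 1 t 0 1) = JJ G.
move=> mG G0; apply: eq_integral => b _ /=.
rewrite -[RHS](leb2_translate (Re (t * toC b)) (Im (t * toC b))) //; last first.
 exact: measurable_fun_pair1.
apply: eq_integral => a _; congr G; rewrite /ract /=; congr pair.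
 by rewrite mul1r; case: (t * toC b).
by rewrite mul0r mul1r add0r; case: b.
Qed.

Lemma JJ_shear2 G (t : C) : measT G -> (forall p, 0 <= G p)%E ->
 JJ (G \o ract 1 0 t 1) = JJ G.
move=> mG G0.
have m1 := measurableT_comp mG (measurable_ract 1 0 t 1).
transitivity (\int[leb2]_a \int[leb2]_b (G \o ract 1 0 t 1) (a, b))%E.
 by apply: JJ_swap m1 _ => p; exact: G0.
transitivity (\int[leb2]_a \int[leb2]_b G (a, b))%E; last by apply/esym/JJ_swap.
apply: eq_integral => a _ /=.
rewrite -[RHS](leb2_translate (Re (t * toC a)) (Im (t * toC a))) //; last first.
 exact: measurable_fun_pair2.
apply: eq_integral => b _; congr G; rewrite /ract /=; congr pair.
 by rewrite mul0r mul1r addr0; case: a.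
by rewrite mul1r addrC; case: (t * toC a).
Qed.

Lemma ract_comp a b c e a' b' c' e' : ract a b c e \o ract a' b' c' e' =
 ract (a * a' + b * c') (a * b' + b * e') (c * a' + e * c') (c * b' + e * e').
by apply/funext => p; rewrite /ract /= !toCK; congr (ofC _, ofC _); ring. Qed.

(** When [c != 0] the matrix is a product of an upper, a lower and an upper unipotent matrix; the
    middle one has entry [c], and the diagonal entries [a] and [e] determine the outer two. *)
Lemma JJ_SL2_gen G (a b c e : C) : c != 0 -> a * e - b * c = 1 ->
 measT G -> (forall p, 0 <= G p)%E -> JJ (G \o ract a b c e) = JJ G.
move=> c0 M1 mG G0.
pose x := (a - 1) / c; pose y := (e - 1) / c.
have aE : a = 1 + x * c by rewrite /x divfK // addrC subrK.
have eE : e = 1 + c * y by rewrite /y mulrC divfK // addrC subrK.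
have bE : b = x + y + x * c * y.
 apply: (mulIf c0); apply/eqP; rewrite -subr_eq0; apply/eqP.
 transitivity (a * e - (a * e - b * c) - (x + y + x * c * y) * c); first by ring.
 by rewrite M1 aE eE; ring.
have -> : ract a b c e = ract 1 x 0 1 \o ract 1 0 c 1 \o ract 1 y 0 1.
 by rewrite !ract_comp aE eE bE; congr ract; ring.
have m1 := measurableT_comp mG (measurable_ract 1 x 0 1).
have m2 := measurableT_comp m1 (measurable_ract 1 0 c 1).
change (JJ (((G \o ract 1 x 0 1) \o ract 1 0 c 1) \o ract 1 y 0 1) = JJ G).
apply: etrans (JJ_shear1 y m2 (fun p => G0 _)) _.
apply: etrans (JJ_shear2 c m1 (fun p => G0 _)) _.
exact: JJ_shear1.
Qed.

Lemma JJ_SL2 G (a b c e : C) : a * e - b * c = 1 ->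
 measT G -> (forall p, 0 <= G p)%E -> JJ (G \o ract a b c e) = JJ G.
move=> M1 mG G0; have [c0|] := eqVneq c 0; last by move=> c0; exact: JJ_SL2_gen.
have e0 : e != 0 by apply: contra_eq_neq M1 => ->; rewrite c0 !mulr0 subrr eq_sym.
(* One lower shear makes the lower left entry nonzero and leads back to the generic case. *)
have -> : ract a b c e = ract (a + b) b (c + e) e \o ract 1 0 (- 1) 1.
 by rewrite ract_comp; congr ract; ring.
have m1 := measurableT_comp mG (measurable_ract (a + b) b (c + e) e).
change (JJ ((G \o ract (a + b) b (c + e) e) \o ract 1 0 (- 1) 1) = JJ G).
apply: etrans (JJ_shear2 (- 1) m1 (fun p => G0 _)) _.
by apply: JJ_SL2_gen => //; [rewrite c0 add0r|rewrite -M1; ring].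
Qed.

Definition N4 (p : mC * mC) : R := nsq (toC p.1) + nsq (toC p.2).
Definition hq (p : mC * mC) : Sph := hquo (toC p.1) (toC p.2) : Ch.

Lemma measurable_N4 : measT N4.
by apply: measurable_funD; apply: measurable_nsq; [exact: cmeas_fst|exact: cmeas_snd]. Qed.

Lemma measurable_hq : measT hq.
pose q (p : mC * mC) : C := rC (nsq (toC p.2))^-1 * (toC p.1 * (toC p.2)^*).
have -> : hq = fun p => if nsq (toC p.2) == 0 then (None : Ch) : Sph else iota (ofC (q p)).
 apply/funext => p; rewrite /hq /hquo nsq_eq0; case: ifPn => // b0.
 rewrite /iota toCK; congr Some; rewrite /q; apply: (mulIf b0); rewrite divfK //.
 rewrite -!mulrA [_ * toC p.2]mulrC conj_mulC [toC p.1 * _]mulrC mulrA.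
 rewrite [X in _ = X * _](_ : _ = 1) ?mul1r //; apply/eqP.
 by rewrite eq_complex /= mulVf ?nsq_eq0 // !mulr0 mul0r subr0 addr0 !eqxx.
have mn2 : measT (fun p : mC * mC => nsq (toC p.2)) by apply: measurable_nsq; exact: cmeas_snd.
apply: measurable_fun_ifT.
- by apply: measurable_fun_eqr => //; exact: measurable_cst.
- exact: measurable_cst.
apply: measurableT_comp; first exact: measurable_iota.
apply: measurable_ofC; apply: cmeasM.
 split => /=; last exact: measurable_cst.
 by apply: measurable_invr => // p; exact: nsq_ge0.
by apply: cmeasM; [exact: cmeas_fst|apply: cmeas_conj; exact: cmeas_snd].
Qed.

(** The vectors of the punctured unit ball of C^2 whose line belongs to [A]. SU(2) preserves both
    the ball and the volume, so the volume of this cone is a rotation invariant function of [A];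
    [JJ_coneE] shows that it is a multiple of the spherical measure. *)
Definition coneset (A : set Sph) : set (mC * mC) := [set p | 0 < N4 p <= 1 /\ A (hq p)].

Lemma measurable_coneset A : measurable A -> measurable (coneset A).
move=> mA; rewrite (_ : coneset A = (N4 @^-1` `]0, 1]) `&` (hq @^-1` A)).
 apply: measurableI; first by rewrite -[X in measurable X]setTI; exact: (measurable_N4 measurableT).
 by rewrite -[X in measurable X]setTI; exact: (measurable_hq measurableT).
by apply/seteqP; split=> p /=; rewrite in_itv.
Qed.

Definition coneG (A : set Sph) (p : mC * mC) : \bar R := (\1_(coneset A) p)%:E.

Lemma measurable_coneG A : measurable A -> measT (coneG A).
by move=> mA; apply/measurable_EFinP; apply: measurable_indic; exact: measurable_coneset.
Qed.

Lemma coneG_ge0 A p : (0 <= coneG A p)%E.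
by rewrite lee_fin. Qed.

Definition unitary2 (U : 'M[C]_2) : Prop := forall a b : C,
 nsq (U 0 0 * a + U 0 1 * b) + nsq (U 1 0 * a + U 1 1 * b) = nsq a + nsq b.

Lemma JJ_cone_unitary (U : 'M[C]_2) (A : set Sph) : SL2 U -> unitary2 U -> measurable A ->
 JJ (coneG ((mobius U : Sph -> Sph) @^-1` A)) = JJ (coneG A).
move=> U1 Uu mA.
have d1 : U 0 0 * U 1 1 - U 0 1 * U 1 0 = 1 by move: U1; rewrite /SL2 /= det2E.
apply: etrans (JJ_SL2 d1 (measurable_coneG mA) (coneG_ge0 A)).
congr JJ; apply/funext => p; rewrite /coneG !indicE; congr (_%:R%:E); congr nat_of_bool.
apply/idP/idP; rewrite !inE /coneset /N4 /hq /= !toCK Uu => -[h1 h2]; split => //.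
 rewrite -mobius_hquo //; rewrite -vn_gt0; by case/andP: h1.
by rewrite mobius_hquo // -vn_gt0; case/andP: h1.
Qed.

Lemma leb2_rect (a b c e : R) : a <= b -> c <= e ->
 leb2 (`[a, b]%classic `*` `[c, e]%classic : set mC) = ((b - a) * (e - c))%:E.
move=> ab ce.
have itvE (x y : R) : x <= y -> lebesgue_measure (`[x, y]%classic : set R) = (y - x)%:E.
 move=> xy; rewrite lebesgue_measure_itv /= lte_fin.
 by move: xy; rewrite le_eqVlt => /predU1P[->|->] //; rewrite ltxx subrr.
transitivity (lebesgue_measure (`[a, b]%classic : set R) * lebesgue_measure (`[c, e]%classic : set R))%E.
 by apply: product_measure1E; exact: measurable_itv.
by rewrite !itvE.
Qed.

Lemma leb2_pt (p : mC) : leb2 [set p] = 0%E.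
case: p => x y; rewrite (_ : [set (x, y)] = `[x, x]%classic `*` `[y, y]%classic).
 by rewrite (@leb2_rect x x y y (lexx _) (lexx _)) subrr mul0r.
by apply/seteqP; split=> [[a b] [-> ->] /=|[a b] /=]; rewrite !in_itv /= ?lexx // => -[/andP[h1 h2] /andP[h3 h4]]; congr pair; apply/eqP; rewrite eq_le ?h2 ?h4.
Qed.

(** The weight |b|^2 is the Jacobian of [a = z b] for fixed [b]. Its integral [coneK] only has to be
    positive and finite to be cancelled. *)
Definition ballw (b : mC) : \bar R := (nsq (toC b) * \1_[set q : mC | nsq (toC q) <= 1] b)%:E.

Lemma measurable_disc (r : R) : measurable [set q : mC | nsq (toC q) <= r].
rewrite (_ : mkset _ = (fun q : mC => nsq (toC q)) @^-1` `]-oo, r]).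
 by rewrite -[X in measurable X]setTI; exact: (measurable_nsq (@cmeas_toC) measurableT).
by apply/seteqP; split=> p /=; rewrite in_itv.
Qed.

Lemma measurable_ballw : measT ballw.
apply/measurable_EFinP; apply: measurable_funM.
 by apply: measurable_nsq; exact: cmeas_toC.
by apply: measurable_indic; exact: measurable_disc.
Qed.

Lemma ballw_ge0 b : (0 <= ballw b)%E.
by pos. Qed.

Definition coneK : \bar R := (\int[leb2]_b ballw b)%E.

Lemma coneK_gt0 : (0 < coneK)%E.
(* On this square |b|^2 lies between 1/2 and 98/100, hence inside the unit disc. *)
pose Q : set mC := `[2^-1, 7 / 10]%classic `*` `[2^-1, 7 / 10]%classic.
have mQ : measurable Q by apply: measurableX; exact: measurable_itv.
apply: (@lt_le_trans _ _ (\int[leb2]_(b in Q) (2^-1)%:E)%E).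
 have -> : (\int[leb2]_(b in Q) (2^-1)%:E = (2^-1)%:E * leb2 Q)%E by rewrite -integral_cst.
 have -> : leb2 Q = ((7 / 10 - 2^-1) * (7 / 10 - 2^-1))%:E by apply: leb2_rect; lra.
 by rewrite -EFinM; apply: mulr_gt0; [|apply: mulr_gt0]; lra.
apply: (@le_trans _ _ (\int[leb2]_(b in Q) ballw b)%E).
 apply: ge0_le_integral => //.
  by apply: measurable_funTS; exact: measurable_ballw.
 move=> [x y] [/=]; rewrite !in_itv /= => /andP[x1 x2] /andP[y1 y2].
 have h1 : 2^-1 ^+ 2 <= x ^+ 2 <= (7 / 10) ^+ 2.
  by rewrite !ler_sqr ?nnegrE; lra.
 have h2 : 2^-1 ^+ 2 <= y ^+ 2 <= (7 / 10) ^+ 2.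
  by rewrite !ler_sqr ?nnegrE; lra.
 rewrite lee_fin indicE mem_set /nsq /=; move: h1 h2; rewrite !expr2 => /andP[? ?] /andP[? ?]; lra.
by apply: ge0_subset_integral => //; [exact: measurable_ballw|move=> *; exact: ballw_ge0].
Qed.

Section SphereMeasureInvariance.

(** The integrand of the cone after the substitution [a = z b], in which membership in [A] depends
    on [z] only. *)
Let H (A : set Sph) (p : mC * mC) : \bar R :=
 (nsq (toC p.2) * \1_[set p : mC * mC | nsq (toC p.2) * (1 + nsq (toC p.1)) <= 1] p * \1_(iota @^-1` A) p.1)%:E.

Let measurable_iotaV (A : set Sph) : measurable A -> measurable (iota @^-1` A).
by move=> mA; rewrite -[X in measurable X]setTI; exact: (measurable_iota measurableT). Qed.

Let mH A : measurable A -> measT (H A).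
move=> mA; apply/measurable_EFinP; apply: measurable_funM; last first.
 apply: (@measurableT_comp _ _ _ _ _ _ (\1_(iota @^-1` A) : mC -> R) setT fst) => //.
 by apply: measurable_indic; exact: measurable_iotaV.
have mf : measT (fun p : mC * mC => nsq (toC p.2)) by apply: measurable_nsq; exact: cmeas_snd.
have mg : measT (fun p : mC * mC => nsq (toC p.1)) by apply: measurable_nsq; exact: cmeas_fst.
apply: measurable_funM => //; apply: measurable_indic.
rewrite (_ : mkset _ = (fun p : mC * mC => nsq (toC p.2) * (1 + nsq (toC p.1))) @^-1` `]-oo, 1]).
 rewrite -[X in measurable X]setTI.
 have mh : measT (fun p : mC * mC => nsq (toC p.2) * (1 + nsq (toC p.1))).
  by apply: measurable_funM => //; apply: measurable_funD.
 exact: (mh measurableT).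
by apply/seteqP; split=> p /=; rewrite in_itv.
Qed.

Let H_ge0 A p : (0 <= H A p)%E.
by rewrite lee_fin !mulr_ge0 ?nsq_ge0 // indicE. Qed.

(** Change of variable [a = z b] by [leb2_cmul]: the factor |b|^2 appears and |a|^2 + |b|^2 becomes
    |b|^2 (1 + |z|^2). *)
Let coneG_slice (A : set Sph) (b : mC) : measurable A -> toC b != 0 ->
 (\int[leb2]_a coneG A (a, b) = \int[leb2]_z H A (z, b))%E.
move=> mA b0; have nb : b.1 ^+ 2 + b.2 ^+ 2 != 0 by rewrite -nsq_toC nsq_eq0.
have mG := measurable_fun_pair1 b (measurable_coneG mA).
have E := leb2_cmul nb mG (fun a => coneG_ge0 A (a, b)).
have {}E : (\int[leb2]_a coneG A (a, b) = (b.1 ^+ 2 + b.2 ^+ 2)%:E *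
  \int[leb2]_z coneG A ((b.1 * z.1 - b.2 * z.2, b.2 * z.1 + b.1 * z.2)%R, b))%E.
 by rewrite E muleA -EFinM divff // mul1e.
rewrite E -ge0_integralZl //; try (by move=> *; exact: coneG_ge0); try (by rewrite lee_fin addr_ge0 // sqr_ge0); last first.
 apply: (@measurableT_comp _ _ _ _ _ _ (coneG A) setT (fun z : mC => ((b.1 * z.1 - b.2 * z.2, b.2 * z.1 + b.1 * z.2)%R, b) : mC * mC)).
  exact: measurable_coneG.
 apply: measurable_fun_pair => //; apply: measurable_fun_pair.
  by apply: measurable_funB; apply: measurable_funM => //.
 by apply: measurable_funD; apply: measurable_funM => //.
apply: eq_integral => z _; rewrite /coneG /H -EFinM -mulrA; congr (_%:E); congr (_ * _).
rewrite !indicE -natrM; congr (_%:R).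
have Ez : toC (b.1 * z.1 - b.2 * z.2, b.2 * z.1 + b.1 * z.2)%R = toC z * toC b.
 by rewrite /toC /=; cring.
have nE : N4 ((b.1 * z.1 - b.2 * z.2, b.2 * z.1 + b.1 * z.2)%R, b) = nsq (toC b) * (1 + nsq (toC z)).
 by rewrite /N4 /= Ez nsqM; ring.
have hE : hq ((b.1 * z.1 - b.2 * z.2, b.2 * z.1 + b.1 * z.2)%R, b) = iota z.
 by rewrite /hq /= Ez /hquo (negbTE b0) mulfK.
have n0 : 0 < nsq (toC b) * (1 + nsq (toC z)).
 by rewrite mulr_gt0 ?nsq_gt0 // ltr_wpDr ?nsq_ge0.
rewrite mulnb; congr nat_of_bool; apply/idP/andP.
 by rewrite inE /coneset /= nE hE n0 /= => -[h1 h2]; rewrite !inE.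
by rewrite !inE /coneset /= nE hE n0 /= => -[h1 h2].
Qed.

(** Rescaling [b] by the square root of 1 + |z|^2 turns the constraint into the unit disc. The
    Jacobian and the weight contribute one factor (1 + |z|^2)^-1 each, which gives the spherical
    density up to [pi]. *)
Let H_slice (A : set Sph) (z : mC) :
 (\int[leb2]_b H A (z, b) =
  @coneK * (((1 + nsq (toC z)) ^+ 2)^-1 * \1_(iota @^-1` A) z)%:E)%E.
have s0 : 0 < 1 + nsq (toC z) by rewrite ltr_wpDr ?nsq_ge0.
pose s := Num.sqrt (1 + nsq (toC z)).
have s2 : s ^+ 2 = 1 + nsq (toC z) by rewrite sqr_sqrtr // ltW.
have ns : s ^+ 2 + 0 ^+ 2 != 0 by rewrite expr0n addr0 s2 lt0r_neq0.
have E := leb2_cmul ns (@measurable_ballw) (@ballw_ge0).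
have i0 : (0 <= ((1 + nsq (toC z))^-1 * \1_(iota @^-1` A) z)%:E)%E.
 by rewrite lee_fin mulr_ge0 ?invr_ge0 ?(ltW s0) // indicE.
transitivity (((1 + nsq (toC z))^-1 * \1_(iota @^-1` A) z)%:E *
  \int[leb2]_b ballw (s * b.1 - 0 * b.2, 0 * b.1 + s * b.2)%R)%E.
 rewrite -ge0_integralZl //; try (by move=> *; exact: ballw_ge0); last first.
  apply: (@measurableT_comp _ _ _ _ _ _ (@ballw) setT (fun b : mC => (s * b.1 - 0 * b.2, 0 * b.1 + s * b.2)%R : mC)).
   exact: measurable_ballw.
  apply: measurable_fun_pair.
   by apply: measurable_funB; apply: measurable_funM => //.
  by apply: measurable_funD; apply: measurable_funM => //.
 apply: eq_integral => b _; rewrite /H /ballw -EFinM; congr EFin.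
 rewrite !indicE /=.
 have nE : nsq (toC (s * b.1 - 0 * b.2, 0 * b.1 + s * b.2)) = (1 + nsq (toC z)) * nsq (toC b).
  by rewrite -s2 !nsq_toC /=; ring.
 have hmem : (((s * b.1 - 0 * b.2, 0 * b.1 + s * b.2) : mC) \in [set q : mC | nsq (toC q) <= 1]) = (((z, b) : mC * mC) \in [set p : mC * mC | nsq (toC p.2) * (1 + nsq (toC p.1)) <= 1]).
  by apply/idP/idP; rewrite !inE /= nE mulrC.
 by rewrite hmem nE; field; exact: lt0r_neq0.
rewrite E -/coneK expr0n addr0 s2 muleA -EFinM muleC; congr (_ * _)%E.
by congr EFin; field; exact: lt0r_neq0.
Qed.

(** Integration of the two slice formulas in both orders. The first is available for [b != 0] only,
    hence the equality almost everywhere. *)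
Lemma JJ_coneE (A : set Sph) : measurable A ->
 JJ (coneG A) = (@coneK * (pi%:E * sph2 (iota @^-1` A)))%E.
move=> mA.
have mI := measurable_iotaV mA.
transitivity (\int[leb2]_b \int[leb2]_z H A (z, b))%E.
 apply: ge0_ae_eq_integral => //.
 - exact: (@measurable_fun_fubini_tonelli_G _ _ _ _ R leb2 _ (measurable_coneG mA) (coneG_ge0 A)).
 - exact: (@measurable_fun_fubini_tonelli_G _ _ _ _ R leb2 _ (mH mA) (H_ge0 A)).
 - by move=> b _; apply: integral_ge0 => a _; exact: coneG_ge0.
 - by move=> b _; apply: integral_ge0 => a _; exact: H_ge0.
 exists [set (0, 0)]; split; [|exact: leb2_pt|].
  by rewrite (_ : [set (0, 0)] = [set 0] `*` [set 0]); [apply: measurableX; exact: measurable_set1|apply/seteqP; split=> [[x y] [-> ->]|[x y] [/= -> ->]]].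
 move=> b hb; apply/eqP; apply: contra_notT hb => b0 _; apply: coneG_slice => //.
 apply: contra b0; rewrite /toC; case: b => x y; rewrite eq_complex /= => /andP[/eqP -> /eqP ->].
 by [].
transitivity (\int[leb2]_z \int[leb2]_b H A (z, b))%E.
 by rewrite (@fubini_tonelli _ _ _ _ R leb2 leb2 (H A) (mH mA)).
under eq_integral do rewrite H_slice.
have K0 : (0 <= @coneK)%E by apply/ltW/coneK_gt0.
have mD : measT (fun z : mC => (((1 + nsq (toC z)) ^+ 2)^-1 * \1_(iota @^-1` A) z)%:E).
 apply/measurable_EFinP; apply: measurable_funM; last exact: measurable_indic.
 apply: measurable_invr; last by move=> z; exact: sqr_ge0.
 by apply: measurable_funX; exact: measurable_1nsq.
have D0 z : (0 <= (((1 + nsq (toC z)) ^+ 2)^-1 * \1_(iota @^-1` A) z)%:E)%E.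
 by rewrite lee_fin mulr_ge0 ?invr_ge0 ?sqr_ge0.
rewrite ge0_integralZl //; congr (_ * _)%E.
rewrite /sph2 [in RHS]integral_mkcond -ge0_integralZl //; try (by rewrite lee_fin pi_ge0);
 try (by move=> z _; rewrite patchE; case: ifP => // _; rewrite lee_fin rho_ge0); last first.
 by apply/(measurable_restrictT _ mI)/measurable_EFinP/measurable_funTS; exact: measurable_rho.
apply: eq_integral => z _; rewrite patchE indicE.
case: ifPn => zA; last by rewrite mulr0 mule0.
rewrite (_ : true%:R = 1 :> R) // mulr1 -EFinM /rho -addrA -nsq_toC; congr EFin.
have p0 : pi != 0 :> R by rewrite gt_eqF // pi_gt0.
by rewrite [in RHS]invfM mulrA divff // mul1r.
Qed.

Lemma leb2_box : leb2 (`[-1, 1]%classic `*` `[-1, 1]%classic : set mC) = 4%:E.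
by rewrite leb2_rect; [congr EFin|lra|lra]; ring. Qed.

Let mbox : measurable (`[-1, 1]%classic `*` `[-1, 1]%classic : set mC).
by apply: measurableX; exact: measurable_itv. Qed.

Let nsq_box (q : mC) : nsq (toC q) <= 1 -> (`[-1, 1]%classic `*` `[-1, 1]%classic : set mC) q.
case: q => x y; rewrite nsq_toC /= !in_itv /= -!ler_norml => h; split.
 by rewrite -(@ler_sqr _ _ 1) ?nnegrE ?real_normK ?num_real ?expr1n //; have := sqr_ge0 y; lra.
by rewrite -(@ler_sqr _ _ 1) ?nnegrE ?real_normK ?num_real ?expr1n //; have := sqr_ge0 x; lra.
Qed.

Lemma coneK_lty : (@coneK < +oo)%E.
apply: (@le_lt_trans _ _ (\int[leb2]_b (\1_(`[-1, 1]%classic `*` `[-1, 1]%classic : set mC) b)%:E)%E).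
 apply: ge0_le_integral => //.
 - by move=> b _; exact: ballw_ge0.
 - exact: measurable_ballw.
 - by apply/measurable_EFinP; exact: measurable_indic.
 move=> b _; rewrite lee_fin !indicE; have [h|h] := boolP (b \in [set q : mC | nsq (toC q) <= 1]).
  by rewrite mulr1 mem_set; [move: h; rewrite inE|apply: nsq_box; move: h; rewrite inE].
 by rewrite mulr0.
set Q : set mC := `[-1, 1]%classic `*` `[-1, 1]%classic.
have -> : (\int[leb2]_x (\1_Q x)%:E = leb2 Q)%E by rewrite integral_indic // setIT.
by rewrite leb2_box ltry.
Qed.

Lemma JJ_cone_lty (A : set Sph) : measurable A -> (JJ (coneG A) < +oo)%E.
move=> mA; set Q : set mC := `[-1, 1]%classic `*` `[-1, 1]%classic.
have LQ : leb2 Q = 4%:E := leb2_box.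
apply: (@le_lt_trans _ _ (\int[leb2]_b ((4 : R) * \1_Q b)%:E)%E); last first.
 under eq_integral do rewrite EFinM.
 rewrite ge0_integralZl //; last by apply/measurable_EFinP; exact: measurable_indic.
 have -> : (\int[leb2]_x (\1_Q x)%:E = leb2 Q)%E by rewrite integral_indic // setIT.
 by rewrite LQ ltry.
apply: ge0_le_integral => //.
- by move=> b _; apply: integral_ge0 => a _; exact: coneG_ge0.
- exact: (@measurable_fun_fubini_tonelli_G _ _ _ _ R leb2 _ (measurable_coneG mA) (coneG_ge0 A)).
- by apply/measurable_EFinP; apply: measurable_funM => //; exact: measurable_indic.
move=> b _; have [bQ|bQ] := boolP (b \in Q); last first.
 rewrite integral0_eq // => a _; rewrite /coneG indicE.
 rewrite (_ : _ \in _ = false) //; apply: contraNF bQ; rewrite !inE /coneset /N4 /= => -[/andP[_ h] _].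
 by apply: nsq_box; have := nsq_ge0 (toC a); lra.
apply: (@le_trans _ _ (\int[leb2]_a (\1_Q a)%:E)%E); last first.
 have -> : (\int[leb2]_x (\1_Q x)%:E = leb2 Q)%E by rewrite integral_indic // setIT.
 by rewrite LQ indicE bQ mulr1.
apply: ge0_le_integral => //.
- by move=> a _; exact: coneG_ge0.
- exact: (measurable_fun_pair1 b (measurable_coneG mA)).
- by apply/measurable_EFinP; exact: measurable_indic.
move=> a _; rewrite /coneG lee_fin !indicE.
case: (boolP (_ \in coneset A)) => // h; rewrite mem_set //; apply: nsq_box.
by move: h; rewrite inE /coneset /N4 => -[/andP[_ h] _]; have := nsq_ge0 (toC b); lra.
Qed.

Let Kpi_neq0 : exists2 k : R, 0 < k & (@coneK * pi%:E = k%:E)%E.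
have := @coneK_gt0; have := coneK_lty; case: coneK => // k _; rewrite lte_fin => k0.
by exists (k * pi); rewrite ?mulr_gt0 ?pi_gt0.
Qed.

Lemma sph2_lty : (@sph2 setT < +oo)%E.
have := JJ_cone_lty (@measurableT _ Sph); rewrite JJ_coneE // muleA preimage_setT.
have [k k0 ->] := Kpi_neq0.
have : (0 <= @sph2 setT)%E by pos.
case: (sph2 setT) => [r||] //= _; first by move=> _; rewrite ltry.
by rewrite gt0_muley.
Qed.

Lemma sph2_unitary (U : 'M[C]_2) (A : set Sph) : SL2 U -> unitary2 U -> measurable A ->
 sph2 (iota @^-1` ((mobius U : Sph -> Sph) @^-1` A)) = sph2 (iota @^-1` A).
move=> U1 Uu mA.
have mUA : measurable ((mobius U : Sph -> Sph) @^-1` A).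
 by rewrite -[X in measurable X]setTI; apply: (continuous_measurable_Sph (mobius_continuous U1)).
have := JJ_cone_unitary U1 Uu mA; rewrite !JJ_coneE // !muleA.
have [k k0 ->] := Kpi_neq0 => /(congr1 (fun x => (k^-1)%:E * x)%E).
by rewrite !muleA -EFinM mulVf ?lt0r_neq0 // !mul1e.
Qed.

End SphereMeasureInvariance.

(* Spherical integrals are taken over the finite plane: the point at infinity
  is negligible. *)
Definition sI (g : C -> R) : R := \int[sph2]_p g (toC p).
Definition sm : R := sI (fun=> 1).

Definition adm (g : C -> R) : Prop :=
 measT (fun p : mC => g (toC p)) /\ exists K, forall z, `|g z| <= K.

Lemma adm_integrable g : adm g -> sph2.-integrable setT (EFin \o (fun p : mC => g (toC p))).
case=> mg [K gK]; apply: measurable_bounded_integrable => //; first exact: sph2_lty.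
exists K; split; first exact: num_real.
by move=> x Kx p _; apply: le_trans (gK _) (ltW Kx).
Qed.

Lemma adm_cst c : adm (fun=> c).
by split; [exact: measurable_cst|exists `|c|]. Qed.

Lemma admD g h : adm g -> adm h -> adm (fun z => g z + h z).
move=> [mg [K gK]] [mh [L hL]]; split; first exact: measurable_funD.
by exists (K + L) => z; rewrite (le_trans (ler_normD _ _)) // lerD.
Qed.

Lemma admM g h : adm g -> adm h -> adm (fun z => g z * h z).
move=> [mg [K gK]] [mh [L hL]]; split; first exact: measurable_funM.
by exists (K * L) => z; rewrite normrM ler_pM.
Qed.

Lemma admN g : adm g -> adm (fun z => - g z).
move=> ag; have := admM (adm_cst (-1)) ag.
by congr adm; apply/funext => z; rewrite mulN1r.
Qed.

Lemma admB g h : adm g -> adm h -> adm (fun z => g z - h z).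
by move=> ag ah; apply: admD => //; exact: admN. Qed.

Lemma sID g h : adm g -> adm h -> sI (fun z => g z + h z) = sI g + sI h.
by move=> ag ah; rewrite /sI RintegralD //; exact: adm_integrable. Qed.

Lemma sIB g h : adm g -> adm h -> sI (fun z => g z - h z) = sI g - sI h.
by move=> ag ah; rewrite /sI RintegralB //; exact: adm_integrable. Qed.

Lemma sIZ c g : adm g -> sI (fun z => c * g z) = c * sI g.
by move=> ag; rewrite /sI RintegralZl //; exact: adm_integrable. Qed.

Lemma sI_cst c : sI (fun=> c) = c * sm.
by rewrite -[in LHS](mulr1 c); exact: (sIZ c (adm_cst 1)). Qed.

Lemma sI_le g h : adm g -> adm h -> (forall z, g z <= h z) -> sI g <= sI h.
by move=> ag ah gh; apply: le_Rintegral => //; exact: adm_integrable. Qed.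

Lemma sI_ge0 g : (forall z, 0 <= g z) -> 0 <= sI g.
by move=> g0; apply: Rintegral_ge0 => p _; exact: g0. Qed.

Definition mass (P : C -> bool) : R := sI (fun z => (P z)%:R).

Definition mpred (P : C -> bool) : Prop := measT (fun p : mC => P (toC p)).

Lemma adm_pred P : mpred P -> adm (fun z => (P z)%:R).
move=> mP; split; last by exists 1 => z; case: (P z); rewrite ?normr1 ?normr0.
rewrite (_ : (fun p => _) = \1_[set p : mC | P (toC p)]).
 by apply: measurable_indic; rewrite -[X in measurable X]setTI; apply: (mP measurableT [set true]).
apply/funext => p; rewrite indicE; have -> : (p \in [set p : mC | P (toC p)]) = P (toC p) by apply/idP/idP; rewrite inE.
by [].
Qed.

Lemma mpred_lt (f g : C -> R) : measT (fun p : mC => f (toC p)) ->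
 measT (fun p : mC => g (toC p)) -> mpred (fun z => f z < g z).
by move=> mf mg; apply: measurable_fun_ltr. Qed.

Lemma mpred_or P Q : mpred P -> mpred Q -> mpred (fun z => P z || Q z).
by move=> mP mQ; apply: measurable_or. Qed.

Lemma mass_sub P Q : mpred P -> mpred Q -> (forall z, P z -> Q z) -> mass P <= mass Q.
move=> mP mQ PQ; apply: sI_le; try exact: adm_pred.
by move=> z; case: (boolP (P z)) => [/PQ ->|_] //; rewrite ler0n.
Qed.

Lemma mass_or P Q : mpred P -> mpred Q -> mass (fun z => P z || Q z) <= mass P + mass Q.
move=> mP mQ; rewrite -sID; try exact: adm_pred; apply: sI_le.
- by apply: adm_pred; exact: mpred_or.
- by apply: admD; exact: adm_pred.
by move=> z; rewrite -natrD ler_nat; case: (P z); case: (Q z).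
Qed.

Lemma massE P : mpred P -> mass P = fine (sph2 [set p : mC | P (toC p)]).
move=> mP; rewrite /mass /sI /Rintegral; congr fine.
transitivity (\int[sph2]_p (\1_[set p : mC | P (toC p)] p)%:E)%E.
 apply: eq_integral => p _; rewrite indicE; have -> : (p \in [set p : mC | P (toC p)]) = P (toC p) by apply/idP/idP; rewrite inE.
 by [].
rewrite integral_indic ?setIT //.
by rewrite -[X in measurable X]setTI; apply: (mP measurableT [set true]).
Qed.

Lemma sph2_le_leb2 (A : set mC) : measurable A -> (sph2 A <= leb2 A)%E.
move=> mA; rewrite -[leb2 A]mul1e -(integral_cst leb2 mA) /sph2.
apply: ge0_le_integral => //.
- by move=> p _; rewrite lee_fin rho_ge0.
- by apply/measurable_EFinP; apply: measurable_funTS; exact: measurable_rho.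
move=> p _; rewrite lee_fin /rho invf_le1; last first.
 by rewrite mulr_gt0 ?pi_gt0 // exprn_gt0 // -addrA ltr_wpDr // addr_ge0 ?sqr_ge0.
have h1 : 1 <= pi :> R by apply: le_trans (pi_ge2 R); rewrite ler1n.
by apply: (le_trans h1); rewrite ler_peMr ?pi_ge0 // exprn_ege1 // -addrA lerDl addr_ge0 ?sqr_ge0.
Qed.

Lemma sm_gt0 : 0 < sm.
pose Q : set mC := `[-1, 1]%classic `*` `[-1, 1]%classic.
have mQ : measurable Q by apply: measurableX; exact: measurable_itv.
have aq : adm (fun z => \1_Q (ofC z)).
 split; last by exists 1 => z; rewrite indicE; case: (_ \in _); rewrite ?normr1 ?normr0.
 have -> : (fun p : mC => \1_Q (ofC (toC p)) : R) = \1_Q by apply/funext=> p; rewrite ofCK.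
 exact: measurable_indic.
have p9 : 0 < (pi * 9)^-1 :> R by rewrite invr_gt0 mulr_gt0 ?pi_gt0.
have h : ((4 * (pi * 9)^-1)%:E <= sph2 Q)%E.
 rewrite mulrC EFinM -(@leb2_box) -(integral_cst leb2 mQ); apply: ge0_le_integral => //.
 - by move=> p _; rewrite ltW.
 - by apply/measurable_EFinP; apply: measurable_funTS; exact: measurable_rho.
 move=> [x y] [/=]; rewrite !in_itv /= => /andP[x1 x2] /andP[y1 y2]; rewrite lee_fin /rho /=.
 have hx : x ^+ 2 <= 1 by rewrite -ler_sqrt ?sqrtr_sqr ?sqrtr1 ?ler_norml ?x1.
 have hy : y ^+ 2 <= 1 by rewrite -ler_sqrt ?sqrtr_sqr ?sqrtr1 ?ler_norml ?y1.
 have hx0 := sqr_ge0 x; have hy0 := sqr_ge0 y.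
 have hs : 0 < 1 + x ^+ 2 + y ^+ 2 by lra.
 rewrite lef_pV2 ?posrE ?mulr_gt0 ?pi_gt0 //.
 rewrite ler_pM2l ?pi_gt0 // (_ : 9 = 3 ^+ 2); last by ring.
 by rewrite ler_sqr ?nnegrE; lra.
have h2 : (sph2 Q <= sph2 (setT : set mC))%E by apply: le_measure => //; rewrite ?inE.
have s1 : sm = fine (sph2 (setT : set mC)) by rewrite /sm /sI Rintegral_cst // mul1r.
rewrite s1 fine_gt0 // sph2_lty andbT (lt_le_trans _ (le_trans h h2)) // lte_fin.
by pos.
Qed.

Lemma sI_unitary (U : 'M[C]_2) (h : Ch -> R) : SL2 U -> unitary2 U -> continuous h ->
 (\int[sph2]_p (h (mobius U (iota p)))%:E = \int[sph2]_p (h (iota p))%:E)%E.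
move=> U1 Uu ch.
have mh : measT (fun z : Sph => (h z)%:E).
 by apply/measurable_EFinP; exact: continuous_measurable_SphR.
have mU : measT (mobius U : Sph -> Sph).
 exact: (continuous_measurable_Sph (mobius_continuous U1)).
have mUi : measT ((mobius U : Sph -> Sph) \o iota).
 exact: measurableT_comp mU (@measurable_iota).
have bh : exists K, forall z, `|h z| <= K.
 have : compact (setT : set Ch) by exact: one_point_compactification_compact.
 move=> cT; have := continuous_compact (@continuous_subspaceT _ _ setT h ch) cT.
 move=> /compact_bounded[K [_ hK]]; exists (K + 1) => z; apply: (hK (K + 1)); rewrite ?ltrDl //.
have ih phi (mphi : measT (phi : mC -> Sph)) :
  sph2.-integrable setT ((fun z : Sph => (h z)%:E) \o phi).
 apply: measurable_bounded_integrable => //; first exact: sph2_lty.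
  by apply: measurableT_comp mphi; exact: continuous_measurable_SphR.
 have [K hK] := bh; exists K; split; first exact: num_real.
 by move=> x Kx p _; apply: le_trans (hK _) (ltW Kx).
have E1 := @integral_pushforward _ _ _ _ R ((mobius U : Sph -> Sph) \o iota) mUi sph2 setT (fun z : Sph => (h z)%:E) mh (ih _ mUi) measurableT.
have E2 := @integral_pushforward _ _ _ _ R iota (@measurable_iota) sph2 setT (fun z : Sph => (h z)%:E) mh (ih _ (@measurable_iota)) measurableT.
rewrite !preimage_setT in E1 E2.
transitivity (\int[pushforward sph2 ((mobius U : Sph -> Sph) \o iota)]_z (h z)%:E)%E; first by rewrite E1.
transitivity (\int[pushforward sph2 iota]_z (h z)%:E)%E; last by rewrite E2.
apply: eq_measure_integral; first exact: measurable_iota.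
move=> mi A mA _; change (sph2 (iota @^-1` ((mobius U : Sph -> Sph) @^-1` A)) = sph2 (iota @^-1` A)).
exact: (sph2_unitary U1 Uu mA).
Qed.

(** * Non-concentration: a binary form is small only near its zeros *)

Definition cap (a b : C) (e : R) (z : C) : bool :=
 nsq (a * z + b) < e * ((nsq a + nsq b) * (1 + nsq z)).

Lemma mpred_cap a b e : mpred (cap a b e).
apply: mpred_lt.
 by apply: measurable_nsq; apply: cmeasD (cmeasM (cmeas_cst a) (@cmeas_toC)) (cmeas_cst b).
apply: measurable_funM => //; apply: measurable_funM => //.
exact: measurable_1nsq.
Qed.

Lemma mpred_hev_lt d p c : mpred (fun z => nsq (hev d p z 1) < c * (1 + nsq z) ^+ d).
apply: mpred_lt; first by apply: measurable_nsq; exact: cmeas_hev (@cmeas_toC) (cmeas_cst 1).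
by apply: measurable_funM => //; apply: measurable_funX; exact: measurable_1nsq.
Qed.

(** Completes a normalized linear form to an element of SU(2), so that a rotation makes the form a
    coordinate. *)
Lemma unit_lift (a b : C) : (a != 0) || (b != 0) ->
 exists U : 'M[C]_2, [/\ SL2 U, unitary2 U & exists2 k : C, nsq k * (nsq a + nsq b) = 1 &
  U 0 0 = k * a /\ U 0 1 = k * b].
move=> ab; have n0 : 0 < nsq a + nsq b by rewrite vn_gt0.
pose s := Num.sqrt (nsq a + nsq b).
have s2 : s ^+ 2 = nsq a + nsq b by rewrite sqr_sqrtr // ltW.
have s0 : 0 < s by pos.
pose k : C := rC s^-1.
have nk : nsq k * (nsq a + nsq b) = 1 by rewrite nsq_real -s2 exprVn mulVf // sqrf_eq0 gt_eqF.
pose U : 'M[C]_2 := \matrix_(i, j) (nth [::] [:: [:: k * a; k * b]; [:: - (k * b)^*; (k * a)^*]] i)`_j.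
have d1 : k * a * (k * a)^* + k * b * (k * b)^* = 1.
 by rewrite !conj_mulC !nsqM; apply/eqP; rewrite eq_complex /= -mulrDr nk addr0 !eqxx.
exists U; split.
- rewrite /SL2 /= det2E !mxE /= -d1; ring.
- move=> u v; rewrite !mxE /= -[RHS]mul1r -nk.
 have -> : nsq k * (nsq a + nsq b) = nsq (k * a) + nsq (k * b) by rewrite !nsqM mulrDr.
 move: (k * a) (k * b) => [x y] [x' y']; case: u => u1 u2; case: v => v1 v2.
 by rewrite /nsq /=; ring.
- by exists k => //; rewrite !mxE.
Qed.

(** For [e <= 1 / 2] the condition |z|^2 < e (1 + |z|^2) gives |z|^2 <= 2 e. The cap thus lies in a
    square of area 8 e, and the spherical density is at most 1. *)
Lemma mass_cap0 e : 0 <= e <= 1 / 2 -> mass (cap 1 0 e) <= 8 * e.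
move=> /andP[e0 e2]; rewrite massE; last exact: mpred_cap.
pose s := Num.sqrt (2 * e); have s0 : 0 <= s by pos.
have s2 : s ^+ 2 = 2 * e by rewrite sqr_sqrtr // mulr_ge0.
pose Q : set mC := `[- s, s]%classic `*` `[- s, s]%classic.
have mQ : measurable Q by apply: measurableX; exact: measurable_itv.
have lQ : leb2 Q = (8 * e)%:E by rewrite leb2_rect; [congr EFin; rewrite opprK; have : (s + s) * (s + s) = 4 * s ^+ 2 by ring| |]; lra.
have sub : [set p : mC | cap 1 0 e (toC p)] `<=` Q.
 move=> [x y]; rewrite /cap /= nsq1 nsq0 !addr0 !mul1r nsq_toC /= => h.
 have {}h : x ^+ 2 + y ^+ 2 <= s ^+ 2.
  rewrite s2; have : 0 <= x ^+ 2 + y ^+ 2 by rewrite addr_ge0 ?sqr_ge0.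
  move: h; move: (x ^+ 2 + y ^+ 2) => t h t0.
  have : e * t <= 1 / 2 * t by rewrite ler_wpM2r.
  lra.
 split; rewrite /= in_itv -ler_norml -ler_sqr // real_normK ?num_real //; apply: le_trans h.
  by rewrite lerDl sqr_ge0.
 by rewrite lerDr sqr_ge0.
have mS : measurable [set p : mC | cap 1 0 e (toC p)].
 by rewrite -[X in measurable X]setTI; apply: ((mpred_cap 1 0 e) measurableT [set true]).
have h : (sph2 [set p : mC | cap 1 0 e (toC p)] <= (8 * e)%:E)%E.
 rewrite -lQ; apply: le_trans (sph2_le_leb2 mQ); apply: le_measure => //; rewrite inE //.
by rewrite -lee_fin fineK // ge0_fin_numE ?(le_lt_trans h) ?ltry.
Qed.

(** A rotation carries the zero of the linear form to 0; in the set [A] below the cap is described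
    by the chordal distance to 0, so that [sph2_unitary] applies. *)
Lemma mass_cap a b e : (a != 0) || (b != 0) -> 0 <= e <= 1 / 2 -> mass (cap a b e) <= 8 * e.
move=> ab he; apply: le_trans (mass_cap0 he).
have [U [U1 Uu [k nk [Ua Ub]]]] := unit_lift ab.
have k0 : 0 < nsq k.
 by rewrite lt_def nsq_ge0 andbT; apply: contra_eqN nk => /eqP ->; rewrite mul0r eq_sym.
pose A : set Sph := [set z : Ch | chordal z (Some 0) ^+ 2 < 4 * e].
have mA : measurable A.
 apply: sub_sigma_algebra; rewrite openE => z Az; apply/nbhs_chordal.
 have cz : chordal z (Some 0) < Num.sqrt (4 * e).
  by rewrite -(ger0_norm (chordal_ge0 _ _)) -sqrtr_sqr ltr_sqrt // (le_lt_trans (sqr_ge0 _) Az).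
 exists (Num.sqrt (4 * e) - chordal z (Some 0)); first by rewrite subr_gt0.
 move=> y zy; rewrite /A /=.
 have : chordal y (Some 0) < Num.sqrt (4 * e).
  by apply: le_lt_trans (chordal_triangle y z _) _; rewrite (chordal_sym y) -ltrBrDr.
 by rewrite -{1}(ger0_norm (chordal_ge0 _ _)) -sqrtr_sqr ltr_sqrt // (le_lt_trans (sqr_ge0 _) Az).
have capE (u v : C) : (u != 0) || (v != 0) -> A (hquo u v) <-> nsq u < e * (nsq u + nsq v).
 move=> uv; rewrite /A /= -hquo_some chordal_hquo ?oner_neq0 ?orbT //.
 rewrite mulr1 mulr0 subr0 nsq0 nsq1 add0r mulr1 -mulrA ltr_pM2l // ltr_pdivrMr //.
 by rewrite vn_gt0.
rewrite !massE; try exact: mpred_cap.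
apply: eqR_le; congr fine.
transitivity (sph2 (iota @^-1` ((mobius U : Sph -> Sph) @^-1` A))); last first.
 rewrite sph2_unitary //; congr sph2; apply/seteqP; split=> p.
  rewrite /= /iota -hquo_some => /capE; rewrite oner_neq0 orbT /cap => /(_ isT).
  by rewrite nsq0 nsq1 addr0 mul1r addr0 mul1r addrC.
 rewrite /= /iota -hquo_some => h; apply/capE; rewrite ?oner_neq0 ?orbT //; move: h.
 by rewrite /cap nsq0 nsq1 addr0 mul1r addr0 mul1r addrC.
have nU z : nsq (U 0 0 * z + U 0 1 * 1) = nsq k * nsq (a * z + b).
 by rewrite Ua Ub -nsqM; congr nsq; ring.
have nT z : nsq (U 0 0 * z + U 0 1 * 1) + nsq (U 1 0 * z + U 1 1 * 1) = 1 + nsq z.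
 by rewrite Uu nsq1 addrC.
have cz z : cap a b e z <-> nsq (U 0 0 * z + U 0 1 * 1) < e * (nsq (U 0 0 * z + U 0 1 * 1) + nsq (U 1 0 * z + U 1 1 * 1)).
 rewrite nT nU /cap -(ltr_pM2l k0) mulrCA mulrA.
 by rewrite -[e * nsq k * _]mulrA (mulrA (nsq k)) nk mul1r.
have key p : cap a b e (toC p) <-> A (mobius U (Some (toC p) : Ch)).
 rewrite -hquo_some mobius_hquo ?oner_neq0 ?orbT //; apply: iff_trans (cz _) _; apply: iff_sym.
 by apply: capE; apply: SL2_nz => //; rewrite oner_neq0 orbT.
congr sph2; apply/seteqP; split=> p h; first exact: (iffLR (key p) h).
exact: (iffRL (key p) h).
Qed.

(** The factor [(e / 2) ^ d] fits the induction on the degree: each unit linear factor costs [e]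
    when it is not small, and a factor 2 in the coefficient norm by [cn_linp]. *)
Definition small (d : nat) (p : {poly C}) (e : R) (z : C) : bool :=
 nsq (hev d p z 1) < (e / 2) ^+ d * cn d p * (1 + nsq z) ^+ d.

Lemma mpred_small d p e : mpred (small d p e).
exact: mpred_hev_lt. Qed.

Lemma cn_linp d a b (q : {poly C}) : (size q <= d.+1)%N -> nsq a + nsq b = 1 ->
 cn d.+1 (linp a b * q) <= 2 * cn d q.
move=> sq ab.
have h (j : nat) : nsq (linp a b * q)`_j <= nsq (if j is j'.+1 then q`_j' else 0) + nsq q`_j.
 have -> : (linp a b * q)`_j = a * (if j is j'.+1 then q`_j' else 0) + b * q`_j.
  by rewrite /linp mulrDl coefD -scalerAl coefZ coefXM coefCM; case: j.
 move: (if j is _.+1 then _ else _) (q`_j) ab => [x y] [u v]; case: a => a1 a2; case: b => b1 b2.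
 rewrite /nsq /= => ab.
 have -> : (a1 * x - a2 * y + (b1 * u - b2 * v)) ^+ 2 + (a1 * y + a2 * x + (b1 * v + b2 * u)) ^+ 2 =
  (a1 ^+ 2 + a2 ^+ 2 + (b1 ^+ 2 + b2 ^+ 2)) * (x ^+ 2 + y ^+ 2 + (u ^+ 2 + v ^+ 2)) -
  ((a1 * u + a2 * v - (b1 * x + b2 * y)) ^+ 2 + (a1 * v - a2 * u - (b1 * y - b2 * x)) ^+ 2) by ring.
 by rewrite ab mul1r gerBl addr_ge0 ?sqr_ge0.
rewrite /cn; apply: le_trans (ler_sum _ (fun (j : 'I_d.+2) _ => h j)) _.
rewrite big_split big_ord_recl /= nsq0 add0r [X in _ + X]big_ord_recr /= (nth_default _ sq) nsq0 addr0.
by rewrite mulr_natl.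
Qed.

(** A form of positive degree has a linear factor over C. If the leading coefficient vanishes the
    zero is at infinity, and the factor is the constant polynomial 1 read in degree 1. *)
Lemma hom_factor d (p : {poly C}) : (size p <= d.+2)%N ->
 exists a b (q : {poly C}), [/\ nsq a + nsq b = 1, (size q <= d.+1)%N & p = linp a b * q].
move=> sp; have [sp'|sp'] := leqP (size p) d.+1.
 exists 0, 1, p; split=> //; first by rewrite nsq0 nsq1 add0r.
 by rewrite /linp scale0r add0r mul1r.
have /closed_rootP[r rp] : size p != 1%N by rewrite neq_ltn (leq_trans _ sp') ?orbT.
move/factor_theorem: rp => [q Ep].
pose s := Num.sqrt (1 + nsq r).
have s2 : s ^+ 2 = 1 + nsq r by rewrite sqr_sqrtr // addr_ge0.
have s0 : s != 0 by rewrite -sqrf_eq0 s2 gt_eqF // ltr_wpDr.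
pose k : C := rC s; have k0 : k != 0 by rewrite -nsq_eq0 nsq_real sqrf_eq0.
exists k^-1, (- r / k), (k *: q); split.
- rewrite nsqM nsqV nsqN nsq_real s2 -[X in X + _]mul1r -mulrDl divff //.
 by rewrite -s2 sqrf_eq0.
- have p0 : p != 0 by rewrite -size_poly_gt0 (leq_trans _ sp').
 have q0 : q != 0 by apply: contraNneq p0 => q0; rewrite Ep q0 mul0r.
 move: sp; rewrite Ep size_Mmonic ?monicXsubC // size_XsubC addn2 /= => sp.
 by rewrite (leq_trans (size_scale_leq _ _)).
rewrite Ep /linp -scalerAr scalerAl scalerDr scalerA divff // scale1r -polyCN mulrC; congr (_ * _).
by rewrite scale_polyC mulrC divfK.
Qed.

(** If the product of a unit linear form and [q] is small, then one of the two is small; induction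
    adds up the areas of d caps. *)
Lemma mass_small d (p : {poly C}) e : (size p <= d.+1)%N -> 0 <= e <= 1 / 2 ->
 mass (small d p e) <= d%:R * (8 * e).
move=> + he; have /andP[e0 e1] := he.
elim: d p => [|d IH] p sp.
 rewrite mul0r /mass /small (_ : (fun z => _) = fun=> 0) ?sI_cst ?mul0r //.
 apply/funext => z; rewrite /cn big_ord1 !expr0 mul1r mulr1.
 by rewrite /hev big_ord1 !mulr1 ltxx.
have [a [b [q [ab sq Ep]]]] := hom_factor sp.
have ab0 : (a != 0) || (b != 0) by rewrite -vn_gt0 ab.
apply: (@le_trans _ _ (mass (fun z => cap a b e z || small d q e z))).
 apply: mass_sub; [exact: mpred_small|apply: mpred_or; [exact: mpred_cap|exact: mpred_small]|].
 move=> z; rewrite /small /cap ab mul1r; apply: contraTT; rewrite negb_or -!leNgt => /andP[h1 h2].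
 have Eh := hevM z 1 (size_linp a b) sq; rewrite hev_linp mulr1 add1n -Ep in Eh; rewrite Eh nsqM.
 have w0 : 0 <= 1 + nsq z by pos.
 apply: le_trans (ler_pM _ _ h1 h2); [|by pos|by rewrite !mulr_ge0 ?exprn_ge0 ?divr_ge0].
 rewrite (_ : e * _ * _ = (e / 2) ^+ d.+1 * (2 * cn d q) * (1 + nsq z) ^+ d.+1).
  rewrite ler_wpM2r ?exprn_ge0 // ler_wpM2l ?exprn_ge0 ?divr_ge0 //.
  by rewrite Ep; exact: cn_linp.
 by rewrite !exprS; field.
apply: le_trans (mass_or _ _) _; [exact: mpred_cap|exact: mpred_small|].
have -> : d.+1%:R * (8 * e) = 8 * e + d%:R * (8 * e) by rewrite -natr1; ring.
exact: lerD (mass_cap ab0 he) (IH q sq).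
Qed.

(** * Points of hyperbolic space as classes of SL_2 modulo SU(2) *)

Definition mk2 (a b c e : C) : 'M[C]_2 :=
 \matrix_(i, j) (nth [::] [:: [:: a; b]; [:: c; e]] i)`_j.

Lemma mk2E a b c e : ((mk2 a b c e 0 0 = a) * (mk2 a b c e 0 1 = b) *
 (mk2 a b c e 1 0 = c) * (mk2 a b c e 1 1 = e))%type.
by rewrite !mxE. Qed.

Lemma ord2P (i : 'I_2) : i = 0 \/ i = 1.
by case: i => [[|[|//]] hi]; [left|right]; apply: val_inj. Qed.

Lemma mx2P (A B : 'M[C]_2) : A 0 0 = B 0 0 -> A 0 1 = B 0 1 -> A 1 0 = B 1 0 ->
 A 1 1 = B 1 1 -> A = B.
by move=> *; apply/matrixP => i j; case: (ord2P i) => ->; case: (ord2P j) => ->. Qed.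

(** The adjugate, which is the inverse on SL_2 and has entries linear in those of [M]. *)
Definition inv2 M := mk2 (M 1 1) (- M 0 1) (- M 1 0) (M 0 0).

Lemma SL2E M : SL2 M <-> M 0 0 * M 1 1 - M 0 1 * M 1 0 = 1.
by rewrite /SL2 /= det2E. Qed.

Lemma SL2_mul M N : SL2 M -> SL2 N -> SL2 (M *m N).
by rewrite /SL2 /= det_mulmx => -> ->; rewrite mulr1. Qed.

Lemma SL2_inv2 M : SL2 M -> SL2 (inv2 M).
by rewrite !SL2E !mk2E => <-; ring. Qed.

Lemma SL2_1 : SL2 (1%:M : 'M[C]_2).
by rewrite /SL2 /= det1. Qed.

Lemma mul_inv2 M : SL2 M -> inv2 M *m M = 1%:M.
by move/SL2E => h; apply: mx2P; rewrite mulmx2E !mxE /= -?h; ring.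
Qed.

Lemma mul_inv2r M : SL2 M -> M *m inv2 M = 1%:M.
by move/SL2E => h; apply: mx2P; rewrite mulmx2E !mxE /= -?h; ring.
Qed.

Lemma inv2K M : inv2 (inv2 M) = M.
by apply: mx2P; rewrite !mk2E ?opprK. Qed.

Lemma inv2_mul M N : inv2 (M *m N) = inv2 N *m inv2 M.
by apply: mx2P; rewrite !(mk2E, mulmx2E); ring. Qed.

Lemma mn_inv2 M : mn (inv2 M) = mn M.
by rewrite /mn !mk2E !nsqN; ring. Qed.

Lemma nsqE (z : C) : nsq z = Re z ^+ 2 + Im z ^+ 2. by []. Qed.

(* Frobenius norm: an element of SL_2 has squared norm at least 2, with equality
  exactly on SU(2). *)
Lemma SL2_mn M : SL2 M ->
 mn M - 2 = nsq (M 0 0 - (M 1 1)^*) + nsq (M 0 1 + (M 1 0)^*).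
move/SL2E => h; have h1 := congr1 (@Re R) h; rewrite !reim in h1.
have -> : 2 = 2 * Re (M 0 0 * M 1 1 - M 0 1 * M 1 0) by rewrite h mulr1.
by rewrite /mn !nsqE !reim; ring.
Qed.

Lemma mn_ge2 M : SL2 M -> 2 <= mn M.
by move/SL2_mn => h; rewrite -subr_ge0 h addr_ge0. Qed.

Definition su2 (U : 'M[C]_2) : Prop :=
 [/\ U 1 1 = (U 0 0)^*, U 1 0 = - (U 0 1)^* & nsq (U 0 0) + nsq (U 0 1) = 1].

Lemma mn2_su2 M : SL2 M -> mn M = 2 -> su2 M.
move=> h m2; have := SL2_mn h; rewrite m2 subrr => /esym/eqP.
rewrite paddr_eq0 // !nsq_eq0 subr_eq0 addr_eq0 => /andP[/eqP e1 /eqP e2].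
have e3 : M 1 1 = (M 0 0)^* by rewrite e1 conjCK.
have e4 : M 1 0 = - (M 0 1)^* by rewrite e2 rmorphN /= conjCK opprK.
split=> //; move/SL2E: h => h; have := congr1 (@Re R) h.
by rewrite e3 e4 !nsqE !reim => <-; ring.
Qed.

Lemma su2_SL2 U : su2 U -> SL2 U.
by case=> e3 e4 h; apply/SL2E; rewrite e3 e4; creim; [rewrite -h !nsqE|]; ring.
Qed.

Lemma su2_unitary U : su2 U -> unitary2 U.
case=> e3 e4 h a b; rewrite e3 e4 -[RHS]mul1r -h.
by rewrite !nsqE !reim; ring.
Qed.

Lemma su2_mn U : su2 U -> mn U = 2.
by case=> e3 e4 h; rewrite /mn e3 e4 nsqN !nsq_conj; lra. Qed.

Lemma su2_inv2 U : su2 U -> su2 (inv2 U).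
case=> e3 e4 h; rewrite /su2 !mk2E e3 e4 !opprK !conjCK nsqN nsq_conj; split=> //.
by rewrite rmorphN opprK. Qed.

Lemma mn_mul_su2 M (U : 'M[C]_2) : su2 U -> mn (M *m U) = mn M.
case=> e3 e4 h; rewrite /mn !mulmx2E e3 e4 -[RHS]mul1r -h.
by rewrite !nsqE !reim; ring.
Qed.

Lemma mn_su2_mul M (U : 'M[C]_2) : su2 U -> mn (U *m M) = mn M.
by move=> hU; rewrite -mn_inv2 inv2_mul mn_mul_su2 ?mn_inv2 //; exact: su2_inv2.
Qed.

(** [rowA], [rowB] and [rowc] are the entries of the Hermitian matrix [M M^*], on which the point
    [M . 0] depends. *)
Definition rowA M : R := nsq (M 0 0) + nsq (M 0 1).
Definition rowB M : R := nsq (M 1 0) + nsq (M 1 1).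
Definition rowc M : C := M 0 0 * (M 1 0)^* + M 0 1 * (M 1 1)^*.

Lemma mn_rows M : mn M = rowA M + rowB M.
by rewrite /mn /rowA /rowB; ring. Qed.

Lemma rows_det M : SL2 M -> rowA M * rowB M = 1 + nsq (rowc M).
move/SL2E => h; rewrite -[1](@nsq1) -h /rowA /rowB /rowc.
by rewrite !nsqE !reim; ring.
Qed.

(** The image of the centre of the ball under [M], found by solving [herm x = M M^*]; the trace of
    the right side is [mn M]. *)
Definition mpt M : 'rV[R]_3 :=
 (mn M + 2)^-1 *: \row_i [:: 2 * Re (rowc M); 2 * Im (rowc M); rowA M - rowB M]`_i.

Lemma mptE M : ((mpt M 0 0 = ((mn M + 2)^-1 * (2 * Re (rowc M)))%R) *
 (mpt M 0 1 = ((mn M + 2)^-1 * (2 * Im (rowc M)))%R) *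
 (mpt M 0 2 = ((mn M + 2)^-1 * (rowA M - rowB M))%R))%type.
by rewrite !mxE. Qed.

Lemma sqnorm_mpt M : SL2 M -> sqnorm3 (mpt M) = (mn M - 2) / (mn M + 2).
move=> h; have hd := rows_det h.
have n0 : mn M + 2 != 0 by rewrite gt_eqF // addr_gt0 // (lt_le_trans _ (mn_ge2 h)).
rewrite sqnorm3E !mptE; apply: (mulIf n0); apply: (mulIf n0).
rewrite divfK //.
transitivity (4 * nsq (rowc M) + (rowA M - rowB M) ^+ 2); first by rewrite nsqE; field.
have -> : nsq (rowc M) = rowA M * rowB M - 1 by rewrite hd addrC addKr.
by rewrite mn_rows; ring.
Qed.

Lemma mpt_ball M : SL2 M -> ball3 (mpt M).
move=> h; have m2 := mn_ge2 h; rewrite /ball3 /= sqnorm_mpt // ltr_pdivrMr; lra.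
Qed.

Lemma herm_entry (x : 'rV[R]_3) (z w : C) : ball3 x ->
 (1 - sqnorm3 x != 0 -> z = rC (1 - sqnorm3 x) * w) -> (1 - rC (sqnorm3 x))^-1 * z = w.
rewrite /ball3 /= => hx; have n0 : 1 - sqnorm3 x != 0 by rewrite subr_eq0 gt_eqF.
have -> : 1 - rC (sqnorm3 x) = rC (1 - sqnorm3 x) :> C by creim; rewrite ?oppr0 ?addr0.
by move=> -> //; rewrite mulKf // negb_and n0.
Qed.

Lemma herm00 (x : 'rV[R]_3) : ball3 x -> herm x 0 0 = rC ((1 + sqnorm3 x + 2 * x 0 2) / (1 - sqnorm3 x)).
by move=> hx; rewrite /herm !mxE; apply: herm_entry => // n0; creim; rewrite /=; [field|ring]. Qed.

Lemma herm11 (x : 'rV[R]_3) : ball3 x -> herm x 1 1 = rC ((1 + sqnorm3 x - 2 * x 0 2) / (1 - sqnorm3 x)).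
by move=> hx; rewrite /herm !mxE; apply: herm_entry => // n0; creim; rewrite /=; [field|ring]. Qed.

Lemma herm01 (x : 'rV[R]_3) : ball3 x -> herm x 0 1 = Complex (2 * x 0 0 / (1 - sqnorm3 x)) (2 * x 0 1 / (1 - sqnorm3 x)).
by move=> hx; rewrite /herm !mxE; apply: herm_entry => // n0; creim; rewrite /=; field. Qed.

Lemma herm10 (x : 'rV[R]_3) : ball3 x -> herm x 1 0 = (herm x 0 1)^*.
by move=> hx; rewrite herm01 // /herm !mxE; apply: herm_entry => // n0; creim; rewrite /=; field. Qed.

Lemma ball30 : ball3 (0 : 'rV[R]_3).
by rewrite /ball3 /= sqnorm3E !mxE expr0n /=. Qed.

Lemma herm0 : herm (0 : 'rV[R]_3) = 1%:M.
have s0 : sqnorm3 (0 : 'rV[R]_3) = 0 by rewrite sqnorm3E !mxE expr0n !addr0.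
apply: mx2P; rewrite ?herm10 ?herm00 ?herm01 ?herm11 ?s0; try exact: ball30; rewrite !mxE /=.
all: by apply: complexP; rewrite /= ?mulr0 ?addr0 ?subr0 ?divr1 ?oppr0.
Qed.

Lemma MMstar M :
 M *m (map_mx Num.conj M)^T = mk2 (rC (rowA M)) (rowc M) ((rowc M)^*) (rC (rowB M)).
apply: mx2P; rewrite mulmx2E !mk2E !mxE.
- by rewrite !conj_mulC; apply: complexP; rewrite !reim ?addr0.
- by [].
- by rewrite /rowc rmorphD !rmorphM /= !conjCK; ring.
- by rewrite !conj_mulC; apply: complexP; rewrite !reim ?addr0.
Qed.

Lemma moves0P M x : ball3 x ->
 moves M 0 x <-> [/\ (1 + sqnorm3 x + 2 * x 0 2) / (1 - sqnorm3 x) = rowA M,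
  (1 + sqnorm3 x - 2 * x 0 2) / (1 - sqnorm3 x) = rowB M,
  2 * x 0 0 / (1 - sqnorm3 x) = Re (rowc M) &
  2 * x 0 1 / (1 - sqnorm3 x) = Im (rowc M)].
move=> hx; rewrite /moves herm0 mulmx1 MMstar; split=> [h|[h1 h2 h3 h4]].
 have h00 := congr1 (fun A : 'M[C]_2 => A 0 0) h; have h11 := congr1 (fun A : 'M[C]_2 => A 1 1) h.
 have h01 := congr1 (fun A : 'M[C]_2 => A 0 1) h.
 rewrite !mk2E herm00 in h00; rewrite !mk2E herm11 in h11; rewrite !mk2E herm01 // in h01.
 by case: h00 => h00; case: h11 => h11; rewrite -h01.
have h01 : herm x 0 1 = rowc M by rewrite herm01 //; apply: complexP.
apply: mx2P; rewrite !mk2E ?herm10 ?h01 ?herm00 ?herm11 ?h1 ?h2 //.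
Qed.

Lemma moves_mpt M : SL2 M -> moves M 0 (mpt M).
move=> h; apply/moves0P; first exact: mpt_ball.
have m2 := mn_ge2 h; rewrite sqnorm_mpt // !mptE.
have n0 : mn M + 2 != 0 by rewrite //; lra.
have -> : 1 - (mn M - 2) / (mn M + 2) = 4 / (mn M + 2) by field.
have e : mn M = rowA M + rowB M := mn_rows M.
have n1 : rowA M + rowB M + 2 != 0 by rewrite -e.
have n2 : rowA M + rowB M + 2 - (rowA M + rowB M - 2) != 0.
 by rewrite (_ : _ - _ = 4); [rewrite pnatr_eq0|ring].
by rewrite e; split; field; rewrite ?n2.
Qed.

Lemma moves_uniq M x : ball3 x -> SL2 M -> moves M 0 x -> x = mpt M.
move=> hx h /(moves0P _ hx)[h1 h2 h3 h4].
have s0 : 1 - sqnorm3 x != 0 by rewrite subr_eq0 gt_eqF.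
have e : mn M + 2 = 4 / (1 - sqnorm3 x).
 by rewrite mn_rows -h1 -h2; field.
apply/rowP => i; have [->|->|->] : [\/ i = 0, i = 1 | i = 2].
- case: i => [[|[|[|//]]] hi]; [apply: Or31|apply: Or32|apply: Or33]; exact: val_inj.
all: by rewrite !mptE e -?h1 -?h2 -?h3 -?h4; field.
Qed.

(** Cholesky decomposition: an upper triangular [M] with [M M^* = herm x]. The remaining diagonal
    entry comes out right since both sides have determinant 1. *)
Lemma ball_mpt (x : 'rV[R]_3) : ball3 x -> exists2 M : 'M[C]_2, SL2 M & x = mpt M.
move=> hx; have s1 : 0 < 1 - sqnorm3 x by rewrite subr_gt0.
have hs := sqnorm3E x.
pose H11 := (1 + sqnorm3 x - 2 * x 0 2) / (1 - sqnorm3 x).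
have H0 : 0 < H11.
 apply: divr_gt0 => //; rewrite hs; have := sqr_ge0 (x 0 0); have := sqr_ge0 (x 0 1).
 have : 0 <= (1 - x 0 2) ^+ 2 by pos.
 rewrite hs in s1; move=> a b c.
 rewrite (_ : 1 + _ - _ = x 0 0 ^+ 2 + x 0 1 ^+ 2 + (1 - x 0 2) ^+ 2); last by ring.
 rewrite ltNge; apply/negP => h.
 have /eqP : (1 - x 0 2) ^+ 2 = 0 by apply/eqP; rewrite eq_le; lra.
 rewrite sqrf_eq0 subr_eq0 => /eqP e2; rewrite -e2 expr1n in s1.
 by lra.
pose p := Num.sqrt H11^-1.
have p2 : p ^+ 2 = H11^-1 by rewrite sqr_sqrtr // invr_ge0 ltW.
have p0 : p != 0 by rewrite -sqrf_eq0 p2 invr_eq0 gt_eqF.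
pose q : C := rC p * Complex (2 * x 0 0 / (1 - sqnorm3 x)) (2 * x 0 1 / (1 - sqnorm3 x)).
pose M := mk2 (rC p) q 0 (rC p^-1).
have M1 : SL2 M.
 by apply/SL2E; rewrite !mk2E; apply: complexP; rewrite !reim ?divff //; ring.
exists M => //; apply: moves_uniq => //; apply/(moves0P _ hx).
have eB : rowB M = H11 by rewrite /rowB !mk2E nsq0 nsq_real exprVn p2 invrK add0r.
have ec : rowc M = Complex (2 * x 0 0 / (1 - sqnorm3 x)) (2 * x 0 1 / (1 - sqnorm3 x)).
 rewrite /rowc !mk2E rmorph0 mulr0 add0r /q.
 by move: (_ / _) (_ / _) => u v; creim; field.
split=> //; last 2 first.
- by rewrite ec.
- by rewrite ec.
apply: (mulIf (lt0r_neq0 H0)); rewrite -{2}eB (rows_det M1) ec /H11 nsqE !reim.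
by have := lt0r_neq0 s1; rewrite hs => n0; field.
Qed.

Lemma mn_inv2_mul M N : mn (inv2 M *m N) =
 rowA M * rowB N + rowB M * rowA N - 2 * (Re (rowc M) * Re (rowc N) + Im (rowc M) * Im (rowc N)).
by rewrite /mn !mulmx2E !mk2E /rowA /rowB /rowc !nsqE !reim; ring. Qed.

(** The squared Frobenius norm of M^-1 N is twice the hyperbolic cosine of the distance. Distances
    thus become norms of matrices. *)
Lemma hdist_mpt M N : SL2 M -> SL2 N ->
 hdist (mpt M) (mpt N) = arcosh (mn (inv2 M *m N) / 2).
move=> hM hN; rewrite /hdist; congr arcosh.
have m2 := mn_ge2 hM; have n2 := mn_ge2 hN.
rewrite mn_inv2_mul.
have nM : mn M + 2 != 0 by rewrite //; lra.
have nN : mn N + 2 != 0 by rewrite //; lra.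
have -> : sqnorm3 (mpt M - mpt N) = sqnorm3 (mpt M) + sqnorm3 (mpt N) -
  2 * (mpt M 0 0 * mpt N 0 0 + mpt M 0 1 * mpt N 0 1 + mpt M 0 2 * mpt N 0 2).
 by rewrite !sqnorm3E !mxE; ring.
rewrite !sqnorm_mpt // !mptE.
have eM := mn_rows M; have eN := mn_rows N.
rewrite eM eN; rewrite eM in nM; rewrite eN in nN.
have k1 : rowA M + rowB M + 2 - (rowA M + rowB M - 2) != 0.
 by rewrite (_ : _ - _ = 4); [rewrite pnatr_eq0|ring].
have k2 : rowA N + rowB N + 2 - (rowA N + rowB N - 2) != 0.
 by rewrite (_ : _ - _ = 4); [rewrite pnatr_eq0|ring].
by field; rewrite ?nM ?nN.
Qed.

Lemma mpt_eq M N : SL2 M -> SL2 N -> mpt M = mpt N -> su2 (inv2 M *m N).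
move=> hM hN e; have hMN := SL2_mul (SL2_inv2 hM) hN.
apply: mn2_su2 => //.
have m2 := mn_ge2 hM; have n2 := mn_ge2 hN.
have eS := sqnorm_mpt hM; rewrite e (sqnorm_mpt hN) in eS.
have em : mn M = mn N.
 have nM : mn M + 2 != 0 by rewrite gt_eqF //; lra.
 have nN : mn N + 2 != 0 by rewrite gt_eqF //; lra.
 have : (mn N - 2) * (mn M + 2) = (mn M - 2) * (mn N + 2).
  by apply/eqP; rewrite -eqr_div //; apply/eqP.
 lra.
have nN : mn N + 2 != 0 by rewrite gt_eqF //; lra.
have e0 := congr1 (fun x : 'rV[R]_3 => x 0 0) e; have e1 := congr1 (fun x : 'rV[R]_3 => x 0 1) e.
have e2 := congr1 (fun x : 'rV[R]_3 => x 0 2) e; rewrite !mptE em in e0; rewrite !mptE em in e1.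
rewrite !mptE em in e2.
have {}e0 := mulfI (invr_neq0 nN) e0; have {}e1 := mulfI (invr_neq0 nN) e1; have {}e2 := mulfI (invr_neq0 nN) e2.
rewrite mn_inv2_mul.
have hd := rows_det hN; rewrite nsqE in hd.
rewrite !mn_rows in em.
have -> : rowA M = rowA N by lra.
have -> : rowB M = rowB N by lra.
have -> : Re (rowc M) = Re (rowc N) by lra.
have -> : Im (rowc M) = Im (rowc N) by lra.
move: hd; rewrite !expr2; lra.
Qed.

Lemma mpt_mul_su2 M (U : 'M[C]_2) : su2 U -> mpt (M *m U) = mpt M.
move=> hU; have hm := mn_mul_su2 M hU; case: hU => e3 e4 h.
have hA : rowA (M *m U) = rowA M.
 by rewrite /rowA !mulmx2E e3 e4 -[RHS]mul1r -h !nsqE !reim; ring.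
have hB : rowB (M *m U) = rowB M.
 by rewrite /rowB !mulmx2E e3 e4 -[RHS]mul1r -h !nsqE !reim; ring.
have hc : rowc (M *m U) = rowc M.
 rewrite /rowc !mulmx2E e3 e4; apply: complexP; rewrite -[RHS]mul1r -h !nsqE !reim; ring.
by rewrite /mpt hm hA hB hc.
Qed.

Lemma star_mul (A B : 'M[C]_2) : (map_mx Num.conj (A *m B))^T = (map_mx Num.conj B)^T *m (map_mx Num.conj A)^T.
by rewrite map_mxM trmx_mul. Qed.

Lemma moves_inv N y : SL2 N -> moves N y 0 -> moves (inv2 N) 0 y.
move=> h; rewrite /moves herm0 => e; rewrite mulmx1.
have e1 : (map_mx Num.conj (1%:M : 'M[C]_2))^T = 1%:M by rewrite rmorph1 trmx1.
rewrite -[LHS]mul1mx -[LHS]mulmx1 -{1}(mul_inv2 h) -e1 -(mul_inv2 h) star_mul.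
transitivity (inv2 N *m (N *m herm y *m (map_mx Num.conj N)^T) *m (map_mx Num.conj (inv2 N))^T).
 by rewrite !mulmxA.
by rewrite -e mulmx1.
Qed.

Lemma moves_inv_mpt N y : SL2 N -> ball3 y -> moves N y 0 -> y = mpt (inv2 N).
by move=> h hy /(moves_inv h) /moves_uniq; apply => //; exact: SL2_inv2. Qed.

Lemma moves_of_mpt N : SL2 N -> moves N (mpt (inv2 N)) 0.
move=> h; have := moves_mpt (SL2_inv2 h); rewrite /moves herm0 mulmx1 => ->.
rewrite mulmxA -mulmxA -star_mul mul_inv2r // mul1mx.
by rewrite map_scalar_mx rmorph1 trmx1.
Qed.

(* Pairs of binary forms of degree d without common zero, i.e. homogeneous lifts
  of rational maps. *)
Definition nzW d W : Prop := [/\ (size W.1 <= d.+1)%N, (size W.2 <= d.+1)%N &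
 forall a b : C, (a != 0) || (b != 0) -> (hev d W.1 a b != 0) || (hev d W.2 a b != 0)].

(** * Balanced pairs of forms: the moment matrix, uniqueness and existence *)

Definition n2 d W (z : C) : R := nsq (hev d W.1 z 1) + nsq (hev d W.2 z 1).

Definition cn2 d W : R := cn d W.1 + cn d W.2.

(** [pl] composes with [N] on the target side (a left action), [pr] with [M] on the source side (a
    right action); the two commute by [pr_pl]. *)
Definition pl N W : polpair :=
 (N 0 0 *: W.1 + N 0 1 *: W.2, N 1 0 *: W.1 + N 1 1 *: W.2).

Definition pr d M W : polpair := (hcomp d M W.1, hcomp d M W.2).

Definition Vf d W (i : 'I_3) : R :=
 sI (fun z => stereo (hquo (hev d W.1 z 1) (hev d W.2 z 1)) 0 i).

Definition bal d W : Prop := forall i, Vf d W i = 0.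

(** The integrals of [qi] over the sphere form a Hermitian quadratic form in [(a, b)], the second
    moment of W / |W|. The three coordinates of [Vf] are its traceless part. *)
Definition qi d W (a b z : C) : R :=
 nsq (a * hev d W.1 z 1 + b * hev d W.2 z 1) / n2 d W z.

Lemma n2_ge0 d W z : 0 <= n2 d W z.
by rewrite addr_ge0. Qed.

Lemma cn2_ge0 d W : 0 <= cn2 d W.
by pos. Qed.

Lemma one_nz (z : C) : (z != 0) || ((1 : C) != 0).
by rewrite oner_neq0 orbT. Qed.

Lemma n2_gt0 d W z : nzW d W -> 0 < n2 d W z.
by case=> _ _ h; rewrite vn_gt0; apply: h; exact: one_nz. Qed.

Lemma size_lin d (a b : C) (p q : {poly C}) : (size p <= d.+1)%N -> (size q <= d.+1)%N ->
 (size (a *: p + b *: q)%R <= d.+1)%N.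
move=> sp sq; rewrite (leq_trans (size_polyD _ _)) // geq_max.
by rewrite !(leq_trans (size_scale_leq _ _)).
Qed.

Lemma nz_pl d N W : SL2 N -> nzW d W -> nzW d (pl N W).
move=> hN [s1 s2 h]; split; [exact: size_lin|exact: size_lin|].
by move=> a b ab; rewrite !hev_lin; apply: SL2_nz => //; exact: h.
Qed.

Lemma nz_pr d M W : SL2 M -> nzW d W -> nzW d (pr d M W).
move=> hM [s1 s2 h]; split; [exact: size_hcomp|exact: size_hcomp|].
by move=> a b ab; rewrite !hev_hcomp; apply: h; exact: SL2_nz.
Qed.

Lemma plM d N N' W : nzW d W -> pl (N *m N') W = pl N (pl N' W).
by move=> _; congr pair; rewrite !mulmx2E !scalerDr !scalerA !scalerDl addrACA.
Qed.

Lemma pl1 W : pl 1%:M W = W.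
by case: W => p q; rewrite /pl !mxE !scale0r !scale1r addr0 add0r.
Qed.

Lemma prM d M N W : pr d N (pr d M W) = pr d (M *m N) W.
by rewrite /pr !hcompM. Qed.

Lemma pr_pl d M N W : pr d M (pl N W) = pl N (pr d M W).
by rewrite /pr /pl !hcomp_lin. Qed.

Lemma pr1 d W : nzW d W -> pr d 1%:M W = W.
by case: W => p q [s1 s2 _]; rewrite /pr !hcomp1. Qed.

Lemma nsq_lin (a b p q : C) : nsq (a * p + b * q) <= (nsq a + nsq b) * (nsq p + nsq q).
have -> : (nsq a + nsq b) * (nsq p + nsq q) = nsq (a * p + b * q) + nsq (b^* * p - a^* * q).
 by rewrite !nsqE !reim; ring.
by rewrite lerDl.
Qed.

Lemma cmeas_hevt d p : cmeas (fun t : mC => hev d p (toC t) 1).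
exact: cmeas_hev (@cmeas_toC) (cmeas_cst 1). Qed.

Lemma measurable_n2 d W : measT (fun t : mC => n2 d W (toC t)).
by apply: measurable_funD; apply: measurable_nsq; exact: cmeas_hevt. Qed.

Lemma adm_qi d W a b : nzW d W -> adm (qi d W a b).
move=> nz; split.
 apply: measurable_funM.
  by apply: measurable_nsq; apply: cmeasD; apply: cmeasM; [exact: cmeas_cst|exact: cmeas_hevt|exact: cmeas_cst|exact: cmeas_hevt].
 by apply: measurable_invr; [exact: measurable_n2|move=> t; exact: n2_ge0].
exists (nsq a + nsq b) => z; have n0 := n2_gt0 z nz.
rewrite ger0_norm; last by rewrite divr_ge0 // ltW.
by rewrite ler_pdivrMr // nsq_lin.
Qed.

Definition ci : C := Complex 0 1.

Lemma stereo_qi d W z : nzW d W ->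
 [/\ stereo (hquo (hev d W.1 z 1) (hev d W.2 z 1)) 0 0 = qi d W 1 1 z - 1,
   stereo (hquo (hev d W.1 z 1) (hev d W.2 z 1)) 0 1 = qi d W 1 ci z - 1 &
   stereo (hquo (hev d W.1 z 1) (hev d W.2 z 1)) 0 2 = 2 * qi d W 1 0 z - 1].
move=> nz; have := n2_gt0 z nz; case: nz => _ _ /(_ z 1 (one_nz z)) h.
rewrite /n2 stereo_hquo // !mxE /qi /n2 /=.
move: (hev d W.1 z 1) (hev d W.2 z 1) h => p q _ n0; have {}n0 := lt0r_neq0 n0.
split; rewrite !nsqE !reim in n0 *; field; exact: n0.
Qed.

Lemma qi_lin d W a b z : nzW d W ->
 qi d W a b z = nsq b + (nsq a - nsq b) * qi d W 1 0 z +
  (Re (a * b^*) * (qi d W 1 1 z - 1) - Im (a * b^*) * (qi d W 1 ci z - 1)).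
move=> nz; have := n2_gt0 z nz; rewrite /qi /n2.
move: (hev d W.1 z 1) (hev d W.2 z 1) => p q n0; have {}n0 := lt0r_neq0 n0.
rewrite !nsqE !reim in n0 *; field; exact: n0.
Qed.

Lemma VfE d W : nzW d W -> [/\ Vf d W 0 = sI (qi d W 1 1) - sm,
 Vf d W 1 = sI (qi d W 1 ci) - sm & Vf d W 2 = 2 * sI (qi d W 1 0) - sm].
move=> nz; have a1 := @adm_cst 1; have aq a b := adm_qi a b nz.
rewrite /Vf /sm; split.
- rewrite -sIB; [|exact: aq|exact: a1].
 by congr sI; apply/funext => z; have [-> _ _] := stereo_qi z nz.
- rewrite -sIB; [|exact: aq|exact: a1].
 by congr sI; apply/funext => z; have [_ -> _] := stereo_qi z nz.
rewrite -sIZ; last exact: aq.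
rewrite -sIB; [|by apply: admM; [exact: adm_cst|exact: aq]|exact: a1].
by congr sI; apply/funext => z; have [_ _ ->] := stereo_qi z nz.
Qed.

Lemma ord3P (i : 'I_3) : [\/ i = 0, i = 1 | i = 2].
by case: i => [[|[|[|//]]] hi]; [apply: Or31|apply: Or32|apply: Or33]; exact: val_inj.
Qed.

Lemma sI_qi d W a b : nzW d W ->
 sI (qi d W a b) = nsq b * sm + (nsq a - nsq b) * sI (qi d W 1 0) +
  (Re (a * b^*) * (sI (qi d W 1 1) - sm) - Im (a * b^*) * (sI (qi d W 1 ci) - sm)).
move=> nz; have aq a' b' := adm_qi a' b' nz; have ac c := @adm_cst c.
rewrite (_ : qi d W a b = fun z => nsq b + (nsq a - nsq b) * qi d W 1 0 z +
  (Re (a * b^*) * (qi d W 1 1 z - 1) - Im (a * b^*) * (qi d W 1 ci z - 1))); last first.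
 by apply/funext => z; exact: qi_lin.
have b1 := admB (aq 1 1) (ac 1); have b2 := admB (aq 1 ci) (ac 1).
rewrite sID; [|exact: admD (ac _) (admM (ac _) (aq _ _))|exact: admB (admM (ac _) b1) (admM (ac _) b2)].
rewrite sID; [|exact: ac|exact: admM (ac _) (aq _ _)].
rewrite sIB; [|exact: admM (ac _) b1|exact: admM (ac _) b2].
rewrite !sIZ; [|exact: b2|exact: b1|exact: aq].
rewrite !sIB; [|exact: aq|exact: ac|exact: aq|exact: ac].
by rewrite !sI_cst mul1r.
Qed.

(** Balance means that the second moment is a multiple of the identity. In this form it applies
    directly to the rows of a matrix. *)
Lemma balP d W : nzW d W ->
 bal d W <-> forall a b, sI (qi d W a b) = (nsq a + nsq b) * (sm / 2).
move=> nz; have [v0 v1 v2] := VfE nz; split=> [h a b|h i].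
 have := h 0; have := h 1; have := h 2; rewrite v0 v1 v2 => h2 h1 h0.
 rewrite sI_qi // h0 h1 !mulr0 subr0 addr0.
 have -> : sI (qi d W 1 0) = sm / 2 by lra.
 by field.
case: (ord3P i) => ->; rewrite ?v0 ?v1 ?v2 h /ci !nsqE !reim; lra.
Qed.

Lemma qi_pl d N W a b z : 
 nsq (a * hev d (pl N W).1 z 1 + b * hev d (pl N W).2 z 1) =
 nsq ((a * N 0 0 + b * N 1 0) * hev d W.1 z 1 + (a * N 0 1 + b * N 1 1) * hev d W.2 z 1).
by rewrite !hev_lin; congr nsq; ring. Qed.

Lemma n2_pl d N W z : n2 d (pl N W) z = nsq (N 0 0 * hev d W.1 z 1 + N 0 1 * hev d W.2 z 1) +
 nsq (N 1 0 * hev d W.1 z 1 + N 1 1 * hev d W.2 z 1).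
by rewrite /n2 !hev_lin. Qed.

Lemma n2_pl_su2 d U W z : su2 U -> n2 d (pl U W) z = n2 d W z.
by move=> hU; rewrite n2_pl (su2_unitary hU). Qed.

Lemma bal_su2 d U W : su2 U -> nzW d W -> bal d W -> bal d (pl U W).
move=> hU nz; have nzU := nz_pl (su2_SL2 hU) nz.
move/(balP nz) => h; apply/(balP nzU) => a b.
rewrite (_ : qi d (pl U W) a b = qi d W (a * U 0 0 + b * U 1 0) (a * U 0 1 + b * U 1 1)).
 rewrite h; congr (_ * _); case: hU => e3 e4 hU; rewrite e3 e4 -[RHS]mul1r -hU.
 by rewrite !nsqE !reim; ring.
by apply/funext => z; rewrite /qi qi_pl n2_pl_su2.
Qed.

Lemma nsq_rowmul N (p q : C) :
 nsq (N 0 0 * p + N 0 1 * q) + nsq (N 1 0 * p + N 1 1 * q) <= mn N * (nsq p + nsq q).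
have h1 := nsq_lin (N 0 0) (N 0 1) p q; have h2 := nsq_lin (N 1 0) (N 1 1) p q.
have -> : mn N = (nsq (N 0 0) + nsq (N 0 1)) + (nsq (N 1 0) + nsq (N 1 1)) by rewrite /mn; ring.
by rewrite mulrDl; exact: lerD.
Qed.

Lemma n2_pl_le d N W z : n2 d (pl N W) z <= mn N * n2 d W z.
by rewrite n2_pl nsq_rowmul. Qed.

Lemma n2_pl_ge d N W z : SL2 N -> nzW d W -> n2 d W z <= mn N * n2 d (pl N W) z.
move=> hN nz; rewrite -{1}(pl1 W) -(mul_inv2 hN) (plM _ _ nz) -(mn_inv2 N).
exact: n2_pl_le.
Qed.

Lemma sI_ratio d N W : nzW d W -> bal d W ->
 adm (fun z => n2 d (pl N W) z / n2 d W z) /\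
 sI (fun z => n2 d (pl N W) z / n2 d W z) = mn N * (sm / 2).
move=> nz /(balP nz) h.
have e : (fun z => n2 d (pl N W) z / n2 d W z) = fun z => qi d W (N 0 0) (N 0 1) z + qi d W (N 1 0) (N 1 1) z.
 by apply/funext => z; rewrite n2_pl mulrDl.
have a1 := adm_qi (N 0 0) (N 0 1) nz; have a2 := adm_qi (N 1 0) (N 1 1) nz.
split; first by rewrite e; exact: admD.
by rewrite e sID // !h /mn; ring.
Qed.

(** [mass_small] with the area prescribed: [delta] depends on [d] and [eta] but not on the form. *)
Lemma nonconc d (eta : R) : 0 < eta -> exists2 delta : R, 0 < delta & forall p : {poly C},
 (size p <= d.+1)%N ->
 mass (fun z => nsq (hev d p z 1) < delta * cn d p * (1 + nsq z) ^+ d) <= eta.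
move=> eta0; pose e := Num.min (1 / 2) (eta / (8 * d.+1%:R)).
have e0 : 0 < e by rewrite lt_min divr_gt0 // mulr_gt0.
have e1 : e <= 1 / 2 by rewrite ge_min lexx.
have e2 : d%:R * (8 * e) <= eta.
 have h : e <= eta / (8 * d.+1%:R) by rewrite ge_min lexx orbT.
 rewrite ler_pdivlMr // in h; apply: le_trans h.
 have : d%:R <= d.+1%:R :> R by rewrite ler_nat.
 move: d%:R d.+1%:R => x y xy.
 rewrite (_ : x * (8 * e) = 8 * e * x); last by ring.
 rewrite (_ : e * (8 * y) = 8 * e * y); last by ring.
 by rewrite ler_pM2l // mulr_gt0.
exists ((e / 2) ^+ d); first by pos.
move=> p sp; apply: le_trans e2; apply: (mass_small sp).
by rewrite (ltW e0).
Qed.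

Lemma n2_le d W z : nzW d W -> n2 d W z <= d.+1%:R * cn2 d W * (1 + nsq z) ^+ d.
case=> s1 s2 _; have h1 := hev_le z 1 s1; have h2 := hev_le z 1 s2.
rewrite nsq1 [nsq z + 1]addrC in h1 h2.
by apply: le_trans (lerD h1 h2) _; rewrite /cn2 mulrDr mulrDl.
Qed.

(** In a nontrivial linear relation, a zero of one form is a zero of the other one too, against
    [nzW]; positivity of the degree provides the zero. *)
Lemma nz_indep d W a b : (0 < d)%N -> nzW d W -> a *: W.1 + b *: W.2 = 0 -> a = 0 /\ b = 0.
move=> d0 [s1 s2 nz] h.
have key (c e : C) (p q : {poly C}) : (size q <= d.+1)%N -> c != 0 -> c *: p + e *: q = 0 ->
  exists u v : C, [/\ (u != 0) || (v != 0), hev d p u v = 0 & hev d q u v = 0].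
 move=> sq c0 hpq; case: d d0 s1 s2 nz sq => // d _ s1 s2 nz sq.
 have [u [v [q' [uv sq' Eq]]]] := hom_factor sq.
 have uv0 : (u != 0) || (v != 0) by rewrite -vn_gt0 uv.
 have hq : hev d.+1 q (- v) u = 0.
  rewrite Eq -add1n hevM ?size_linp // hev_linp.
  by rewrite //; ring.
 exists (- v), u; split=> //; first by rewrite oppr_eq0 orbC.
 have := congr1 (fun r => hev d.+1 r (- v) u) hpq; rewrite hev_lin hq mulr0 addr0.
 have -> : hev d.+1 0 (- v) u = 0 by rewrite /hev big1 // => j _; rewrite coef0 !mul0r.
 by move/eqP; rewrite mulf_eq0 (negbTE c0) => /eqP.
have [a0|a0] := eqVneq a 0; last first.
 have [u [v [uv hp hq]]] := key _ _ _ _ s2 a0 h.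
 by have := nz _ _ uv; rewrite hp hq eqxx.
split=> //; apply/eqP; apply: contraT => b0; rewrite addrC in h.
have [u [v [uv hp hq]]] := key _ _ _ _ s1 b0 h.
by have := nz _ _ uv; rewrite hp hq eqxx.
Qed.

(** A nonzero form is bounded below, after weighting, off a set of at most half the total mass; its
    domination by a function of integral zero is then impossible. *)
Lemma bal_ge0_eq0 d (p : {poly C}) (g : C -> R) (K : R) : (size p <= d.+1)%N -> adm g -> 0 < K ->
 (forall z, nsq (hev d p z 1) <= g z * (K * (1 + nsq z) ^+ d)) -> sI g = 0 -> p = 0.
move=> sp ag K0 hg g0; apply/eqP; rewrite -(cn_eq0 sp); apply/eqP.
have s0 := @sm_gt0; have c0 := cn_ge0 d p.
have [|delta de0 /(_ p sp) hm] := @nonconc d (sm / 2); first by pos.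
set P := fun z => _ in hm.
have mP : mpred P by exact: mpred_hev_lt.
have aP := adm_pred mP; have ac c := @adm_cst c.
have w0 (z : C) : 0 < (1 + nsq z) ^+ d by pos.
have gg z : 0 <= g z.
 by rewrite -(pmulr_lge0 _ (mulr_gt0 K0 (w0 z))) (le_trans _ (hg z)).
have : sI (fun z => delta * cn d p / K * (1 - (P z)%:R)) <= sI g.
 apply: sI_le => //; first exact: admM (ac _) (admB (ac _) aP).
 move=> z; case: (boolP (P z)); first by rewrite subrr mulr0.
 rewrite /P -leNgt => h; rewrite subr0 mulr1 ler_pdivrMr // -(ler_pM2r (w0 z)).
 by apply: le_trans h _; apply: le_trans (hg z) _; rewrite mulrA.
rewrite g0 sIZ; last exact: admB (ac _) aP.
rewrite sIB // -/sm -/(mass P) => h.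
have h2 : sm / 2 <= sm - mass P by lra.
apply/eqP; rewrite eq_le c0 andbT; apply: contraLR h; rewrite -!ltNge => cp.
by rewrite !mulr_gt0 ?invr_gt0 // (lt_le_trans _ h2) // divr_gt0.
Qed.

(** Let u be the ratio of |N W|^2 to |W|^2. Balance of both pairs gives u and 1/u the same average
    [mn N / 2], so [mn N - u - 1 / u] has integral zero. It is also nonnegative, hence vanishes, and
    this makes N^* N scalar. *)
Lemma bal_unique d N W : (0 < d)%N -> SL2 N -> nzW d W -> bal d W -> bal d (pl N W) -> su2 N.
move=> d0 hN nz bW bN; have nzN := nz_pl hN nz.
have [a1 i1] := sI_ratio N nz bW.
have [a2 i2] := sI_ratio (inv2 N) nzN bN.
rewrite -(plM _ _ nz) mul_inv2 // pl1 mn_inv2 in a2 i2.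
pose x := nsq (N 0 0) + nsq (N 1 0); pose y := nsq (N 0 1) + nsq (N 1 1).
pose t : C := (N 0 0)^* * N 0 1 + (N 1 0)^* * N 1 1.
have hxy : x * y - nsq t = 1.
 move/SL2E: (hN) => e; rewrite -(@nsq1) -e /x /y /t.
 by rewrite !nsqE !reim; ring.
have eT : mn N = x + y by rewrite /mn /x /y; ring.
(* With [w = (W.1, W.2)] and H = N^* N, whose entries are x, t, t^* and y, this polynomial is the
   determinant of [w] and [H w]; it vanishes where [w] is an eigenvector of H. *)
pose Rp : {poly C} := t^* *: (W.1 * W.1) + (rC (y - x)) *: (W.1 * W.2) - t *: (W.2 * W.2).
case: (nz) => s1 s2 _.
have sR : (size Rp <= (d + d).+1)%N.
 have -> : Rp = 1 *: (t^* *: (W.1 * W.1) + (rC (y - x)) *: (W.1 * W.2)) + (- t) *: (W.2 * W.2) by rewrite scale1r scaleNr.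
 apply: size_lin; last exact: size_mul_le.
 by apply: size_lin; exact: size_mul_le.
have hR z : nsq (hev (d + d) Rp z 1) = nsq (t^* * hev d W.1 z 1 ^+ 2 + rC (y - x) * (hev d W.1 z 1 * hev d W.2 z 1) - t * hev d W.2 z 1 ^+ 2).
 rewrite /Rp -[- (t *: _)]scaleNr !hevD !hevS !hevM // !expr2; congr nsq; ring.
(* Lagrange's identity |w|^2 |H w|^2 = <w, H w>^2 + |det(w, H w)|^2, where |H w|^2 is rewritten by
   Cayley-Hamilton: H has trace [mn N] and determinant 1. *)
have main z : nsq (hev (d + d) Rp z 1) = mn N * n2 d W z * n2 d (pl N W) z - n2 d W z ^+ 2 - n2 d (pl N W) z ^+ 2.
 have -> : mn N * n2 d W z * n2 d (pl N W) z - n2 d W z ^+ 2 - n2 d (pl N W) z ^+ 2 =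
  mn N * n2 d W z * n2 d (pl N W) z - (x * y - nsq t) * n2 d W z ^+ 2 - n2 d (pl N W) z ^+ 2 by rewrite hxy mul1r.
 have -> : n2 d (pl N W) z = x * nsq (hev d W.1 z 1) + y * nsq (hev d W.2 z 1) +
   2 * Re (t * (hev d W.1 z 1)^* * hev d W.2 z 1).
  by rewrite n2_pl /x /y /t !nsqE !reim; ring.
 rewrite hR eT /n2; move: (hev d W.1 z 1) (hev d W.2 z 1) => p q; clearbody x y t.
 by rewrite !nsqE !reim; ring.
have R0 : Rp = 0.
 pose K := d.+1%:R * cn2 d W; pose K' := d.+1%:R * cn2 d (pl N W).
 have KK : 0 < (K + 1) * (K' + 1).
  by rewrite mulr_gt0 // ltr_wpDl // mulr_ge0 ?cn2_ge0.
 apply: (@bal_ge0_eq0 (d + d) Rp (fun z => mn N - n2 d (pl N W) z / n2 d W z - n2 d W z / n2 d (pl N W) z) _ sR _ KK).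
 - by apply: admB => //; apply: admB => //; exact: adm_cst.
 - move=> z; have n0 := n2_gt0 z nz; have n0' := n2_gt0 z nzN.
  have -> : mn N - n2 d (pl N W) z / n2 d W z - n2 d W z / n2 d (pl N W) z =
   nsq (hev (d + d) Rp z 1) / (n2 d W z * n2 d (pl N W) z).
   by rewrite main; field; rewrite ?gt_eqF.
  rewrite mulrAC ler_pdivlMr ?mulr_gt0 // ler_wpM2l //.
  have w0 : 0 <= (1 + nsq z) ^+ d by pos.
  have h1 : n2 d W z <= (K + 1) * (1 + nsq z) ^+ d.
   by apply: le_trans (n2_le z nz) _; rewrite ler_wpM2r // lerDl.
  have h2 : n2 d (pl N W) z <= (K' + 1) * (1 + nsq z) ^+ d.
   by apply: le_trans (n2_le z nzN) _; rewrite ler_wpM2r // lerDl.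
  by apply: le_trans (ler_pM (ltW n0) (ltW n0') h1 h2) _; rewrite exprD mulrACA.
 rewrite sIB; [|by apply: admB => //; exact: adm_cst|by []].
 rewrite sIB; [|exact: adm_cst|by []].
 by rewrite sI_cst i1 i2; field.
have ind a b := @nz_indep d W a b d0 nz.
have nz1 (r : C) : W.1 - r *: W.2 != 0.
 apply/eqP => h; have [] := ind 1 (- r); first by rewrite scale1r scaleNr.
 by move/eqP; rewrite oner_eq0.
have nz2 : W.2 != 0.
 apply/eqP => h; have [] := ind 0 1; first by rewrite scale0r scale1r add0r.
 by move=> _ /eqP; rewrite oner_eq0.
(* For [t != 0] the vanishing quadratic expression in [W.1] and [W.2] splits into two linear factors
   over C, and one of them would be a linear relation between the forms. *)
have t0 : t = 0.
 apply/eqP; apply: contraT => t0.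
 have a0 : t^* != 0 by rewrite conjC_eq0.
 pose b : C := rC (y - x); pose D := sqrtC (b ^+ 2 + 4 * t^* * t).
 have D2 : D ^+ 2 = b ^+ 2 + 4 * t^* * t by rewrite /D sqrtCK.
 pose r1 := (- b + D) / (2 * t^*); pose r2 := (- b - D) / (2 * t^*).
 have e1 : t^* * (r1 + r2) = - b by rewrite /r1 /r2; field.
 have e2 : t^* * (r1 * r2) = - t.
  have -> : t^* * (r1 * r2) = (b ^+ 2 - D ^+ 2) / (4 * t^*) by rewrite /r1 /r2; field.
  by rewrite D2; field.
 have : t^* *: ((W.1 - r1 *: W.2) * (W.1 - r2 *: W.2)) = 0.
  rewrite -R0 /Rp -/b -[- (t *: _)]scaleNr -e2 (_ : b = - (t^* * (r1 + r2))); last by rewrite e1 opprK.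
  rewrite -!mul_polyC !(polyCM, polyCN, polyCD); ring.
 by move/eqP; rewrite scaler_eq0 (negbTE a0) mulf_eq0 (negbTE (nz1 _)) (negbTE (nz1 _)).
have xy : x = y.
 have : rC (y - x) *: (W.1 * W.2) = 0 by rewrite -R0 /Rp t0 rmorph0 !scale0r add0r subr0.
 move/eqP; rewrite scaler_eq0 mulf_eq0 (negbTE nz2) orbF.
 have /negbTE -> : W.1 != 0 by have := nz1 0; rewrite scale0r subr0.
 by rewrite orbF eq_complex subr_eq0 => /andP[/eqP -> _].
apply: mn2_su2 => //; rewrite eT xy.
have y0 : 0 <= y by rewrite addr_ge0.
have : y ^+ 2 = 1 by rewrite -hxy t0 nsq0 subr0 xy.
by move/eqP; rewrite sqrf_eq1 => /orP[/eqP -> //|/eqP yN]; lra.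
Qed.

(* The balanced representatives of W are the minimizers of this functional. *)
Definition phiW d W N : R :=
 sI (fun z => ln (n2 d (pl N W) z / n2 d W z)).

Lemma n2_ratio_bnd d N W z : SL2 N -> nzW d W ->
 (mn N)^-1 <= n2 d (pl N W) z / n2 d W z <= mn N.
move=> hN nz; have n0 := n2_gt0 z nz; have m2 := mn_ge2 hN; have m0 : 0 < mn N by lra.
rewrite ler_pdivrMr // n2_pl_le andbT ler_pdivlMr // ler_pdivrMl //.
exact: n2_pl_ge.
Qed.

Lemma adm_ratio d N W : nzW d W -> adm (fun z => n2 d (pl N W) z / n2 d W z).
move=> nz.
have e : (fun z => n2 d (pl N W) z / n2 d W z) = fun z => qi d W (N 0 0) (N 0 1) z + qi d W (N 1 0) (N 1 1) z.
 by apply/funext => z; rewrite n2_pl mulrDl.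
by rewrite e; apply: admD; exact: adm_qi.
Qed.

Lemma adm_ln_ratio d N W : SL2 N -> nzW d W -> adm (fun z => ln (n2 d (pl N W) z / n2 d W z)).
move=> hN nz; split.
 exact: (measurableT_comp (@measurable_ln R) (proj1 (adm_ratio N nz))).
exists (ln (mn N)) => z; have /andP[h1 h2] := n2_ratio_bnd z hN nz.
have m2 := mn_ge2 hN; have m0 : 0 < mn N by lra.
have i0 : 0 < (mn N)^-1 by pos.
rewrite ler_norml -lnV // !ler_ln ?posrE //; first by rewrite h1.
all: exact: lt_le_trans i0 h1.
Qed.

Lemma phiW_mul d E N W : SL2 E -> SL2 N -> nzW d W ->
 phiW d W (E *m N) = phiW d (pl N W) E + phiW d W N.
move=> hE hN nz; have nzN := nz_pl hN nz.
rewrite /phiW -sID; [|exact: adm_ln_ratio|exact: adm_ln_ratio].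
congr sI; apply/funext => z; rewrite (plM _ _ nz) -lnM ?posrE; last 2 first.
- by rewrite divr_gt0 // n2_gt0 //; exact: nz_pl.
- by rewrite divr_gt0 // n2_gt0.
have := n2_gt0 z nz; have := n2_gt0 z nzN => a b; congr ln; field.
by rewrite !gt_eqF.
Qed.

Lemma phiW1 d W : nzW d W -> phiW d W 1%:M = 0.
move=> nz; rewrite /phiW (_ : (fun z => _) = fun=> 0) ?sI_cst ?mul0r //.
by apply/funext => z; rewrite pl1 divff ?ln1 // gt_eqF // n2_gt0.
Qed.

Lemma phiW_le d N W (s : R) : SL2 N -> nzW d W ->
 (forall z, n2 d (pl N W) z <= (1 + s) * n2 d W z) -> 0 <= s -> phiW d W N <= s * sm.
move=> hN nz h s0; rewrite -sI_cst; apply: sI_le; [exact: adm_ln_ratio|exact: adm_cst|].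
move=> z; have n0 := n2_gt0 z nz; have n1 := n2_gt0 z (nz_pl hN nz).
apply: (@le_trans _ _ (ln (1 + s))); last by apply: le_ln1Dx; lra.
by rewrite ler_ln ?posrE ?divr_gt0 //; [rewrite ler_pdivrMr|lra].
Qed.

(** The stationarity conditions at a minimum, extracted from the inequalities for upper unipotent
    matrices (parameters [x], [y]) and for diagonal ones (parameter [t]). *)
Lemma first_order (g sm A B : R) : 
 (forall x y : R, 0 <= (x ^+ 2 + y ^+ 2) * (sm - g) + (x * A + y * B)) ->
 (forall t : R, 0 < t -> sm <= t ^+ 2 * g + (t ^+ 2)^-1 * (sm - g)) ->
 [/\ A = 0, B = 0 & 2 * g = sm].
move=> h1 h2.
have AB : A ^+ 2 + B ^+ 2 = 0.
 apply/eqP; apply: contraT => n0.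
 have p0 : 0 < A ^+ 2 + B ^+ 2 by rewrite lt_def n0 addr_ge0 ?sqr_ge0.
 (* A step against the gradient [(A, B)], short enough that the linear term outweighs the quadratic
    one. *)
 pose s := (1 + `|sm - g|)^-1; have s0 : 0 < s by pos.
 have hs : s * (1 + `|sm - g|) = 1 by rewrite mulVf.
 have := h1 (- s * A) (- s * B).
 rewrite (_ : _ + _ = s * (A ^+ 2 + B ^+ 2) * (s * (sm - g) - 1)); last by ring.
 rewrite pmulr_rge0 ?mulr_gt0 // subr_ge0 => h.
 have : s * (sm - g) <= s * `|sm - g| by rewrite ler_pM2l // ler_norm.
 move: hs; rewrite mulrDr mulr1; lra.
have A0 : A = 0 by apply/eqP; rewrite -sqrf_eq0 eq_le sqr_ge0; have := sqr_ge0 B; lra.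
have B0 : B = 0 by apply/eqP; rewrite -sqrf_eq0 eq_le sqr_ge0; have := sqr_ge0 A; lra.
split=> //.
have h3 (u : R) : 0 < u -> 0 <= (u - 1) * (u * g - (sm - g)).
 move=> u0; have := h2 (Num.sqrt u); rewrite sqrtr_gt0 u0 (sqr_sqrtr (ltW u0)) => /(_ isT).
 rewrite -(ler_pM2l u0) mulrDr mulrA mulVKf ?gt_eqF //.
 by move=> h; rewrite (_ : _ * _ = u * (u * g) + (sm - g) - u * sm); [lra|ring].
apply/eqP; apply: contraT => n0; exfalso.
pose D := sm - 2 * g.
have D0 : 0 < `|D| by rewrite normr_gt0 /D subr_eq0 eq_sym.
pose e := `|D| / (2 * (`|g| + `|D| + 1)).
have e0 : 0 < e by pos.
have eq : e * (2 * (`|g| + `|D| + 1)) = `|D| by rewrite divfK.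
have eg : e * `|g| < `|D|.
 have : 0 <= e * `|D| by rewrite mulr_ge0 // ltW.
 have : 0 <= e * `|g| by rewrite mulr_ge0 // ltW.
 move: eq; rewrite !mulrDr !mulr1; nra.
have e1 : e < 1.
 rewrite /e ltr_pdivrMr // mul1r; have := normr_ge0 g; have := normr_ge0 D; lra.
have ge1 : e * g <= e * `|g| by rewrite ler_pM2l // ler_norm.
have ge2 : - (e * g) <= e * `|g| by rewrite -mulrN ler_pM2l // -normrN ler_norm.
case: (ltP 0 D) => hD.
 have u0 : 0 < 1 + e by lra.
 have := h3 _ u0.
 have -> : 1 + e - 1 = e by ring.
 rewrite pmulr_rge0 // mulrDl mul1r => hh; rewrite (gtr0_norm hD) in eg.
 by move: eg ge1 hh; rewrite /D; lra.
have u0 : 0 < 1 - e by lra.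
have := h3 _ u0.
have -> : 1 - e - 1 = - e by ring.
rewrite mulNr oppr_ge0 pmulr_rle0 // mulrDl mul1r mulNr => hh; rewrite (ler0_norm hD) in eg.
by move: eg ge2 hh; rewrite /D; lra.
Qed.

(** Since ln u <= u - 1, minimality of the logarithmic functional bounds the average of the ratio
    below by its value at the identity. That average is quadratic in the entries of [E], and
    [first_order] applies. *)
Lemma min_bal d W : nzW d W -> (forall E, SL2 E -> 0 <= phiW d W E) -> bal d W.
move=> nz hE.
have aq a b := adm_qi a b nz.
have key E : SL2 E -> sm <= sI (qi d W (E 0 0) (E 0 1)) + sI (qi d W (E 1 0) (E 1 1)).
 move=> h; have := hE _ h; rewrite -sID; [|exact: aq|exact: aq].
 rewrite (_ : (fun z => _ + _) = fun z => n2 d (pl E W) z / n2 d W z); last first.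
  by apply/funext => z; rewrite n2_pl mulrDl.
 move=> h0; have : phiW d W E <= sI (fun z => n2 d (pl E W) z / n2 d W z - 1).
  apply: sI_le; [exact: adm_ln_ratio|by apply: admB; [exact: adm_ratio|exact: adm_cst]|].
  move=> z; have n0 := n2_gt0 z nz; have n1 := n2_gt0 z (nz_pl h nz).
  rewrite -[X in ln X](subrK 1) addrC; apply: le_ln1Dx.
  have := divr_gt0 n1 n0; lra.
 rewrite sIB; [|exact: adm_ratio|exact: adm_cst]; rewrite -/sm; lra.
have [v0 v1 v2] := VfE nz.
have [A0 B0 g0] : [/\ Vf d W 0 = 0, Vf d W 1 = 0 & 2 * sI (qi d W 1 0) = sm].
 rewrite v0 v1; apply: first_order => [x y|t t0].
  have hE1 : SL2 (mk2 1 (Complex x y) 0 1) by apply/SL2E; rewrite !mk2E; ring.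
  have := key _ hE1; rewrite !mk2E (sI_qi 1 (Complex x y) nz) (sI_qi 0 1 nz) !nsqE !reim.
  set g := sI (qi d W 1 0); set A := sI (qi d W 1 1) - sm; set B := sI (qi d W 1 ci) - sm.
  move=> h; rewrite -[X in X <= _](subrr sm) lerBlDr (le_trans h) // le_eqVlt; apply/orP; left; apply/eqP.
  ring.
 have hE1 : SL2 (mk2 (rC t) 0 0 (rC t^-1)).
  by apply/SL2E; rewrite !mk2E; creim; field; rewrite gt_eqF.
 have := key _ hE1; rewrite !mk2E (sI_qi (rC t) 0 nz) (sI_qi 0 (rC t^-1) nz) !nsqE !reim.
 set g := sI (qi d W 1 0); set A := sI (qi d W 1 1) - sm; set B := sI (qi d W 1 ci) - sm.
 move=> h; rewrite (le_trans h) // le_eqVlt; apply/orP; left; apply/eqP.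
 by field; rewrite gt_eqF.
move=> i; case: (ord3P i) => -> //; rewrite v2 g0 subrr //.
Qed.

(** Linear independence provides a nonzero 2 by 2 minor of the coefficients, and Cramer's rule
    recovers [a] and [b] from two coefficients of the combination. *)
Lemma lin_lower d W : (0 < d)%N -> nzW d W -> exists2 k : R, 0 < k &
 forall a b : C, k * (nsq a + nsq b) <= cn d (a *: W.1 + b *: W.2).
move=> d0 nz; case: (nz) => s1 s2 _; have ind a b := @nz_indep d W a b d0 nz.
have [i [j ij]] : exists i j : nat, W.1`_i * W.2`_j - W.1`_j * W.2`_i != 0.
 have p0 : W.1 != 0.
  apply/eqP => h; have [] := ind 1 0; first by rewrite h scaler0 scale0r add0r.
  by move/eqP; rewrite oner_eq0.
 have l0 : lead_coef W.1 != 0 by rewrite lead_coef_eq0.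
 apply: contrapT => hn.
 have [] := ind (W.2`_(size W.1).-1) (- lead_coef W.1); last by move=> _ /eqP; rewrite oppr_eq0 (negbTE l0).
 apply/polyP => j; rewrite coefD !coefZ coef0; apply/eqP; apply: contraT => h; exfalso; apply: hn.
 exists j, (size W.1).-1; apply: contraNN h => /eqP h; rewrite -lead_coefE in h.
 by rewrite mulrC mulNr h.
have id_ : (i <= d)%N.
 rewrite leqNgt; apply: contraNN ij => id; rewrite [W.1`_i]nth_default ?[W.2`_i]nth_default ?mul0r ?mulr0 ?subrr //.
  exact: leq_trans s2 id.
 exact: leq_trans s1 id.
have jd : (j <= d)%N.
 rewrite leqNgt; apply: contraNN ij => id; rewrite [W.1`_j]nth_default ?[W.2`_j]nth_default ?mul0r ?mulr0 ?subrr //.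
  exact: leq_trans s2 id.
 exact: leq_trans s1 id.
set Dt := _ - _ in ij; have D0 : 0 < nsq Dt by rewrite nsq_gt0.
pose S := nsq W.1`_i + nsq W.1`_j + nsq W.2`_i + nsq W.2`_j.
have S0 : 0 <= S by rewrite /S; nneg.
exists (nsq Dt / (4 * (S + 1))); first by rewrite divr_gt0 // mulr_gt0 // ltr_wpDl.
move=> a b; set c := cn d _; have c0 : 0 <= c := cn_ge0 _ _.
rewrite mulrAC ler_pdivrMr ?mulr_gt0 ?ltr_wpDl //.
have hi : nsq (a * W.1`_i + b * W.2`_i) <= c.
 by have := nsq_le_cn (a *: W.1 + b *: W.2) id_; rewrite coefD !coefZ.
have hj : nsq (a * W.1`_j + b * W.2`_j) <= c.
 by have := nsq_le_cn (a *: W.1 + b *: W.2) jd; rewrite coefD !coefZ.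
have key (u v x y : C) : nsq x <= c -> nsq y <= c -> nsq u + nsq v <= S -> nsq (u * x + v * y) <= S * (c + c).
 move=> hx hy hS; apply: le_trans (nsq_lin _ _ _ _) _; by apply: ler_pM; [nneg|nneg|exact: hS|exact: lerD].
have ha : nsq a * nsq Dt <= S * (c + c).
 rewrite -nsqM (_ : a * Dt = W.2`_j * (a * W.1`_i + b * W.2`_i) + (- W.2`_i) * (a * W.1`_j + b * W.2`_j)); last by rewrite /Dt; ring.
 apply: key => //; rewrite nsqN /S; have := nsq_ge0 W.1`_i; have := nsq_ge0 W.1`_j; lra.
have hb : nsq b * nsq Dt <= S * (c + c).
 rewrite -nsqM (_ : b * Dt = (- W.1`_j) * (a * W.1`_i + b * W.2`_i) + W.1`_i * (a * W.1`_j + b * W.2`_j)); last by rewrite /Dt; ring.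
 apply: key => //; rewrite nsqN /S; have := nsq_ge0 W.2`_i; have := nsq_ge0 W.2`_j; lra.
rewrite mulrDr ![nsq Dt * _]mulrC; apply: le_trans (lerD ha hb) _.
rewrite (_ : _ + _ = c * (4 * S)); last by ring.
by rewrite ler_wpM2l // ler_pM2l // lerDl.
Qed.

Lemma mn_mul (A B : 'M[C]_2) : mn (A *m B) <= mn A * mn B.
have h1 := nsq_rowmul A (B 0 0) (B 1 0); have h2 := nsq_rowmul A (B 0 1) (B 1 1).
have -> : mn (A *m B) = nsq (A 0 0 * B 0 0 + A 0 1 * B 1 0) + nsq (A 1 0 * B 0 0 + A 1 1 * B 1 0) +
  (nsq (A 0 0 * B 0 1 + A 0 1 * B 1 1) + nsq (A 1 0 * B 0 1 + A 1 1 * B 1 1)).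
 by rewrite /mn !mulmx2E; ring.
apply: le_trans (lerD h1 h2) _; rewrite -mulrDr.
have -> : nsq (B 0 0) + nsq (B 1 0) + (nsq (B 0 1) + nsq (B 1 1)) = mn B by rewrite /mn; ring.
exact: lexx.
Qed.

(** The larger row of [N] gives a form with coefficients of size at least [mn N / 2] up to a
    constant. The ratio is then at least [c1 * mn N], except on at most a quarter of the total mass,
    where it is still at least [(mn N)^-1]; for large [mn N] the integral of the logarithm is
    positive. *)
Lemma phiW_coercive d W : (0 < d)%N -> nzW d W ->
 exists K : R, forall N, SL2 N -> phiW d W N <= 0 -> mn N <= K.
move=> d0 nz; have [k k0 hk] := lin_lower d0 nz; have s0 := @sm_gt0.
have [delta de0 hdel] : exists2 delta : R, 0 < delta & forall p : {poly C}, (size p <= d.+1)%N ->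
 mass (fun z => nsq (hev d p z 1) < delta * cn d p * (1 + nsq z) ^+ d) <= sm / 4.
 by apply: nonconc; rewrite divr_gt0.
pose K0 := d.+1%:R * cn2 d W + 1.
have K00 : 0 < K0 by rewrite ltr_wpDl // mulr_ge0 // cn2_ge0.
pose c1 := delta * k / (2 * K0); have c10 : 0 < c1 by rewrite divr_gt0 ?mulr_gt0.
exists (expR (2 * `|ln c1|)) => N hN hphi.
have m2 := mn_ge2 hN; have m0 : 0 < mn N by lra.
have [a [b [ab hab]]] : exists a b, mn N / 2 <= nsq a + nsq b /\
  forall z, nsq (hev d (a *: W.1 + b *: W.2) z 1) <= n2 d (pl N W) z.
 have [h|h] := leP (mn N / 2) (nsq (N 0 0) + nsq (N 0 1)).
  by exists (N 0 0), (N 0 1); split=> // z; rewrite /n2 lerDl.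
 exists (N 1 0), (N 1 1); split; first by rewrite /mn in h *; lra.
 by move=> z; rewrite /n2 lerDr.
case: (nz) => s1 s2 _; set X := a *: W.1 + b *: W.2 in hab.
have sX : (size X <= d.+1)%N by exact: size_lin.
have hm := hdel X sX; set P := fun z => _ in hm.
have mP : mpred P by exact: mpred_hev_lt.
have aP := adm_pred mP; have ac c := @adm_cst c.
have i0 : 0 < (mn N)^-1 by pos.
have low : sI (fun z => ln (c1 * mn N) - (ln (c1 * mn N) + ln (mn N)) * (P z)%:R) <= phiW d W N.
 apply: sI_le; [exact: admB (ac _) (admM (ac _) aP)|exact: adm_ln_ratio|].
 move=> z; have /andP[r1 r2] := n2_ratio_bnd z hN nz.
 have rp := lt_le_trans i0 r1.
 case: (boolP (P z)) => Pz; rewrite ?mulr1 ?mulr0 ?subr0.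
  by rewrite opprD addrA subrr add0r -lnV // ler_ln.
 rewrite ler_ln; [|by rewrite posrE; exact: mulr_gt0|by rewrite posrE]; move: Pz; rewrite /P -leNgt => Pz.
 have n0 := n2_gt0 z nz; rewrite ler_pdivlMr //.
 have w0 : 0 < (1 + nsq z) ^+ d by pos.
 have h1 : n2 d W z <= K0 * (1 + nsq z) ^+ d.
  by apply: le_trans (n2_le z nz) _; rewrite ler_wpM2r ?ltW // ltrDl.
 apply: le_trans (hab z); apply: le_trans Pz.
 have h2 : k * (mn N / 2) <= cn d X by apply: le_trans (hk a b); rewrite ler_pM2l.
 apply: (@le_trans _ _ (c1 * mn N * (K0 * (1 + nsq z) ^+ d))).
  by rewrite ler_pM2l //; exact: mulr_gt0.
 rewrite mulrA ler_pM2r // /c1 (_ : _ * _ * _ = delta * (k * (mn N / 2))); first by rewrite ler_pM2l.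
 by field; rewrite gt_eqF.
have : ln (c1 * mn N) * sm - (ln (c1 * mn N) + ln (mn N)) * mass P <= 0.
 apply: le_trans hphi; apply: le_trans low; rewrite sIB; [|exact: ac|exact: admM (ac _) aP].
 by rewrite sI_cst sIZ.
have mP0 : 0 <= mass P by apply: sI_ge0 => z; rewrite ler0n.
rewrite lnM //; set l := ln c1; set t := ln (mn N) => hh.
have t0 : 0 <= t by apply: ln_ge0; lra.
rewrite -[X in X <= _](@lnK R) // ler_expR -/t.
have l2 := ler_norm (- l); rewrite normrN in l2.
have [h|h] := leP 0 (l + t + t); last by lra.
have h3 : (l + t + t) * mass P <= (l + t + t) * (sm / 4) by rewrite ler_wpM2l.
have h4 : (3 * l + 2 * t) * sm <= 0 by lra.
have : 3 * l + 2 * t <= 0 by rewrite -(pmulr_lle0 _ s0).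
lra.
Qed.

Lemma nsq_young (s : R) (a b : C) : 0 < s -> nsq (a + b) <= (1 + s) * nsq a + (1 + s^-1) * nsq b.
move=> s0; rewrite -subr_ge0.
have -> : (1 + s) * nsq a + (1 + s^-1) * nsq b - nsq (a + b) = s^-1 * nsq (rC s * a - b).
 by rewrite !nsqE !reim; field; rewrite gt_eqF.
by rewrite mulr_ge0 // invr_ge0 ltW.
Qed.

(** By the cocycle rule [phiW_mul] the difference is the functional at N' N^-1, a matrix close to
    the identity. *)
Lemma phiW_close d W (N N' : 'M[C]_2) (s : R) : nzW d W -> SL2 N -> SL2 N' -> 0 < s ->
 mn (N' *m inv2 N - 1%:M) <= s ^+ 2 -> phiW d W N' - phiW d W N <= (2 * s + s ^+ 2) * sm.
move=> nz hN hN' s0 hs; have nzN := nz_pl hN nz.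
have hE : SL2 (N' *m inv2 N) by apply: SL2_mul => //; exact: SL2_inv2.
have -> : N' = (N' *m inv2 N) *m N by rewrite -mulmxA mul_inv2 // mulmx1.
rewrite phiW_mul // addrK; apply: phiW_le => //.
 set D := _ - _ in hs; have -> : N' *m inv2 N = 1%:M + D by rewrite /D addrC subrK.
 clearbody D.
 move=> z; rewrite n2_pl !mxE /= /n2; set p := hev d _ z 1; set q := hev d _ z 1.
 have h1 := nsq_young p (D 0 0 * p + D 0 1 * q) s0; have h2 := nsq_young q (D 1 0 * p + D 1 1 * q) s0.
 have h3 := nsq_rowmul D p q.
 rewrite (_ : (1%:R + D 0 0) * p + (0%:R + D 0 1) * q = p + (D 0 0 * p + D 0 1 * q)); last by ring.
 rewrite (_ : (0%:R + D 1 0) * p + (1%:R + D 1 1) * q = q + (D 1 0 * p + D 1 1 * q)); last by ring.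
 apply: le_trans (lerD h1 h2) _.
 have h4 : mn D * (nsq p + nsq q) <= s ^+ 2 * (nsq p + nsq q) by rewrite ler_wpM2r // addr_ge0.
 have h5 := le_trans h3 h4.
 have i0 : 0 <= 1 + s^-1 by rewrite addr_ge0 // invr_ge0 ltW.
 have := ler_wpM2l i0 h5; move: (nsq (_ + _)) (nsq (_ + _)) (nsq p) (nsq q) => x y u v h6.
 have -> : (1 + (2 * s + s ^+ 2)) * (u + v) = (1 + s) * (u + v) + (1 + s^-1) * (s ^+ 2 * (u + v)).
  by field; rewrite gt_eqF.
 by move: h6; rewrite !mulrDr; lra.
by rewrite addr_ge0 // mulr_ge0 // ltW.
Qed.

(** Outside a compact set of matrices the functional is positive, hence above its value 0 at the
    identity; so a minimum over the compact set is global. *)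
Lemma bal_exists d W : (0 < d)%N -> nzW d W -> exists2 N, SL2 N & bal d (pl N W).
move=> d0 nz; have [K hK] := phiW_coercive d0 nz; have sm0 := @sm_gt0.
(* The summand 2 makes room for the identity, whose squared norm is 2. *)
pose K1 := `|K| + 2; have K12 : 2 <= K1 by rewrite /K1 lerDr.
pose M (x : C * C * (C * C)) : 'M[C]_2 := mk2 x.1.1 x.1.2 x.2.1 x.2.2.
pose det1 x := nsq (x.1.1 * x.2.2 - x.1.2 * x.2.1 - 1) : R.
pose D := [set z : C | normR z <= K1].
pose A := ((D `*` D) `*` (D `*` D)) `&` [set x | det1 x = 0].
have Asl x : A x -> SL2 (M x).
 by move=> [_ /eqP]; rewrite nsq_eq0 subr_eq0 => /eqP e; apply/SL2E; rewrite !mk2E.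
have Abd x : A x -> mn (M x) <= 4 * K1 ^+ 2.
 move=> [[[h1 h2] [h3 h4]] _]; have sq (z : C) : D z -> nsq z <= K1 ^+ 2.
  by move=> hz; rewrite -normR_sqr ler_sqr ?nnegrE //; lra.
 by have := sq _ h1; have := sq _ h2; have := sq _ h3; have := sq _ h4; rewrite /mn /M !mk2E; lra.
have inA N : SL2 N -> mn N <= K1 -> exists2 x, A x & M x = N.
 move=> hN h; exists (N 0 0, N 0 1, (N 1 0, N 1 1)); last by apply: mx2P; rewrite /M !mk2E.
 have sq z : nsq z <= K1 -> D z.
  move=> hz; rewrite /D /= -ler_sqr ?nnegrE ?normR_sqr //; last by lra.
  by apply: le_trans hz _; rewrite ler_peMl; lra.
 have [n1 n2 n3 n4] : [/\ nsq (N 0 0) <= K1, nsq (N 0 1) <= K1, nsq (N 1 0) <= K1 & nsq (N 1 1) <= K1].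
  by move: h; rewrite /mn; have := nsq_ge0 (N 0 0); have := nsq_ge0 (N 0 1); have := nsq_ge0 (N 1 0); have := nsq_ge0 (N 1 1); split; lra.
 by split; [split; split; exact: sq|move/SL2E: hN; rewrite /det1 /= => ->; rewrite subrr nsq0].
have cx x : [/\ (fun y => y.1.1) @ x --> x.1.1, (fun y => y.1.2) @ x --> x.1.2,
  (fun y => y.2.1) @ x --> x.2.1 & (fun y => y.2.2) @ x --> (x : C * C * (C * C)).2.2].
 by split; apply: cvg_comp; [exact: cvg_fst|exact: cvg_fst|exact: cvg_fst|exact: cvg_snd|
  exact: cvg_snd|exact: cvg_fst|exact: cvg_snd|exact: cvg_snd].
have cA : compact A.
 have cD := @compact_disc K1; apply: compact_closedI; first by apply: compact_setX; apply: compact_setX.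
 apply: (@closed_comp _ _ det1 [set x | x = 0]) => [x _|]; last exact: closed_eq.
 have [c1 c2 c3 c4] := cx x.
 have c : (fun y : C * C * (C * C) => y.1.1 * y.2.2 - y.1.2 * y.2.1 - 1) @ x --> x.1.1 * x.2.2 - x.1.2 * x.2.1 - 1.
  exact: (cvgB (cvgB (cvgM c1 c4) (cvgM c2 c3)) (cvg_cst _)).
 exact: (@continuous_comp _ _ _ _ nsq x c (@nsq_continuous _)).
have cF : {within A, continuous (fun x => phiW d W (M x))}.
 apply/subspace_continuousP => x Ax; apply/cvgrPdist_lt => e e0.
 pose s := Num.min 1 (e / (4 * sm)); have s0 : 0 < s by rewrite lt_min ltr01 divr_gt0 // mulr_gt0.
 have s1 : s <= 1 by rewrite ge_min lexx.
 have s2 : (2 * s + s ^+ 2) * sm < e.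
  have : s * (4 * sm) <= e by rewrite -ler_pdivlMr ?mulr_gt0 // ge_min lexx orbT.
  have : s ^+ 2 <= s by rewrite ler_piMl // ltW.
  have : 0 < s * sm by pos.
  move=> a b c; have := ler_wpM2r (ltW sm0) b; move: a c; rewrite mulrDl; lra.
 pose eta := s / (4 * K1); have K10 : 0 < K1 by lra.
 have eta0 : 0 < eta by rewrite divr_gt0 // mulr_gt0.
 have close y y' : SL2 (M y) -> SL2 (M y') -> mn (M y) <= 4 * K1 ^+ 2 -> mn (M y' - M y) <= 4 * eta ^+ 2 ->
   phiW d W (M y') - phiW d W (M y) < e.
  move=> h1 h2 h3 h4; apply: le_lt_trans s2; apply: phiW_close => //.
  rewrite -(mul_inv2r h1) -mulmxBl; apply: le_trans (mn_mul _ _) _; rewrite mn_inv2.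
  apply: le_trans (ler_pM (mn_ge0 _) (mn_ge0 _) h4 h3) _.
  by apply: eqR_le; rewrite /eta; field; rewrite gt_eqF.
 have [/cvgC_P c1 /cvgC_P c2 /cvgC_P c3 /cvgC_P c4] := cx x.
 have nb : \forall y \near x, [/\ normR (y.1.1 - x.1.1) < eta, normR (y.1.2 - x.1.2) < eta,
   normR (y.2.1 - x.2.1) < eta & normR (y.2.2 - x.2.2) < eta].
  by apply: filterS2 (filterI (c1 _ eta0) (c2 _ eta0)) (filterI (c3 _ eta0) (c4 _ eta0)) => y [h1 h2] [h3 h4].
 apply: (@filterS _ (nbhs x) _ _ _ _ nb) => y [h1 h2 h3 h4] Ay.
 have sq (z : C) : normR z < eta -> nsq z <= eta ^+ 2.
  by move=> hz; rewrite -normR_sqr ler_sqr ?nnegrE // ltW.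
 have small : mn (M y - M x) <= 4 * eta ^+ 2.
  by have := sq _ h1; have := sq _ h2; have := sq _ h3; have := sq _ h4; rewrite /mn !mxE; lra.
 have small' : mn (M x - M y) <= 4 * eta ^+ 2.
  by move: small; rewrite /mn !mxE -![nsq (y.1.1 - _)]nsqN -[nsq (y.1.2 - _)]nsqN -[nsq (y.2.1 - _)]nsqN -[nsq (y.2.2 - _)]nsqN !opprB.
 rewrite ltr_norml ltrNl opprB /=.
 by rewrite (close x y (Asl _ Ax) (Asl _ Ay) (Abd _ Ax) small) (close y x (Asl _ Ay) (Asl _ Ax) (Abd _ Ay) small').
have m1 : mn (1%:M : 'M[C]_2) <= K1 by rewrite /mn !mxE nsq0 nsq1; lra.
have [x1 A1 e1] := inA _ SL2_1 m1.
have [x] := compact_EVT_min (ex_intro _ _ A1 : A !=set0) cA cF.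
rewrite inE => Ax hmin; have sx := Asl _ Ax.
have glob N : SL2 N -> phiW d W (M x) <= phiW d W N.
 move=> hN; have [h|h] := leP (phiW d W N) 0; last first.
  by apply: le_trans (ltW h); rewrite -(phiW1 nz) -e1; apply: hmin; rewrite inE.
 have mK : mn N <= K1 by apply: le_trans (hK _ hN h) _; rewrite /K1; have := ler_norm K; lra.
 by have [y Ay <-] := inA N hN mK; apply: hmin; rewrite inE.
exists (M x) => //; apply: min_bal; first exact: nz_pl.
by move=> E hE; have := glob _ (SL2_mul hE sx); rewrite phiW_mul //; lra.
Unshelve. all: by end_near.
Qed.

(** * The barycentric extension described by balanced pairs *)

Definition rW d (f : Ratd R d) : polpair := (rP f, rQ f).

Lemma nz_rW d (f : Ratd R d) : nzW d (rW f).
by split; [exact: size_rP|exact: size_rQ|exact: rat_nz]. Qed.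

Definition sandwich d (f : Ratd R d) M N (z : Ch) : Ch :=
 mobius N (ratfun f (mobius M z)).

Lemma sandwich_hquo d (f : Ratd R d) M N (a b : C) : SL2 M -> SL2 N -> (a != 0) || (b != 0) ->
 sandwich f M N (hquo a b) =
 hquo (hev d (pl N (pr d M (rW f))).1 a b) (hev d (pl N (pr d M (rW f))).2 a b).
move=> hM hN ab; rewrite /sandwich mobius_hquo // ratfun_hquo; last exact: SL2_nz.
rewrite mobius_hquo; last by apply: rat_nz; exact: SL2_nz.
by rewrite !hev_lin !hev_hcomp.
Qed.

Lemma sandwich_continuous d (f : Ratd R d) M N : SL2 M -> SL2 N -> continuous (sandwich f M N).
move=> hM hN z; have c1 := mobius_continuous hM; have c2 := @ratfun_continuous d f; have c3 := mobius_continuous hN.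
exact: (@continuous_comp _ _ _ (fun z => ratfun f (mobius M z)) (mobius N) z
 (@continuous_comp _ _ _ (mobius M) (ratfun f) z (c1 z) (c2 _)) (c3 _)).
Qed.

Lemma continuous_stereo_sandwich d (f : Ratd R d) M N i : SL2 M -> SL2 N ->
 continuous (fun z : Ch => stereo (sandwich f M N z) 0 i : R).
move=> hM hN z; have c1 := @sandwich_continuous d f M N hM hN; have c2 := @stereo_continuous i.
exact: (@continuous_comp Ch Ch R (sandwich f M N) (fun z : Ch => stereo z 0 i) z (c1 z) (c2 _)).
Qed.

Lemma stereo_bound (z : Ch) i : `|stereo z 0 i| <= 1.
have := stereo_norm z; rewrite sqnorm3E => h.
rewrite -(@ler_sqr _ _ 1) ?nnegrE // real_normK ?num_real // expr1n -h.
have := sqr_ge0 (stereo z 0 0); have := sqr_ge0 (stereo z 0 1); have := sqr_ge0 (stereo z 0 2).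
by case: (ord3P i) => -> *; lra.
Qed.

Lemma int_stereo d (f : Ratd R d) M N i : SL2 M -> SL2 N ->
 (\int[sph2]_p (stereo (sandwich f M N (@iota p)) 0 i)%:E =
  (Vf d (pl N (pr d M (rW f))) i)%:E)%E.
move=> hM hN.
have e p : stereo (sandwich f M N (@iota p)) 0 i =
  stereo (hquo (hev d (pl N (pr d M (rW f))).1 (toC p) 1) (hev d (pl N (pr d M (rW f))).2 (toC p) 1)) 0 i.
 by rewrite /iota -hquo_some sandwich_hquo // one_nz.
rewrite /Vf /sI /Rintegral fineK; first by apply: eq_integral => p _; rewrite e.
apply: integrable_fin_num => //.
apply: (@eq_integrable _ _ _ _ _ _ (EFin \o (fun p : mC => stereo (sandwich f M N (@iota p)) 0 i))) => //.
 by move=> p _; rewrite /= e.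
apply: measurable_bounded_integrable => //; first exact: sph2_lty.
 apply: (@measurableT_comp _ _ _ _ _ _ (fun z : Sph => stereo (sandwich f M N (z : Ch)) 0 i : R) setT iota _ (@measurable_iota)).
 have cs := @continuous_stereo_sandwich d f M N i hM hN; exact: (continuous_measurable_SphR cs).
exists 1; split; first exact: num_real.
by move=> x x1 p _; apply: le_trans (stereo_bound _ _) (ltW x1).
Qed.

Lemma bary_integral d (f : Ratd R d) M N i : SL2 M -> SL2 N ->
 (\int[push (mobius N) (push (ratfun f) (push (mobius M) (@sph_measure R)))]_z (stereo z 0 i)%:E =
  (Vf d (pl N (pr d M (rW f))) i)%:E)%E.
move=> hM hN.
have mg : measT ((sandwich f M N : Sph -> Sph) \o iota).
 apply: measurableT_comp (@measurable_iota).
 by apply: continuous_measurable_Sph; exact: sandwich_continuous.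
have -> : push (mobius N) (push (ratfun f) (push (mobius M) (@sph_measure R))) =
  pushforward sph2 ((sandwich f M N : Sph -> Sph) \o iota).
 by rewrite /push.
have ms : measT (fun z : Sph => (stereo (z : Ch) 0 i)%:E).
 by apply/measurable_EFinP; apply: continuous_measurable_SphR; exact: stereo_continuous.
have is_ : sph2.-integrable setT ((fun z : Sph => (stereo (z : Ch) 0 i)%:E) \o ((sandwich f M N : Sph -> Sph) \o iota)).
 apply: measurable_bounded_integrable => //; first exact: sph2_lty.
  apply: (@measurableT_comp _ _ _ _ _ _ (fun z : Sph => stereo (z : Ch) 0 i) setT _ _ mg).
  exact: (continuous_measurable_SphR (@stereo_continuous i)).
 exists 1; split; first exact: num_real.
 by move=> x x1 p _; apply: le_trans (stereo_bound _ _) (ltW x1).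
have := @integral_pushforward _ _ _ _ R ((sandwich f M N : Sph -> Sph) \o iota) mg sph2 setT (fun z : Sph => (stereo (z : Ch) 0 i)%:E) ms is_ measurableT.
rewrite preimage_setT => E; rewrite -(int_stereo f i hM hN); exact: E.
Qed.

(** Rotation invariance of the spherical measure: the extension at a point does not depend on the
    matrix chosen to represent that point. *)
Lemma Vf_right_su2 d (f : Ratd R d) M N U i : SL2 M -> SL2 N -> su2 U ->
 Vf d (pl N (pr d (M *m U) (rW f))) i = Vf d (pl N (pr d M (rW f))) i.
move=> hM hN hU; have U1 := su2_SL2 hU; apply: EFin_inj.
apply: (etrans (esym (int_stereo f i (SL2_mul hM U1) hN))); apply: (etrans _ (int_stereo f i hM hN)).
have cs := @continuous_stereo_sandwich d f M N i hM hN.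
apply: (etrans _ (sI_unitary U1 (su2_unitary hU) cs)).
by apply: eq_integral => p _; rewrite /sandwich mobiusM.
Qed.

(** [bary_ext] is a choice, so both existence and uniqueness of the barycenter enter. Independence
    of the source matrix is [Vf_right_su2], of the target matrix [bal_su2], and uniqueness of the
    point is [bal_unique]. *)
Lemma bary_extP d (f : Ratd R d) M N : (0 < d)%N -> SL2 M -> SL2 N ->
 bal d (pl N (pr d M (rW f))) -> bary_ext (ratfun f) (mpt M) = mpt (inv2 N).
move=> d0 hM hN hb; have nz := nz_pr hM (nz_rW f); have hN' := SL2_inv2 hN.
rewrite /bary_ext; apply: (@xget_subset1 _ _ _ (mpt (inv2 N))) => /=.
 move=> M' hM' /(moves_uniq (mpt_ball hM) hM') eM.
 have hU := mpt_eq hM hM' eM; split; first exact: mpt_ball.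
 move=> L hL /(moves_inv_mpt hL (mpt_ball hN')) eL i.
 have hV := mpt_eq hN' (SL2_inv2 hL) eL; rewrite inv2K in hV.
 have {hV}hV := su2_inv2 hV; rewrite inv2_mul inv2K in hV.
 rewrite bary_integral //.
 have -> : M' = M *m (inv2 M *m M') by rewrite mulmxA mul_inv2r // mul1mx.
 have -> : L = (L *m inv2 N) *m N by rewrite -mulmxA mul_inv2 // mulmx1.
 rewrite Vf_right_su2 //; last by apply: SL2_mul => //; exact: su2_SL2.
 by rewrite (plM _ _ nz) (bal_su2 hV (nz_pl hN nz)).
move=> y y' /= hy hy'.
have key w : (forall M0 : 'M[C]_2, SL2 M0 -> moves M0 0 (mpt M) ->
  is_barycenter (push (ratfun f) (push (mobius M0) (@sph_measure R))) w) -> w = mpt (inv2 N).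
 move=> /(_ M hM (moves_mpt hM))[bw hw]; have [L hL eL] := ball_mpt bw.
 have hL' := SL2_inv2 hL.
 have mL : moves (inv2 L) w 0 by rewrite eL -[L in mpt L]inv2K; exact: moves_of_mpt.
 have bL : bal d (pl (inv2 L) (pr d M (rW f))).
  by move=> i; apply: EFin_inj; rewrite -bary_integral // hw.
 have su : su2 (inv2 L *m inv2 N).
  apply: (bal_unique d0 (SL2_mul hL' hN') (nz_pl hN nz) hb).
  by rewrite -(plM _ _ nz) -mulmxA mul_inv2 // mulmx1.
 by rewrite -[inv2 N]mul1mx -(mul_inv2r hL) -mulmxA mpt_mul_su2.
by rewrite (key _ hy) (key _ hy').
Qed.

Lemma bary_ext_bal d (f : Ratd R d) M : (0 < d)%N -> SL2 M ->
 exists N, [/\ SL2 N, bal d (pl N (pr d M (rW f))) & bary_ext (ratfun f) (mpt M) = mpt (inv2 N)].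
move=> d0 hM; have [N hN hb] := bal_exists d0 (nz_pr hM (nz_rW f)).
by exists N; split=> //; exact: bary_extP.
Qed.

Lemma bary_ext_ball d (f : Ratd R d) x : (0 < d)%N -> ball3 x -> ball3 (bary_ext (ratfun f) x).
move=> d0 /ball_mpt[M hM ->]; have [N [hN _ ->]] := bary_ext_bal f d0 hM.
by apply: mpt_ball; exact: SL2_inv2.
Qed.

(* The average of |N W|^2 / |W|^2 is |N|^2 / 2 and this ratio is at most |N|^2, so it is
  comparable to |N|^2 on a set of definite measure, hence somewhere where W is large. *)
Lemma bal_coercive d : exists2 c : R, 0 < c & forall W N, nzW d W -> bal d W -> SL2 N ->
 c * mn N * cn2 d W <= cn2 d (pl N W).
have s0 := @sm_gt0.
have [|dl dl0 hdl] := @nonconc d (sm / 8); first by pos.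
exists (dl / (8 * d.+1%:R)); first by pos.
move=> W N nz hb hN; rewrite leNgt; apply/negP => hlt.
have [s1 s2 _] := nz; have mN : 0 < mn N by exact: lt_le_trans (mn_ge2 hN).
have [p [sp hp hn]] : exists p : {poly C}, [/\ (size p <= d.+1)%N, cn2 d W <= 2 * cn d p &
  forall z, nsq (hev d p z 1) <= n2 d W z].
 have [le|/ltW le] := leP (cn d W.2) (cn d W.1).
  by exists W.1; split=> //; [rewrite /cn2; lra|move=> z; rewrite lerDl].
 by exists W.2; split=> //; [rewrite /cn2; lra|move=> z; rewrite lerDr].
pose bad (z : C) := nsq (hev d p z 1) < dl * cn d p * (1 + nsq z) ^+ d.
have mbad : mpred bad by exact: mpred_hev_lt.
have nzN := nz_pl hN nz; have [ag ig] := sI_ratio N nz hb.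
have bnd z : n2 d (pl N W) z / n2 d W z <= mn N / 4 + mn N * (bad z)%:R.
 have w0 := n2_gt0 z nz; have := n2_pl_le d N W z => le1; have := n2_le z nzN => le2.
 rewrite ler_pdivrMr //; case: (boolP (bad z)) => hz.
  rewrite mulr1; apply: le_trans le1 _; rewrite ler_pM2r //; lra.
 rewrite mulr0 addr0; rewrite /bad -leNgt in hz; apply: le_trans le2 _.
 have z0 : 0 < (1 + nsq z) ^+ d by pos.
 have a1 : d.+1%:R * cn2 d (pl N W) <= d.+1%:R * (dl / (8 * d.+1%:R) * mn N * cn2 d W).
  by rewrite ler_pM2l // ltW.
 have a2 : d.+1%:R * (dl / (8 * d.+1%:R) * mn N * cn2 d W) = dl / 8 * mn N * cn2 d W.
  by move: (mn N) (cn2 d W) => x y; field; exact: lt0r_neq0.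
 rewrite a2 in a1.
 have a3 : dl / 8 * mn N * cn2 d W <= dl / 8 * mn N * (2 * cn d p).
  by rewrite ler_pM2l // mulr_gt0 // divr_gt0.
 have a4 := ler_wpM2r (ltW z0) (le_trans a1 a3).
 have a5 : mn N / 4 * (dl * cn d p * (1 + nsq z) ^+ d) <= mn N / 4 * n2 d W z.
  by rewrite ler_pM2l ?divr_gt0 //; apply: le_trans hz (hn z).
 apply: le_trans a4 _; apply: le_trans a5; apply: eqR_le.
 by move: (mn N) (cn d p) (_ ^+ d) => x y w; field.
have ab : adm (fun z => (bad z)%:R) by apply: adm_pred.
have ac := @adm_cst; have a2 := admM (ac (mn N)) ab.
have : sI (fun z => n2 d (pl N W) z / n2 d W z) <= sI (fun z => mn N / 4 + mn N * (bad z)%:R).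
 by apply: sI_le => //; exact: admD.
rewrite ig sID // sI_cst sIZ // -/(mass bad).
have : mn N * mass bad <= mn N * (sm / 8) by rewrite ler_pM2l //; exact: hdl.
have : 0 < mn N * sm by exact: mulr_gt0.
by move: (mn N) (mass bad) s0 => x y; move: (sm) => m; clear; lra.
Qed.

(** A balanced pair minimizes the coefficient norm on its orbit up to a constant depending on [d]: a
    Kempf-Ness property. *)
Lemma bal_norm d : exists2 K : R, 0 < K & forall W N, nzW d W -> bal d W -> SL2 N ->
 cn2 d W <= K * cn2 d (pl N W).
have [c c0 hc] := bal_coercive d; have c2 : 0 < c * 2 by pos.
exists (c * 2)^-1 => [|W N nz hb hN]; first by pos.
rewrite -ler_pdivrMl ?invr_gt0 // invrK; apply: le_trans (hc W N nz hb hN).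
by rewrite ler_wpM2r ?cn2_ge0 // ler_pM2l // mn_ge2.
Qed.

(** * Hyperbolic distances up to bounded error, and polar coordinates *)

Lemma arcosh_bnd (t : R) : 1 <= t -> ln t <= arcosh t <= ln (2 * t).
move=> t1; have t0 : 0 < t by lra.
have s0 := sqrtr_ge0 (t ^+ 2 - 1).
have s1 : Num.sqrt (t ^+ 2 - 1) <= t.
 have q : 0 <= t ^+ 2 - 1 by rewrite subr_ge0 exprn_ege1.
 by rewrite -ler_sqr ?nnegrE ?(ltW t0) // (sqr_sqrtr q) gerBl.
by rewrite /arcosh !ler_ln ?posrE; lra.
Qed.

Definition hd M N : R := ln (mn (inv2 M *m N)).

Lemma hd_bnd M N : SL2 M -> SL2 N ->
 hd M N - ln 2 <= hdist (mpt M) (mpt N) <= hd M N.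
move=> hM hN; rewrite hdist_mpt //; have m2 := mn_ge2 (SL2_mul (SL2_inv2 hM) hN).
have := @arcosh_bnd (mn (inv2 M *m N) / 2); rewrite ler_pdivlMr // mul1r => /(_ m2).
rewrite (_ : 2 * (mn (inv2 M *m N) / 2) = mn (inv2 M *m N)); last by field.
rewrite /hd => /andP[h1 ->]; rewrite andbT; apply: le_trans h1.
by rewrite ln_div ?posrE // (lt_le_trans _ m2).
Qed.

Lemma mn_gt0 M : SL2 M -> 0 < mn M.
by move/mn_ge2 => h; apply: lt_le_trans h. Qed.

Lemma hd_triangle (M N L : 'M[C]_2) : SL2 M -> SL2 N -> SL2 L -> hd M L <= hd M N + hd N L.
move=> hM hN hL; have m1 := mn_gt0 (SL2_mul (SL2_inv2 hM) hN); have m2 := mn_gt0 (SL2_mul (SL2_inv2 hN) hL).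
have m3 := mn_gt0 (SL2_mul (SL2_inv2 hM) hL).
have eL : inv2 M *m N *m (inv2 N *m L) = inv2 M *m L.
 by move: (inv2 M) (inv2 N) (mul_inv2r hN) => A B hB; rewrite mulmxA -(mulmxA A) hB mulmx1.
have key : mn (inv2 M *m L) <= mn (inv2 M *m N) * mn (inv2 N *m L) by rewrite -eL; exact: mn_mul.
rewrite /hd; move: m1 m2 m3 key; move: (mn _) (mn _) (mn _) => x y z x0 y0 z0 h.
by rewrite -lnM // ler_ln //; exact: mulr_gt0.
Qed.

Lemma hdist_sym (x y : 'rV[R]_3) : hdist x y = hdist y x.
rewrite /hdist; congr arcosh; congr (1 + _).
have -> : sqnorm3 (x - y) = sqnorm3 (y - x) by rewrite !sqnorm3E !mxE; ring.
by rewrite [(1 - sqnorm3 x) * _]mulrC.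
Qed.

Lemma hdist_ge0 (x y : 'rV[R]_3) : ball3 x -> ball3 y -> 0 <= hdist x y.
rewrite /ball3 /= => hx hy; apply: le_trans (_ : ln 1 <= _); first by rewrite ln1.
have t1 : 1 <= 1 + 2 * sqnorm3 (x - y) / ((1 - sqnorm3 x) * (1 - sqnorm3 y)).
 rewrite lerDl divr_ge0 ?mulr_ge0 ?subr_ge0 ?(ltW hx) ?(ltW hy) //.
 by rewrite sqnorm3E !addr_ge0 ?sqr_ge0.
have /andP[h _] := arcosh_bnd t1; apply: le_trans h.
by rewrite ler_ln ?posrE; lra.
Qed.

Lemma hdistxx (x : 'rV[R]_3) : hdist x x = 0.
rewrite /hdist subrr (_ : sqnorm3 0 = 0); last by rewrite sqnorm3E !mxE expr0n !addr0.
by rewrite mulr0 mul0r addr0 /arcosh expr1n subrr sqrtr0 addr0 ln1.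
Qed.

(** The defect [2 * ln 2] stems from replacing arcosh by a logarithm in [hd_bnd]; after division by
    [r n] it disappears in the limit. *)
Lemma hdist_triangle (x y z : 'rV[R]_3) : ball3 x -> ball3 y -> ball3 z ->
 hdist x z <= hdist x y + hdist y z + 2 * ln 2.
move=> /ball_mpt[M hM ->] /ball_mpt[N hN ->] /ball_mpt[L hL ->].
have := hd_bnd hM hL; have := hd_bnd hM hN; have := hd_bnd hN hL; have := hd_triangle hM hN hL.
move: (hdist _ _) (hdist _ _) (hdist _ _) (hd _ _) (hd _ _) (hd _ _) => x1 x2 x3 y1 y2 y3; lra.
Qed.

(** [uz a b] is a rotation taking 0 to [a : b], and [dg s] moves the centre by [s] towards 0; their
    product represents [hgeod], see [hgeod_mpt]. *)
Definition uz (a b : C) : 'M[C]_2 := mk2 (b^*) a (- a^*) b.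
Definition dg (s : R) : 'M[C]_2 := mk2 (rC (expR (- (s / 2)))) 0 0 (rC (expR (s / 2))).

Lemma uz_su2 a b : nsq a + nsq b = 1 -> su2 (uz a b).
by move=> h; rewrite /su2 !mk2E conjCK nsq_conj addrC. Qed.

Lemma expR_half (s : R) : expR (s / 2) ^+ 2 = expR s.
by rewrite expr2 -expRD; congr expR; field. Qed.

Lemma expRN_half (s : R) : expR (- (s / 2)) ^+ 2 = expR (- s).
by rewrite -(expR_half (- s)) mulNr. Qed.

Lemma expR_mulN (s : R) : expR s * expR (- s) = 1.
by rewrite -expRD subrr expR0. Qed.

Lemma dg_SL2 s : SL2 (dg s).
apply/SL2E; rewrite !mk2E; creim; last by ring.
by rewrite -[RHS](expR_mulN (s / 2)); ring.
Qed.

Lemma gM_SL2 s a b : nsq a + nsq b = 1 -> SL2 (uz a b *m dg s).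
by move=> h; apply: SL2_mul; [exact/su2_SL2/uz_su2|exact: dg_SL2]. Qed.

Lemma hgeod_mpt (s : R) (a b : C) : nsq a + nsq b = 1 ->
 hgeod s (hquo a b) = mpt (uz a b *m dg s).
move=> h; have ab : (a != 0) || (b != 0) by rewrite -vn_gt0 h.
have e1 := expR_half s; have e2 := expRN_half s.
have p1 := expR_gt0 s.
have eE : expR (- s) = (expR s)^-1 by rewrite expRN.
have hA : rowA (uz a b *m dg s) = nsq b * expR (- s) + nsq a * expR s.
 by rewrite /rowA !mulmx2E !mk2E -e1 -e2 !nsqE !reim; ring.
have hB : rowB (uz a b *m dg s) = nsq a * expR (- s) + nsq b * expR s.
 by rewrite /rowB !mulmx2E !mk2E -e1 -e2 !nsqE !reim; ring.
have hc : rowc (uz a b *m dg s) = a * b^* * rC (expR s - expR (- s)).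
 by rewrite /rowc !mulmx2E !mk2E -e1 -e2; cring.
have hm : mn (uz a b *m dg s) = expR s + expR (- s).
 by rewrite mn_rows hA hB; transitivity ((nsq a + nsq b) * (expR s + expR (- s))); [ring|rewrite h mul1r].
rewrite /hgeod /mpt hm hA hB hc stereo_hquo // h invr1 scale1r.
have q1 : expR s + 1 != 0 by rewrite //; lra.
have q2 : expR s + expR (- s) + 2 != 0 by rewrite //; lra.
have q3 : expR s != 0 by rewrite gt_eqF.
have key : (expR s - 1) / (expR s + 1) = (expR s - expR (- s)) / (expR s + expR (- s) + 2).
 rewrite eE in q2 *; rewrite -[LHS](mulfK q2); congr (_ / _).
 by field; rewrite q3.
rewrite key [_ / _]mulrC -scalerA; congr (_ *: _).
apply/rowP => i; rewrite !mxE; case: (ord3P i) => -> /=; rewrite ?reim; ring.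
Qed.

Lemma hgeod0 z : hgeod 0 z = 0 :> 'rV[R]_3.
by rewrite /hgeod expR0 subrr mul0r scale0r. Qed.

Lemma hgeod_ball s z : ball3 (hgeod s z : 'rV[R]_3).
by have [a [b [_ <- h]]] := hquo_surj z; rewrite hgeod_mpt //; apply: mpt_ball; exact: gM_SL2. Qed.

Lemma mn_dg_mul (s t : R) (B : 'M[C]_2) : mn (inv2 (dg s) *m B *m dg t) =
 expR (s - t) * nsq (B 0 0) + expR (s + t) * nsq (B 0 1) +
 expR (- (s + t)) * nsq (B 1 0) + expR (t - s) * nsq (B 1 1).
have -> : inv2 (dg s) *m B *m dg t =
  mk2 (rC (expR (s / 2) * expR (- (t / 2))) * B 0 0) (rC (expR (s / 2) * expR (t / 2)) * B 0 1)
   (rC (expR (- (s / 2)) * expR (- (t / 2))) * B 1 0) (rC (expR (- (s / 2)) * expR (t / 2)) * B 1 1).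
 by apply: mx2P; rewrite !mulmx2E !mk2E; cring.
move: (B 0 0) (B 0 1) (B 1 0) (B 1 1) => w x y z.
rewrite /mn !mk2E !nsqM !nsq_real opprD !expRD.
by rewrite -(expR_half s) -(expR_half t) -(expRN_half s) -(expRN_half t); ring.
Qed.

Lemma uz_ratio (a b c e : C) : inv2 (uz a b) *m uz c e =
 mk2 (b * e^* + a * c^*) (b * c - a * e)
  (a^* * e^* - b^* * c^*) (a^* * c + b^* * e).
by apply: mx2P; rewrite mulmx2E !mk2E; ring. Qed.

Lemma hgeod_mn (s t : R) (a b c e : C) : nsq a + nsq b = 1 -> nsq c + nsq e = 1 ->
 mn (inv2 (uz a b *m dg s) *m (uz c e *m dg t)) =
 (expR (s - t) + expR (t - s)) * (1 - nsq (a * e - b * c)) +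
 (expR (s + t) + expR (- (s + t))) * nsq (a * e - b * c).
move=> h k.
have h1 : 1 - nsq (a * e - b * c) = nsq (b * e^* + a * c^*).
 by rewrite -[1]mulr1 -{1}h -k !nsqE !reim; ring.
rewrite inv2_mul mulmxA -(mulmxA (inv2 (dg s))) uz_ratio mn_dg_mul !mk2E h1.
have -> : nsq (b * c - a * e) = nsq (a * e - b * c) by rewrite -nsqN opprB.
have -> : nsq (a^* * e^* - b^* * c^*) = nsq (a * e - b * c).
 by rewrite -nsq_conj rmorphB !rmorphM /= !conjCK.
have -> : nsq (a^* * c + b^* * e) = nsq (b * e^* + a * c^*).
 by rewrite -nsq_conj rmorphD !rmorphM /= !conjCK addrC.
by ring.
Qed.

(** Up to a bounded factor, the exponential of minus the Gromov product, based at the centre, of the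
    points at distances [s] and [t] in the directions [z] and [w]. *)
Definition gap (s t : R) (z w : Ch) : R :=
 Num.max (chordal z w) (Num.max (expR (- s)) (expR (- t))).

Lemma gap_gt0 s t z w : 0 < gap s t z w.
by rewrite /gap !lt_max expR_gt0 !orbT. Qed.

(** The hyperbolic law of cosines [hgeod_mn]: after factoring out exp(s + t), the dominant terms are
    the squares of the three quantities in [gap], up to constant factors. *)
Lemma hdist_hgeod (s t : R) (z w : Ch) : 0 <= s -> 0 <= t ->
 `|hdist (hgeod s z) (hgeod t w) - (s + t + 2 * ln (gap s t z w))| <= ln 8.
move=> s0 t0.
have [a [b [_ <- h]]] := hquo_surj z; have [c [e [_ <- k]]] := hquo_surj w.
rewrite !hgeod_mpt //; have hb := hd_bnd (gM_SL2 s h) (gM_SL2 t k).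
have g0 := gap_gt0 s t (hquo a b) (hquo c e); move: hb; rewrite /hd (hgeod_mn s t h k).
have hc : chordal (hquo a b) (hquo c e) ^+ 2 = 4 * nsq (a * e - b * c).
 by rewrite chordal_hquo1 // exprMn normR_sqr; ring.
set B := nsq (a * e - b * c) in hc *; have B0 : 0 <= B := nsq_ge0 _.
have B1 : B <= 1.
 have := chordal_le2 (hquo a b) (hquo c e); have := chordal_ge0 (hquo a b) (hquo c e).
 move: hc; nra.
clearbody B.
set X := _ + _ * B; set g := gap _ _ _ _ in g0 *.
have E0 := expR_gt0 (s + t).
have Est : expR (s - t) = expR (s + t) * expR (- t) ^+ 2 by rewrite -expRM_natl -expRD; congr expR; rewrite mulr_natl; ring.
have Ets : expR (t - s) = expR (s + t) * expR (- s) ^+ 2 by rewrite -expRM_natl -expRD; congr expR; rewrite mulr_natl; ring.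
have g1 : expR (- s) <= g by rewrite /g /gap !le_max lexx orbT.
have g2 : expR (- t) <= g by rewrite /g /gap !le_max lexx !orbT.
have g3 : chordal (hquo a b) (hquo c e) <= g by rewrite /g /gap le_max lexx.
have sq (x : R) : 0 <= x -> x <= g -> x ^+ 2 <= g ^+ 2 by move=> *; rewrite ler_sqr ?nnegrE // ltW.
have Eneg : expR (- (s + t)) <= expR (s + t) by rewrite ler_expR; lra.
have ET0 := expR_ge0 (t - s).
have gs := sq _ (expR_ge0 _) g1; have gt := sq _ (expR_ge0 _) g2; have gc := sq _ (chordal_ge0 _ _) g3.
have up : X <= 4 * (expR (s + t) * g ^+ 2).
 have u1 : expR (s - t) * (1 - B) <= expR (s - t) by rewrite ler_piMr //; lra.
 have u2 : expR (t - s) * (1 - B) <= expR (t - s) by rewrite ler_piMr //; lra.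
 have u3 : expR (- (s + t)) * B <= expR (s + t) * B by rewrite ler_wpM2r.
 have u4 : expR (s + t) * expR (- t) ^+ 2 <= expR (s + t) * g ^+ 2 by rewrite ler_pM2l.
 have u5 : expR (s + t) * expR (- s) ^+ 2 <= expR (s + t) * g ^+ 2 by rewrite ler_pM2l.
 have u6 : expR (s + t) * (4 * B) <= expR (s + t) * g ^+ 2 by rewrite ler_pM2l // -hc.
 rewrite /X; lra.
have low : expR (s + t) * g ^+ 2 <= 4 * X.
 have l1 : expR (s - t) <= expR (s + t) by rewrite ler_expR; lra.
 have l2 : expR (t - s) <= expR (s + t) by rewrite ler_expR; lra.
 have v1 : expR (s - t) * B <= expR (s + t) * B by rewrite ler_wpM2r.
 have v2 : expR (t - s) * B <= expR (s + t) * B by rewrite ler_wpM2r.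
 have v3 : 0 <= expR (s - t) * (1 - B) by rewrite mulr_ge0 //; lra.
 have v4 : 0 <= expR (t - s) * (1 - B) by rewrite mulr_ge0 //; lra.
 have v5 : 0 <= expR (- (s + t)) * B by pos.
 have w1 : expR (s - t) <= X by rewrite /X; lra.
 have w2 : expR (t - s) <= X by rewrite /X; lra.
 have w3 : expR (s + t) * B <= X by rewrite /X; lra.
 rewrite /g /gap; case: (leP (expR (- s)) (expR (- t))) => _;
  rewrite /Num.max /Order.max; case: ifP => _; rewrite ?hc; lra.
have X0 : 0 < X by have : 0 < expR (s + t) * g ^+ 2 by [pos|]; lra.
have lE : ln (expR (s + t) * g ^+ 2) = s + t + 2 * ln g.
 by rewrite lnM ?posrE ?exprn_gt0 // expRK lnXn // mulr_natl.
have G0 : 0 < expR (s + t) * g ^+ 2 by pos.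
have a1 : ln X <= ln 4 + (s + t + 2 * ln g).
 by rewrite -lE -lnM ?posrE // ler_ln ?posrE // mulr_gt0.
have a2 : s + t + 2 * ln g <= ln 4 + ln X.
 by rewrite -lE -lnM ?posrE // ler_ln ?posrE // mulr_gt0.
have e8 : ln 8 = ln 4 + ln 2 :> R by rewrite -lnM ?posrE //; congr ln; ring.
have l2 : 0 <= ln 2 :> R by apply: ln_ge0; lra.
move=> /andP[b1 b2]; rewrite e8 ler_norml; apply/andP; split; lra.
Qed.

Lemma hdist0_hgeod (s : R) (z : Ch) : 0 <= s -> s - ln 2 <= hdist 0 (hgeod s z) <= s + ln 2.
move=> s0; have [a [b [_ <- h]]] := hquo_surj z.
have e0 : (0 : 'rV[R]_3) = mpt (1%:M : 'M[C]_2).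
 apply: moves_uniq; [exact: ball30|exact: SL2_1|].
 by rewrite /moves herm0 mulmx1 mul1mx map_scalar_mx rmorph1 trmx1.
rewrite e0 hgeod_mpt //; have := hd_bnd SL2_1 (gM_SL2 s h); rewrite /hd.
have -> : inv2 1%:M = 1%:M :> 'M[C]_2 by apply: mx2P; rewrite !mxE ?oppr0.
rewrite mul1mx mn_su2_mul; last exact: uz_su2.
have -> : mn (dg s) = expR s + expR (- s).
 by rewrite /mn !mk2E !nsq_real expr0n !addr0 expR_half expRN_half addrC.
have p1 := expR_gt0 s; have p2 := expR_gt0 (- s).
have : expR (- s) <= expR s by rewrite ler_expR; lra.
move=> p3; set L := ln _.
have : s <= L by rewrite -{1}(expRK s) ler_ln ?posrE; lra.
have : L <= s + ln 2.
 have -> : s + ln 2 = ln (expR s * 2) by rewrite lnM ?posrE // expRK.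
 rewrite ler_ln ?posrE; lra.
lra.
Qed.

Lemma stereo_surj (x : 'rV[R]_3) : sqnorm3 x = 1 -> exists z : Ch, stereo z = x.
move=> h; have hs := sqnorm3E x; rewrite h in hs.
have [w1|w1] := eqVneq (x 0 2) 1.
 exists None; apply/rowP => i; rewrite mxE.
 have xy : x 0 0 ^+ 2 + x 0 1 ^+ 2 = 0 by rewrite w1 in hs; lra.
 have a0 := sqr_ge0 (x 0 0); have b0 := sqr_ge0 (x 0 1).
 have /eqP : x 0 0 ^+ 2 = 0 by lra.
 have /eqP : x 0 1 ^+ 2 = 0 by lra.
 by rewrite !sqrf_eq0 => /eqP e1 /eqP e0; case: (ord3P i) => ->; rewrite ?w1.
have w0 : 1 - x 0 2 != 0 by rewrite subr_eq0 eq_sym.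
exists (Some (Complex (x 0 0 / (1 - x 0 2)) (x 0 1 / (1 - x 0 2)) : C)).
apply/rowP => i; rewrite mxE normR_sqr nsqE !reim mxE.
have wp : 0 < 1 - x 0 2.
 rewrite lt_def w0 subr_ge0 /=; have a0 := sqr_ge0 (x 0 0); have b0 := sqr_ge0 (x 0 1).
 by case: (leP (x 0 2) 1) => // h1; have : 1 < x 0 2 ^+ 2 by [rewrite exprn_egt1|]; lra.
have n1 : 1 + ((x 0 0 / (1 - x 0 2)) ^+ 2 + (x 0 1 / (1 - x 0 2)) ^+ 2) = 2 / (1 - x 0 2).
 rewrite !exprMn -mulrDl; have -> : x 0 0 ^+ 2 + x 0 1 ^+ 2 = 1 - x 0 2 ^+ 2 by lra.
 by field.
have n2 : (x 0 0 / (1 - x 0 2)) ^+ 2 + (x 0 1 / (1 - x 0 2)) ^+ 2 - 1 = 2 * x 0 2 / (1 - x 0 2).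
 rewrite !exprMn -mulrDl; have -> : x 0 0 ^+ 2 + x 0 1 ^+ 2 = 1 - x 0 2 ^+ 2 by lra.
 by field.
by rewrite n1; case: (ord3P i) => -> /=; rewrite ?n2; field.
Qed.

Lemma ball_hgeod (x : 'rV[R]_3) : ball3 x -> exists s z, 0 <= s /\ x = hgeod s z.
rewrite /ball3 /= => hx; have hs := sqnorm3E x.
have n0 : 0 <= sqnorm3 x by rewrite hs !addr_ge0 ?sqr_ge0.
pose rho := Num.sqrt (sqnorm3 x).
have r0 : 0 <= rho by rewrite sqrtr_ge0.
have r2 : rho ^+ 2 = sqnorm3 x by rewrite (sqr_sqrtr n0).
have [rz|rz] := eqVneq rho 0.
 exists 0, None; split=> //; rewrite hgeod0; rewrite rz expr0n /= in r2.
 have a0 := sqr_ge0 (x 0 0); have b0 := sqr_ge0 (x 0 1); have c0 := sqr_ge0 (x 0 2).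
 have /eqP : x 0 0 ^+ 2 = 0 by lra.
 have /eqP : x 0 1 ^+ 2 = 0 by lra.
 have /eqP : x 0 2 ^+ 2 = 0 by lra.
 rewrite !sqrf_eq0 => /eqP e2 /eqP e1 /eqP e0.
 by apply/rowP => i; rewrite mxE; case: (ord3P i) => ->.
have r1 : rho < 1 by rewrite -(@ltr_sqr _ _ 1) ?nnegrE // r2 expr1n.
have [z hz] : exists z : Ch, stereo z = rho^-1 *: x.
 apply: stereo_surj; rewrite sqnorm3E !mxE !exprMn -!mulrDr -hs -r2 exprVn mulVf // sqrf_eq0 //.
exists (ln ((1 + rho) / (1 - rho))), z; split.
 by apply: ln_ge0; rewrite ler_pdivlMr; lra.
have pp : 0 < (1 + rho) / (1 - rho) by rewrite divr_gt0; lra.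
rewrite /hgeod (lnK pp).
have q : 1 - rho != 0 by rewrite gt_eqF // subr_gt0.
have -> : ((1 + rho) / (1 - rho) - 1) / ((1 + rho) / (1 - rho) + 1) = rho.
 have -> : (1 + rho) / (1 - rho) - 1 = 2 * rho / (1 - rho) by field.
 have -> : (1 + rho) / (1 - rho) + 1 = 2 / (1 - rho) by field.
 by field.
by rewrite hz scalerA divff // scale1r.
Qed.

(** * Spinors and the discrete curvature of a grid of vectors *)

Definition cis (t : R) : C := Complex (cos t) (sin t).

Lemma cisD s t : cis (s + t) = cis s * cis t.
by apply: complexP; rewrite !reim /cis ?cosD ?sinD; ring. Qed.

Lemma cis0 : cis 0 = 1.
by rewrite /cis cos0 sin0. Qed.

Lemma nsq_cis t : nsq (cis t) = 1.
by rewrite nsqE /cis cos2Dsin2. Qed.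

Lemma cis_neq0 t : cis t != 0.
by rewrite -nsq_eq0 nsq_cis. Qed.

Lemma cisN t : cis (- t) = (cis t)^-1.
by apply: (mulIf (cis_neq0 t)); rewrite mulVf ?cis_neq0 // -cisD addNr cis0. Qed.

Lemma cis_sum (I : Type) (r : seq I) (F : I -> R) :
 cis (\sum_(i <- r) F i) = \prod_(i <- r) cis (F i).
by elim: r => [|i r IH]; rewrite ?big_nil ?cis0 // !big_cons cisD IH. Qed.

Lemma cis2pi : cis (2 * pi) = 1.
have -> : 2 * pi = pi + pi :> R by ring.
by rewrite cisD /cis cospi sinpi; cring.
Qed.

Lemma cis_eq1 t : cis t = 1 -> `|t| < 2 * pi -> t = 0.
move=> h ht; have hc : cos t = 1 by have := congr1 (@Re R) h; rewrite /cis.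
have hs : sin (t / 2) = 0.
 have e : t = t / 2 + t / 2 by field.
 have := hc; rewrite {1}e cosD; have := cos2Dsin2 (t / 2); rewrite !expr2 => h1 h2.
 by apply/eqP; rewrite -sqrf_eq0; apply/eqP; rewrite expr2; lra.
have [t0|t0|->] := ltrgtP t 0; last by [].
 have : 0 < sin (- (t / 2)).
  by apply: sin_gt0_pi; rewrite ltr0_norm // in ht; apply/andP; split; lra.
 by rewrite sinN hs oppr0 ltxx.
have : 0 < sin (t / 2).
 by apply: sin_gt0_pi; rewrite gtr0_norm // in ht; apply/andP; split; lra.
by rewrite hs ltxx.
Qed.

Definition uu (z : C) : C := z * rC (normR z)^-1.

Lemma uuM z w : uu (z * w) = uu z * uu w.
by rewrite /uu normRM invfM mulrACA; congr (_ * _); cring. Qed.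

Lemma nsq_uu z : z != 0 -> nsq (uu z) = 1.
by move=> z0; rewrite nsqM nsq_real exprVn normR_sqr mulfV // nsq_eq0. Qed.

Lemma uu_neq0 z : z != 0 -> uu z != 0.
by move=> z0; rewrite -nsq_eq0 nsq_uu. Qed.

Lemma uu_conj z : z != 0 -> uu (z^*) = (uu z)^-1.
move=> z0; apply: (mulIf (uu_neq0 z0)); rewrite mulVf ?uu_neq0 // -uuM [_ * z]mulrC conj_mulC /uu normR_real.
have n0 : 0 < nsq z by rewrite nsq_gt0.
by rewrite gtr0_norm //; creim; field; rewrite gt_eqF.
Qed.

Lemma uu_real (x : R) : 0 < x -> uu (rC x) = 1.
by move=> x0; rewrite /uu normR_real gtr0_norm //; creim; field; rewrite gt_eqF. Qed.

Definition arg (z : C) : R := atan (Im z / Re z).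

Lemma arg_bnd z : `|arg z| < pi / 2.
by rewrite /arg ltr_norml; have := atan_ltpi2 (Im z / Re z); have := atan_gtNpi2 (Im z / Re z) => -> ->. Qed.

Lemma cis_arg (z : C) : 0 < Re z -> cis (arg z) = uu z.
move=> z0; rewrite /cis /arg; set t := _ / _.
have hs : Num.sqrt (1 + t ^+ 2) = normR z / Re z.
 have -> : 1 + t ^+ 2 = (normR z / Re z) ^+ 2.
  by rewrite [in RHS]exprMn normR_sqr nsqE exprVn /t; field; rewrite gt_eqF.
 by rewrite sqrtr_sqr ger0_norm // divr_ge0 // ltW.
have nz : 0 < normR z.
 by rewrite normR_gt0; apply: contraTneq z0 => ->; rewrite ltxx.
have hc : cos (atan t) = Re z / normR z.
 by rewrite cos_atan hs invf_div.
have hsin : sin (atan t) = Im z / normR z.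
 have : sin (atan t) = tan (atan t) * cos (atan t).
  have cn0 : cos (atan t) != 0 by rewrite hc mulf_neq0 ?invr_eq0 // gt_eqF.
  by rewrite /tan divfK.
 by rewrite atanK hc => ->; rewrite /t; field; rewrite !gt_eqF.
by rewrite hc hsin /uu; cring.
Qed.

Lemma arg_unique (z : C) t : 0 < Re z -> cis t = uu z -> `|t| <= pi -> t = arg z.
move=> z0 h ht; apply/eqP; rewrite -subr_eq0; apply/eqP; apply: cis_eq1.
 by rewrite cisD cisN cis_arg // h mulfV // -cis_arg // cis_neq0.
apply: le_lt_trans (ler_normB _ _) _; have := arg_bnd z; have := @pi_gt0 R; lra.
Qed.

Lemma arg_real (x : R) : arg (rC x) = 0.
by rewrite /arg mul0r atan0. Qed.

Lemma small_arg (e : R) : 0 < e -> exists2 k : R, 0 < k & k <= 1 / 2 /\ forall (z : C) (x : R), 0 < x ->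
 normR (z - rC x) <= k * x -> 0 < Re z /\ `|arg z| < e.
move=> e0; have := @continuous_atan R 0; move/cvgrPdist_lt => /(_ e e0) /nbhs_ballP[k /= k0 hk].
pose k' := Num.min (1 / 2) (k / 4).
have k'0 : 0 < k' by rewrite lt_min !divr_gt0.
have k1 : k' <= 1 / 2 by rewrite ge_min lexx.
have k2 : k' <= k / 4 by rewrite ge_min lexx orbT.
exists k' => //; split=> // z x x0 hz.
have hre : `|Re z - x| <= k' * x.
 by apply: le_trans hz; have := Re_le_normR (z - rC x); rewrite !reim.
have him : `|Im z| <= k' * x.
 by apply: le_trans hz; have := Im_le_normR (z - rC x); rewrite !reim subr0.
have kx : k' * x <= 1 / 2 * x by rewrite ler_pM2r.
have re2 : x / 2 <= Re z by move: hre; rewrite ler_norml => /andP[]; lra.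
have re0 : 0 < Re z by lra.
split=> //; have := hk (Im z / Re z); rewrite atan0 sub0r normrN; apply.
rewrite /ball /= sub0r normrN normrM normfV (gtr0_norm re0) ltr_pdivrMr //.
apply: le_lt_trans him _; have : k' * x <= k / 4 * x by rewrite ler_pM2r.
have : k * (x / 2) <= k * Re z by rewrite ler_pM2l.
have : 0 < k * x by pos.
lra.
Qed.

Definition inn (a b : C * C) : C := a.1^* * b.1 + a.2^* * b.2.

Lemma inn_conj a b : (inn a b)^* = inn b a.
by rewrite /inn rmorphD !rmorphM /= !conjCK; ring. Qed.

Lemma inn_self a : inn a a = rC (nsq a.1 + nsq a.2).
by rewrite /inn ![_^* * _]mulrC !conj_mulC; apply: complexP; rewrite !reim ?addr0. Qed.

Definition vdot (x y : vec) : R := x 0 * y 0 + x 1 * y 1 + x 2 * y 2.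
Definition vnorm (x : vec) : R := Num.sqrt (vdot x x).
Definition vc (x : vec) : C := Complex (x 0) (x 1).

Lemma vdot_ge0 x : 0 <= vdot x x.
by rewrite /vdot !addr_ge0 // sqr_ge0. Qed.

Lemma vnorm_sqr x : vnorm x ^+ 2 = vdot x x.
by rewrite /vnorm (sqr_sqrtr (vdot_ge0 x)). Qed.

Lemma vnorm_ge0 x : 0 <= vnorm x. pos. Qed.

(** The matrix |x| + x . sigma, with sigma the Pauli matrices up to orientation. It is positive of
    rank at most one, so for [x != 0] it is a multiple of [a a^*] for a spinor [a], unique up to
    scaling. *)
Definition Hm (x : vec) : 'M[C]_2 :=
 mk2 (rC (vnorm x + x 2)) (vc x) ((vc x)^*) (rC (vnorm x - x 2)).

(** The trace of the triple product, a Bargmann invariant: up to a positive factor the cyclic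
    product of the inner products of three spinors, hence independent of their phases. Its argument
    is half the signed area of the spherical triangle. *)
Definition T3 (x y z : vec) : C :=
 (Hm x *m Hm y *m Hm z) 0 0 + (Hm x *m Hm y *m Hm z) 1 1.

Definition N2 (x y : vec) : C := (Hm x *m Hm y) 0 0.

Lemma N2E x y : N2 x y = rC ((vnorm x + x 2) * (vnorm y + y 2)) + vc x * (vc y)^*.
by rewrite /N2 mulmx2E !mk2E; cring. Qed.

Lemma ReT3 x y z : Re (T3 x y z) = 2 * (vnorm x * vnorm y * vnorm z +
 vnorm x * vdot y z + vnorm y * vdot x z + vnorm z * vdot x y).
by rewrite /T3 !mulmx2E !mk2E /vdot /vc !reim; ring. Qed.

Definition spinor (x : vec) (a : C * C) : Prop := exists2 k : R, 0 < k &
 [/\ rC (vnorm x + x 2) = rC k * (a.1 * a.1^*),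
   vc x = rC k * (a.1 * a.2^*) &
   rC (vnorm x - x 2) = rC k * (a.2 * a.2^*)].

Lemma spinor_Hm x a : spinor x a -> exists2 k : R, 0 < k & Hm x = mk2 (rC k * (a.1 * a.1^*))
 (rC k * (a.1 * a.2^*)) (rC k * (a.2 * a.1^*)) (rC k * (a.2 * a.2^*)).
case=> k k0 [h1 h2 h3]; exists k => //; rewrite /Hm h1 h2 h3; congr mk2.
by rewrite !rmorphM /= conjCK [a.1^* * _]mulrC; congr (_ * _); apply: complexP; rewrite !reim ?oppr0.
Qed.

Lemma T3_spinor x y z a b c : spinor x a -> spinor y b -> spinor z c ->
 exists2 k : R, 0 < k & T3 x y z = rC k * (inn a b * inn b c * inn c a).
move=> /spinor_Hm[k1 k10 h1] /spinor_Hm[k2 k20 h2] /spinor_Hm[k3 k30 h3].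
exists (k1 * k2 * k3); first by pos.
have -> : rC (k1 * k2 * k3) = rC k1 * rC k2 * rC k3 :> C by cring.
by rewrite /T3 h1 h2 h3 !mulmx2E !mk2E /inn; ring.
Qed.

Lemma N2_spinor x y a b : spinor x a -> spinor y b ->
 exists2 k : R, 0 < k & N2 x y = rC k * (a.1 * inn a b * b.1^*).
move=> /spinor_Hm[k1 k10 h1] /spinor_Hm[k2 k20 h2].
exists (k1 * k2); first by pos.
have -> : rC (k1 * k2) = rC k1 * rC k2 :> C by cring.
by rewrite /N2 h1 h2 !mulmx2E !mk2E /inn; ring.
Qed.

(** The spinor with positive first coordinate, a continuous section away from the negative third
    axis. At directions where it breaks down, the value [(0, 1)] is taken. *)
Definition spin (x : vec) : C * C :=
 if 0 < vnorm x + x 2 then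
  (rC (Num.sqrt (vnorm x + x 2)), (vc x)^* * rC (Num.sqrt (vnorm x + x 2))^-1)
 else (0, 1).

Lemma vnorm_ge x : `|x 2| <= vnorm x.
rewrite -ler_sqr ?nnegrE ?vnorm_ge0 // real_normK ?num_real // vnorm_sqr /vdot -!expr2.
by have := sqr_ge0 (x 0); have := sqr_ge0 (x 1); lra.
Qed.

Lemma nsq_vc x : nsq (vc x) = (vnorm x + x 2) * (vnorm x - x 2).
have -> : (vnorm x + x 2) * (vnorm x - x 2) = vnorm x ^+ 2 - x 2 ^+ 2 by ring.
by rewrite vnorm_sqr /vdot nsqE /vc !reim; ring.
Qed.

Lemma spin_spinor x : 0 < vnorm x -> spinor x (spin x).
move=> x0; rewrite /spin; case: ifPn => [h|].
 set s := Num.sqrt _; have s2 : s ^+ 2 = vnorm x + x 2 by rewrite (sqr_sqrtr (ltW h)).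
 have s0 : s != 0 by rewrite -sqrf_eq0 s2 gt_eqF.
 exists 1 => //=; split.
 - by rewrite -s2; cring.
 - by creim; field.
 creim; last by ring.
 apply: (mulfI (lt0r_neq0 h)); rewrite -nsq_vc nsqE -s2 /vc !reim.
 by field.
rewrite -leNgt => h; have := vnorm_ge x; rewrite ler_norml => /andP[h1 h2].
have e : vnorm x + x 2 = 0 by lra.
have e0 : vc x = 0 by apply/eqP; rewrite -nsq_eq0 nsq_vc e mul0r.
exists (vnorm x - x 2); first by lra.
by rewrite e0 e; split; cring.
Qed.

Lemma inn_neq0 x y a b : spinor x a -> spinor y b -> 0 < vnorm x -> 0 < vnorm y -> 0 < vdot x y ->
 inn a b != 0.
move=> sa sb x0 y0 xy; have [k k0 h] := T3_spinor sa sb sb.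
apply: contraTneq xy => h0; move: h; rewrite h0 !mul0r mulr0 => /(congr1 (@Re R)).
rewrite ReT3 reim -vnorm_sqr => h.
rewrite -leNgt leNgt; apply/negP => xy.
have p2 : 0 < vnorm y * vdot x y by pos.
have p3 : 0 < vnorm x * vnorm y ^+ 2 by pos.
lra.
Qed.

Lemma uu_T3 x y z a b c : spinor x a -> spinor y b -> spinor z c ->
 uu (T3 x y z) = uu (inn a b) * uu (inn b c) * uu (inn c a).
by move=> sa sb sc; have [k k0 ->] := T3_spinor sa sb sc; rewrite !uuM uu_real // mul1r. Qed.

Lemma uu_N2 x y a b : spinor x a -> spinor y b ->
 uu (N2 x y) = uu a.1 * uu (inn a b) * uu (b.1^*).
by move=> sa sb; have [k k0 ->] := N2_spinor sa sb; rewrite !uuM uu_real // mul1r. Qed.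

Lemma N2_close x y (e : R) : 0 < x 2 -> vnorm x <= 2 * vnorm x ->
 (forall i, `|x i - y i| <= e) -> `|vnorm x - vnorm y| <= 3 * e ->
 normR (N2 x y - rC ((vnorm x + x 2) ^+ 2 + nsq (vc x))) <= 8 * e * (vnorm x + x 2).
move=> x2 _ he hn; have xn := vnorm_ge x; rewrite gtr0_norm // in xn.
have -> : N2 x y - rC ((vnorm x + x 2) ^+ 2 + nsq (vc x)) =
  rC ((vnorm x + x 2) * (vnorm y - vnorm x + (y 2 - x 2))) + vc x * (vc y - vc x)^*.
 by rewrite N2E /vc; apply: complexP; rewrite !nsqE !reim; ring.
have e0 : 0 <= e by apply: le_trans (he 0).
apply: le_trans (normRD _ _) _; rewrite normR_real normRM normR_conj normrM.
have p : 0 < vnorm x + x 2 by lra.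
have h1 : `|vnorm y - vnorm x + (y 2 - x 2)| <= 4 * e.
 move: hn (he 2); rewrite !ler_norml => /andP[a1 a2] /andP[b1 b2]; apply/andP; split; lra.
have h2 : normR (vc y - vc x) <= 2 * e.
 apply: le_trans (normR_leD _) _; rewrite /vc !reim distrC [X in _ + X]distrC.
 have := he 0; have := he 1; lra.
have h3 : normR (vc x) <= vnorm x + x 2.
 have q := nsq_vc x; rewrite -normR_sqr in q.
  rewrite -ler_sqr ?nnegrE ?(ltW p) // q expr2; apply: ler_wpM2l; [exact: ltW|lra].
rewrite (gtr0_norm p).
have := ler_wpM2l (ltW p) h1; have := ler_pM (normR_ge0 _) (normR_ge0 _) h3 h2.
move: (normR _ * normR _) (_ * `|_|) => u v; have : 0 <= e * (vnorm x + x 2) by rewrite mulr_ge0 // ltW.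
lra.
Qed.

(* A grid of vectors, cyclic in the second index, with all neighbours at acute
  angles; its total curvature, minus the one of the outer boundary measured in
  the section spin. *)
Definition curv n (v : nat -> nat -> vec) : R :=
 \sum_(j < n) \sum_(k < n) (arg (T3 (v k j) (v k.+1 j) (v k.+1 j.+1)) +
               arg (T3 (v k j) (v k.+1 j.+1) (v k j.+1))) -
 \sum_(j < n) arg (N2 (v n j) (v n j.+1)).

Definition nbr (p q : nat * nat) : bool :=
 ((q.1 == p.1) || (q.1 == p.1.+1)) && ((q.2 == p.2) || (q.2 == p.2.+1)).

Record grid n (v : nat -> nat -> vec) : Prop := Grid {
 grid_center : forall j, v 0%N j = v 0%N 0%N;
 grid_cyclic : forall k, v k n = v k 0%N;
 grid_pos : forall k j, 0 < vnorm (v k j);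
 grid_acute : forall p q, nbr p q -> 0 < vdot (v p.1 p.2) (v q.1 q.2);
 grid_outer : forall j, 0 < v n j 2 /\ 0 < Re (N2 (v n j) (v n j.+1)) }.

Lemma vdotC (x y : vec) : vdot x y = vdot y x.
by rewrite /vdot; ring. Qed.

Lemma T3_pos (x y z : vec) : 0 < vnorm x -> 0 < vnorm y -> 0 < vnorm z ->
 0 < vdot x y -> 0 < vdot y z -> 0 < vdot x z -> 0 < Re (T3 x y z).
move=> x0 y0 z0 xy yz xz; rewrite ReT3 mulr_gt0 // !addr_gt0 ?mulr_gt0 //.
Qed.

Lemma face_pos n v k j : grid n v ->
 0 < Re (T3 (v k j) (v k.+1 j) (v k.+1 j.+1)) /\
 0 < Re (T3 (v k j) (v k.+1 j.+1) (v k j.+1)).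
move=> g; have p := grid_pos g; have a := grid_acute g.
have h1 := a (k, j) (k.+1, j); have h2 := a (k, j) (k.+1, j.+1); have h3 := a (k, j) (k, j.+1).
have h4 := a (k.+1, j) (k.+1, j.+1); have h5 := a (k, j.+1) (k.+1, j.+1).
rewrite /nbr !eqxx ?orbT /= in h1 h2 h3 h4 h5.
by split; apply: T3_pos => //; rewrite ?h1 ?h2 ?h3 ?h4 // vdotC h5.
Qed.

Lemma telescope_prod (F : nat -> C) n : (forall k, F k != 0) ->
 \prod_(k < n) (F k.+1 / F k) = F n / F 0%N.
move=> F0; elim: n => [|n IH]; first by rewrite big_ord0 divff.
by rewrite big_ord_recr /= IH; field; rewrite !F0.
Qed.

(** Exponentiating, each triangle becomes a product of phases of inner products along its edges.
    Interior edges occur twice with opposite orientation, the cyclic ends match, the centre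
    contributes 1, and the boundary is exactly what [curv] subtracts. So [curv] is a multiple of 2
    pi. *)
Lemma cis_curv n v : grid n v -> cis (curv n v) = 1.
move=> g; have p := grid_pos g; have a := grid_acute g.
pose s k j := spin (v k j).
have sp k j : spinor (v k j) (s k j) by apply: spin_spinor.
have i0 q q' : nbr q q' -> inn (s q.1 q.2) (s q'.1 q'.2) != 0.
 by move=> h; apply: (inn_neq0 (sp _ _) (sp _ _)) => //; exact: a.
pose X k j := uu (inn (s k j) (s k.+1 j)); pose Y k j := uu (inn (s k j) (s k j.+1)).
have X0 k j : X k j != 0.
 by apply: uu_neq0; apply: (i0 (k, j) (k.+1, j)); rewrite /nbr !eqxx ?orbT.
have Y0 k j : Y k j != 0.
 by apply: uu_neq0; apply: (i0 (k, j) (k, j.+1)); rewrite /nbr !eqxx ?orbT.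
have face k j : cis (arg (T3 (v k j) (v k.+1 j) (v k.+1 j.+1)) + arg (T3 (v k j) (v k.+1 j.+1) (v k j.+1))) =
  (X k j / X k j.+1) * (Y k.+1 j / Y k j).
 have [f1 f2] := face_pos k j g; rewrite cisD !cis_arg //.
 rewrite (uu_T3 (sp k j) (sp k.+1 j) (sp k.+1 j.+1)) (uu_T3 (sp k j) (sp k.+1 j.+1) (sp k j.+1)).
 have d0 : inn (s k j) (s k.+1 j.+1) != 0 by apply: (i0 (k, j) (k.+1, j.+1)); rewrite /nbr !eqxx ?orbT.
 rewrite -(inn_conj (s k j) (s k.+1 j.+1)) uu_conj // -(inn_conj (s k j.+1) (s k.+1 j.+1)) uu_conj; last first.
  by apply: (i0 (k, j.+1) (k.+1, j.+1)); rewrite /nbr !eqxx ?orbT.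
 rewrite -(inn_conj (s k j) (s k j.+1)) uu_conj; last first.
  by apply: (i0 (k, j) (k, j.+1)); rewrite /nbr !eqxx ?orbT.
 rewrite -/(X k j) -/(X k j.+1) -/(Y k.+1 j) -/(Y k j).
 have := uu_neq0 d0; move: (uu _) => D D0.
 by field; rewrite X0 Y0.
have outer j : cis (arg (N2 (v n j) (v n j.+1))) = Y n j.
 have [v2 v3] := grid_outer g j; have [v4 _] := grid_outer g j.+1.
 rewrite cis_arg // (uu_N2 (sp _ _) (sp _ _)) /s /spin.
 have q1 : 0 < vnorm (v n j) + v n j 2 by pos.
 have q2 : 0 < vnorm (v n j.+1) + v n j.+1 2 by pos.
 rewrite q1 q2 /= -/(spin (v n j)) -/(spin (v n j.+1)).
 have cr (x : R) : (rC x : C)^* = rC x by apply: complexP; rewrite !reim ?oppr0.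
 rewrite cr !uu_real ?sqrtr_gt0 // mul1r mulr1 /Y /s /spin q1 q2 //.
rewrite /curv cisD cisN !cis_sum.
have -> : \prod_(i < n) cis (\sum_(k < n) (arg (T3 (v k i) (v k.+1 i) (v k.+1 i.+1)) + arg (T3 (v k i) (v k.+1 i.+1) (v k i.+1)))) =
  \prod_(j < n) Y n j.
 have Yc j : Y 0%N j = 1.
  rewrite /Y /s !(grid_center g j) !(grid_center g j.+1) inn_self uu_real //.
  have [k k0 [h1 h2 h3]] := sp 0%N 0%N.
  rewrite vn_gt0; apply: contraTT (p 0%N 0%N); rewrite negb_or !negbK => /andP[/eqP e1 /eqP e2].
  move: h1 h3; rewrite /s e1 e2 !mul0r !mulr0 => /(congr1 (@Re R)) /= h1 /(congr1 (@Re R)) /= h3.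
  by rewrite -leNgt; lra.
 transitivity (\prod_(j < n) ((\prod_(k < n) (X k j / X k j.+1)) * (\prod_(k < n) (Y k.+1 j / Y k j)))).
  by apply: eq_bigr => j _; rewrite cis_sum -big_split; apply: eq_bigr => k _; exact: face.
 rewrite big_split exchange_big /= big1 ?mul1r.
  by apply: eq_bigr => j _; rewrite (@telescope_prod (Y ^~ j)) // Yc divr1.
 move=> k _; have ec : X k n = X k 0%N by rewrite /X /s (grid_cyclic g k) (grid_cyclic g k.+1).
 have Xi j : (X k j)^-1 != 0 by rewrite invr_eq0.
 have := @telescope_prod (fun j => (X k j)^-1) n Xi; rewrite ec (divff (Xi _)) => h.
 by rewrite -[RHS]h; apply: eq_bigr => j _; rewrite invrK mulrC.
rewrite (eq_bigr _ (fun (j : 'I_n) _ => outer j)) mulfV //.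
by apply/prodf_neq0 => j _; exact: Y0.
Qed.

Lemma telescope_sum (F : nat -> R) n : \sum_(k < n) (F k.+1 - F k) = F n - F 0%N.
elim: n => [|n IH]; first by rewrite big_ord0 subrr.
by rewrite big_ord_recr /= IH; ring.
Qed.

(** If spinors can be chosen over the whole grid with nearly aligned neighbours, the cancellation
    already holds for the arguments: with each below pi / 3, three of them sum to less than pi and
    there is no jump by 2 pi. Only the boundary comparison between this choice and [spin]
    remains. *)
Lemma curv_gauge n v (a : nat -> nat -> C * C) : grid n v ->
 (forall k j, (k <= n)%N -> (j <= n)%N -> spinor (v k j) (a k j)) ->
 (forall j, a 0%N j = a 0%N 0%N) -> (forall k, a k n = a k 0%N) ->
 (forall p q, nbr p q -> (q.1 <= n)%N -> (q.2 <= n)%N ->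
   0 < Re (inn (a p.1 p.2) (a q.1 q.2)) /\ `|arg (inn (a p.1 p.2) (a q.1 q.2))| < pi / 3) ->
 curv n v = \sum_(j < n) (arg (inn (a n j) (a n j.+1)) - arg (N2 (v n j) (v n j.+1))).
move=> g sp a0 an small.
pose x k j := arg (inn (a k j) (a k.+1 j)); pose y k j := arg (inn (a k j) (a k j.+1)).
pose z k j := arg (inn (a k j) (a k.+1 j.+1)).
have face (k j : 'I_n) : arg (T3 (v k j) (v k.+1 j) (v k.+1 j.+1)) + arg (T3 (v k j) (v k.+1 j.+1) (v k j.+1)) =
  (x k j - x k j.+1) + (y k.+1 j - y k j).
 have kn := ltn_ord k; have jn := ltn_ord j; have kn' := ltnW kn; have jn' := ltnW jn.
 have [f1 f2] := face_pos k j g.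
 have [x1 x2] : 0 < Re (inn (a k j) (a k.+1 j)) /\ `|x k j| < pi / 3.
  by apply: (small (val k, val j) (k.+1, val j)) => //; rewrite /nbr !eqxx ?orbT.
 have [x1' x2'] : 0 < Re (inn (a k j.+1) (a k.+1 j.+1)) /\ `|x k j.+1| < pi / 3.
  by apply: (small (val k, j.+1) (k.+1, j.+1)) => //; rewrite /nbr !eqxx ?orbT.
 have [y1 y2] : 0 < Re (inn (a k j) (a k j.+1)) /\ `|y k j| < pi / 3.
  by apply: (small (val k, val j) (val k, j.+1)) => //; rewrite /nbr !eqxx ?orbT.
 have [y1' y2'] : 0 < Re (inn (a k.+1 j) (a k.+1 j.+1)) /\ `|y k.+1 j| < pi / 3.
  by apply: (small (k.+1, val j) (k.+1, j.+1)) => //; rewrite /nbr !eqxx ?orbT.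
 have [z1 z2] : 0 < Re (inn (a k j) (a k.+1 j.+1)) /\ `|z k j| < pi / 3.
  by apply: (small (val k, val j) (k.+1, j.+1)) => //; rewrite /nbr !eqxx ?orbT.
 have nz (w : C) : 0 < Re w -> w != 0 by apply: contraTneq => ->; rewrite ltxx.
 have tri3 (b c e : R) : `|b| < pi / 3 -> `|c| < pi / 3 -> `|e| < pi / 3 -> `|b + c - e| <= pi.
  move=> h1 h2 h3; apply: le_trans (ler_normB _ _) _; have := ler_normD b c; lra.
 have e1 : x k j + y k.+1 j - z k j = arg (T3 (v k j) (v k.+1 j) (v k.+1 j.+1)).
  apply: arg_unique => //; last exact: tri3.
  rewrite (uu_T3 (sp k j kn' jn') (sp k.+1 j kn jn') (sp k.+1 j.+1 kn jn)) -(inn_conj (a k j) (a k.+1 j.+1)).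
  by rewrite uu_conj ?nz // !cisD cisN !cis_arg.
 have e2 : z k j - x k j.+1 - y k j = arg (T3 (v k j) (v k.+1 j.+1) (v k j.+1)).
  apply: arg_unique => //; last by rewrite -addrA -opprD; apply: le_trans (ler_normB _ _) _; have := ler_normD (x k j.+1) (y k j); lra.
  rewrite (uu_T3 (sp k j kn' jn') (sp k.+1 j.+1 kn jn) (sp k j.+1 kn' jn)) -(inn_conj (a k j.+1) (a k.+1 j.+1)) -(inn_conj (a k j) (a k j.+1)).
  by rewrite !uu_conj ?nz // !cisD !cisN !cis_arg.
 by rewrite -e1 -e2; ring.
rewrite /curv.
have -> : \sum_(j < n) \sum_(k < n) (arg (T3 (v k j) (v k.+1 j) (v k.+1 j.+1)) + arg (T3 (v k j) (v k.+1 j.+1) (v k j.+1))) =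
  \sum_(j < n) y n j.
 transitivity (\sum_(j < n) \sum_(k < n) (x k j - x k j.+1) + \sum_(j < n) \sum_(k < n) (y k.+1 j - y k j)).
  by rewrite -big_split; apply: eq_bigr => j _; rewrite -big_split; apply: eq_bigr => k _; exact: face.
 rewrite exchange_big /= big1 ?add0r => [|k _].
  apply: eq_bigr => j _; rewrite (telescope_sum (y ^~ j)) {2}/y !(a0 j) !(a0 j.+1) inn_self arg_real subr0 //.
 have := telescope_sum (fun j => - x k j) n; rewrite {3 4}/x (an k) (an k.+1) subrr => h.
 by rewrite -[RHS]h; apply: eq_bigr => j _; rewrite opprK addrC.
by rewrite -sumrB.
Qed.

Lemma vnorm_close (x y : vec) (e : R) : (forall i, `|x i - y i| <= e) -> `|vnorm x - vnorm y| <= 3 * e.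
move=> h; have e0 : 0 <= e by apply: le_trans (h 0).
have vE (z : vec) : vnorm z = Num.sqrt (sqnorm3 (\row_i z i)).
 by rewrite /vnorm sqnorm3E !mxE /vdot.
have key (a b : vec) : (forall i, `|a i - b i| <= e) -> vnorm a <= vnorm b + 3 * e.
 move=> hab; rewrite !vE.
 have -> : \row_i a i = \row_i b i + \row_i (a i - b i) by apply/rowP => i; rewrite !mxE addrC subrK.
 apply: le_trans (sqrt_tri3 _ _) _; rewrite lerD2l.
 rewrite -[leRHS]ger0_norm ?mulr_ge0 // -sqrtr_sqr ler_wsqrtr // sqnorm3E !mxE.
 have sq i : (a i - b i) ^+ 2 <= e ^+ 2 by rewrite -[leLHS]real_normK ?num_real // ler_sqr.
 by have := sq 0; have := sq 1; have := sq 2; have := sqr_ge0 e; rewrite exprMn; lra.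
have k1 := key x y h; have k2 : vnorm y <= vnorm x + 3 * e by apply: key => i; rewrite distrC.
by rewrite ler_norml; apply/andP; split; lra.
Qed.

Lemma ImT3 (x y z : vec) : Im (T3 x y z) = - 2 * (x 0 * (y 1 * z 2 - y 2 * z 1) +
 x 1 * (y 2 * z 0 - y 0 * z 2) + x 2 * (y 0 * z 1 - y 1 * z 0)).
by rewrite /T3 !mulmx2E !mk2E /vc !reim; ring. Qed.

Lemma ReN2 (x y : vec) : Re (N2 x y) = (vnorm x + x 2) * (vnorm y + y 2) + (x 0 * y 0 + x 1 * y 1).
by rewrite N2E /vc !reim; ring. Qed.

Lemma ImN2 (x y : vec) : Im (N2 x y) = x 1 * y 0 - x 0 * y 1.
by rewrite N2E /vc !reim; ring. Qed.

Section Continuity.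
Variables (F : set_system R) (FF : ProperFilter F).

Lemma cvg_vdot (f g : R -> vec) (x y : vec) : (forall i, f ^~ i @ F --> x i) -> (forall i, g ^~ i @ F --> y i) ->
 (fun h => vdot (f h) (g h)) @ F --> vdot x y.
by move=> hf hg; apply: cvgD; [apply: cvgD|]; apply: cvgM. Qed.

Lemma cvg_vnorm (f : R -> vec) (x : vec) : (forall i, f ^~ i @ F --> x i) ->
 (fun h => vnorm (f h)) @ F --> vnorm x.
by move=> hf; apply: continuous_cvg; [exact: sqrt_continuous|exact: cvg_vdot]. Qed.

Lemma cvg_arg (f : R -> C) (z : C) : (fun h => Re (f h)) @ F --> Re z ->
 (fun h => Im (f h)) @ F --> Im z -> Re z != 0 ->
 (fun h => arg (f h)) @ F --> arg z.
move=> h1 h2 h3; have ca := @continuous_atan R (Im z / Re z).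
apply: (@continuous_cvg _ _ _ F _ (fun h => Im (f h) / Re (f h)) (@atan R) (Im z / Re z) ca).
by apply: cvgM => //; apply: cvgV.
Qed.

Lemma cvg_argT3 (f g k : R -> vec) (x y z : vec) : (forall i, f ^~ i @ F --> x i) ->
 (forall i, g ^~ i @ F --> y i) -> (forall i, k ^~ i @ F --> z i) -> Re (T3 x y z) != 0 ->
 (fun h => arg (T3 (f h) (g h) (k h))) @ F --> arg (T3 x y z).
move=> hf hg hk n0; have nf := cvg_vnorm hf; have ng := cvg_vnorm hg; have nk := cvg_vnorm hk.
apply: cvg_arg => //.
 rewrite ReT3; under eq_fun do rewrite ReT3.
 apply: cvgM; first exact: cvg_cst.
 apply: cvgD; [apply: cvgD; [apply: cvgD|]|]; apply: cvgM => //; try exact: cvg_vdot.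
 by apply: cvgM.
rewrite ImT3; under eq_fun do rewrite ImT3.
apply: cvgM; first exact: cvg_cst.
by apply: cvgD; [apply: cvgD|]; apply: cvgM => //; apply: cvgB; apply: cvgM.
Qed.

Lemma cvg_argN2 (f g : R -> vec) (x y : vec) : (forall i, f ^~ i @ F --> x i) ->
 (forall i, g ^~ i @ F --> y i) -> Re (N2 x y) != 0 ->
 (fun h => arg (N2 (f h) (g h))) @ F --> arg (N2 x y).
move=> hf hg n0; have nf := cvg_vnorm hf; have ng := cvg_vnorm hg.
apply: cvg_arg => //.
 rewrite ReN2; under eq_fun do rewrite ReN2.
 apply: cvgD; first by apply: cvgM; apply: cvgD.
 by apply: cvgD; apply: cvgM.
rewrite ImN2; under eq_fun do rewrite ImN2.
by apply: cvgB; apply: cvgM.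
Qed.

Lemma cvg_sumR n (f : nat -> R -> R) (l : nat -> R) : (forall i, f i @ F --> l i) ->
 (fun x => \sum_(i < n) f i x) @ F --> \sum_(i < n) l i.
move=> h; elim: n => [|n IH].
 by rewrite big_ord0; under eq_fun do rewrite big_ord0; exact: cvg_cst.
rewrite big_ord_recr /=; under eq_fun do rewrite big_ord_recr /=.
exact: cvgD.
Qed.

End Continuity.

Lemma arg_scale (k : R) (z : C) : 0 < k -> arg (rC k * z) = arg z.
move=> k0; rewrite /arg !reim; congr atan.
rewrite !mul0r subr0 addr0; have [->|z0] := eqVneq (Re z) 0; first by rewrite mulr0 invr0 !mulr0.
by field; rewrite z0 gt_eqF.
Qed.

Lemma Re_scale (k : R) (z : C) : Re (rC k * z) = k * Re z.
by rewrite !reim mul0r subr0. Qed.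

(** Over the upper hemisphere the boundary term of [curv] is the inner product in the section [spin]
    itself, so the two terms of [curv_gauge] cancel there. *)
Lemma spin_N2 (x y : vec) : 0 < vnorm x -> 0 < vnorm y -> 0 < x 2 -> 0 < y 2 ->
 exists2 k : R, 0 < k & N2 x y = rC k * inn (spin x) (spin y).
move=> x0 y0 x2 y2; have [k k0 ->] := N2_spinor (spin_spinor x0) (spin_spinor y0).
have q1 : 0 < vnorm x + x 2 by pos.
have q2 : 0 < vnorm y + y 2 by pos.
have e1 : (spin x).1 = rC (Num.sqrt (vnorm x + x 2)) by rewrite /spin q1.
have e2 : (spin y).1 = rC (Num.sqrt (vnorm y + y 2)) by rewrite /spin q2.
exists (k * Num.sqrt (vnorm x + x 2) * Num.sqrt (vnorm y + y 2)); first by rewrite !mulr_gt0 ?sqrtr_gt0.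
by rewrite e1 e2; move: (inn _ _) => w; cring.
Qed.

Lemma fine_mesh (eta : R) (m : nat) : 0 < eta -> exists n : nat, [/\ (0 < n)%N, (16 * m <= n)%N,
 n%:R^-1 < eta & normR (cis (2 * pi / n%:R) - 1) < eta].
move=> e0; have [t t0 ht] : exists2 t : R, 0 < t & forall s, `|s| < t -> normR (cis s - 1) < eta.
 have e2 : 0 < eta / 2 by pos.
 have := @continuous_cos R 0; move/cvgrPdist_lt => /(_ _ e2) /nbhs_ballP[t1 /= t10 h1].
 have := @continuous_sin R 0; move/cvgrPdist_lt => /(_ _ e2) /nbhs_ballP[t2 /= t20 h2].
 exists (Num.min t1 t2); first by rewrite lt_min t10.
 move=> s; rewrite lt_min => /andP[s1 s2].
 have := h1 s; rewrite /ball /= sub0r normrN cos0 distrC => /(_ s1) a1.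
 have := h2 s; rewrite /ball /= sub0r normrN sin0 distrC subr0 => /(_ s2) a2.
 apply: le_lt_trans (normR_leD _) _; rewrite /cis !reim oppr0 addr0; lra.
pose n := (Num.bound (2 * pi / t) + Num.bound eta^-1 + 16 * m + 1)%N.
have pi0 := @pi_gt0 R.
have b1 : 2 * pi / t < (Num.bound (2 * pi / t))%:R.
 by apply: archi_boundP; rewrite divr_ge0 ?ltW // mulr_gt0.
have b2 : eta^-1 < (Num.bound eta^-1)%:R by apply: archi_boundP; rewrite invr_ge0 ltW.
have nE : (n%:R : R) = (Num.bound (2 * pi / t))%:R + (Num.bound eta^-1)%:R + (16 * m)%:R + 1.
 by rewrite /n !natrD.
have m0 : 0 <= (16 * m)%:R :> R by [].
have c1 : 0 < 2 * pi / t by rewrite divr_gt0 // mulr_gt0.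
have c2 : 0 < eta^-1 by pos.
exists n; split.
- by rewrite /n.
- by rewrite /n -addnA -addnA; apply: leq_trans (leq_addl _ _); rewrite addnCA leq_addr.
- by rewrite -[X in _ < X]invrK ltf_pV2 ?posrE //; lra.
apply: ht; rewrite gtr0_norm ?divr_gt0 ?mulr_gt0 // ltr_pdivrMr // [t * _]mulrC -ltr_pdivrMr; lra.
Qed.

Lemma mul_div_cancel (x y z c1 c2 : C) : c1 != 0 -> x * (c2 / c1) * (c1 * (y * z)) = c2 * (y * (z * x)).
by move=> c0; field. Qed.

Lemma IVT_down (D : R -> R) v : {within `[0, 1], continuous D} -> D 1 <= v <= D 0 ->
 exists2 h, h \in `[0, 1] & D h = v.
by move=> c /andP[h1 h0]; apply: IVT => //; rewrite ge_min le_max h0 h1 !orbT. Qed.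

Lemma vnorm_eq0 (x : vec) : vnorm x = 0 -> forall i, x i = 0.
move=> v0 i; have := vnorm_sqr x; rewrite v0 expr0n /= /vdot -!expr2 => h0.
have s0 := sqr_ge0 (x 0); have s1 := sqr_ge0 (x 1); have s2 := sqr_ge0 (x 2).
by apply/eqP; rewrite -sqrf_eq0; apply/eqP; case: (ord3P i) => ->; lra.
Qed.

Lemma coord_le_vnorm (x : vec) i : `|x i| <= vnorm x.
rewrite -ler_sqr ?nnegrE ?vnorm_ge0 // real_normK ?num_real // vnorm_sqr /vdot -!expr2.
have := sqr_ge0 (x 0); have := sqr_ge0 (x 1); have := sqr_ge0 (x 2).
by case: (ord3P i) => ->; lra.
Qed.

Lemma close_acute (x y : vec) eps : 0 < vnorm x -> eps <= vnorm x / 32 -> (forall i, `|x i - y i| <= eps) ->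
 0 < vdot x y.
move=> x0 he hc; have -> : vdot x y = vnorm x ^+ 2 - (x 0 * (x 0 - y 0) + x 1 * (x 1 - y 1) + x 2 * (x 2 - y 2)).
 by rewrite vnorm_sqr /vdot; ring.
have ti i : x i * (x i - y i) <= vnorm x * (vnorm x / 32).
 apply: le_trans (ler_norm _) _; rewrite normrM ler_pM ?coord_le_vnorm //; exact: le_trans (hc i) he.
have := ti 0; have := ti 1; have := ti 2; have := mulr_gt0 x0 x0; rewrite expr2; lra.
Qed.

Lemma spinor_stereo (p q : C) (c : R) (x : vec) : 0 < c -> 0 < nsq p + nsq q ->
 (forall i, x i = c * stereo (hquo p q) 0 i) -> spinor x (p, q) /\ vnorm x = c.
move=> c0 np vi; have ab : (p != 0) || (q != 0) by rewrite -vn_gt0.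
have vn : vnorm x = c.
 rewrite /vnorm /vdot !vi; have := stereo_norm (hquo p q); rewrite sqnorm3E => hs.
 rewrite (_ : _ + _ + _ = c ^+ 2 * 1); last by rewrite -hs; ring.
 by rewrite mulr1 sqrtr_sqr gtr0_norm.
split=> //; exists (2 * c / (nsq p + nsq q)); first by rewrite divr_gt0 // mulr_gt0.
rewrite vn /vc !vi stereo_hquo // !mxE /=; have {}np := lt0r_neq0 np; rewrite !nsqE in np *.
by split; creim; field.
Qed.

Lemma inn_near (p1 p2 q1 q2 : C) : inn (p1, q1) (p2, q2) - rC (nsq p1 + nsq q1) =
 - (p1^* * (p1 - p2) + q1^* * (q1 - q2)).
have -> : rC (nsq p1 + nsq q1) = p1 * p1^* + q1 * q1^*.
 by rewrite !conj_mulC; apply: complexP; rewrite !reim ?addr0.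
by rewrite /inn /=; ring.
Qed.

Lemma inn_near_le (L w eta e k : R) (p1 p2 q1 q2 : C) : 0 <= L -> 0 < e -> 0 < k -> 0 < eta -> 0 <= w -> w < 2 * eta ->
 eta * (3 * ((L + 1) * (2 * (e^-1 + 1)))) <= k -> e <= nsq p1 + nsq q1 ->
 normR (p1 - p2) <= L * w -> normR (q1 - q2) <= L * w ->
 normR (inn (p1, q1) (p2, q2) - rC (nsq p1 + nsq q1)) <= k * (nsq p1 + nsq q1).
move=> L0 e0 k0 eta0 w0 hw et2 nn lP lQ; rewrite inn_near normRN; apply: le_trans (normRD _ _) _.
rewrite !normRM !normR_conj; have b1 (z : C) : normR z <= 1 + nsq z.
 by rewrite -normR_sqr; have := sqr_ge0 (normR z - 1); have := sqr_ge0 (normR z); rewrite sqrrB; clear; lra.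
have l2 : L * w <= (L + 1) * (2 * eta) by apply: ler_pM => //; [rewrite lerDl|exact: ltW].
have t1 := ler_pM (normR_ge0 p1) (normR_ge0 (p1 - p2)) (b1 p1) (le_trans lP l2).
have t2 := ler_pM (normR_ge0 q1) (normR_ge0 (q1 - q2)) (b1 q1) (le_trans lQ l2).
apply: le_trans (lerD t1 t2) _; rewrite -mulrDl.
set N := nsq p1 + nsq q1 in nn *; have -> : 1 + nsq p1 + (1 + nsq q1) = 2 + N by rewrite /N; ring.
have N0 : 0 < N by exact: lt_le_trans nn.
have h1 : 2 + N <= N * (2 * (e^-1 + 1)).
 have : 1 <= N * e^-1 by rewrite ler_pdivlMr // mul1r.
 by rewrite !mulrDr; clear -N0; lra.
have h2 : 0 <= (L + 1) * (2 * eta) by rewrite !mulr_ge0 ?addr_ge0 // ltW.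
apply: le_trans (ler_wpM2r h2 h1) _.
have e2 (x y z : R) : N * (2 * x) * (y * (2 * z)) = N * (2 / 3 * (z * (3 * (y * (2 * x))))) by clear; field.
rewrite e2 [k * N]mulrC ler_pM2l //.
by move: et2 k0; move: (eta * _) => ww; clear; lra.
Qed.

(** A degree argument on the cylinder over the disc. If [V] had no zero, the curvature of the slice
    at height [h] would be continuous in [h] with values in 2 pi Z. It is 0 at the top, where all
    vectors point upwards, and 2 pi m at the bottom, where the first form winds [m] times along the
    boundary. *)
Lemma degree_zero (P Q : C -> C) (V : C -> R -> vec) (c e L k : R) (A : C) (m : nat) :
 0 < c -> 0 < e -> 0 <= L -> 0 < k -> k <= 1 / 2 ->
 (forall (z : C) (x : R), 0 < x -> normR (z - rC x) <= k * x -> 0 < Re z /\ `|arg z| < pi / 8) ->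
 (0 < m)%N -> A != 0 ->
 (forall eps, 0 < eps -> exists2 delta : R, 0 < delta & forall w w' h h',
   normR (w - w') < delta -> `|h - h'| < delta -> forall i, `|V w h i - V w' h' i| <= eps) ->
 (forall w, normR w <= 1 -> 0 < V w 1 2) ->
 (forall w h, normR w = 1 -> 0 <= h <= 1 -> 0 < V w h 2) ->
 (forall w i, normR w <= 1 -> V w 0 i = c * stereo (hquo (P w) (Q w)) 0 i) ->
 (forall w, normR w <= 1 -> e <= nsq (P w) + nsq (Q w)) ->
 (forall w w', normR w <= 1 -> normR w' <= 1 ->
   normR (P w - P w') <= L * normR (w - w') /\ normR (Q w - Q w') <= L * normR (w - w')) ->
 (forall w, normR w = 1 -> normR (P w - A * w ^+ m) <= k * normR A) ->
 exists w h, [/\ normR w <= 1, 0 <= h <= 1 & forall i, V w h i = 0].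
move=> c0 e0 L0 k0 k1 hk m0 A0 modV top side bot low lip wind; apply: contrapT => hno.
have pi0 := @pi_gt0 R.
have Vpos w h : normR w <= 1 -> 0 <= h <= 1 -> 0 < vnorm (V w h).
 move=> hw hh; rewrite lt_def vnorm_ge0 andbT; apply: contra_notN hno => /eqP v0.
 by exists w, h; split=> //; exact: vnorm_eq0.
pose K : set (C * R) := [set z : C | normR z <= 1] `*` `[0, 1]%classic.
have [r0 r00 hr0] : exists2 r0, 0 < r0 & forall w h, normR w <= 1 -> 0 <= h <= 1 -> r0 <= vnorm (V w h).
 have cK : compact K by apply: compact_setX; [exact: compact_disc|exact: segment_compact].
 have K0 : K !=set0 by exists (0, 0); split=> /=; rewrite ?normR0 // in_itv /= lexx ler01.
 have cF : continuous (fun p : C * R => vnorm (V p.1 p.2)).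
  move=> p; apply: cont_real => ep ep0.
  have ep3 : 0 < ep / 4 by pos.
  have [de de0 hde] := modV _ ep3.
  have nb : nbhs p ([set q : C | normR (q - p.1) < de] `*` ball p.2 de).
   exists ([set q : C | normR (q - p.1) < de], ball p.2 de) => //; split; last exact: nbhsx_ballx.
   by apply/nbhsC_P; exists de.
  apply: filterS nb => q [q1 q2]; have {}q1 : normR (p.1 - q.1) < de by rewrite normRB; exact: q1.
  apply: (@le_lt_trans _ _ (3 * (ep / 4))); last by clear -ep0; lra.
  by apply: vnorm_close => i; apply: hde.
 have [[w h]] := compact_EVT_min K0 cK (continuous_subspaceT cF); rewrite inE => -[/= hw hh] hmin.
 rewrite in_itv /= in hh.
 exists (vnorm (V w h)); first exact: Vpos.
 by move=> w' h' hw' hh'; apply: (hmin (w', h')); rewrite inE; split; rewrite /=.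
(* Small enough for [N2_close]: its error [8 * eps] is half of [k * r0], where [r0] bounds the norm
   of [V] below. *)
pose eps := k * r0 / 16; have eps0 : 0 < eps by pos.
have [de de0 hde] := modV _ eps0.
pose eta := Num.min (de / 3) (k / (3 * ((L + 1) * (2 * (e^-1 + 1))))).
have ei0 : 0 < e^-1 by pos.
have q0 : 0 < (L + 1) * (2 * (e^-1 + 1)) by rewrite mulr_gt0; clear -L0 ei0; lra.
have eta0 : 0 < eta by rewrite lt_min !divr_gt0 // mulr_gt0.
have [n [n0 n16 n1 n2]] := fine_mesh m eta0.
have nR : 0 < n%:R :> R by pos.
(* A polar grid of the unit disc: index 0 is the centre for every angle, and radii are capped at 1
   so that the grid makes sense for all indices. *)
pose w (a j : nat) : C := rC ((minn a n)%:R / n%:R) * cis (j%:R * (2 * pi / n%:R)).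
have wn a j : normR (w a j) = (minn a n)%:R / n%:R.
 by rewrite normRM normR_real [X in _ * X]normRE nsq_cis sqrtr1 mulr1 ger0_norm // divr_ge0.
have cS j : cis (j.+1%:R * (2 * pi / n%:R)) = cis (j%:R * (2 * pi / n%:R)) * cis (2 * pi / n%:R).
 have -> : (j.+1%:R : R) = j%:R + 1 by rewrite natr1.
 by rewrite (mulrDl) mul1r cisD.
have wS a j : w a j.+1 = w a j * cis (2 * pi / n%:R) by rewrite /w cS; exact: mulrA.
have w0 j : w 0%N j = w 0%N 0%N.
 have z0 : rC ((minn 0 n)%:R / n%:R) = 0 :> C by rewrite min0n mul0r.
 by rewrite /w z0 !mul0r.
have wcyc a : w a n = w a 0%N.
 have e1 : (n%:R : R) * (2 * pi / n%:R) = 2 * pi by rewrite mulrC divfK // gt_eqF.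
 by rewrite /w e1 cis2pi mul0r cis0.
have w1 a j : normR (w a j) <= 1 by rewrite wn ler_pdivrMr // mul1r ler_nat geq_minr.
have wo j : normR (w n j) = 1 by rewrite wn minnn divff // gt_eqF.
have wnbr p q : nbr p q -> normR (w p.1 p.2 - w q.1 q.2) < 2 * eta.
 case: p q => [a j] [b l] /andP[/= hb hl].
 have s1 : normR (w a j - w b j) < eta.
  rewrite /w -mulrBl normRM [X in _ * X]normRE nsq_cis sqrtr1 mulr1.
  have -> : rC ((minn a n)%:R / n%:R) - rC ((minn b n)%:R / n%:R) =
   rC (((minn a n)%:R - (minn b n)%:R) / n%:R) :> C by cring.
  rewrite normR_real normrM normfV (gtr0_norm nR); apply: le_lt_trans n1.
  rewrite -[leRHS]mul1r ler_pM2r ?invr_gt0 //; case/orP: hb => /eqP ->; first by rewrite subrr normr0.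
  rewrite distrC; have [an|an] := ltnP a n.
   by rewrite (minn_idPl an) -natr1 addrC addKr normr1.
  by rewrite (minn_idPr (leqW an)) subrr normr0.
 have s2 : normR (w b j - w b l) <= normR (cis (2 * pi / n%:R) - 1).
  case/orP: hl => /eqP ->; first by rewrite subrr normR0.
  have -> : w b j - w b j.+1 = - (w b j * (cis (2 * pi / n%:R) - 1)).
   by rewrite wS; ring.
  by rewrite normRN normRM ler_piMl.
 have -> : w a j - w b l = (w a j - w b j) + (w b j - w b l) by ring.
 by apply: le_lt_trans (normRD _ _) _; clear -s1 s2 n2; lra.
have et1 : eta <= de / 3 by rewrite ge_min lexx.
have et2 : eta * (3 * ((L + 1) * (2 * (e^-1 + 1)))) <= k.
 have q3 : 0 < 3 * ((L + 1) * (2 * (e^-1 + 1))) by pos.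
 by rewrite -(ler_pdivlMr _ _ q3) ge_min lexx orbT.
have close p q h : nbr p q -> forall i, `|V (w p.1 p.2) h i - V (w q.1 q.2) h i| <= eps.
 by move=> /wnbr hpq; apply: hde; [clear -hpq et1 eta0; lra|rewrite subrr normr0].
pose v h (a j : nat) : vec := V (w a j) h.
have acute h p q : 0 <= h <= 1 -> nbr p q -> 0 < vdot (v h p.1 p.2) (v h q.1 q.2).
 move=> hh hpq; have hc := close p q h hpq; rewrite -/(v h _ _) -/(v h _ _) in hc.
 have x0 := hr0 _ _ (w1 p.1 p.2) hh; rewrite -/(v h _ _) in x0.
 apply: close_acute hc; first exact: lt_le_trans x0.
 have := ler_pM (ltW k0) (ltW r00) k1 x0; rewrite /eps; clear; lra.
have N2small x y : (forall i, `|x i - y i| <= eps) -> 0 < x 2 -> r0 <= vnorm x ->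
  0 < Re (N2 x y) /\ `|arg (N2 x y)| < pi / 8.
 move=> hxy x2 xr; have hn := vnorm_close hxy.
 have x0 : 0 < vnorm x by exact: lt_le_trans xr.
 have xx : vnorm x <= 2 * vnorm x by clear -x0; lra.
 have := N2_close x2 xx hxy hn => hN.
 apply: (hk _ ((vnorm x + x 2) ^+ 2 + nsq (vc x))).
  by rewrite ltr_wpDr // exprn_gt0 // addr_gt0.
 apply: le_trans hN _; apply: (@le_trans _ _ (k * (vnorm x + x 2) ^+ 2)); last first.
  by rewrite ler_pM2l // lerDl.
 rewrite expr2 mulrA ler_pM2r ?addr_gt0 // /eps.
 have : k * r0 <= k * (vnorm x + x 2) by rewrite ler_pM2l //; clear -xr x2; lra.
 by have := mulr_gt0 k0 r00; clear; lra.
have nb1 j : nbr (n, j) (n, j.+1) by rewrite /nbr !eqxx ?orbT.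
have hgrid h : 0 <= h <= 1 -> grid n (v h).
 move=> hh; split.
 - by move=> j; rewrite /v w0.
 - by move=> a; rewrite /v wcyc.
 - by move=> a j; exact: Vpos.
 - by move=> p q; exact: acute.
 move=> j; have o := side _ _ (wo j) hh; split=> //.
 by have [] := N2small _ _ (close _ _ h (nb1 j)) o (hr0 _ _ (w1 n j) hh).
pose D h := curv n (v h).
have cD : {within `[0, 1], continuous D}.
 apply: continuous_in_subspaceT => h; rewrite inE /= in_itv /= => hh.
 have g := hgrid h hh.
 have cV a j i : (fun x => v x a j i) @ h --> v h a j i.
  apply: cont_real => ep ep0; have ep2 : 0 < ep / 2 by pos.
  have [d1 d10 hd1] := modV _ ep2; apply/nbhs_ballP; exists d1 => //= y hy.
  apply: (@le_lt_trans _ _ (ep / 2)); last by clear -ep0; lra.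
  by rewrite /v; apply: hd1 => //; rewrite subrr normR0.
 have c2 : (fun x => \sum_(j < n) arg (N2 (v x n j) (v x n j.+1))) @ h --> \sum_(j < n) arg (N2 (v h n j) (v h n j.+1)).
  apply: (@cvg_sumR (nbhs h) _ n (fun j x => arg (N2 (v x n j) (v x n j.+1))) (fun j => arg (N2 (v h n j) (v h n j.+1)))) => j.
  by apply: cvg_argN2 => //; have [_ p] := grid_outer g j; rewrite gt_eqF.
 pose fc x a j := arg (T3 (v x a j) (v x a.+1 j) (v x a.+1 j.+1)) + arg (T3 (v x a j) (v x a.+1 j.+1) (v x a j.+1)).
 have cf a j : (fun x => fc x a j) @ h --> fc h a j.
  have [f1 f2] := face_pos a j g; have g1 := lt0r_neq0 f1; have g2 := lt0r_neq0 f2.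
  exact: (cvgD (cvg_argT3 _ (cV _ _) (cV _ _) (cV _ _) g1) (cvg_argT3 _ (cV _ _) (cV _ _) (cV _ _) g2)).
 have c1 : (fun x => \sum_(j < n) \sum_(a < n) fc x a j) @ h --> \sum_(j < n) \sum_(a < n) fc h a j.
  apply: (@cvg_sumR (nbhs h) _ n (fun j x => \sum_(a < n) fc x a j) (fun j => \sum_(a < n) fc h a j)) => j.
  by apply: (@cvg_sumR (nbhs h) _ n (fun a x => fc x a j) (fun a => fc h a j)).
 exact: (cvgB c1 c2).
have h01 : 0 <= (0 : R) <= 1 by rewrite lexx ler01.
have h11 : 0 <= (1 : R) <= 1 by rewrite lexx ler01.
(* On top [spin] is an admissible choice of spinors over the whole grid, so the boundary terms
   cancel. *)
have D1 : D 1 = 0.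
 have g := hgrid 1 h11.
 have link p q : nbr p q -> exists2 l : R, 0 < l & N2 (v 1 p.1 p.2) (v 1 q.1 q.2) = rC l * inn (spin (v 1 p.1 p.2)) (spin (v 1 q.1 q.2)).
  by move=> _; apply: spin_N2; [exact: Vpos|exact: Vpos|exact: top|exact: top].
 rewrite /D (@curv_gauge n (v 1) (fun a j => spin (v 1 a j)) g).
 - rewrite big1 // => j _; have [l l0 ->] := link _ _ (nb1 j).
  by rewrite arg_scale // subrr.
 - by move=> a j _ _; apply: spin_spinor; exact: Vpos.
 - by move=> j; rewrite (grid_center g).
 - by move=> a; rewrite (grid_cyclic g).
 move=> p q hpq _ _; have [l l0 hl] := link _ _ hpq.
 have [] := N2small _ _ (close _ _ 1 hpq) (top _ (w1 p.1 p.2)) (hr0 _ _ (w1 p.1 p.2) h11).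
 rewrite -/(v 1 _ _) -/(v 1 _ _) hl Re_scale pmulr_rgt0 // arg_scale // => r1 r2; split=> //; clear -r2 pi0; lra.
(* At the bottom the pair [(P, Q)] itself serves as spinors; compared with [spin], it turns by the
   argument of [P] along the boundary. *)
have D0 : D 0 = 2 * pi * m%:R.
 have g := hgrid 0 h01.
 pose a b j := (P (w b j), Q (w b j)).
 have sp b j : spinor (v 0 b j) (a b j).
  have np := lt_le_trans e0 (low _ (w1 b j)).
  by apply: (spinor_stereo c0 np _).1 => i; rewrite /v bot.
 have linkB p q : nbr p q -> 0 < Re (inn (a p.1 p.2) (a q.1 q.2)) /\ `|arg (inn (a p.1 p.2) (a q.1 q.2))| < pi / 8.
  move=> hpq; have hw := wnbr _ _ hpq; have [lP lQ] := lip _ _ (w1 p.1 p.2) (w1 q.1 q.2).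
  have nn := low _ (w1 p.1 p.2); apply: (hk _ _ (lt_le_trans e0 nn)).
  exact: (inn_near_le L0 e0 k0 eta0 (normR_ge0 _) hw et2 nn lP lQ).
 pose b j := arg (P (w n j) / (A * w n j ^+ m)).
 have wz j : w n j != 0 by rewrite -normR_gt0 wo.
 have Az j : A * w n j ^+ m != 0 by rewrite mulf_neq0 // expf_neq0.
 have hb j : 0 < Re (P (w n j) / (A * w n j ^+ m)) /\ `|b j| < pi / 8.
  apply: (hk _ 1) => //; rewrite mulr1.
  have -> : P (w n j) / (A * w n j ^+ m) - rC 1 = (P (w n j) - A * w n j ^+ m) / (A * w n j ^+ m).
   by rewrite mulrBl divff.
  rewrite normR_div normRM normRX wo expr1n mulr1 ler_pdivrMr ?normR_gt0 //; exact: wind.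
 have Pz j : P (w n j) != 0.
  by have [+ _] := hb j; apply: contraTneq => ->; rewrite mul0r ltxx.
 have ucis t : uu (cis t) = cis t.
  by rewrite /uu normRE nsq_cis sqrtr1 invr1; cring.
 have uX (z : C) l : uu (z ^+ l) = uu z ^+ l.
  elim: l => [|l IH]; last by rewrite !exprS uuM IH.
  by rewrite !expr0; exact: uu_real.
 have uw j : uu (w n j) = cis (j%:R * (2 * pi / n%:R)).
  rewrite /w minnn divff ?gt_eqF // uuM ucis uu_real // mul1r //.
 have cb j : cis (b j) * (uu A * cis (j%:R * (2 * pi / n%:R)) ^+ m) = uu (P (w n j)).
  rewrite /b cis_arg; last by case: (hb j).
  by rewrite -uw -uX -!uuM; congr uu; rewrite divfK.
 (* The increment of the argument of [P] along one boundary edge: the winding of the monomial plus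
    perturbations [b], which telescope around the circle. *)
 pose t j := 2 * pi / n%:R * m%:R + (b j.+1 - b j).
 have cX s (l : nat) : cis s ^+ l = cis (s * l%:R).
  elim: l => [|l IH]; first by rewrite mulr0 cis0.
  by rewrite exprS IH -cisD -natr1 mulrDr mulr1 addrC.
 have ct j : cis (t j) * uu (P (w n j)) = uu (P (w n j.+1)).
  rewrite -!cb /t !cisD cisN -!cX cS exprMn.
  exact: mul_div_cancel (cis_neq0 _).
 have term (j : 'I_n) : arg (inn (a n j) (a n j.+1)) - arg (N2 (v 0 n j) (v 0 n j.+1)) = t j.
  have [l1 l2] := linkB _ _ (nb1 j); have [_ o] := grid_outer g j.
  suff -> : arg (N2 (v 0 n j) (v 0 n j.+1)) = arg (inn (a n j) (a n j.+1)) - t j by ring.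
  apply/esym/arg_unique => //.
   rewrite (uu_N2 (sp n j) (sp n j.+1)) uu_conj /=; last exact: Pz.
   rewrite cisD cisN cis_arg // -(ct j); field.
   by rewrite cis_neq0 uu_neq0.
  apply: le_trans (ler_normB _ _) _.
  have tb : `|t j| <= pi / 8 + (pi / 8 + pi / 8).
   apply: le_trans (ler_normD _ _) _; apply: lerD.
    rewrite ger0_norm; last by rewrite ?mulr_ge0 // ltW.
    have : (16 * m)%:R <= n%:R :> R by rewrite ler_nat.
    rewrite natrM => hh; rewrite mulrAC ler_pdivrMr //.
    have : pi * (16 * m%:R) <= pi * n%:R :> R by rewrite ler_pM2l.
    by clear; lra.
   by apply: le_trans (ler_normB _ _) _; rewrite lerD //; apply: ltW; [case: (hb j.+1)|case: (hb j)].
  by move: tb l2; rewrite /=; clear -pi0; lra.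
 rewrite /D (@curv_gauge n (v 0) a g).
 - rewrite (eq_bigr _ (fun j _ => term j)) /t big_split /= (telescope_sum b) sumr_const card_ord -mulr_natr.
  have -> : b n = b 0%N by rewrite /b wcyc.
  by rewrite subrr; field; rewrite gt_eqF.
 - by move=> bb j _ _; exact: sp.
 - by move=> j; rewrite /a w0.
 - by move=> bb; rewrite /a wcyc.
 by move=> p q hpq _ _; have [l1 l2] := linkB _ _ hpq; split=> //; clear -l2 pi0; lra.
(* By the intermediate value theorem the curvature takes the value pi at some height, where its
   exponential would be -1 instead of 1. *)
have m1 : 1 <= m%:R :> R by rewrite ler1n.
have [|h] := @IVT_down D pi cD.
 by rewrite D1 D0; have := ler_wpM2l (ltW pi0) m1; clear -pi0; lra.
rewrite in_itv /= => hh Dh; have := cis_curv (hgrid h hh); rewrite -/(D h) Dh /cis cospi => /(congr1 (@Re R)).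
by rewrite !reim; clear; lra.
Qed.

(** * Preimages of the origin and the lower bound on the values of a lift *)

Lemma coef_hcomp_diag d (x y : C) (p : {poly C}) (j : nat) : (size p <= d.+1)%N -> (j <= d)%N ->
 (hcomp d (mk2 x 0 0 y) p)`_j = x ^+ j * y ^+ (d - j) * p`_j.
move=> sp jd; have -> : hcomp d (mk2 x 0 0 y) p = \poly_(j < d.+1) (x ^+ j * y ^+ (d - j) * p`_j).
 apply: (@hev_inj d); [exact: size_hcomp|exact: size_poly|move=> a b].
 rewrite hev_hcomp !mk2E !mul0r addr0 add0r /hev; apply: eq_bigr => i _.
 by rewrite coef_poly ltn_ord !exprMn; ring.
by rewrite coef_poly ltnS jd.
Qed.

Lemma expRX (s : R) n : expR s ^+ n = expR (s * n%:R).
by rewrite -expRM_natl mulrC. Qed.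

Lemma cn_hcomp_dg d (s : R) (p : {poly C}) : (size p <= d.+1)%N ->
 cn d (hcomp d (dg s) p) = \sum_(j < d.+1) expR (s * (d%:R - 2 * j%:R)) * nsq p`_j.
move=> sp; apply: eq_bigr => -[j jd] _; rewrite /= coef_hcomp_diag // !nsqM !nsqX !nsq_real.
rewrite expR_half expRN_half !expRX -expRD; congr (expR _ * _).
by rewrite natrB //; ring.
Qed.

Lemma cn2_su2 d (U : 'M[C]_2) W : su2 U -> cn2 d (pl U W) = cn2 d W.
move=> hU; rewrite /cn2 /cn -!big_split /=; apply: eq_bigr => j _.
by rewrite !coefD !coefZ; exact: (su2_unitary hU).
Qed.

Lemma cn2_pr_le d M W : nzW d W -> cn2 d (pr d M W) <= chc d * mn M ^+ d * cn2 d W.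
by case=> s1 s2 _; rewrite /cn2 mulrDr lerD // cn_hcomp. Qed.

Lemma mpt1 : mpt (1%:M : 'M[C]_2) = 0.
apply/esym/moves_uniq; [exact: ball30|exact: SL2_1|].
by rewrite /moves herm0 mulmx1 mul1mx map_scalar_mx rmorph1 trmx1.
Qed.

Lemma mpt0_su2 N : SL2 N -> mpt N = 0 -> su2 N.
move=> hN e; have := mpt_eq SL2_1 hN; rewrite mpt1 e => /(_ erefl).
have -> : inv2 1%:M = 1%:M :> 'M[C]_2 by apply: mx2P; rewrite !mxE ?oppr0.
by rewrite mul1mx.
Qed.

Lemma su2_mpt0 N : su2 N -> mpt N = 0.
by move=> hN; rewrite -[N]mul1mx mpt_mul_su2 // mpt1. Qed.

Lemma coef0_pr d (a b : C) W : (pr d (uz a b) W).1`_0 = hev d W.1 a b /\ (pr d (uz a b) W).2`_0 = hev d W.2 a b.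
have h p : (hcomp d (uz a b) p)`_0 = hev d p a b.
 by have := hev_zero d (hcomp d (uz a b) p) 1; rewrite expr1n hev_hcomp !mk2E !mulr0 !mulr1 !add0r.
by rewrite !h.
Qed.

Lemma normalize (p q : C) : 0 < nsq p + nsq q -> exists c e r : C, [/\ nsq c + nsq e = 1, p = r * c & q = r * e].
move=> n0; pose s := Num.sqrt (nsq p + nsq q); have s2 : s ^+ 2 = nsq p + nsq q by rewrite (sqr_sqrtr (ltW n0)).
have s0 : s != 0 by rewrite -sqrf_eq0 s2 gt_eqF.
have z0 : rC s != 0 :> C by rewrite negb_and s0.
exists (p / rC s), (q / rC s), (rC s); split.
- by rewrite !nsqM nsqV nsq_real -mulrDl -s2 divff // sqrf_eq0.
- by rewrite mulrC divfK.
- by rewrite mulrC divfK.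
Qed.

Lemma rotate_target (p q c e r : C) : nsq c + nsq e = 1 -> p = r * c -> q = r * e ->
 inv2 (uz c e) 0 0 * p + inv2 (uz c e) 0 1 * q = 0 /\
 inv2 (uz c e) 1 0 * p + inv2 (uz c e) 1 1 * q = r.
move=> h -> ->; rewrite !mk2E; split; first by ring.
have : rC (nsq c + nsq e) = c^* * c + e^* * e.
 by rewrite ![_^* * _]mulrC !conj_mulC; apply: complexP; rewrite !reim ?addr0.
by rewrite h => h1; rewrite -[RHS]mulr1 (_ : (1 : C) = rC 1) // h1; ring.
Qed.

(** [preim_radius] is a supremum, which is meaningful only for a bounded set. At distance [s] in the
    direction [z] the coefficient norm is at least of order exp(s d); moving towards f(z) in the
    target reduces it to order exp(s (d - 1)). For a balanced pair [bal_norm] allows only a bounded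
    reduction, so [s] is bounded. *)
Lemma zero_bounded d (f : Ratd R d) : (0 < d)%N ->
 exists B : R, forall y, ball3 y -> bary_ext (ratfun f) y = 0 -> hdist 0 y <= B.
move=> d0; have [K K0 hK] := @bal_norm d; have [e e0 he] := rat_lower f.
have nzf := nz_rW f.
pose C1 := chc d * 2 ^+ d * cn2 d (rW f).
exists (ln (K * C1 / e) + ln 2) => y /ball_hgeod[s [z [s0 ->]]] hy.
have [a [b [_ zE h]]] := hquo_surj z; move: hy; rewrite -zE => hy.
have /andP[_ hd0] := hdist0_hgeod (hquo a b) s0; apply: le_trans hd0 _; rewrite lerD2r.
rewrite hgeod_mpt // in hy.
set M := uz a b *m dg s in hy; have hM : SL2 M := gM_SL2 s h.
have [N [hN hb eN]] := bary_ext_bal f d0 hM; rewrite eN in hy.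
have suN := mpt0_su2 (SL2_inv2 hN) hy; have {suN}suN := su2_inv2 suN; rewrite inv2K in suN.
pose W1 := pr d (uz a b) (rW f).
have hU := uz_su2 h; have nz1 : nzW d W1 by apply: nz_pr => //; exact: su2_SL2.
have BE : pr d M (rW f) = pr d (dg s) W1 by rewrite /W1 prM.
have [c0 c1] := coef0_pr d a b (rW f).
have n0 : e <= nsq W1.1`_0 + nsq W1.2`_0.
 by rewrite c0 c1; have := he a b; rewrite h expr1n mulr1.
have [c [g [r [cg p0 q0]]]] : exists c g r, [/\ nsq c + nsq g = 1, W1.1`_0 = r * c & W1.2`_0 = r * g].
 by apply: normalize; apply: lt_le_trans n0.
have hV := uz_su2 cg; set V := uz c g in hV.
(* The target rotation [V] sends f(z) to 0, so the first form loses its constant coefficient. *)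
pose W2 := pl (inv2 V) W1.
have sV := su2_inv2 hV; have nz2 : nzW d W2 by apply: nz_pl => //; exact: su2_SL2.
have W20 : W2.1`_0 = 0 by rewrite coefD !coefZ; have [-> _] := rotate_target cg p0 q0.
have key := hK (pl N (pr d M (rW f))) (dg (- s) *m inv2 V *m inv2 N) (nz_pl hN (nz_pr hM nzf)) hb.
have nzB := nz_pr hM nzf; have dS := dg_SL2 (- s).
have {key} := key (SL2_mul (SL2_mul dS (su2_SL2 sV)) (SL2_inv2 hN)).
rewrite -(plM _ _ nzB) -mulmxA mul_inv2 // mulmx1 (plM _ _ nzB) (cn2_su2 _ _ suN) BE -pr_pl -/W2.
case: (nz1) => s1 s1' _; case: (nz2) => s2 s2' _.
have low : expR (s * d%:R) * e <= cn2 d (pr d (dg s) W1).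
 rewrite /cn2 !cn_hcomp_dg // !big_ord_recl /= mulr0 subr0.
 have pos (p : {poly C}) : 0 <= \sum_(i < d) expR (s * (d%:R - 2 * (bump 0 i)%:R)) * nsq p`_(bump 0 i).
  by apply: sumr_ge0 => i _; rewrite mulr_ge0.
 have := pos W1.1; have := pos W1.2; have : expR (s * d%:R) * e <= expR (s * d%:R) * (nsq W1.1`_0 + nsq W1.2`_0).
  by rewrite ler_pM2l ?expR_gt0.
 move: (\sum_(i < d) _) (\sum_(i < d) _) => u v; rewrite mulrDr; lra.
(* The first form gains exp(s) from the target but starts at index 1, where the source gives at most
   exp(s (d - 2)); the second loses exp(s). *)
have up : cn2 d (pl (dg (- s)) (pr d (dg s) W2)) <= expR (s * (d%:R - 1)) * cn2 d W2.
 rewrite /cn2 /pl !mk2E !scale0r addr0 add0r !cnZ !nsq_real.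
 rewrite expRN_half expR_half opprK !cn_hcomp_dg // mulrDr /cn !mulr_sumr lerD //.
  apply: ler_sum => -[j jd] _ /=; case: j jd => [|j] jd; first by rewrite W20 nsq0 !mulr0.
  rewrite mulrA -expRD ler_wpM2r // ler_expR.
  have : 0 <= s * j%:R by rewrite mulr_ge0.
  rewrite -natr1; lra.
 apply: ler_sum => -[j jd] _ /=; rewrite mulrA -expRD ler_wpM2r // ler_expR.
 have : 0 <= s * j%:R by rewrite mulr_ge0.
 lra.
have W2b : cn2 d W2 <= C1.
 rewrite (cn2_su2 _ _ sV) /C1 -(su2_mn hU); exact: cn2_pr_le.
move=> h1; have h2 : expR (s * d%:R) * e <= K * (expR (s * (d%:R - 1)) * C1).
 apply: le_trans low _; apply: le_trans h1 _; rewrite ler_pM2l //; apply: le_trans up _.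
 by rewrite ler_pM2l ?expR_gt0.
have E : expR (s * d%:R) = expR s * expR (s * (d%:R - 1)) by rewrite -expRD; congr expR; ring.
have h3 : expR s <= K * C1 / e.
 rewrite ler_pdivlMr // -(ler_pM2r (expR_gt0 (s * (d%:R - 1)))).
 by rewrite mulrAC -E; apply: le_trans h2 _; rewrite mulrCA mulrC.
rewrite -[X in X <= _]expRK ler_ln ?posrE ?expR_gt0 //; apply: lt_le_trans h3; exact: expR_gt0.
Qed.

Lemma preim_radius_ge d (f : Ratd R d) (y : 'rV[R]_3) : (0 < d)%N -> ball3 y -> bary_ext (ratfun f) y = 0 ->
 hdist 0 y <= preim_radius (ratfun f) 0.
move=> d0 hy ey; have [B hB] := zero_bounded f d0; apply: ub_le_sup; last by exists y.
by exists B => _ [x [hx ex] <-]; exact: hB.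
Qed.

Lemma sandwich_lipschitz d (f : Ratd R d) M N : SL2 M -> SL2 N ->
 exists2 L : R, 0 <= L & forall z w, chordal (sandwich f M N z) (sandwich f M N w) <= L * chordal z w.
move=> hM hN; have [L1 L10 h1] := mobius_lipschitz hM; have [L2 L20 h2] := ratfun_lipschitz f.
have [L3 L30 h3] := mobius_lipschitz hN; exists (L3 * (L2 * L1)); first by rewrite !mulr_ge0.
move=> z w; rewrite /sandwich -!mulrA; apply: le_trans (h3 _ _) _; rewrite ler_wpM2l //.
by apply: le_trans (h2 _ _) _; rewrite ler_wpM2l.
Qed.

Lemma stereo_coord (x y : Ch) i : `|stereo x 0 i - stereo y 0 i| <= chordal x y.
rewrite /chordal -sqrtr_sqr ler_wsqrtr // sqnorm3E !mxE.
have a0 := sqr_ge0 (stereo x 0 0 - stereo y 0 0); have a1 := sqr_ge0 (stereo x 0 1 - stereo y 0 1).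
have a2 := sqr_ge0 (stereo x 0 2 - stereo y 0 2).
by case: (ord3P i) => ->; lra.
Qed.

Section Family.
Variables (d : nat) (f : Ratd R d) (M1 N1 : 'M[C]_2).
Hypotheses (hM : SL2 M1) (hN : SL2 N1).
Let W := pl N1 (pr d M1 (rW f)).
Let nzf : nzW d W. by apply: nz_pl => //; apply: nz_pr => //; exact: nz_rW. Qed.

(** The map z |-> w + h z in SL_2; [(w, h)] are upper half-space coordinates of the corresponding
    point. *)
Definition aff (w : C) (h : R) : 'M[C]_2 :=
 mk2 (rC (Num.sqrt h)) (w * rC (Num.sqrt h)^-1) 0 (rC (Num.sqrt h)^-1).

(** The centroid, up to normalization, of the image of the spherical measure seen from the point
    [(w, h)]. Unlike the barycenter it makes sense at [h = 0], where it is [sm] times the value on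
    the sphere, which closes the cylinder at the bottom. *)
Definition vv (w : C) (h : R) (i : 'I_3) : R :=
 sI (fun z => stereo (sandwich f M1 N1 (Some (w + rC h * z : C))) 0 i).

Lemma aff_SL2 w (h : R) : 0 < h -> SL2 (aff w h).
move=> h0; have s0 : Num.sqrt h != 0 by rewrite gt_eqF // sqrtr_gt0.
by apply/SL2E; rewrite !mk2E; creim; field.
Qed.

Lemma mobius_aff w (h : R) (z : C) : 0 < h -> mobius (aff w h) (Some z) = Some (w + rC h * z).
move=> h0; have s0 : Num.sqrt h != 0 by rewrite gt_eqF // sqrtr_gt0.
have si0 : rC (Num.sqrt h)^-1 != 0 :> C by rewrite negb_and invr_eq0 s0.
rewrite /= !mk2E mul0r add0r /hquo (negbTE si0); congr Some; apply: (mulIf si0); rewrite divfK //.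
rewrite mulrDl [RHS]addrC; congr (_ + _).
have e : rC h * rC (Num.sqrt h)^-1 = rC (Num.sqrt h) :> C.
 have := sqr_sqrtr (ltW h0); move: (Num.sqrt h) s0 => s s0 <-.
  by creim; [field|ring].
by rewrite mulrAC e.
Qed.

Lemma adm_vv w (h : R) i : 0 <= h -> adm (fun z => stereo (sandwich f M1 N1 (Some (w + rC h * z : C))) 0 i).
rewrite le_eqVlt => /predU1P[<-|h0]; last first.
 split; last by exists 1 => z; exact: stereo_bound.
 have hA := aff_SL2 w h0.
 have cs := @continuous_stereo_sandwich d f (M1 *m aff w h) N1 i (SL2_mul hM hA) hN.
 have := @measurableT_comp _ _ _ _ _ _ _ setT _ (continuous_measurable_SphR cs) (@measurable_iota).
 congr (measT); apply/funext => p; rewrite /= /iota /sandwich mobiusM //.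
 by rewrite mobius_aff.
have -> : (fun z => stereo (sandwich f M1 N1 (Some (w + rC 0 * z : C))) 0 i) =
  fun=> stereo (sandwich f M1 N1 (Some (w : C))) 0 i.
 by apply/funext => z; rewrite mul0r addr0.
exact: adm_cst.
Qed.

Lemma vv0 w i : vv w 0 i = sm * stereo (sandwich f M1 N1 (Some (w : C))) 0 i.
rewrite mulrC -sI_cst; congr sI; apply/funext => z.
by rewrite (_ : rC 0 * z = 0) ?addr0 // mul0r.
Qed.

Lemma sandwich_eval (u : C) : sandwich f M1 N1 (Some u) = hquo W.1.[u] W.2.[u].
by case: nzf => s1 s2 _; rewrite -hquo_some sandwich_hquo ?one_nz // -/W !hev_one.
Qed.

Lemma vv_bal w h : (0 < d)%N -> su2 N1 -> 0 < h -> (forall i, vv w h i = 0) ->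
 bary_ext (ratfun f) (mpt (M1 *m aff w h)) = 0.
move=> d0 suN h0 hv; have hA := aff_SL2 w h0; rewrite -(su2_mpt0 (su2_inv2 suN)).
apply: bary_extP => //; first exact: SL2_mul.
move=> i; rewrite -(hv i) /Vf /vv; congr sI; apply/funext => z.
rewrite -sandwich_hquo ?one_nz //; last exact: SL2_mul.
by rewrite hquo_some -mobius_aff // /sandwich mobiusM.
Qed.

(** For bounded [z] the integrand is Lipschitz in the parameters; near infinity it is merely
    bounded, but that region has mass at most [eps / 4] and the difference is at most 2 there. *)
Lemma vv_modulus (eps : R) : 0 < eps -> exists2 delta : R, 0 < delta & forall (w w' : C) (h h' : R),
 0 <= h -> 0 <= h' -> normR (w - w') < delta -> `|h - h'| < delta -> forall i, `|vv w h i - vv w' h' i| <= eps.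
move=> e0; have s0 := @sm_gt0; have [L L0 hL] := sandwich_lipschitz f hM hN.
(* The constant polynomial 1, read as a form of degree 1, vanishes only at infinity;
   non-concentration thus bounds the mass of a neighbourhood of infinity. *)
have [t t0 ht] : exists2 t : R, 0 < t & forall p : {poly C}, (size p <= 2)%N ->
 mass (fun z => nsq (hev 1 p z 1) < t * cn 1 p * (1 + nsq z) ^+ 1) <= eps / 4.
 by apply: nonconc; rewrite divr_gt0.
have s1 : (size (1%R : {poly C}) <= 2)%N by rewrite size_poly1.
have := ht 1 s1.
have e1 : (fun z : C => nsq (hev 1 1 z 1) < t * cn 1 1 * (1 + nsq z) ^+ 1) = fun z => 1 < t * (1 + nsq z).
 apply/funext => z; rewrite /hev /cn !big_ord_recl !big_ord0 /= !coef1 /= nsq0 nsq1 !mul0r !addr0 !mulr1 ?expr0 ?expr1n ?expr1 ?mulr1 ?nsq1.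
 by [].
rewrite e1; set P := fun z => _ => mP.
have pP : mpred P.
 apply: mpred_lt => //; apply: measurable_funM => //.
 exact: measurable_1nsq.
have aP := adm_pred pP; have ac c := @adm_cst c.
pose r := 1 + t^-1; have r1 : 1 < r by rewrite ltrDl invr_gt0.
pose q := 2 * (L + 1) * sm * (2 * r); have q0 : 0 < q by rewrite !mulr_gt0 //; lra.
exists (eps / (2 * q)); first by rewrite divr_gt0 // mulr_gt0.
move=> w w' h h' hh hh' dw dh i; rewrite /vv -sIB; try exact: adm_vv.
have bnd z : `|stereo (sandwich f M1 N1 (Some (w + rC h * z : C))) 0 i -
  stereo (sandwich f M1 N1 (Some (w' + rC h' * z : C))) 0 i| <= eps / (2 * sm) + 2 * (P z)%:R.
 case: (boolP (P z)) => Pz.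
  rewrite mulr1; apply: (@le_trans _ _ 2); last by rewrite lerDr divr_ge0 ?mulr_ge0 // ltW.
  apply: le_trans (ler_normB _ _) _; have := stereo_bound (sandwich f M1 N1 (Some (w + rC h * z : C))) i.
  have := stereo_bound (sandwich f M1 N1 (Some (w' + rC h' * z : C))) i; lra.
 rewrite mulr0 addr0; apply: le_trans (stereo_coord _ _ _) _; apply: le_trans (hL _ _) _.
 have zr : normR z <= r.
  have : 1 + nsq z <= t^-1 by move: Pz; rewrite /P -leNgt -ler_pdivlMl // mulr1.
  rewrite -normR_sqr /r; have := sqr_ge0 (normR z - 1); rewrite sqrrB expr1n; have := normR_ge0 z; nra.
 have c1 := @chordal_some_le (w + rC h * z) (w' + rC h' * z).
 have c2 : normR (w + rC h * z - (w' + rC h' * z)) <= eps / (2 * q) * (2 * r).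
  have -> : w + rC h * z - (w' + rC h' * z) = (w - w') + rC (h - h') * z.
   by cring.
  apply: le_trans (normRD _ _) _; rewrite normRM normR_real.
  have : `|h - h'| * normR z <= eps / (2 * q) * r by apply: ler_pM => //; exact: ltW.                   
  have eq0 : 0 < eps / (2 * q) by apply: divr_gt0 => //; apply: mulr_gt0.
  have : eps / (2 * q) * 1 <= eps / (2 * q) * r by rewrite ler_pM2l // ltW.
  have := ltW dw; lra.
 have c3 := le_trans c1 (ler_wpM2l (ler0n _ 2) c2).
 apply: le_trans (ler_wpM2l L0 c3) _.
 apply: (@le_trans _ _ ((L + 1) * (2 * (eps / (2 * q) * (2 * r))))).
  have eq0 : 0 <= eps / (2 * q) by apply: divr_ge0; [exact: ltW|apply: mulr_ge0 => //; exact: ltW].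
  have X0 : 0 <= 2 * (eps / (2 * q) * (2 * r)).
   by apply: mulr_ge0 => //; apply: mulr_ge0 => //; apply: mulr_ge0 => //; apply/ltW/(lt_trans ltr01).
  by rewrite [leRHS]mulrDl mul1r lerDl.
 apply: eqR_le; rewrite /q.
 by field; rewrite !gt_eqF //; lra.
have ad : adm (fun z => stereo (sandwich f M1 N1 (Some (w + rC h * z : C))) 0 i -
  stereo (sandwich f M1 N1 (Some (w' + rC h' * z : C))) 0 i) by apply: admB; exact: adm_vv.
have aB : adm (fun z => eps / (2 * sm) + 2 * (P z)%:R) by exact: admD (ac _) (admM (ac _) aP).
have iB : sI (fun z => eps / (2 * sm) + 2 * (P z)%:R) <= eps.
 rewrite sID; [|exact: ac|exact: admM (ac _) aP]; rewrite sI_cst sIZ //.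
 have -> : eps / (2 * sm) * sm = eps / 2 by field; rewrite gt_eqF.
 rewrite -/(mass P); lra.
rewrite ler_norml; apply/andP; split.
 rewrite lerNl -[X in X <= _]mulN1r -sIZ //; apply: le_trans iB; apply: sI_le => //; first exact: admM (ac _) ad.
 by move=> z; rewrite mulN1r; apply: le_trans (bnd z); rewrite -normrN ler_norm.
by apply: le_trans iB; apply: sI_le => // z; apply: le_trans (bnd z); rewrite ler_norm.
Qed.

End Family.

Lemma nat_argmax (u : nat -> R) d : exists2 m, (m <= d)%N & forall j, (j <= d)%N -> u j <= u m.
elim: d => [|d [m md hm]]; first by exists 0%N => // j; rewrite leqn0 => /eqP ->.
have [le|lt] := leP (u m) (u d.+1).
 exists d.+1 => // j; rewrite leq_eqVlt => /predU1P[->//|jd]; exact: le_trans (hm _ _) le.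
exists m; first exact: leqW.
by move=> j; rewrite leq_eqVlt => /predU1P[->|jd]; [exact: ltW|exact: hm].
Qed.

(* The index of the largest term of [t ^ j * al j] is nondecreasing in [t]; among
  the [d + 1] scales [t0 * S ^ (2 i)] two consecutive ones share it, and at the
  geometric mean of these two it dominates by a factor [S]. *)
Lemma dominant d (al : nat -> R) (t0 S : R) :
 (forall j, 0 <= al j) -> 0 < t0 -> 1 < S -> (exists2 j, (j <= d)%N & al 0%N < t0 ^+ j * al j) ->
 exists m t, [/\ (0 < m <= d)%N, 0 < t <= t0 * S ^+ (2 * d)%N, 0 < al m &
  forall j, (j <= d)%N -> j != m -> S * (t ^+ j * al j) <= t ^+ m * al m].
move=> al0 t00 S1 [j0 j0d hj0]; have S0 : 0 < S by lra.
have S1' : 1 <= S by exact: ltW.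
pose s i := t0 * S ^+ (2 * i)%N; pose g i j := s i ^+ j * al j.
have s0 i : 0 < s i by pos.
set T := exists m t, _.
have step n : (n <= d)%N -> T \/ exists m, [/\ (n < m <= d)%N, 0 < al m & forall j, (j <= d)%N -> g n j <= g n m].
 elim: n => [|n IH] nd.
  have [m md hm] := nat_argmax (g 0%N) d; right; exists m.
  have h1 : al 0%N < g 0%N m.
   by apply: lt_le_trans hj0 _; have := hm _ j0d; rewrite /g /s mulr1.
  split=> //.
   rewrite md andbT lt0n; apply: contraTneq h1 => ->.
   by rewrite /g mul1r ltxx.
  rewrite lt_def al0 andbT; apply: contraTneq h1 => e; rewrite /g e mulr0 -leNgt; exact: al0.
 have [|[m [/andP[nm md] am hm]]] := IH (ltnW nd); first by left.
 have [m' md' hm'] := nat_argmax (g n.+1) d.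
 have gS j : g n.+1 j = S ^+ (2 * j)%N * g n j.
  by rewrite /g /s mulnS exprD mulrCA exprMn mulrA -exprM.
 have gm j : 0 < al j -> 0 < g n j by move=> aj; rewrite mulr_gt0 // exprn_gt0.
 have am' : 0 < al m'.
  have := hm' _ md; rewrite !gS => h; have p : 0 < S ^+ (2 * m)%N * g n m by rewrite mulr_gt0 ?exprn_gt0 ?gm.
  rewrite lt_def al0 andbT; apply: contraTneq h => e; rewrite -ltNge /g e !mulr0; exact: p.
 have mm : (m <= m')%N.
  rewrite leqNgt; apply/negP => lt; have := hm' _ md; apply/negP; rewrite -ltNge !gS.
  apply: (@le_lt_trans _ _ (S ^+ (2 * m')%N * g n m)); first by rewrite ler_pM2l ?exprn_gt0 // hm.
  by rewrite ltr_pM2r ?gm // ltr_eXn2l // ltn_pmul2l.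
 have [e|ne] := eqVneq m m'; last first.
  right; exists m'; split=> //; rewrite md' andbT; apply: leq_ltn_trans nm _.
  by rewrite ltn_neqAle ne.
 subst m'; left; exists m, (s n * S); split=> //.
 - by rewrite md andbT; apply: leq_ltn_trans nm.
 - apply/andP; split; first exact: mulr_gt0.
  by rewrite /s -mulrA -exprSr ler_pM2l // ler_weXn2l // ltn_pmul2l.
 - have tj j : (s n * S) ^+ j * al j = S ^+ j * g n j by rewrite exprMn /g; ring.
  move=> j jd jm; rewrite !tj mulrA -exprS.
  case: (ltngtP j m) jm => // lt _.
   apply: (@le_trans _ _ (S ^+ j.+1 * g n m)); first by rewrite ler_pM2l ?exprn_gt0 // hm.
   by rewrite ler_pM2r ?gm // ler_weXn2l.
  rewrite -(ler_pM2l (exprn_gt0 m S0)); apply: (@le_trans _ _ (g n.+1 j)).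
   rewrite gS mulrA -exprD; apply: ler_wpM2r; first by rewrite mulr_ge0 // exprn_ge0 // ltW.
   apply: ler_weXn2l => //.
   by rewrite mul2n -addnn addnS -addSn leq_add2r.
  by apply: le_trans (hm' _ jd) _; rewrite gS [leRHS]mulrA -exprD mul2n addnn.
have [//|[m [/andP[h1 h2] _ _]]] := step d (leqnn d).
by have := leq_trans h1 h2; rewrite ltnn.
Qed.

Lemma poly_lip (p : {poly C}) : exists2 L : R, 0 <= L & forall w w', normR w <= 1 -> normR w' <= 1 ->
 normR p.[w] <= L /\ normR (p.[w] - p.[w']) <= L * normR (w - w').
elim/poly_ind: p => [|p c [L L0 h]].
 by exists 0 => // w w' _ _; rewrite !horner0 subrr mul0r normR0.
exists (2 * L + normR c); first by rewrite addr_ge0 ?mulr_ge0.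
move=> w w' hw hw'; have [b1 l1] := h w w' hw hw'; have [b2 _] := h w' w hw' hw.
have d0 := normR_ge0 (w - w'); rewrite !hornerMXaddC; split.
 apply: le_trans (normRD _ _) _; rewrite normRM.
 by have := ler_pM (normR_ge0 _) (normR_ge0 _) b1 hw; rewrite mulr1; lra.
have -> : p.[w] * w + c - (p.[w'] * w' + c) = (p.[w] - p.[w']) * w + p.[w'] * (w - w') by ring.
apply: le_trans (normRD _ _) _; rewrite !normRM.
have := ler_pM (normR_ge0 _) (normR_ge0 _) l1 hw; have := ler_wpM2r d0 b2.
have : 0 <= normR c * normR (w - w') by pos.
rewrite mulr1 !mulrDl; lra.
Qed.

Lemma normR_horner_le d (p : {poly C}) (K : R) w : (size p <= d.+1)%N -> normR w <= 1 ->
 (forall j, (j <= d)%N -> normR p`_j <= K) -> normR p.[w] <= d.+1%:R * K.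
move=> sp hw hK; rewrite (horner_coef_wide _ sp); apply: le_trans (normR_sum _) _.
rewrite sum_const_ord; apply: ler_sum => -[j jd] _ /=; rewrite normRM normRX.
by rewrite -[leRHS]mulr1 ler_pM ?exprn_ge0 ?hK // exprn_ile1.
Qed.

Definition sub2 (w : C) (h : R) : 'M[C]_2 := mk2 (rC h) w 0 1.

Lemma mn_sub2 w h : normR w <= 1 -> 0 <= h <= 1 -> mn (sub2 w h) <= 3.
move=> hw /andP[h0 h1]; rewrite /mn !mk2E nsq_real nsq0 nsq1 -normR_sqr.
have a1 : normR w ^+ 2 <= 1 by rewrite expr_le1.
have a2 : h ^+ 2 <= 1 by rewrite expr_le1.
lra.
Qed.

Section DominatedZero.
Variables (d : nat) (f : Ratd R d) (M1 N1 : 'M[C]_2) (m : nat) (r : C) (S dl k K1 : R).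
Let W := pl N1 (pr d M1 (rW f)).
Hypotheses (hM : SL2 M1) (suN : su2 N1) (md : (m <= d)%N) (r0 : r != 0) (Wr : W.1`_m = r) (W0 : W.2`_m = 0).
Hypotheses (S1 : 1 < S) (k0 : 0 < k) (k1 : k <= 1 / 2).
Hypothesis dom : forall j, (j <= d)%N -> j != m -> S * (nsq W.1`_j + nsq W.2`_j) <= nsq r.
Hypothesis Sk : (d.+1%:R / k) ^+ 2 <= S.
Hypothesis K1E : K1 = 4 + chc d * 3 ^+ d.
Hypothesis Sdl : 8 * d.+1%:R * K1 * (chc d * 3 ^+ d * d.+1%:R) <= dl * S.
Hypothesis hdl : forall p : {poly C}, (size p <= d.+1)%N ->
 mass (fun z => nsq (hev d p z 1) < dl * cn d p * (1 + nsq z) ^+ d) <= sm / 8.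

Let hN : SL2 N1. exact: su2_SL2. Qed.
Let nzf : nzW d W. by apply: nz_pl => //; apply: nz_pr => //; exact: nz_rW. Qed.

(** The other coefficients are smaller than [r] by the square root of [S], and [S] exceeds the
    square of [(d + 1) / k]; so the first form is a monomial up to relative error [k] on the
    disc. *)
Lemma dominated_lead w : normR w <= 1 -> normR (W.1.[w] - r * w ^+ m) <= k * normR r.
move=> hw; have S0 := lt_trans ltr01 S1.
have [s1 _ _] := nzf.
pose p := W.1 - r *: 'X^m.
have pE : W.1.[w] - r * w ^+ m = p.[w] by rewrite !hornerE.
have sp : (size p <= d.+1)%N.
 rewrite (leq_trans (size_polyD _ _)) // geq_max s1 size_polyN (leq_trans (size_scale_leq _ _)) //.
 by rewrite size_polyXn.
rewrite pE; apply: le_trans (normR_horner_le (K := normR r * (k / d.+1%:R)) sp hw _) _.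
 move=> j jd; rewrite /p coefB coefZ coefXn; have [->|jm] := eqVneq j m.
  by rewrite Wr mulr1 subrr normR0 mulr_ge0 // divr_ge0 ?ltW.
 rewrite mulr0 subr0 -ler_sqr ?nnegrE //; last by rewrite mulr_ge0 // divr_ge0 ?ltW.
 rewrite exprMn !normR_sqr; apply: (@le_trans _ _ (nsq r / S)).
  rewrite ler_pdivlMr // mulrC; apply: le_trans (dom jd jm).
  by rewrite ler_pM2l // lerDl.
 rewrite ler_wpM2l // -[X in _ <= X]invrK lef_pV2 ?posrE ?invr_gt0 ?exprn_gt0 ?divr_gt0 //.
 by rewrite -exprVn invf_div.
apply: eqR_le; field; exact: lt0r_neq0.
Qed.

(** When the first form keeps coefficients of size [r] after substitution, the second is negligible
    against it off a set of mass at most [sm / 8]. There the third coordinate is at least 3/4, while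
    it is never below -1, so the integral is positive. *)
Lemma dominated_height w h : normR w <= 1 -> 0 <= h <= 1 -> nsq r <= K1 * cn d (hcomp d (sub2 w h) W.1) ->
 0 < vv f M1 N1 w h 2.
move=> hw hh hr; have s0 := @sm_gt0; have S0 := lt_trans ltr01 S1.
have [s1 s2 nz] := nzf; set p := hcomp d (sub2 w h) W.1 in hr; set q := hcomp d (sub2 w h) W.2.
have sp : (size p <= d.+1)%N by exact: size_hcomp.
have sq : (size q <= d.+1)%N by exact: size_hcomp.
have e0 : 0 < chc d * 3 ^+ d :> R by pos.
have qle : S * cn d q <= chc d * 3 ^+ d * d.+1%:R * nsq r.
 have c1 : cn d q <= chc d * 3 ^+ d * cn d W.2.
  apply: le_trans (cn_hcomp _ s2) _; rewrite ler_wpM2r // ler_pM2l ?chc_gt0 //.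
  by rewrite lerXn2r ?nnegrE //; exact: mn_sub2.
 have c2 : S * cn d W.2 <= d.+1%:R * nsq r.
  rewrite /cn mulr_sumr sum_const_ord; apply: ler_sum => -[j jd] _ /=.
  have [->|jm] := eqVneq j m; first by rewrite W0 nsq0 mulr0.
  by apply: le_trans (dom jd jm); rewrite ler_pM2l // lerDr.
 have c3 := ler_wpM2l (ltW S0) c1; have c4 := ler_wpM2l (ltW e0) c2.
 by move: c3 c4; move: (cn d q) (cn d W.2) (nsq r) (chc d * _) => x1 x2 x3 x4; lra.
have qp : d.+1%:R * cn d q <= dl / 8 * cn d p.
 have c0 := cn_ge0 d p.
 have a1 : d.+1%:R * (S * cn d q) <= d.+1%:R * (chc d * 3 ^+ d * d.+1%:R * (K1 * cn d p)).
  rewrite ler_pM2l //; apply: le_trans qle _; rewrite ler_pM2l //; exact: mulr_gt0.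
 have a2 := ler_wpM2r c0 Sdl.
 rewrite -(ler_pM2l S0); move: a1 a2.
 by move: (cn d q) (cn d p) (chc d * _) (d.+1%:R) => x1 x2 x3 x4; lra.
pose bad (z : C) := nsq (hev d p z 1) < dl * cn d p * (1 + nsq z) ^+ d.
have mbad : mpred bad by exact: mpred_hev_lt.
have bnd z : 3 / 4 - 2 * (bad z)%:R <= stereo (sandwich f M1 N1 (Some (w + rC h * z : C))) 0 2.
 have := stereo_bound (sandwich f M1 N1 (Some (w + rC h * z : C))) 2; rewrite ler_norml => /andP[b1 _].
 case: (boolP (bad z)) => hb; first by rewrite mulr1; lra.
 rewrite mulr0 subr0 (sandwich_eval f hM hN) -/W.
 have ev (g : {poly C}) : (size g <= d.+1)%N -> g.[w + rC h * z] = hev d (hcomp d (sub2 w h) g) z 1.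
  by move=> sg; rewrite hev_hcomp !mk2E mul0r add0r !mulr1 hev_one // addrC.
 have nz1 := nz _ _ (one_nz (w + rC h * z)); rewrite !hev_one // in nz1.
 rewrite stereo_hquo // !mxE /= !ev // -/p -/q.
 move: nz1; rewrite -vn_gt0 !ev // -/p -/q.
 have := hev_le z 1 sq; rewrite nsq1 [nsq z + 1]addrC; move: hb; rewrite /bad -leNgt.
 have z0 : 0 <= (1 + nsq z) ^+ d by pos.
 have := ler_wpM2r z0 qp; move: (nsq (hev d p z 1)) (nsq (hev d q z 1)) => x y h1 h2 h3 h4.
 rewrite [leRHS]mulrC ler_pdivlMr //; move: h1 h2 h3; move: (d.+1%:R * _) (cn d p) (_ ^+ d) => u v g.
 by lra.
have ab : adm (fun z => (bad z)%:R) by apply: adm_pred.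
have ac := @adm_cst; have a2 := admM (ac 2) ab.
have : sI (fun z => 3 / 4 - 2 * (bad z)%:R) <= vv f M1 N1 w h 2.
 apply: sI_le => //; first by apply: admB.
 by apply: adm_vv => //; case/andP: hh.
rewrite sIB // sI_cst sIZ //; have := hdl sp; rewrite -/(mass bad) /bad.
by move: (mass _) (vv _ _ _ _ _ _) => x y; move: s0; lra.
Qed.

(** [degree_zero] for the family [vv]: the side and the top of the cylinder point upwards by
    [dominated_height], the bottom winds [m] times by [dominated_lead]. A zero of the centroid is a
    preimage of the origin. *)
Lemma dominated_zero : (0 < m)%N -> (forall (z : C) (x : R), 0 < x ->
  normR (z - rC x) <= k * x -> 0 < Re z /\ `|arg z| < pi / 8) ->
 exists w h, [/\ 0 < h, h <= 1 & bary_ext (ratfun f) (mpt (M1 *m aff w h)) = 0].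
move=> m0 hk; have s0 := @sm_gt0; have [s1 s2 nz] := nzf.
have r1 : 0 < normR r by rewrite normR_gt0.
have e0 : 0 < chc d * 3 ^+ d :> R by pos.
have [e e1 low] := pair_lower_bound nz.
have [L1 L10 hL1] := poly_lip W.1; have [L2 L20 hL2] := poly_lip W.2.
have side w h : normR w = 1 -> 0 <= h <= 1 -> 0 < vv f M1 N1 w h 2.
 move=> hw hh; apply: dominated_height => //; first by rewrite hw.
 set p := hcomp _ _ _; have c0 := cn_ge0 d p.
 have hl := @dominated_lead w; rewrite hw lexx in hl; have {}hl := hl isT.
 have p0 : p`_0 = W.1.[w].
  by have := hev_zero d p 1; rewrite expr1n mulr1 => <-; rewrite hev_hcomp !mk2E !mulr0 !mulr1 !add0r hev_one.
 have c1 : nsq W.1.[w] <= cn d p by rewrite -p0; exact: nsq_le_cn.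
 have c2 : normR r / 2 <= normR W.1.[w].
  have := normRB_ge (r * w ^+ m) W.1.[w]; rewrite normRB normRM normRX hw expr1n mulr1.
  have : k * normR r <= 1 / 2 * normR r by rewrite ler_pM2r.
  lra.
 have c3 : nsq r / 4 <= nsq W.1.[w].
  have : (normR r / 2) ^+ 2 <= normR W.1.[w] ^+ 2 by rewrite ler_sqr ?nnegrE // divr_ge0.
  by rewrite exprMn !normR_sqr; lra.
 rewrite K1E mulrDl; have : 0 <= chc d * 3 ^+ d * cn d p by apply: mulr_ge0 => //; exact: ltW.
 lra.
have top w : normR w <= 1 -> 0 < vv f M1 N1 w 1 2.
 move=> hw; have h1 : 0 <= (1 : R) <= 1 by rewrite ler01 lexx.
 apply: dominated_height => //; set p := hcomp _ _ _.
 (* At height 1, translating back by [w] recovers the first form, so its coefficient norm cannot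
    have dropped by more than a constant. *)
 have E : hcomp d (sub2 (- w) 1) p = W.1.
  rewrite hcompM -[RHS](@hcomp1 d) //; congr hcomp; apply: mx2P; rewrite mulmx2E !mk2E !mxE /=.
  - by rewrite mulr0 addr0 mulr1.
  - by rewrite mulr1 mul1r addNr.
  - by rewrite mul0r mulr0 addr0.
  - by rewrite mul0r add0r mulr1.
 have hw' : normR (- w) <= 1 by rewrite normRN.
 have c1 : nsq r <= chc d * 3 ^+ d * cn d p.
  rewrite -Wr; apply: le_trans (nsq_le_cn _ md) _; rewrite -{1}E.
  apply: le_trans (cn_hcomp _ (size_hcomp _ _ _)) _; rewrite ler_wpM2r // ler_pM2l ?chc_gt0 //.
  by rewrite lerXn2r ?nnegrE //; exact: mn_sub2.
 by rewrite K1E; have := cn_ge0 d p; lra.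
(* [degree_zero] asks for a modulus of continuity at all real heights, while [vv] has one at
   nonnegative heights; hence the absolute value. *)
have [] := @degree_zero (horner W.1) (horner W.2) (fun w h => vv f M1 N1 w `|h|) sm e (L1 + L2) k r m s0 e1 (addr_ge0 L10 L20) k0 k1 hk m0 r0.
- move=> eps eps0; have [de de0 hde] := vv_modulus f hM hN eps0; exists de => // w w' h h' h1 h2.
 by apply: hde => //; apply: le_lt_trans h2; exact: ler_dist_dist.
- by move=> w hw; rewrite normr1; exact: top.
- by move=> w h hw hh; rewrite ger0_norm; [exact: side|case/andP: hh].
- by move=> w i _; rewrite normr0 vv0 (sandwich_eval f hM hN).
- move=> w _; have := low w 1; rewrite !hev_one // nsq1 => h; apply: le_trans h.
 by rewrite -[leLHS]mulr1 ler_pM2l // exprn_ege1 // lerDr nsq_ge0.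
- move=> w w' hw hw'; have [_ a1] := hL1 w w' hw hw'; have [_ a2] := hL2 w w' hw hw'.
 by split; [apply: le_trans a1 _|apply: le_trans a2 _]; rewrite ler_wpM2r ?lerDl ?lerDr.
- by move=> w hw; apply: dominated_lead; rewrite hw.
move=> w [h [hw hh v0]]; have /andP[h0 h1] := hh; rewrite ger0_norm // in v0.
exists w, h; suff hp : 0 < h by split=> //; have d0 := leq_trans m0 md; exact (@vv_bal d f M1 N1 hM hN w h d0 suN hp v0).
(* A zero at height 0 is impossible: the vector there is [sm] times a unit vector. *)
rewrite lt_def h0 andbT; apply/eqP => hE; move: v0; rewrite hE => v0.
set x := sandwich f M1 N1 (Some w).
have sx i : stereo x 0 i = 0.
 by have := v0 i; rewrite vv0 => /eqP; rewrite mulf_eq0 gt_eqF //= => /eqP.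
by have := stereo_norm x; rewrite sqnorm3E !sx expr0n !addr0 => /eqP; rewrite eq_sym oner_eq0.
Qed.

End DominatedZero.

Lemma inv2_1 : inv2 1%:M = 1%:M :> 'M[C]_2.
by apply: mx2P; rewrite !mxE ?oppr0. Qed.

Lemma hdist0_mpt_ge M : SL2 M -> ln (mn M / 2) <= hdist 0 (mpt M).
move=> hM; rewrite -mpt1 hdist_mpt //; last exact: SL2_1.
have m2 := mn_ge2 hM; rewrite inv2_1 mul1mx /arcosh.
have s0 : 0 <= Num.sqrt ((mn M / 2) ^+ 2 - 1) by pos.
by rewrite ler_ln ?posrE; lra.
Qed.

(** By contradiction: centre the source at [(a, b)]. A tiny constant term puts all the weight on
    higher coefficients, so at some scale [t] below exp(- 2 rho) a single monomial of positive
    degree dominates. [dominated_zero] then yields a preimage of the origin whose distance exceeds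
    [rho]. *)
Lemma value_lower d : (0 < d)%N -> exists2 c : R, 0 < c & forall (f : Ratd R d) rho, 0 <= rho ->
 preim_radius (ratfun f) 0 <= rho -> forall a b, nsq a + nsq b = 1 ->
 c * expR (- (2 * d%:R * rho)) * cn2 d (rW f) <= nsq (hev d (rP f) a b) + nsq (hev d (rQ f) a b).
move=> d0; have s0 := @sm_gt0.
have pi8 : 0 < pi / 8 :> R by pos.
have [k k0 [k1 hk]] := small_arg pi8.
have [|dl dl0 hdl] := @nonconc d (sm / 8); first by pos.
have D0 : 0 < d.+1%:R :> R by pos.
have e0 : 0 < chc d * 3 ^+ d :> R by pos.
pose K1 : R := 4 + chc d * 3 ^+ d; have K10 : 0 < K1 by rewrite /K1; lra.
pose K2 : R := 8 * d.+1%:R * K1 * (chc d * 3 ^+ d * d.+1%:R).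
have K20 : 0 < K2 by rewrite /K2; apply: mulr_gt0; apply: mulr_gt0 => //; apply: mulr_gt0.
pose S : R := 2 + (d.+1%:R / k) ^+ 2 + K2 / dl.
have q1 : 0 <= (d.+1%:R / k) ^+ 2 by pos.
have q2 : 0 < K2 / dl by pos.
have S1 : 1 < S by rewrite /S; lra.
have Sk : (d.+1%:R / k) ^+ 2 <= S by rewrite /S; lra.
have Sdl : K2 <= dl * S by rewrite mulrC -ler_pdivrMr // /S; lra.
pose SS := S ^+ (2 * d)%N; have SS1 : 1 <= SS by rewrite exprn_ege1 // ltW.
have SS0 : 0 < SS by lra.
(* The power of [S] compensates the loss of scale in [dominant], and the factor 8 produces the final
   contradiction. *)
pose kap := SS^-1 / 8; have kap0 : 0 < kap by pos.
have kap1 : kap <= 1 by rewrite /kap; have : SS^-1 <= 1 by [rewrite invf_le1]; lra.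
pose C1 : R := chc d * 2 ^+ d; have C10 : 0 < C1 by rewrite mulr_gt0 ?chc_gt0.
have K1E : K1 = 4 + chc d * 3 ^+ d by [].
have K2E : K2 = 8 * d.+1%:R * K1 * (chc d * 3 ^+ d * d.+1%:R) by [].
clearbody K1 K2 S; subst K2; clear q1 q2.
exists (kap ^+ d / (d.+1%:R * C1)); first by rewrite divr_gt0 ?exprn_gt0 // mulr_gt0.
move=> f rho rho0 hrho a b ab; rewrite leNgt; apply/negP => hlt.
have hU := uz_su2 ab; set U := uz a b in hU; have U1 := su2_SL2 hU.
pose W1 := pr d U (rW f); have nz1 : nzW d W1 by apply: nz_pr => //; exact: nz_rW.
pose al j := nsq W1.1`_j + nsq W1.2`_j.
have al0 j : 0 <= al j by rewrite addr_ge0.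
have alE : al 0%N = nsq (hev d (rP f) a b) + nsq (hev d (rQ f) a b).
 by have [c0 c1] := coef0_pr d a b (rW f); rewrite /al /W1 c0 c1.
rewrite -alE in hlt.
have T1 : cn2 d (rW f) <= C1 * cn2 d W1.
 have -> : rW f = pr d (inv2 U) W1 by rewrite /W1 prM mul_inv2r // pr1 //; exact: nz_rW.
 by rewrite /C1 -(su2_mn (su2_inv2 hU)); exact: cn2_pr_le.
have Tsum : cn2 d W1 = \sum_(j < d.+1) al j by rewrite /cn2 /cn -big_split.
pose t0 := kap * expR (- (2 * rho)).
have t00 : 0 < t0 by rewrite mulr_gt0 ?expR_gt0.
have x1 : expR (- (2 * rho)) <= 1 by rewrite -expR0 ler_expR oppr_le0 mulr_ge0.
have t01 : t0 <= 1 by rewrite /t0 -[leRHS]mulr1 ler_pM // ltW.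
have t0d : t0 ^+ d = kap ^+ d * expR (- (2 * d%:R * rho)).
 by rewrite /t0 exprMn expRX; congr (_ * expR _); ring.
(* Otherwise the coefficient norm is at most a constant times [t0 ^- d] times the constant term, and
   [t0 ^ d] was chosen so that this contradicts the assumed smallness. *)
have ex : exists2 j, (j <= d)%N & al 0%N < t0 ^+ j * al j.
 apply: contrapT => hno; have hj j : (j <= d)%N -> t0 ^+ j * al j <= al 0%N.
  by move=> jd; rewrite leNgt; apply/negP => lt; apply: hno; exists j.
 have h1 : t0 ^+ d * cn2 d W1 <= d.+1%:R * al 0%N.
  rewrite Tsum mulr_sumr sum_const_ord; apply: ler_sum => -[j jd] _ /=.
  by apply: le_trans (hj _ jd); rewrite ler_wpM2r // ler_wiXn2l // ltW.
 have h2 : t0 ^+ d * cn2 d (rW f) <= t0 ^+ d * (C1 * cn2 d W1) by rewrite ler_pM2l ?exprn_gt0.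
 have h3 : t0 ^+ d * cn2 d (rW f) / (d.+1%:R * C1) = kap ^+ d / (d.+1%:R * C1) * expR (- (2 * d%:R * rho)) * cn2 d (rW f).
  by rewrite t0d; ring.
 rewrite -h3 ltr_pdivlMr ?mulr_gt0 // in hlt.
 have h4 := ler_wpM2l (ltW C10) h1.
 by move: hlt h2 h4; move: (_ ^+ d) (cn2 d W1) (cn2 d (rW f)) => u v x; clear; lra.
have [m [t [/andP[m0 md] /andP[tp tle] am hdom]]] := dominant al0 t00 S1 ex.
(* Moving by [s] towards the point rescales the j-th squared coefficient by [t ^ j], up to a common
   factor. *)
pose s := - (ln t / 2).
have es : expR (- (2 * s)) = t by rewrite /s mulrN opprK mulrC divfK // lnK.
have ds : SL2 (dg s) := dg_SL2 s.
pose M1 := U *m dg s; have hM : SL2 M1 := SL2_mul U1 ds.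
pose W' := pr d M1 (rW f); have W'E : W' = pr d (dg s) W1 by rewrite /W1 prM.
pose E := expR (s * d%:R).
have E0 : 0 < E := expR_gt0 _.
have [z1 z2 _] := nz1.
have cf j : (j <= d)%N -> nsq W'.1`_j + nsq W'.2`_j = E * (t ^+ j * al j).
 move=> jd; rewrite W'E /= !coef_hcomp_diag // !nsqM !nsqX !nsq_real expR_half expRN_half !expRX -mulrDr -/(al j).
 rewrite mulrA -es expRX /E -!expRD; congr (expR _ * _).
 by rewrite natrB //; ring.
have am' : 0 < nsq W'.1`_m + nsq W'.2`_m by rewrite cf // !mulr_gt0 // exprn_gt0.
have [c [e [r [ce p0 p1]]]] := normalize am'.
(* A target rotation that takes the dominant coefficient vector to [(r, 0)]. Being in SU(2), it
   fixes the origin. *)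
pose N1 : 'M[C]_2 := mk2 (c^*) (e^*) (- e) c.
have hN1 : su2 N1 by rewrite /su2 !mk2E !conjCK !nsq_conj.
pose W := pl N1 W'.
have ce1 : c^* * c + e^* * e = 1 :> C.
 rewrite ![_^* * _]mulrC !conj_mulC (_ : (1 : C) = rC 1) // -ce.
 by apply: complexP; rewrite !reim ?addr0.
have Wr : W.1`_m = r.
 by rewrite coefD !coefZ p0 p1 !mk2E -[RHS]mulr1 -ce1; ring.
have W0 : W.2`_m = 0 by rewrite coefD !coefZ p0 p1 !mk2E; ring.
have cfW j : nsq W.1`_j + nsq W.2`_j = nsq W'.1`_j + nsq W'.2`_j.
 by rewrite !coefD !coefZ; exact: (su2_unitary hN1).
have nr : nsq r = E * (t ^+ m * al m) by rewrite -cf // -cfW Wr W0 nsq0 addr0.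
have r0 : r != 0 by rewrite -nsq_gt0 nr !mulr_gt0 // exprn_gt0.
have dom j : (j <= d)%N -> j != m -> S * (nsq W.1`_j + nsq W.2`_j) <= nsq r.
 by move=> jd jm; rewrite cfW cf // nr mulrCA ler_pM2l // hdom.
have [w [h [h0 h1 hb]]] := dominated_zero hM hN1 md r0 Wr W0 S1 k0 k1 dom Sk K1E Sdl hdl m0 hk.
have hA := aff_SL2 w h0.
have := preim_radius_ge d0 (mpt_ball (SL2_mul hM hA)) hb.
move/le_trans => /(_ _ hrho); have := hdist0_mpt_ge (SL2_mul hM hA) => l1 l2.
have {l1 l2} := le_trans l1 l2.
rewrite /M1 -mulmxA mn_su2_mul // => l3.
(* Since [h <= 1], the point of the cylinder lies at least as far out as its top; this entry alone
   records the distance. *)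
have l4 : expR s <= mn (dg s *m aff w h).
 apply: (@le_trans _ _ (nsq ((dg s *m aff w h) 1 1))).
  rewrite mulmx2E !mk2E mul0r add0r nsqM !nsq_real expR_half exprVn (sqr_sqrtr (ltW h0)).
  by apply: ler_peMr; rewrite ?invf_ge1.
 by rewrite /mn lerDr addr_ge0 // addr_ge0.
have es0 := expR_gt0 s.
have l5 : expR s / 2 <= expR rho.
 rewrite -(@ler_ln R) ?posrE ?expR_gt0 ?divr_gt0 //; rewrite expRK; apply: le_trans l3.
 by rewrite ler_ln ?posrE; clear -l4 es0; lra.
have l6 : t <= expR (- (2 * rho)) / 8.
 apply: le_trans tle _; rewrite -/SS /t0 /kap le_eqVlt; apply/orP; left; apply/eqP.
 by move: (expR _) => y; field; exact: lt0r_neq0.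
(* The choice of scale gives exp(2 s) >= 8 exp(2 rho), whereas the bound on preimages gives exp(2 s)
   <= 4 exp(2 rho). *)
have l7 : 8 * expR (2 * rho) <= expR (2 * s).
 have : expR (- (2 * s)) * 8 <= expR (- (2 * rho)) by rewrite es -ler_pdivlMr.
 rewrite !expRN -[X in _ <= X]mul1r -ler_pdivrMr ?invr_gt0 ?expR_gt0 // invrK => l8.
 rewrite -[leRHS]mul1r -ler_pdivrMr ?expR_gt0; clear -l8; lra.
move: l7; rewrite !mulr_natl !mulr2n !expRD; move: l5 es0 (expR_gt0 rho).
move: (expR s) (expR rho); clear=> x y y1 y2 y3 y4.
have h5 : x * x <= (2 * y) * (2 * y) by apply: ler_pM; lra.
have h6 : 0 < y * y by pos.
lra.
Qed.

(** * Compactness in moduli space and divergence of the rescaling radius *)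

Lemma hev_rVpoly d (u : 'rV[C]_d.+1) a b : hev d (rVpoly u) a b = \sum_(j < d.+1) u 0 j * a ^+ j * b ^+ (d - j).
by apply: eq_bigr => j _; rewrite coef_rVpoly_ord. Qed.

(** Pairs with bounded coefficients on which the non-degeneracy of [value_lower] holds with a fixed
    constant. The bound is closed and excludes common zeros, so limits stay rational maps of degree
    [d]. *)
Definition lower_pairs d (c : R) : set ('rV[C]_d.+1 * 'rV[C]_d.+1) :=
 [set p : 'rV[C]_d.+1 * 'rV[C]_d.+1 | [/\ forall j, normR (p.1 0 j) <= 1, forall j, normR (p.2 0 j) <= 1 &
  forall a b, nsq a + nsq b = 1 -> c <= nsq (hev d (rVpoly p.1) a b) + nsq (hev d (rVpoly p.2) a b)]].

Lemma lower_pairs_compact d c : compact (@lower_pairs d c).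
pose B : set 'rV[C]_d.+1 := [set u | forall j, normR (u 0 j) <= 1].
have cB : compact B by apply: (@rV_compact C d.+1 (fun=> [set z | normR z <= 1])) => _; exact: compact_disc.
pose D : set (C * C) := [set u | nsq u.1 + nsq u.2 = 1].
pose h (u : C * C) (p : 'rV[C]_d.+1 * 'rV[C]_d.+1) := nsq (hev d (rVpoly p.1) u.1 u.2) + nsq (hev d (rVpoly p.2) u.1 u.2).
have cc (T : topologicalType) (g : T -> 'rV[C]_d.+1) (u : C * C) : continuous g ->
  continuous (fun x => nsq (hev d (rVpoly (g x)) u.1 u.2)).
 move=> cg x; have c1 : (fun x => hev d (rVpoly (g x)) u.1 u.2) @ x --> hev d (rVpoly (g x)) u.1 u.2.
  rewrite hev_rVpoly; under eq_fun do rewrite hev_rVpoly; apply: cvg_sum_ord => j.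
  have c2 : (fun x => g x 0 j) @ x --> g x 0 j.
   exact: (@continuous_comp _ _ _ g (fun M : 'rV[C]_d.+1 => M 0 j) x (cg x) (@coord_continuous C 1 d.+1 0 j (g x))).
  exact: (cvgM (cvgM c2 (@cvg_cst _ _ _ _ _)) (@cvg_cst _ _ _ _ _)).
 exact: (@continuous_comp _ _ _ (fun x => hev d (rVpoly (g x)) u.1 u.2) nsq x c1 (@nsq_continuous _)).
have ch u : continuous (h u).
 move=> p; have h1 : continuous (fun p : 'rV[C]_d.+1 * 'rV[C]_d.+1 => p.1) by move=> q; exact: cvg_fst.
 have h2 : continuous (fun p : 'rV[C]_d.+1 * 'rV[C]_d.+1 => p.2) by move=> q; exact: cvg_snd.
 exact: (cvgD (cc _ _ u h1 p) (cc _ _ u h2 p)).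
have cl : closed (\bigcap_(u in D) (h u @^-1` [set x | c <= x])).
 apply: closed_bigI => u _; apply: closed_comp; last exact: closed_ge.
 by move=> p _; exact: ch.
have E : @lower_pairs d c = (B `*` B) `&` (\bigcap_(u in D) (h u @^-1` [set x | c <= x])).
 apply/seteqP; split=> [p [h1 h2 h3]|p [[h1 h2] h3]].
  by split=> // u hu; exact: h3.
 by split=> // a b ab; exact: (h3 (a, b)).
rewrite E; apply: compact_closedI => //; exact: compact_setX.
Qed.

Lemma lower_Ratd d (A : 'M[C]_(2, d.+1)) (c : R) : (0 < d)%N -> 0 < c ->
 (forall a b, nsq a + nsq b = 1 -> c <= nsq (hev d (numer A) a b) + nsq (hev d (denom A) a b)) -> Ratd R d A.
move=> d0 c0 low; have nz a b : (a != 0) || (b != 0) -> (hev d (numer A) a b != 0) || (hev d (denom A) a b != 0).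
 move=> ab; have ab0 : 0 < nsq a + nsq b by rewrite vn_gt0.
 have [a' [b' [r [n1 ea eb]]]] := normalize ab0.
 have r0 : r != 0 by apply: contraTneq ab0 => r0; rewrite ea eb r0 !mul0r !nsq0 addr0 ltxx.
 have := lt_le_trans c0 (low _ _ n1); rewrite vn_gt0.
 by rewrite ea eb !hevZ !mulf_eq0 expf_eq0 (negbTE r0) andbF.
have sn : (size (numer A) <= d.+1)%N by exact: size_poly.
have sd : (size (denom A) <= d.+1)%N by exact: size_poly.
rewrite /Ratd; apply/andP; split.
 apply: Pdiv.ClosedField.root_coprimep => x /rootP p0; have := nz x 1; rewrite oner_eq0 orbT => /(_ isT).
 by rewrite !hev_one // p0 eqxx.
rewrite eqn_leq geq_max sn sd ltnNge geq_max; apply/negP => /andP[s1 s2].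
have := nz 1 0; rewrite oner_eq0 => /(_ isT); rewrite !hev_inf !nth_default // !mul0r eqxx.
by [].
Qed.

Definition rat_pair d (f : Ratd R d) : 'rV[C]_d.+1 * 'rV[C]_d.+1 := (row 0 (\val f), row 1 (\val f)).

(** A cluster point of the coefficient rows is again a rational map by [lower_Ratd]; the rest
    transfers neighbourhoods between matrices and their two rows. *)
Lemma lower_rat_compact d c : (0 < d)%N -> 0 < c -> compact (@rat_pair d @^-1` lower_pairs c).
move=> d0 c0 F FF FK; pose G := @rat_pair d @ F.
have FG : ProperFilter G by exact: fmap_proper_filter.
have [[u v] [[huv1 huv2 huv3] clG]] := lower_pairs_compact FG FK.
pose A : 'M[C]_(2, d.+1) := \matrix_(i, j) (if i == 0 then u 0 j else v 0 j).
have A0 : row 0 A = u by apply/rowP => j; rewrite !mxE.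
have A1 : row 1 A = v by apply/rowP => j; rewrite !mxE.
have RA : Ratd R d A by apply: (lower_Ratd d0 c0); rewrite /numer /denom A0 A1.
pose f0 : Ratd R d := exist _ A (mem_set RA).
have f0E : rat_pair f0 = (u, v) by rewrite /rat_pair A0 A1.
exists f0; split; first by rewrite /= f0E.
move=> X Y FX; rewrite nbhsE => -[U [ [X1 oX OE] Of] UY]; rewrite -OE in Of UY.
have [P nP sP] : nbhs A X1 by apply: open_nbhs_nbhs; split.
pose Z : set ('rV[C]_d.+1 * 'rV[C]_d.+1) := [set p : 'rV[C]_d.+1 * 'rV[C]_d.+1 | forall j, P 0 j (p.1 0 j) /\ P 1 j (p.2 0 j)].
have nZ : nbhs (u, v) Z.
 pose Q (k : 'I_2) : set 'rV[C]_d.+1 := [set w | forall i j, P k j (w i j)].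
 have nQ k (w : 'rV[C]_d.+1) : row k A = w -> nbhs w (Q k).
  by move=> <-; exists (fun _ j => P k j) => // i j; rewrite mxE; exact: nP.
 exists (Q 0, Q 1); first by split; [exact: nQ A0|exact: nQ A1].
 by move=> [x y] [/= qx qy] j; split; [exact: qx|exact: qy].
have GX : G (@rat_pair d @` X).
 by apply: (@filterS _ F _ X) FX => x Xx; exists x.
have [_ [[g Xg <-] hZ]] := clG _ _ GX nZ.
exists g; split=> //; apply: UY; apply: sP => i j.
have [z1 z2] := hZ j; rewrite !mxE in z1 z2.
have : i = 0 \/ i = 1 by case: i => [[|[|//]] hi]; [left|right]; exact: val_inj.
by case=> ->.
Qed.

Lemma cls_eq d (f g : Ratd R d) : (forall z, ratfun f z = ratfun g z) -> cls f = cls g.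
move=> h; apply/eqmodP/asboolP; exists 1%:M; first exact: det1.
by move=> z; rewrite !mobius1.
Qed.

(** If the radius stayed below [B], [value_lower] would put the normalized coefficients into a set
    [lower_pairs] independent of n, and the class into its compact image, against degeneration. *)
Lemma degenerating_rescaling d (f : nat -> Ratd R d) : (0 < d)%N ->
 degenerating (fun n => cls (f n)) ->
 (forall n, preim_radius (ratfun (f n)) 0 <= rescaling (ratfun (f n)) + 1) ->
 forall B : R, \forall n \near \oo, B < rescaling (ratfun (f n)).
move=> d0 deg nrm B; have [c c0 hc] := @value_lower d d0.
pose rho := Num.max 0 B + 1; have rho0 : 0 <= rho by rewrite addr_ge0 // le_max lexx.
pose c1 := c * expR (- (2 * d%:R * rho)); have c10 : 0 < c1 by pos.
have cK : compact (@cls R d @` (@rat_pair d @^-1` lower_pairs c1)).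
 apply: continuous_compact; last exact: lower_rat_compact.
 by apply: continuous_subspaceT; exact: pi_continuous.
apply: filterS (deg _ cK) => n hn; rewrite ltNge; apply/negP => le; apply: hn.
have hr : preim_radius (ratfun (f n)) 0 <= rho.
 by apply: le_trans (nrm n) _; rewrite lerD2r le_max le orbT.
have low := hc (f n) rho rho0 hr.
have [e e0 he] := rat_lower (f n).
pose W := rW (f n); have W0 : 0 < cn2 d W.
 have := he 1 0; rewrite nsq1 nsq0 addr0 expr1n mulr1 !hev_inf expr1n !mulr1 => h.
 apply: lt_le_trans e0 _; apply: le_trans h _.
 by rewrite lerD // nsq_le_cn.
(* Scaling both forms by [s] makes the total coefficient norm 1 without changing the map or its
   class. *)
pose s := (Num.sqrt (cn2 d W))^-1; have s0 : 0 < s by rewrite invr_gt0 sqrtr_gt0.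
have s2 : s ^+ 2 * cn2 d W = 1.
 by rewrite exprVn (sqr_sqrtr (ltW W0)) mulVf // gt_eqF.
have sc0 : rC s != 0 :> C by rewrite negb_and gt_eqF.
pose A := rC s *: \val (f n) : 'M[C]_(2, d.+1).
have nA : numer A = rC s *: rP (f n) by rewrite /numer /A /rP linearZ linearZ.
have dA : denom A = rC s *: rQ (f n) by rewrite /denom /A /rQ linearZ linearZ.
have lowA a b : nsq a + nsq b = 1 -> c1 <= nsq (hev d (numer A) a b) + nsq (hev d (denom A) a b).
 move=> ab; have := low a b ab; rewrite nA dA !hevS !nsqM nsq_real -mulrDr => h.
 have := ler_wpM2l (sqr_ge0 s) h; rewrite -/W mulrCA s2 mulr1.
 by [].
have RA : Ratd R d A by apply: (lower_Ratd d0 c10 lowA).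
pose g : Ratd R d := exist _ A (mem_set RA).
exists g; last first.
 apply: cls_eq => z; rewrite /ratfun /= -!/(numer _) -!/(denom _) nA dA.
 by case: z => [z|]; rewrite ?hornerZ ?coefZ hquoZ.
have coefs (p : {poly C}) j : (j <= d)%N -> cn d p <= cn2 d W -> normR (rC s * p`_j) <= 1.
 move=> jd hp; rewrite -(@ler_sqr _ _ 1) ?nnegrE // normR_sqr nsqM nsq_real expr1n -s2.
 by rewrite ler_wpM2l ?sqr_ge0 //; apply: le_trans (nsq_le_cn _ jd) hp.
have rc (i : 'I_2) (j : 'I_d.+1) : (rVpoly (row i (\val (f n))))`_j = \val (f n) i j by rewrite coef_rVpoly_ord mxE.
split=> /=.
- move=> j; rewrite !mxE -(rc 0); apply: coefs; first by rewrite -ltnS.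
 by rewrite lerDl.
- move=> j; rewrite !mxE -(rc 1); apply: coefs; first by rewrite -ltnS.
 by rewrite lerDr.
- exact: lowA.
Qed.

(** A non-principal ultrafilter contains no finite set, hence contains every cofinite one. *)
Lemma near_omega (omega : set_system nat) (P : nat -> Prop) : UltraFilter omega ->
 (forall n, ~ omega [set n]) -> (\forall n \near \oo, P n) -> \forall n \near omega, P n.
move=> U np [N _ hN]; have hlt k : ~ omega [set n | (n < k)%N].
 elim: k => [|k IH] h; first by apply: (@filter_not_empty _ omega); apply: filterS h.
 have [h1|h1] := in_ultra_setVsetC [set k] U; first exact: np h1.
 apply: IH; apply: filterS (filterI h h1) => n /= [].
 by rewrite ltnS leq_eqVlt => /predU1P[->|].
have [h|h] := in_ultra_setVsetC [set n | (n < N)%N] U; first by case: (hlt _ h).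
by apply: filterS h => n /negP; rewrite -leqNgt => /hN.
Qed.

(** * Coarse behaviour of the extension: Lipschitz bound and image of a radial geodesic *)

Lemma bary_coarse d : (0 < d)%N -> exists K : R, forall (f : Ratd R d) x y, ball3 x -> ball3 y ->
 hdist (bary_ext (ratfun f) x) (bary_ext (ratfun f) y) <= d%:R * hdist x y + K.
move=> d0; have [c c0 hc] := @bal_coercive d.
exists (d%:R * ln 2 + ln (chc d / c)) => f x y /ball_mpt[M hM ->] /ball_mpt[M' hM' ->].
have [N [hN bN ->]] := bary_ext_bal f d0 hM; have [N' [hN' bN' ->]] := bary_ext_bal f d0 hM'.
pose B := pr d M (rW f); pose B' := pr d M' (rW f).
have nzB : nzW d B by apply: nz_pr => //; exact: nz_rW.
have nzB' : nzW d B' by apply: nz_pr => //; exact: nz_rW.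
pose D := inv2 M *m M'; have hD : SL2 D := SL2_mul (SL2_inv2 hM) hM'.
pose T := N' *m inv2 N; have hT : SL2 T := SL2_mul hN' (SL2_inv2 hN).
have NB := nz_pl hN nzB; have NB' := nz_pl hN' nzB'.
have B'E : B' = pr d D B by rewrite /B /B' prM /D mulmxA mul_inv2r // mul1mx.
have BE : B = pr d (inv2 D) B'.
 by rewrite B'E prM mul_inv2r // pr1.
have TB : pl T (pl N B) = pl N' B by rewrite -(plM _ _ nzB) /T -mulmxA mul_inv2 // mulmx1.
have TB' : pl (inv2 T) (pl N' B') = pl N B'.
 by rewrite -(plM _ _ nzB') /T inv2_mul inv2K -mulmxA mul_inv2 // mulmx1.
have h1 := hc _ _ NB bN hT; have h2 := hc _ _ NB' bN' (SL2_inv2 hT).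
rewrite TB in h1; rewrite TB' mn_inv2 in h2.
have h3 : cn2 d (pl N' B) <= chc d * mn D ^+ d * cn2 d (pl N' B').
 by rewrite {1}BE -pr_pl -(mn_inv2 D); exact: cn2_pr_le.
have h4 : cn2 d (pl N B') <= chc d * mn D ^+ d * cn2 d (pl N B).
 by rewrite {1}B'E -pr_pl; exact: cn2_pr_le.
have pos W : nzW d W -> 0 < cn2 d W.
 by move=> nz; have := lt_le_trans (n2_gt0 0 nz) (n2_le 0 nz); rewrite nsq0 addr0 expr1n mulr1 pmulr_rgt0.
have p1 := pos _ NB.
have mT := mn_gt0 hT; have mD := mn_gt0 hD.
have key : mn T <= chc d / c * mn D ^+ d.
 have cT : 0 < c * mn T by exact: mulr_gt0.
 have k0 : 0 < chc d * mn D ^+ d by rewrite mulr_gt0 ?chc_gt0 // exprn_gt0.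
 have a1 := le_trans h1 h3; have a2 := le_trans h2 h4.
 (* The bounds for the two points are multiplied, so that the unknown coefficient norms cancel. *)
 have e1 : (c * mn T) ^+ 2 * cn2 d (pl N B) <= (chc d * mn D ^+ d) ^+ 2 * cn2 d (pl N B).
  move: a1 a2 cT k0; move: (c * _) (chc d * _) (cn2 _ _) (cn2 _ _) => t k x1 x2 a1 a2 t0 k0.
  have := ler_wpM2l (ltW t0) a1; have := ler_wpM2l (ltW k0) a2; rewrite !expr2; clear; lra.
 rewrite ler_pM2r // in e1.
 have {}e1 : c * mn T <= chc d * mn D ^+ d by move: e1; rewrite ler_sqr; [|exact: ltW|exact: ltW].
 by rewrite mulrAC ler_pdivlMr // mulrC.
have /andP[_ u1] := hd_bnd (SL2_inv2 hN) (SL2_inv2 hN').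
apply: le_trans u1 _; rewrite {1}/hd inv2K.
have -> : mn (N *m inv2 N') = mn T by rewrite -(mn_inv2 T) /T inv2_mul inv2K.
have /andP[u2 _] := hd_bnd hM hM'; rewrite {1}/hd -/D in u2.
apply: (@le_trans _ _ (ln (chc d / c * mn D ^+ d))).
 by rewrite ler_ln ?posrE // mulr_gt0 ?exprn_gt0 // divr_gt0 // chc_gt0.
rewrite lnM ?posrE ?exprn_gt0 ?divr_gt0 ?chc_gt0 // lnXn // -mulr_natl.
have u3 := ler_wpM2l (ler0n R d) u2.
by move: u3; move: (hdist _ _) (ln _) (ln _) (ln _) => h l1 l2 l3; clear; lra.
Qed.

(** The 2 by 2 minors of the coefficients do not change under SL_2 on the target, and twice a minor
    is at most the squared norm. This bounds the norm below without knowledge of the balancing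
    matrix. *)
Lemma cn2_minor d N W i j : (i <= d)%N -> (j <= d)%N -> i != j -> SL2 N ->
 2 * normR (W.1`_i * W.2`_j - W.1`_j * W.2`_i) <= cn2 d (pl N W).
move=> id jd ij /SL2E hN; set V := pl N W.
have <- : V.1`_i * V.2`_j - V.1`_j * V.2`_i = W.1`_i * W.2`_j - W.1`_j * W.2`_i.
 rewrite -[RHS]mul1r -hN /V !coefD !coefZ; ring.
have two (p : {poly C}) : nsq p`_i + nsq p`_j <= cn d p.
 have id' : (i < d.+1)%N by []. have jd' : (j < d.+1)%N by [].
 have ne : Ordinal jd' != Ordinal id' by rewrite eq_sym.
 rewrite /cn (bigD1 (Ordinal id')) //= lerD2l (bigD1 (Ordinal jd')) //= lerDl.
 by apply: sumr_ge0 => k _; exact: nsq_ge0.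
have am (x y : C) : 2 * normR (x * y) <= nsq x + nsq y.
 by rewrite normRM -!normR_sqr; have := sqr_ge0 (normR x - normR y); rewrite sqrrB; lra.
have t := normRD (V.1`_i * V.2`_j) (- (V.1`_j * V.2`_i)); rewrite normRN in t.
by have := am V.1`_i V.2`_j; have := am V.1`_j V.2`_i; have := two V.1; have := two V.2; rewrite /cn2; lra.
Qed.

Definition ul (z : Ch) : C * C :=
 let s := rC (Num.sqrt (nsq (lift1 z) + nsq (lift2 z)))^-1 in (s * lift1 z, s * lift2 z).

Lemma ul_unit z : nsq (ul z).1 + nsq (ul z).2 = 1.
have n0 : 0 < nsq (lift1 z) + nsq (lift2 z) by rewrite vn_gt0 lift_neq0.
by rewrite !nsqM -mulrDr nsq_real exprVn (sqr_sqrtr (ltW n0)) mulVf // gt_eqF.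
Qed.

Lemma hquo_ul z : hquo (ul z).1 (ul z).2 = z.
have n0 : 0 < nsq (lift1 z) + nsq (lift2 z) by rewrite vn_gt0 lift_neq0.
by rewrite hquoZ ?hquo_lift // negb_and invr_eq0 sqrtr_eq0 -ltNge n0.
Qed.

Definition rot (z : Ch) : 'M[C]_2 := uz (ul z).1 (ul z).2.

Lemma rot_su2 z : su2 (rot z). exact/uz_su2/ul_unit. Qed.

Lemma rot_SL2 z : SL2 (rot z). exact/su2_SL2/rot_su2. Qed.

Lemma hgeod_rot s z : hgeod s z = mpt (rot z *m dg s).
by rewrite -{1}(hquo_ul z) hgeod_mpt // ul_unit. Qed.

(** The lift of [f] in rotated charts that put [z] and [w] at 0. *)
Definition loc d (f : Ratd R d) (z w : Ch) : polpair := pl (inv2 (rot w)) (pr d (rot z) (rW f)).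

Lemma nz_loc d (f : Ratd R d) z w : nzW d (loc f z w).
apply: nz_pl; first exact/SL2_inv2/rot_SL2.
by apply: nz_pr; [exact: rot_SL2|exact: nz_rW].
Qed.

Lemma loc_coef0 d (f : Ratd R d) z : (loc f z (ratfun f z)).1`_0 = 0.
have [c0 c1] := coef0_pr d (ul z).1 (ul z).2 (rW f).
have nz : (hev d (rP f) (ul z).1 (ul z).2 != 0) || (hev d (rQ f) (ul z).1 (ul z).2 != 0).
 by apply: rat_nz; rewrite -vn_gt0 ul_unit.
have e : ratfun f z = hquo (hev d (rP f) (ul z).1 (ul z).2) (hev d (rQ f) (ul z).1 (ul z).2).
 by rewrite -{1}(hquo_ul z) ratfun_hquo // -vn_gt0 ul_unit.
have nw : ((ul (ratfun f z)).1 != 0) || ((ul (ratfun f z)).2 != 0) by rewrite -vn_gt0 ul_unit.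
have /eqP : hquo (ul (ratfun f z)).1 (ul (ratfun f z)).2 = ratfun f z := hquo_ul _.
rewrite {3}e hquo_eqP // => /eqP h.
rewrite /loc coefD !coefZ -/(rot z) c0 c1 !mk2E mulNr h; ring.
Qed.

Lemma cn2_loc_le d (f : Ratd R d) z w : cn2 d (loc f z w) <= chc d * 2 ^+ d * cn2 d (rW f).
rewrite (cn2_su2 _ _ (su2_inv2 (rot_su2 w))) -(su2_mn (rot_su2 z)).
by apply: cn2_pr_le; exact: nz_rW.
Qed.

Lemma loc_eval d (f : Ratd R d) z w (u : C) :
 mobius (inv2 (rot w)) (ratfun f (mobius (rot z) (Some u))) = hquo (loc f z w).1.[u] (loc f z w).2.[u].
have [s1 s2 _] := nz_loc f z w.
have := @sandwich_hquo d f (rot z) (inv2 (rot w)) u 1 (rot_SL2 z) (SL2_inv2 (rot_SL2 w)) (one_nz u).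
by rewrite hquo_some /sandwich -/(loc) !hev_one.
Qed.

Lemma loc_lower d (f : Ratd R d) z w (K : R) :
 (forall a b, nsq a + nsq b = 1 -> K <= nsq (hev d (rP f) a b) + nsq (hev d (rQ f) a b)) ->
 forall a b, nsq a + nsq b = 1 -> K <= nsq (hev d (loc f z w).1 a b) + nsq (hev d (loc f z w).2 a b).
move=> hK a b ab; rewrite /loc /= !hev_lin !hev_hcomp (su2_unitary (su2_inv2 (rot_su2 w))).
by apply: hK; rewrite (su2_unitary (rot_su2 z)).
Qed.

(** The first form has no constant term. At 0 the lower bound is therefore borne by the constant
    coefficient of the second form; at a zero of the second form it is borne by the first, which
    must then have a large coefficient of positive index. *)
Lemma loc_coef_ge d (f : Ratd R d) z (K : R) : (0 < d)%N ->
 (forall a b, nsq a + nsq b = 1 -> K <= nsq (hev d (rP f) a b) + nsq (hev d (rQ f) a b)) ->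
 let W := loc f z (ratfun f z) in
 K <= nsq W.2`_0 /\ exists2 j, (0 < j <= d)%N & K <= d.+1%:R ^+ 2 * nsq W.1`_j.
move=> d0 hK W; have low := loc_lower z (ratfun f z) hK; rewrite -/W in low.
have [s1 s2 nz] := nz_loc f z (ratfun f z); rewrite -/W in s1 s2 nz.
split.
 have := low 0 1; rewrite nsq0 nsq1 add0r !hev_zero !expr1n !mulr1 /W loc_coef0 nsq0 add0r.
 by apply.
have [a [b [ab q0]]] : exists a b : C, nsq a + nsq b = 1 /\ hev d W.2 a b = 0.
 have [qd|qd] := eqVneq W.2`_d 0.
  by exists 1, 0; rewrite nsq1 nsq0 addr0 hev_inf qd mul0r.
 have sz : size W.2 = d.+1.
  by apply/eqP; rewrite eqn_leq s2 ltnNge; apply: contra qd => h; rewrite nth_default.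
 have /closed_rootP[x /rootP hx] : size W.2 != 1%N by rewrite sz -lt0n.
 have n0 : 0 < nsq x + nsq (1 : C) by rewrite vn_gt0 oner_eq0 orbT.
 have [a [b [r [ab ea eb]]]] := normalize n0; exists a, b; split=> //.
 have : hev d W.2 x 1 = 0 by rewrite hev_one.
 rewrite ea eb hevZ => /eqP; rewrite mulf_eq0 => /orP[|/eqP//].
 rewrite expf_eq0 => /andP[_ /eqP r0]; move: n0; rewrite ea eb r0 !mul0r !nsq0 addr0 ltxx.
 by [].
have := low a b ab; rewrite q0 nsq0 addr0; have := hev_le a b s1; rewrite ab expr1n mulr1 => h1 h2.
have [m md hm] := nat_argmax (fun j => nsq W.1`_j) d.
have K1 : K <= d.+1%:R ^+ 2 * nsq W.1`_m.
 apply: le_trans h2 _; apply: le_trans h1 _; rewrite expr2 -mulrA ler_pM2l //.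
 by rewrite /cn sum_const_ord; apply: ler_sum => -[j jd] _; apply: hm.
case: m md hm K1 => [|m] md hm K1; last by exists m.+1.
exists 1%N; first by rewrite d0.
by apply: le_trans K1 _; rewrite ler_wpM2l // /W loc_coef0 nsq0.
Qed.

(** If at depth [s] the index [k] dominates the first form and the constant term the second, then
    [f] acts there like a monomial of degree [k]. The matrix moving by [S] towards f(z) is nearly
    balancing, and [bal_coercive] turns this into a bound on the distance to the barycenter. *)
Lemma bary_ray d : (0 < d)%N -> exists K : R, forall (f : Ratd R d) z s k X, (0 < k <= d)%N ->
 let W := loc f z (ratfun f z) in W.1`_k != 0 -> 1 <= X ->
 \sum_(j < d.+1) expR (- (2 * s * j%:R)) * nsq W.1`_j <= X * (expR (- (2 * s * k%:R)) * nsq W.1`_k) ->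
 \sum_(j < d.+1) expR (- (2 * s * j%:R)) * nsq W.2`_j <= X * nsq W.2`_0 ->
 hdist (bary_ext (ratfun f) (hgeod s z))
  (hgeod (s * k%:R + ln (normR W.2`_0 / normR W.1`_k)) (ratfun f z)) <= ln X + K.
move=> d0; have [c c0 hc] := @bal_coercive d; exists (- ln c) => f z s k X /andP[k0 kd] W pk X1 hP hQ.
have hU := rot_su2 z; have hV := rot_su2 (ratfun f z); set V := rot (ratfun f z) in hV.
set S := s * k%:R + _; rewrite !hgeod_rot -/V; set M := rot z *m dg s.
have hM : SL2 M := SL2_mul (su2_SL2 hU) (dg_SL2 s).
have [N [hN bN ->]] := bary_ext_bal f d0 hM.
pose B := pr d M (rW f); have nzB : nzW d B by apply: nz_pr => //; exact: nz_rW.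
have NB := nz_pl hN nzB.
have hVS : SL2 (V *m dg S) := SL2_mul (su2_SL2 hV) (dg_SL2 S).
have hN' := SL2_inv2 hVS; set N' := inv2 (V *m dg S) in hN'.
pose T := N' *m inv2 N; have hT : SL2 T := SL2_mul hN' (SL2_inv2 hN).
have TB : pl T (pl N B) = pl N' B by rewrite -(plM _ _ nzB) /T -mulmxA mul_inv2 // mulmx1.
have h1 := hc _ _ NB bN hT; rewrite TB in h1.
have [z1 z2 nzl] := nz_loc f z (ratfun f z); rewrite -/W in z1 z2 nzl.
have q0 : W.2`_0 != 0.
 have := nzl 0 1; rewrite oner_eq0 orbT => /(_ isT).
 by rewrite !hev_zero expr1n !mulr1 /W loc_coef0 eqxx.
have nzW1 : nzW d (pr d (rot z) (rW f)) by apply: nz_pr; [exact: rot_SL2|exact: nz_rW].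
have BW : pl (inv2 V) B = pr d (dg s) W by rewrite /B /M -prM -pr_pl.
pose B1 := pr d (dg s) W.
have BE : B = pl V B1 by rewrite /B1 -BW -(plM _ _ nzB) mul_inv2r ?pl1 //; exact: su2_SL2.
have nzB1 : nzW d B1 by apply: nz_pr; [exact: dg_SL2|split].
have coefB (p : {poly C}) j : (size p <= d.+1)%N -> (j <= d)%N ->
  nsq (hcomp d (dg s) p)`_j = expR (s * (d%:R - 2 * j%:R)) * nsq p`_j.
 move=> sp jd; rewrite coef_hcomp_diag // !nsqM !nsqX !nsq_real expR_half expRN_half !expRX -expRD.
 by congr (expR _ * _); rewrite natrB //; ring.
pose x := normR W.2`_0; pose y := normR W.1`_k.
have x0 : 0 < x by rewrite normR_gt0. have y0 : 0 < y by rewrite normR_gt0.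
pose E := expR (s * (d%:R - k%:R)); have E0 : 0 < E := expR_gt0 _.
(* The minor with indices 0 and [k] is a single product, because the constant term of the first form
   vanishes. *)
have low : 2 * (E * (x * y)) <= cn2 d (pl N B).
 have -> : pl N B = pl (N *m V) B1 by rewrite BE -(plM _ _ nzB1).
 apply: le_trans (cn2_minor B1 (leq0n d) kd _ (SL2_mul hN (su2_SL2 hV))); last by case: k k0 {kd pk hP S y y0 E E0 hVS hN' N' T hT TB h1}.
 have -> : B1.1`_0 = 0.
  by apply/eqP; rewrite -nsq_eq0 coefB // /W loc_coef0 nsq0 mulr0.
 rewrite mul0r sub0r normRN normRM ler_pM2l // le_eqVlt; apply/orP; left; apply/eqP.
 rewrite !normRE !coefB // mulr0 subr0 !sqrtrM // -!normRE -/x -/y.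
 have sE (t : R) : Num.sqrt (expR t) = expR (t / 2) by rewrite -expR_half sqrtr_sqr ger0_norm.
 rewrite !sE mulrACA -expRD /E [y * x]mulrC; congr (expR _ * _); field.
 by [].
have eS : expR S = expR (s * k%:R) * (x / y) by rewrite expRD lnK // posrE divr_gt0.
(* [S] is chosen so that, after moving the target, both forms have the same size [E * (x * y)]; this
   matches the lower bound up to the factor [X]. *)
have up : cn2 d (pl N' B) <= X * (2 * (E * (x * y))).
 have -> : pl N' B = pl (inv2 (dg S)) B1 by rewrite /N' inv2_mul (plM _ _ nzB) BW.
 rewrite /cn2 /pl !mk2E oppr0 !scale0r addr0 add0r !cnZ !nsq_real expR_half expRN_half !cn_hcomp_dg //.
 have fac (p : {poly C}) : \sum_(j < d.+1) expR (s * (d%:R - 2 * j%:R)) * nsq p`_j =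
   expR (s * d%:R) * \sum_(j < d.+1) expR (- (2 * s * j%:R)) * nsq p`_j.
  rewrite mulr_sumr; apply: eq_bigr => j _; rewrite mulrA -expRD; congr (expR _ * _); ring.
 rewrite !fac; have e0 := expR_gt0 (s * d%:R).
 have a1 : expR S * (expR (s * d%:R) * (\sum_(j < d.+1) expR (- (2 * s * j%:R)) * nsq W.1`_j)) <= X * (E * (x * y)).
  apply: (@le_trans _ _ (expR S * (expR (s * d%:R) * (X * (expR (- (2 * s * k%:R)) * nsq W.1`_k))))).
   by rewrite ler_pM2l ?expR_gt0 // ler_pM2l.
  rewrite eS le_eqVlt; apply/orP; left; apply/eqP; rewrite -normR_sqr -/y /E.
  have -> : s * (d%:R - k%:R) = s * k%:R + s * d%:R + - (2 * s * k%:R) by ring.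
  rewrite !expRD; move: (expR _) (expR _) (expR _) => e1 e2 e3; field; exact: lt0r_neq0.
 have a2 : expR (- S) * (expR (s * d%:R) * (\sum_(j < d.+1) expR (- (2 * s * j%:R)) * nsq W.2`_j)) <= X * (E * (x * y)).
  apply: (@le_trans _ _ (expR (- S) * (expR (s * d%:R) * (X * nsq W.2`_0)))).
   by rewrite ler_pM2l ?expR_gt0 // ler_pM2l.
  rewrite expRN eS invfM -expRN le_eqVlt; apply/orP; left; apply/eqP; rewrite -normR_sqr -/x /E.
  have -> : s * (d%:R - k%:R) = - (s * k%:R) + s * d%:R by ring.
  rewrite !expRD; move: (expR _) (expR _) => e1 e2; field; by rewrite !lt0r_neq0.
 by move: a1 a2; rewrite [X * (2 * _)]mulrCA; move: (X * _) => w; lra.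
have mT := mn_gt0 hT.
have XT : c * mn T <= X.
 have p0 : 0 < 2 * (E * (x * y)) by rewrite !mulr_gt0.
 rewrite -(ler_pM2r p0); apply: le_trans up; apply: le_trans h1.
 have cT : 0 <= c * mn T by apply: mulr_ge0; exact: ltW.
 by rewrite ler_wpM2l.
have /andP[_ u1] := hd_bnd (SL2_inv2 hN) hVS; apply: le_trans u1 _; rewrite /hd inv2K.
have -> : mn (N *m (V *m dg S)) = mn T by rewrite -(mn_inv2 T) /T inv2_mul inv2K /N' inv2K.
have X0 : 0 < X by lra.
by rewrite -ln_div // ler_ln ?posrE ?divr_gt0 // ler_pdivlMr // mulrC.
Qed.

(** * First order expansions with explicit constants in rotated charts *)

Lemma unit_powB2 (n : nat) (u v : C) : (0 < n)%N -> normR u <= 1 -> normR v <= 1 ->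
 normR (u ^+ n.+1 - v ^+ n.+1) <= n%:R * normR (u - v) * (normR u + normR v).
move=> n0 u1 v1; have -> : u ^+ n.+1 - v ^+ n.+1 = u * (u ^+ n - v ^+ n) + (u - v) * v ^+ n by rewrite !exprS; ring.
apply: le_trans (normRD _ _) _; rewrite !normRM normRX mulrDr; apply: lerD.
 by rewrite mulrC ler_wpM2r //; exact: unit_powB.
apply: ler_pM; rewrite ?exprn_ge0 //; first by rewrite ler_peMl // ler1n.
by rewrite -[leRHS]expr1; apply: ler_wiXn2l; rewrite ?normR_ge0.
Qed.

Section PolyBounds.
Variables (d : nat) (p : {poly C}) (A : R).
Hypotheses (sp : (size p <= d.+1)%N) (A0 : 0 <= A) (pA : forall j, normR p`_j <= A).
Let D : R := d.+1%:R ^+ 2.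

Lemma poly_sub0_le u : normR u <= 1 -> normR (p.[u] - p`_0) <= D * A * normR u.
move=> u1; rewrite (horner_coef_wide _ sp) big_ord_recl expr0 mulr1 addrC addKr.
apply: le_trans (normR_sum _) _; apply: (@le_trans _ _ (\sum_(i < d) A * normR u)).
 apply: ler_sum => i _; rewrite normRM normRX lift0; apply: ler_pM; rewrite ?exprn_ge0 //.
 by rewrite exprS ler_piMr // exprn_ile1.
rewrite -sum_const_ord mulrA !ler_wpM2r // /D -natrX ler_nat.
by rewrite (leq_trans (leqnSn d)) // leq_pmulr.
Qed.

Lemma poly_taylor1 u v : normR u <= 1 -> normR v <= 1 ->
 normR (p.[u] - p.[v] - p`_1 * (u - v)) <= D * A * normR (u - v) * (normR u + normR v).
move=> u1 v1; have e : p.[u] - p.[v] - p`_1 * (u - v) =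
  \sum_(i < d.+1) (p`_i * (u ^+ i - v ^+ i) - (if i == 1%N :> nat then p`_1 * (u - v) else 0)).
 rewrite (horner_coef_wide u sp) (horner_coef_wide v sp) -sumrB [RHS]sumrB; congr (_ - _).
  by apply: eq_bigr => i _; rewrite mulrBr.
 case: d sp => [|n] s.
  by rewrite big_ord1 nth_default // mul0r.
 by rewrite (bigD1 (lift ord0 ord0)) //= big1 ?addr0 // => i; rewrite -val_eqE => /negbTE ->.
rewrite e; apply: le_trans (normR_sum _) _.
have X0 : 0 <= normR (u - v) * (normR u + normR v) by rewrite mulr_ge0 ?addr_ge0.
apply: (@le_trans _ _ (\sum_(i < d.+1) d.+1%:R * A * (normR (u - v) * (normR u + normR v)))); last first.
 by rewrite -sum_const_ord /D !mulrA.
apply: ler_sum => -[[|[|i]] hi] _ /=.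
- by rewrite subrr mulr0 subrr normR0 mulr_ge0 // mulr_ge0.
- by rewrite subrr normR0 mulr_ge0 // mulr_ge0.
rewrite subr0 normRM; apply: (@le_trans _ _ (A * (d.+1%:R * normR (u - v) * (normR u + normR v)))); last first.
 by apply: eqR_le; ring.
apply: ler_pM; rewrite //; apply: le_trans (unit_powB2 _ u1 v1) _ => //.
by rewrite !ler_wpM2r ?addr_ge0 // ler_nat ltnW // ltnW.
Qed.

End PolyBounds.

Lemma quot_norm_bound (D A s a1 a2 a3 a4 a5 a6 a7 a8 a9 h : R) : 1 <= D -> 1 <= A -> 0 <= s -> 0 <= h ->
 0 <= a1 <= A -> 0 <= a2 <= D * A * s -> 0 <= a3 <= D * A * s -> 0 <= a4 <= A -> 0 <= a5 <= 2 * A ^+ 2 -> 0 <= a6 <= 3 * (D * A * s) ->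
 0 <= a7 <= D * A * h * s -> 0 <= a8 <= 2 -> 0 <= a9 <= 2 * A ->
 h * (a1 * a2 + a3 * a4 + a5 * a6) + (a7 * a8 + a9 * a7) <= 12 * D * A ^+ 3 * h * s.
move=> D1 A1 s0 h0 /andP[p1 q1] /andP[p2 q2] /andP[p3 q3] /andP[p4 q4] /andP[p5 q5] /andP[p6 q6] /andP[p7 q7] /andP[p8 q8] /andP[p9 q9].
have A0 : 0 <= A by exact: le_trans ler01 A1.
have D0 : 0 <= D by exact: le_trans ler01 D1.
have h1 := ler_pM p1 p2 q1 q2; have h2 := ler_pM p3 p4 q3 q4; have h3 := ler_pM p5 p6 q5 q6.
have h4 := ler_pM p7 p8 q7 q8; have h5 := ler_pM p9 p7 q9 q7.
have t1 : 0 <= D * s * h by rewrite !mulr_ge0.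
have t2 : A ^+ 2 <= A ^+ 3 by rewrite ler_peMl // exprn_ge0.
have t3 : A <= A ^+ 2 by rewrite ler_peMl.
have h123 : h * (a1 * a2 + a3 * a4 + a5 * a6) <= h * (A * (D * A * s) + D * A * s * A + 2 * A ^+ 2 * (3 * (D * A * s))).
 by rewrite ler_wpM2l // !lerD.
have T2 := ler_wpM2l t1 t2; have T3 := ler_wpM2l t1 t3.
have e1 : h * (A * (D * A * s) + D * A * s * A + 2 * A ^+ 2 * (3 * (D * A * s))) = 2 * (D * s * h * A ^+ 2) + 6 * (D * s * h * A ^+ 3) by ring.
have e2 : D * A * h * s * 2 = 2 * (D * s * h * A) by ring.
have e3 : 2 * A * (D * A * h * s) = 2 * (D * s * h * A ^+ 2) by ring.
have e4 : 12 * D * A ^+ 3 * h * s = 12 * (D * s * h * A ^+ 3) by ring.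
rewrite e4; rewrite e1 in h123; rewrite e2 in h4; rewrite e3 in h5.
move: h123 h4 h5 T2 T3; move: (D * s * h * A ^+ 3) (D * s * h * A ^+ 2) (D * s * h * A) => x y z.
move: (h * _) (a7 * _) (a9 * _) => b1 b2 b3; clear; lra.
Qed.

(** On a disc of radius (2 D A)^-1 the denominator stays within 1/2 of 1. The differences of
    numerator and denominator are expanded to first order, and the factor 48 is 12 from
    [quot_norm_bound] times 4 from the two denominators. *)
Lemma quot_taylor d (p q : {poly C}) (A : R) (u v : C) : let D := d.+1%:R ^+ 2 in let l := p`_1 - p`_0 * q`_1 in
 (size p <= d.+1)%N -> (size q <= d.+1)%N -> 1 <= A -> (forall j, normR p`_j <= A) -> (forall j, normR q`_j <= A) ->
 q`_0 = 1 -> normR u <= (2 * D * A)^-1 -> normR v <= (2 * D * A)^-1 ->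
 q.[u] != 0 /\ normR (p.[u] / q.[u] - p.[v] / q.[v] - l * (u - v)) <= 48 * D * A ^+ 3 * normR (u - v) * (normR u + normR v).
move=> D l sp sq A1 pA qA q0 hu hv.
have A0 : 0 <= A by exact: le_trans ler01 A1.
have D1 : 1 <= D by rewrite -[leLHS](expr1n _ 2) ler_sqr ?nnegrE // ler1n.
have DA1 : 1 <= D * A by rewrite -[leLHS]mulr1 ler_pM.
have DA0 : 0 < D * A by exact: lt_le_trans DA1.
have i1 : (2 * D * A)^-1 <= 1 by rewrite invf_le1 -mulrA; [rewrite -[leLHS]mulr1 ler_pM // ler1n|pos].
have hf (w : C) : normR w <= (2 * D * A)^-1 -> D * A * normR w <= 1 / 2.
 by rewrite -mulrA invfM => h; rewrite mulrC -ler_pdivlMr // mul1r.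
have u1 := le_trans hu i1; have v1 := le_trans hv i1.
have qu := poly_sub0_le sq A0 qA u1; have qv := poly_sub0_le sq A0 qA v1; have pv := poly_sub0_le sp A0 pA v1.
rewrite -/D q0 in qu qv pv; have fu := hf _ hu; have fv := hf _ hv.
have Xp := poly_taylor1 sp A0 pA u1 v1; have Xq := poly_taylor1 sq A0 qA u1 v1; rewrite -/D in Xp Xq.
have half (w : C) : normR (w - 1) <= 1 / 2 -> 1 / 2 <= normR w.
 by move=> h; have := normRB_ge 1 w; rewrite normR1 normRB => h'; lra.
have two (w : C) : normR (w - 1) <= 1 / 2 -> normR w <= 2.
 by move=> h; have := normRD (w - 1) 1; rewrite subrK normR1 => h'; lra.
have hqu := half _ (le_trans qu fu); have hqv := half _ (le_trans qv fv).
have nzu : q.[u] != 0 by rewrite -normR_gt0; lra.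
have nzv : q.[v] != 0 by rewrite -normR_gt0; lra.
split=> //; pose s := normR u + normR v; pose h := u - v.
pose N := h * (p`_1 * (q.[v] - 1) - (p.[v] - p`_0) * q`_1 - l * (q.[u] * q.[v] - 1)) +
 ((p.[u] - p.[v] - p`_1 * h) * q.[v] - p.[v] * (q.[u] - q.[v] - q`_1 * h)).
have e : p.[u] / q.[u] - p.[v] / q.[v] - l * (u - v) = N / (q.[u] * q.[v]).
 by rewrite /N /l /h; field; rewrite nzv.
have s0 : 0 <= s by pos.
have us : normR u <= s by rewrite lerDl.
have vs : normR v <= s by rewrite lerDr.
have pv2 : normR p.[v] <= 2 * A.
 have := normRD (p.[v] - p`_0) p`_0; rewrite subrK => h1; have := pA 0%N; have := le_trans pv fv; lra.
have lA : normR l <= 2 * A ^+ 2.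
 apply: le_trans (normRD _ _) _; rewrite normRN normRM; have h1 := ler_pM (normR_ge0 _) (normR_ge0 _) (pA 0%N) (qA 1%N).
 have := pA 1%N; have : A <= A ^+ 2 by rewrite ler_peMl.
 rewrite -expr2 in h1; lra.
have qq : normR (q.[u] * q.[v] - 1) <= 3 * (D * A * s).
 have -> : q.[u] * q.[v] - 1 = (q.[u] - 1) * q.[v] + (q.[v] - 1) by ring.
 apply: le_trans (normRD _ _) _; rewrite normRM.
 have h1 := ler_pM (normR_ge0 _) (normR_ge0 _) qu (two _ (le_trans qv fv)).
 have h2 := ler_wpM2l (ltW DA0) us; have h3 := ler_wpM2l (ltW DA0) vs; lra.
have hN : normR N <= 12 * D * A ^+ 3 * normR h * s.
 apply: le_trans _ (@quot_norm_bound D A s (normR p`_1) (normR (q.[v] - 1)) (normR (p.[v] - p`_0)) (normR q`_1)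
  (normR l) (normR (q.[u] * q.[v] - 1)) (D * A * normR h * s) (normR q.[v]) (normR p.[v]) (normR h) D1 A1 s0 (normR_ge0 _) _ _ _ _ _ _ _ _ _);
  rewrite ?normR_ge0 //=; first last.
 - by rewrite two // (le_trans qv).
 - by rewrite lexx mulr_ge0 // mulr_ge0 // ltW.
 - by apply: le_trans pv _; rewrite ler_wpM2l // ltW.
 - by apply: le_trans qv _; rewrite ler_wpM2l // ltW.
 apply: le_trans (normRD _ _) _; apply: lerD.
  rewrite normRM ler_wpM2l //; apply: le_trans (normRD _ _) _; rewrite normRN normRM lerD2r.
  by apply: le_trans (normRD _ _) _; rewrite normRN !normRM.
 apply: le_trans (normRD _ _) _; rewrite normRN !normRM; apply: lerD.
  by rewrite ler_wpM2r.
 by rewrite ler_wpM2l.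
rewrite e normR_div ler_pdivrMr; last by rewrite normR_gt0 mulf_neq0.
apply: le_trans hN _; rewrite normRM.
have h4 : 1 / 2 * (1 / 2) <= normR q.[u] * normR q.[v] by rewrite ler_pM.
have T0 : 0 <= 12 * D * A ^+ 3 * normR h * s by rewrite !mulr_ge0.
have := ler_wpM2l T0 h4; have -> : 48 * D * A ^+ 3 * normR (u - v) * (normR u + normR v) = 4 * (12 * D * A ^+ 3 * normR h * s).
 by rewrite /h /s; ring.
rewrite -[4 * _ * _]mulrA; move: (12 * D * A ^+ 3 * normR h * s) (normR q.[u] * normR q.[v]) => x y.
by move: (x * y) => t; clear; lra.
Qed.

(** The chart is a rotation, hence a chordal isometry, so estimates in it carry over to the sphere
    without distortion depending on [z]. *)
Definition fchart (z : Ch) (u : C) : Ch := mobius (rot z) (Some u : Ch).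

Lemma fchart0 z : fchart z 0 = z.
rewrite /fchart /= !mulr0 !add0r -[RHS]hquo_ul /rot /uz !mk2E.
by [].
Qed.

Lemma fchart_solve w (y : Ch) (v : C) : mobius (inv2 (rot w)) y = Some v -> y = fchart w v.
move=> h; rewrite /fchart -h -mobiusM; last exact/SL2_inv2/rot_SL2.
by rewrite mul_inv2r ?mobius1 //; exact: rot_SL2.
Qed.

(* In the charts centred at z and w, g has derivative l at 0 up to a quadratic
  error, and moves 0 by at most eta; A bounds all other constants at once. *)
Definition expands (g : Ch -> Ch) (z w : Ch) (l : C) (eta A : R) : Prop :=
 [/\ 1 <= A, normR l <= A & exists G : C -> C, [/\
  forall u, normR u <= A^-1 -> g (fchart z u) = fchart w (G u), normR (G 0) <= eta &
  forall u v, normR u <= A^-1 -> normR v <= A^-1 ->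
   normR (G u - G v - l * (u - v)) <= A * normR (u - v) * (normR u + normR v)]].

Lemma expands_mono g z w l eta A A' : A <= A' -> expands g z w l eta A -> expands g z w l eta A'.
move=> AA [A1 lA [G [h1 h2 h3]]]; have i : A'^-1 <= A^-1 by rewrite lef_pV2 ?posrE; lra.
split; [exact: le_trans AA|exact: le_trans AA|exists G; split=> //].
 by move=> u hu; apply: h1; exact: le_trans i.
move=> u v hu hv; apply: le_trans (h3 _ _ (le_trans hu i) (le_trans hv i)) _.
by rewrite !ler_wpM2r ?addr_ge0.
Qed.

Lemma expands_id z : expands id z z 1 0 1.
split=> //; first by rewrite normR1.
exists id; split=> //; first by rewrite normR0.
by move=> u v _ _; rewrite mul1r subrr normR0 !mulr_ge0 ?addr_ge0.
Qed.

(** The first map must fix the centre of the chart exactly (error 0) for the quadratic error to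
    persist; only the last one may displace it. The constant is 9 A^3 from inserting the 3 A -
    Lipschitz first map plus A^2 from the linear part. *)
Lemma expands_comp g1 g2 z w y l1 l2 eta A : expands g1 z w l1 0 A -> expands g2 w y l2 eta A ->
 expands (g2 \o g1) z y (l2 * l1) eta (10 * A ^+ 3).
move=> [A1 lA1 [G1 [f1 z1 e1]]] [_ lA2 [G2 [f2 z2 e2]]].
have A0 : 0 < A by exact: lt_le_trans A1.
have A23 : A ^+ 2 <= A ^+ 3 by rewrite ler_peMl ?exprn_ge0 // ltW.
have A12 : A <= A ^+ 2 by rewrite ler_peMl // ltW.
have A3 : 0 < A ^+ 3 by pos.
have d1 : (10 * A ^+ 3)^-1 <= (3 * A ^+ 2)^-1.
 by rewrite lef_pV2 ?posrE ?mulr_gt0 //; move: (A ^+ 3) (A ^+ 2) A3 A23 => *; lra.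
have d2 : (10 * A ^+ 3)^-1 <= A^-1.
 by rewrite lef_pV2 ?posrE ?mulr_gt0 //; move: (A ^+ 3) (A ^+ 2) A3 A23 A12 => *; lra.
have z10 : G1 0 = 0 by apply/eqP; rewrite -normR_eq0 eq_le z1 normR_ge0.
have lip u v : normR u <= A^-1 -> normR v <= A^-1 -> normR (G1 u - G1 v) <= 3 * A * normR (u - v).
 move=> hu hv; have h := e1 _ _ hu hv; have := normRD (G1 u - G1 v - l1 * (u - v)) (l1 * (u - v)).
 rewrite subrK normRM => h2; apply: le_trans h2 _.
 have h3 : A * normR (u - v) * (normR u + normR v) <= A * normR (u - v) * (A^-1 + A^-1).
  by rewrite ler_wpM2l ?lerD // mulr_ge0 // ltW.
 have e : A * normR (u - v) * (A^-1 + A^-1) = 2 * normR (u - v) by field; exact: lt0r_neq0.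
 rewrite e in h3; have h4 := ler_wpM2r (normR_ge0 (u - v)) lA1.
 have h5 := ler_wpM2r (normR_ge0 (u - v)) A1.
 have h6 := le_trans h h3; rewrite mul1r in h5; move: h4 h5 h6.
 by move: (normR (u - v)) (normR (G1 u - G1 v - _)) (normR l1 * _) => b c e'; clear; lra.
have small u : normR u <= (10 * A ^+ 3)^-1 -> normR (G1 u) <= 3 * A * normR u /\ normR (G1 u) <= A^-1.
 move=> hu; have h := lip u 0 (le_trans hu d2); rewrite z10 !subr0 normR0 in h.
 have h1 : normR (G1 u) <= 3 * A * normR u by apply: h; rewrite invr_ge0 ltW.
 split=> //; apply: le_trans h1 _; rewrite -ler_pdivlMl ?mulr_gt0 // -invfM.
 by apply: le_trans hu _; apply: le_trans d1 _; rewrite mulrA.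
split.
- by move: A12 A23; move: (A ^+ 2) (A ^+ 3) => *; lra.
- rewrite normRM; apply: le_trans (ler_pM (normR_ge0 _) (normR_ge0 _) lA2 lA1) _; rewrite -expr2.
 by move: (A ^+ 3) (A ^+ 2) A3 A23 => *; lra.
exists (G2 \o G1); split=> [u hu||u v hu hv] /=.
- by rewrite f1 ?(le_trans hu) // f2; have [] := small u hu.
- by rewrite z10.
have hu' := le_trans hu d2; have hv' := le_trans hv d2.
have [su su'] := small u hu; have [sv sv'] := small v hv.
have -> : G2 (G1 u) - G2 (G1 v) - l2 * l1 * (u - v) = (G2 (G1 u) - G2 (G1 v) - l2 * (G1 u - G1 v)) + l2 * (G1 u - G1 v - l1 * (u - v)) by ring.
apply: le_trans (normRD _ _) _; rewrite normRM.
have h1 := e2 _ _ su' sv'; have h2 := e1 _ _ hu' hv'; have h3 := lip _ _ hu' hv'.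
have h4 := ler_pM (normR_ge0 _) (normR_ge0 _) lA2 h2.
have s3 := lerD su sv; rewrite -mulrDr in s3.
have B1 : A * normR (G1 u - G1 v) * (normR (G1 u) + normR (G1 v)) <= A * (3 * A * normR (u - v)) * (3 * A * (normR u + normR v)).
 apply: ler_pM => //; rewrite ?addr_ge0 //; first by pos.
 by rewrite ler_wpM2l // ltW.
have X0 : 0 <= normR (u - v) * (normR u + normR v) by rewrite mulr_ge0 ?addr_ge0.
have X := ler_wpM2r X0 A23.
move: h1 h4 B1 X; move: (normR (G2 _ - _ - _)) (normR l2 * _) (A * normR (G1 u - _) * _) => x1 x2 x3.
move: (normR (u - v)) (normR u + normR v) => p q; clear; lra.
Qed.

Lemma expands_poly d (P Q : {poly C}) g z w (A : R) : (size P <= d.+1)%N -> (size Q <= d.+1)%N -> Q`_0 != 0 -> 1 <= A ->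
 (forall j, normR P`_j <= A * normR Q`_0) -> (forall j, normR Q`_j <= A * normR Q`_0) ->
 (forall u, mobius (inv2 (rot w)) (g (fchart z u)) = hquo P.[u] Q.[u]) ->
 expands g z w ((P`_1 * Q`_0 - P`_0 * Q`_1) / Q`_0 ^+ 2) (normR (P`_0 / Q`_0)) (48 * d.+1%:R ^+ 2 * A ^+ 3).
move=> sP sQ q0 A1 hP hQ hg; pose D : R := d.+1%:R ^+ 2.
have A0 : 0 < A by exact: lt_le_trans A1.
have D1 : 1 <= D by rewrite -[leLHS](expr1n _ 2) ler_sqr ?nnegrE // ler1n.
pose p := (Q`_0)^-1 *: P; pose q := (Q`_0)^-1 *: Q.
have q0n : 0 < normR Q`_0 by rewrite normR_gt0.
have pA j : normR p`_j <= A by rewrite coefZ normRM normRV mulrC ler_pdivrMr.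
have qA j : normR q`_j <= A by rewrite coefZ normRM normRV mulrC ler_pdivrMr.
have sp : (size p <= d.+1)%N by apply: leq_trans sP; exact: size_scale_leq.
have sq : (size q <= d.+1)%N by apply: leq_trans sQ; exact: size_scale_leq.
have qq0 : q`_0 = 1 by rewrite coefZ mulVf.
have A23 : A ^+ 2 <= A ^+ 3 by rewrite ler_peMl ?exprn_ge0 // ltW.
have A12 : A <= A ^+ 2 by rewrite ler_peMl // ltW.
have DA3 : A ^+ 3 <= D * A ^+ 3 by rewrite ler_peMl // exprn_ge0 // ltW.
have lE : (P`_1 * Q`_0 - P`_0 * Q`_1) / Q`_0 ^+ 2 = p`_1 - p`_0 * q`_1 by rewrite !coefZ; field.
have i1 : (48 * D * A ^+ 3)^-1 <= (2 * D * A)^-1.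
 have D0 : 0 < D by exact: lt_le_trans D1.
 have h := ler_wpM2l (ltW D0) (le_trans A12 A23); have h' : 0 < D * A by pos.
 rewrite -[48 * D * _]mulrA -[2 * D * _]mulrA lef_pV2 ?posrE ?mulr_gt0 //.
 by move: h h'; move: (D * A) (D * A ^+ 3) => x y; clear; lra.
have Gp u : P.[u] / Q.[u] = p.[u] / q.[u].
 by rewrite !hornerZ -mulf_div divff ?invr_eq0 // mul1r.
rewrite lE; split.
- by rewrite -/D; move: (A ^+ 2) (A ^+ 3) (D * A ^+ 3) (mulrA 48 D (A ^+ 3)) A12 A23 DA3 => a b c <- *; lra.
- apply: le_trans (normRD _ _) _; rewrite normRN normRM.
 have := ler_pM (normR_ge0 _) (normR_ge0 _) (pA 0%N) (qA 1%N); have := pA 1%N; rewrite -expr2 -/D.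
 by move: (A ^+ 2) (A ^+ 3) (D * A ^+ 3) (mulrA 48 D (A ^+ 3)) A12 A23 DA3 => a b c <- *; lra.
exists (fun u => P.[u] / Q.[u]); split=> [u hu||u v hu hv].
- apply: fchart_solve; rewrite hg /hquo ifF //; apply/negbTE.
 have [qu _] := quot_taylor sp sq A1 pA qA qq0 (le_trans hu i1) (le_trans hu i1).
 by apply: contraNN qu => /eqP e; rewrite hornerZ e mulr0.
- by rewrite !horner_coef0.
rewrite !Gp; have [_] := quot_taylor sp sq A1 pA qA qq0 (le_trans hu i1) (le_trans hv i1).
by rewrite -/D.
Qed.

(** The derivative of [f] at [z] in the charts centred at [z] and at its image; it also depends on
    the chosen unit lifts, but only by a phase. *)
Definition lamf d (f : Ratd R d) (z : Ch) : C :=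
 (loc f z (ratfun f z)).1`_1 / (loc f z (ratfun f z)).2`_0.

Lemma loc_coef0_neq0 d (f : Ratd R d) z : (loc f z (ratfun f z)).2`_0 != 0.
have [_ _ h] := nz_loc f z (ratfun f z); have := h 0 1; rewrite oner_eq0 orbT => /(_ isT).
by rewrite !hev_zero !expr1n !mulr1 loc_coef0 eqxx.
Qed.

Lemma expands_rat d (f : Ratd R d) z (A : R) : let W := loc f z (ratfun f z) in 1 <= A ->
 (forall j, (j <= d)%N -> normR W.1`_j <= A * normR W.2`_0 /\ normR W.2`_j <= A * normR W.2`_0) ->
 expands (ratfun f) z (ratfun f z) (lamf f z) 0 (48 * d.+1%:R ^+ 2 * A ^+ 3).
move=> W A1 hA; have [s1 s2 _] := nz_loc f z (ratfun f z); rewrite -/W in s1 s2.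
have q0 := loc_coef0_neq0 f z; rewrite -/W in q0; have p0 : W.1`_0 = 0 by exact: loc_coef0.
have big j : (d < j)%N -> W.1`_j = 0 /\ W.2`_j = 0.
 by move=> dj; rewrite !nth_default //; exact: leq_trans dj.
have X0 : 0 <= A * normR W.2`_0 by rewrite mulr_ge0 // (le_trans ler01).
have h1 j : normR W.1`_j <= A * normR W.2`_0.
 by have [/hA[]|/big[-> _]] := leqP j d; rewrite ?normR0.
have h2 j : normR W.2`_j <= A * normR W.2`_0.
 by have [/hA[]|/big[_ ->]] := leqP j d; rewrite ?normR0.
have ev u : mobius (inv2 (rot (ratfun f z))) (ratfun f (fchart z u)) = hquo W.1.[u] W.2.[u] by exact: loc_eval.
have := expands_poly s1 s2 q0 A1 h1 h2 ev; rewrite p0 !mul0r subr0 normR0.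
suff -> : W.1`_1 * W.2`_0 / W.2`_0 ^+ 2 = lamf f z by [].
by rewrite /lamf -/W; field.
Qed.

Lemma expands_rat_ex d (f : Ratd R d) z : exists A, expands (ratfun f) z (ratfun f z) (lamf f z) 0 A.
pose W := loc f z (ratfun f z); have q0 := loc_coef0_neq0 f z; rewrite -/W in q0.
have q1 : 0 < normR W.2`_0 by rewrite normR_gt0.
have [s1 s2 _] := nz_loc f z (ratfun f z); rewrite -/W in s1 s2.
pose B := Num.sqrt (cn d W.1) + Num.sqrt (cn d W.2).
have B0 : 0 <= B by rewrite addr_ge0.
exists (48 * d.+1%:R ^+ 2 * (1 + B / normR W.2`_0) ^+ 3); apply: expands_rat.
 by rewrite lerDl divr_ge0.
move=> j jd; rewrite -/W mulrDl mul1r divfK ?gt_eqF //; have q2 := ltW q1.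
have h1 := coef_le_cn j s1; have h2 := coef_le_cn j s2.
have := sqrtr_ge0 (cn d W.1); have := sqrtr_ge0 (cn d W.2); rewrite /B.
by move: h1 h2 q2; move: (normR _) (normR _) (normR _) (Num.sqrt _) (Num.sqrt _) => *; split; lra.
Qed.

Definition lamn d (f : Ratd R d) (z : Ch) (q : nat) : C := \prod_(j < q) lamf f (iter j (ratfun f) z).

Lemma expands_iter d (f : Ratd R d) z q : exists A, expands (iter q (ratfun f)) z (iter q (ratfun f) z) (lamn f z q) 0 A.
elim: q => [|q [A IH]].
 by exists 1; rewrite /lamn big_ord0; exact: expands_id.
have [B hB] := expands_rat_ex f (iter q (ratfun f) z).
exists (10 * (Num.max A B) ^+ 3); rewrite /lamn big_ord_recr /= mulrC.
apply: (@expands_comp (iter q (ratfun f)) (ratfun f)); [apply: expands_mono IH|apply: expands_mono hB].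
 by rewrite le_max lexx.
by rewrite le_max lexx orbT.
Qed.

Lemma mobius_su2_chordal (U : 'M[C]_2) (x y : Ch) : su2 U -> chordal (mobius U x) (mobius U y) = chordal x y.
move=> hU; have [a [b [ab0 <- ab]]] := hquo_surj x; have [c [e [ce0 <- ce]]] := hquo_surj y.
rewrite !mobius_hquo // !chordal_hquo1 //; [|by rewrite (su2_unitary hU)|by rewrite (su2_unitary hU)].
congr (_ * normR _); have /SL2E h := su2_SL2 hU.
transitivity ((U 0 0 * U 1 1 - U 0 1 * U 1 0) * (a * e - b * c)); first by ring.
by rewrite h mul1r.
Qed.

Lemma chordal_fchart z u v : chordal (fchart z u) (fchart z v) = chordal (Some u : Ch) (Some v).
by apply: mobius_su2_chordal; exact: rot_su2. Qed.

Lemma chordal_some_ge (u v : C) : normR u <= 1 -> normR v <= 1 -> normR (u - v) <= chordal (Some u : Ch) (Some v).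
move=> u1 v1; rewrite -ler_sqr ?nnegrE // chordal_some normR_sqr.
have U1 : nsq u <= 1 by rewrite -normR_sqr expr_le1.
have V1 : nsq v <= 1 by rewrite -normR_sqr expr_le1.
have U0 := nsq_ge0 u; have V0 := nsq_ge0 v.
rewrite ler_pdivlMr; last by rewrite mulr_gt0 // ltr_wpDr.
rewrite mulrC ler_wpM2r //; have : (1 + nsq u) * (1 + nsq v) <= 2 * 2 by apply: ler_pM; lra.
by move: (_ * _) => x; lra.
Qed.

(** Used to return to the chart at [z] from the chart at a nearby iterate. The change of chart is an
    element of SU(2) with first row [(a, b)]; its derivative has modulus |a|^-2 >= 1, and 1536 is 48
    * 2^2 * 2^3 from [expands_poly]. *)
Lemma expands_id_near (z' z : Ch) : chordal z' z <= 1 -> exists l : C, 1 <= normR l /\ expands id z' z l (2 * chordal z' z) 1536.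
move=> h1; pose M := inv2 (rot z) *m rot z'.
have hM : su2 M.
 apply: mn2_su2; first by apply: SL2_mul; [apply: SL2_inv2|]; exact: rot_SL2.
 by rewrite (mn_mul_su2 _ (rot_su2 z')) mn_inv2 su2_mn //; exact: rot_su2.
have [m11 m10 m1] := hM; set a := M 0 0 in m11 m1; set b := M 0 1 in m10 m1.
have eb : chordal z' z = 2 * normR b.
 rewrite -[in LHS](hquo_ul z') -[in LHS](hquo_ul z) chordal_hquo1 ?ul_unit //; congr (_ * _).
 by rewrite /b /M mulmx2E /inv2 /rot /uz !mk2E; congr normR; ring.
have b2 : normR b <= 1 / 2 by lra.
have B2 : nsq b <= 1 / 4.
 by have := ler_pM (normR_ge0 b) (normR_ge0 b) b2 b2; rewrite -expr2 normR_sqr; lra.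
have A1 : normR a <= 1 by rewrite -(@expr_le1 _ 2) // normR_sqr; have := nsq_ge0 b; lra.
have A2 : 1 / 2 <= normR a.
 by rewrite -ler_sqr ?nnegrE // normR_sqr; lra.
have a0 : a != 0 by rewrite -normR_gt0; lra.
have ca0 : a^* != 0 by rewrite conjC_eq0.
pose P := linp a b; pose Q := linp (- b^*) (a^*).
have cP : (P`_0 = b) * (P`_1 = a) by rewrite /P /linp !coefD !coefZ !coefX !coefC mulr0 mulr1 add0r addr0.
have cQ : (Q`_0 = a^*) * (Q`_1 = - b^*) by rewrite /Q /linp !coefD !coefZ !coefX !coefC mulr0 mulr1 add0r addr0.
have s2 := size_linp a b; have s3 := size_linp (- b^*) (a^*).
have hP j : normR P`_j <= 2 * normR Q`_0.
 case: j => [|[|j]]; rewrite ?cP ?cQ normR_conj; [lra|lra|].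
 by rewrite nth_default ?normR0 ?(leq_trans s2) //; lra.
have hQ j : normR Q`_j <= 2 * normR Q`_0.
 case: j => [|[|j]]; rewrite ?cQ ?normRN ?normR_conj; [lra|lra|].
 by rewrite nth_default ?normR0 ?(leq_trans s3) //; lra.
have ev u : mobius (inv2 (rot z)) (id (fchart z' u)) = hquo P.[u] Q.[u].
 rewrite /fchart -mobiusM; last exact: rot_SL2.
 by rewrite -/M /= m11 m10 -/a -/b /P /Q /linp !hornerE.
have q0 : Q`_0 != 0 by rewrite cQ.
have := @expands_poly 1 P Q id z' z 2 s2 s3 q0 _ hP hQ ev; rewrite !cP !cQ => h.
exists ((a * a^* - b * - b^*) / a^* ^+ 2); split.
 have -> : a * a^* - b * - b^* = 1.
  by rewrite mulrN opprK !conj_mulC; apply: complexP; rewrite !reim // addr0.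
 rewrite mul1r normRV normRX normR_conj invf_ge1 ?exprn_gt0 ?(lt_le_trans _ A2) //.
 by rewrite expr_le1.
have [|x1 x2 [G [g1 g2 g3]]] := h; first by rewrite ler1n.
have e : 48 * 2%:R ^+ 2 * 2 ^+ 3 = 1536 :> R by rewrite !exprS; ring.
rewrite e in x1 x2 g1 g3; split=> //; exists G; split=> //; apply: le_trans g2 _.
rewrite normR_div normR_conj eb ler_pdivrMr ?(lt_le_trans _ A2) //.
have := ler_wpM2l (normR_ge0 b) A2; move: (normR b) (normR a) (normR_ge0 b) => x y x0; lra.
Qed.

(** * Periodic points: repelling ones nearby, attracting ones, multipliers, finiteness *)

Lemma eq0_small (x : R) : 0 <= x -> (forall e, 0 < e -> x <= 3 * e) -> x = 0.
move=> x0 h; apply/eqP; rewrite eq_le x0 andbT leNgt; apply/negP => xp.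
by have := h (x / 4) (divr_gt0 xp (ltr0n _ 4)); lra.
Qed.

(** Successive iterates approach each other geometrically; a cluster point in the compact disc must
    then be fixed. *)
Lemma contraction_fixpoint (T : C -> C) (rho : R) : 0 <= rho -> normR (T 0) <= rho / 2 ->
 (forall u v, normR u <= rho -> normR v <= rho -> normR (T u - T v) <= normR (u - v) / 2) ->
 exists2 p, normR p <= rho & T p = p.
move=> r0 T0 hT.
have self u : normR u <= rho -> normR (T u) <= rho.
 move=> hu; have z0 : normR (0 : C) <= rho by rewrite normR0.
 have := hT u 0 hu z0; rewrite subr0 => h1; have := normRD (T u - T 0) (T 0); rewrite subrK => h2; lra.
pose x n := iter n T 0; have xr n : normR (x n) <= rho.
 by elim: n => [|n IH]; [rewrite normR0|exact: self].
have step n : 2 ^+ n * normR (x n.+1 - x n) <= rho.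
 elim: n => [|n IH]; first by rewrite expr0 mul1r /x /= subr0; lra.
 by have := hT _ _ (xr n.+1) (xr n); rewrite exprSr -mulrA => h; apply: le_trans IH; rewrite ler_wpM2l ?exprn_ge0 //; lra.
have near0 e : 0 < e -> exists N : nat, forall n, (N <= n)%N -> normR (x n.+1 - x n) <= e.
 move=> e0; exists (Num.bound (rho / e)) => n hn; have := step n => h.
 have h1 : rho / e < 2 ^+ n.
  apply: lt_trans (archi_boundP (divr_ge0 r0 (ltW e0))) _; rewrite -natrX ltr_nat.
  by apply: leq_ltn_trans hn _; exact: ltn_expl.
 rewrite ltr_pdivrMr // in h1; rewrite -(@ler_pM2l _ (2 ^+ n)) ?exprn_gt0 //.
 exact: le_trans h (ltW h1).
have hF : (x @ \oo) [set w | normR w <= rho] by exists 0%N => // n _; exact: xr.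
have [p [pr cp]] := @compact_disc rho (x @ \oo) _ hF.
exists p => //; apply/eqP; rewrite -subr_eq0 -normR_eq0; apply/eqP.
apply: eq0_small => [|e e0]; first exact: normR_ge0.
have [N hN] := near0 e e0.
have := cp (x @` [set n | (N <= n)%N]) [set u | normR (u - p) < e] _ _.
case.
- by exists N => // n hn; exists n.
- by apply/nbhsC_P; exists e.
move=> _ [[n hn <-] /= hp]; have h1 := hN n hn; have h2 := hT _ _ pr (xr n).
rewrite (normRB p) in h2.
have e1 : T p - p = (T p - T (x n)) + ((x n.+1 - x n) + (x n - p)) by rewrite /x /=; ring.
rewrite e1; have h3 := normRD (T p - T (x n)) ((x n.+1 - x n) + (x n - p)).
by have h4 := normRD (x n.+1 - x n) (x n - p); lra.
Qed.

(** A fixed point is found by a Newton iteration with frozen derivative. It lies in the Julia set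
    because the local map doubles distances to it until they reach a definite size. *)
Lemma expands_repelling (f : Ch -> Ch) q z l eta A : expands (iter q f) z z l eta A -> 3 <= normR l ->
 eta <= (16 * A)^-1 -> exists zeta, [/\ chordal zeta z <= 2 * eta, iter q f zeta = zeta & julia f zeta].
move=> [A1 lA [G [g1 g2 g3]]] l3 hE; set c0 := (16 * A)^-1 in hE.
have A0 : 0 < A by exact: lt_le_trans A1.
have c0p : 0 < c0 by rewrite invr_gt0 mulr_gt0.
have cA : A * c0 = 1 / 16 by rewrite /c0; field; exact: lt0r_neq0.
have cA' : A^-1 = 16 * c0 by rewrite /c0; field; exact: lt0r_neq0.
have c1 : c0 <= 1 / 16 by rewrite -cA ler_peMl // ltW.
have e0 : 0 <= eta by exact: le_trans (normR_ge0 _) g2.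
have near u v : normR u <= 2 * c0 -> normR v <= 2 * c0 -> normR (G u - G v - l * (u - v)) <= normR (u - v) / 4.
 move=> hu hv; apply: le_trans (g3 _ _ _ _) _; rewrite ?cA'; [lra|lra|].
 have h : normR u + normR v <= 4 * c0 by lra.
 have := ler_wpM2l (mulr_ge0 (ltW A0) (normR_ge0 (u - v))) h.
 have -> : A * normR (u - v) * (4 * c0) = 4 * (A * c0) * normR (u - v) by ring.
 by rewrite cA => h'; apply: le_trans h' _; apply: eqR_le; field.
have l1 : 2 <= normR (l - 1) by have := normRB_ge l 1; rewrite normR1; lra.
have l10 : l - 1 != 0 by rewrite -normR_gt0; lra.
(* Dividing by [l - 1] makes the map contracting: its variation is the quadratic remainder, at most
   a quarter of the distance, divided by a number of modulus at least 2. *)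
have [u0 hu0 fix0] : exists2 p, normR p <= eta & p - (G p - p) / (l - 1) = p.
 apply: (@contraction_fixpoint (fun u => u - (G u - u) / (l - 1)) eta e0).
  rewrite subr0 sub0r normRN normR_div ler_pdivrMr; last by lra.
  by have := ler_wpM2l e0 l1; lra.
 move=> u v hu hv; have -> : u - (G u - u) / (l - 1) - (v - (G v - v) / (l - 1)) = - ((G u - G v - l * (u - v)) / (l - 1)).
  by field.
 rewrite normRN normR_div ler_pdivrMr; last by lra.
 apply: le_trans (near _ _ _ _) _; [lra|lra|].
 by have n0 := normR_ge0 (u - v); have := ler_wpM2l n0 l1; lra.
have Gu0 : G u0 = u0.
 move/eqP: fix0; rewrite -subr_eq0 addrC addKr oppr_eq0 mulf_eq0 invr_eq0 (negbTE l10) orbF subr_eq0.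
 by move/eqP.
have s0 : normR u0 <= c0 by exact: le_trans hE.
have fx : iter q f (fchart z u0) = fchart z u0 by rewrite g1 ?Gu0 // cA'; lra.
exists (fchart z u0); split=> //.
 rewrite -{2}(fchart0 z) chordal_fchart; apply: le_trans (chordal_some_le _ _) _.
 by rewrite subr0; lra.
move=> [U [oU Uz] hU]; have := hU _ Uz c0 c0p => /nbhs_chordal[e1 e1p he].
pose t := Num.min (e1 / 4) (c0 / 2).
have t0 : 0 < t by rewrite lt_min !divr_gt0.
have [t1 t2] : t <= e1 / 4 /\ t <= c0 / 2 by split; rewrite ge_min lexx ?orbT.
pose y := fchart z (u0 + rC t).
have hy : chordal (fchart z u0) y < e1.
 rewrite chordal_fchart; apply: le_lt_trans (chordal_some_le _ _) _.
 rewrite opprD addrA subrr sub0r normRN normR_real gtr0_norm //; lra.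
have fk k : iter (k * q) f (fchart z u0) = fchart z u0.
 by rewrite iterM; elim: k => //= k ->.
(* Equicontinuity would keep the returns of [y] within [c0], while each return at least doubles the
   distance to the fixed point. *)
have orbit k : exists u, [/\ iter (k * q) f y = fchart z u, normR (u - u0) < c0 & 2 ^+ k * t <= normR (u - u0)].
 elim: k => [|k [u [h1 h2 h3]]].
  exists (u0 + rC t); rewrite [_ + _ - _]addrC addKr normR_real gtr0_norm //; split=> //; first lra.
  by rewrite mul1r.
 have hu : normR u <= 2 * c0 by have := normRD (u - u0) u0; rewrite subrK; lra.
 have hn := near u u0 hu; rewrite Gu0 in hn; have {}hn : normR (G u - u0 - l * (u - u0)) <= normR (u - u0) / 4 by apply: hn; lra.
 have e : iter (k.+1 * q) f y = fchart z (G u) by rewrite iterD h1 g1 // cA'; lra.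
 have := he _ hy (k.+1 * q)%N; rewrite e fk chordal_fchart => hc.
 exists (G u); split=> //.
  rewrite normRB; apply: le_lt_trans hc; apply: chordal_some_ge; first lra.
  have b1 := normRD (G u - u0 - l * (u - u0)) (l * (u - u0)); rewrite subrK normRM in b1.
  have b2 := normRD (G u - u0) u0; rewrite subrK in b2.
  have b3 := ler_pM (normR_ge0 _) (normR_ge0 _) lA (ltW h2); rewrite cA in b3.
  by lra.
 have -> : 2 ^+ k.+1 * t = 2 * (2 ^+ k * t) by rewrite exprS mulrA.
 have b2 : normR (G u - u0) >= normR (l * (u - u0)) - normR (G u - u0 - l * (u - u0)).
  have := normRD (G u - u0) (- (G u - u0 - l * (u - u0))).
  by rewrite normRN opprB addrC subrK => b; lra.
 rewrite normRM in b2; have b3 := ler_wpM2r (normR_ge0 (u - u0)) l3; have := normR_ge0 (u - u0).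
 by lra.
have [u [_ h1 h2]] := orbit (Num.bound (c0 / t)).
have := archi_boundP (divr_ge0 (ltW c0p) (ltW t0)); rewrite ltr_pdivrMr // => h3.
have : (Num.bound (c0 / t))%:R * t <= 2 ^+ (Num.bound (c0 / t)) * t.
 rewrite ler_wpM2r ?(ltW t0) //; move: (Num.bound _) => n.
 by rewrite -natrX ler_nat ltnW // ltn_expl.
lra.
Qed.

(** It suffices to control the multiples of [q]: the fewer than [q] remaining iterates cost at most
    a power of the Lipschitz constant of [f]. *)
Lemma fatou_of_lipschitz d (f : Ratd R d) q (U : set Ch) (K : R) : (0 < q)%N -> open U -> 0 <= K ->
 (forall x y, U x -> U y -> forall k, chordal (iter (k * q) (ratfun f) x) (iter (k * q) (ratfun f) y) <= K * chordal x y) ->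
 U `<=` Defs.fatou (ratfun f).
move=> q0 oU K0 hK z Uz; exists U => // x Ux e e0.
have [L L0 hL] := ratfun_lipschitz f; pose M := L + 1; have M1 : 1 <= M by rewrite lerDr.
have M0 : 0 <= M by exact: le_trans M1.
have lip j a b : chordal (iter j (ratfun f) a) (iter j (ratfun f) b) <= M ^+ j * chordal a b.
 elim: j => [|j IH]; first by rewrite expr0 mul1r.
 rewrite /= exprS -mulrA; apply: le_trans (hL _ _) _; by apply: ler_pM => //; rewrite lerDl.
have B0 : 0 < M ^+ q * K + 1 by rewrite ltr_wpDl // mulr_ge0 // exprn_ge0.
have near1 : \forall y \near x, chordal x y < e / (M ^+ q * K + 1).
 by apply/nbhs_chordal; exists (e / (M ^+ q * K + 1)) => //; rewrite divr_gt0.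
have near2 : \forall y \near x, U y by exact: open_nbhs_nbhs.
apply: filterS2 near1 near2 => y h1 h2 n; rewrite (divn_eq n q) addnC !iterD.
apply: le_lt_trans (lip _ _ _) _; apply: (@le_lt_trans _ _ (M ^+ q * (K * chordal x y))).
 apply: ler_pM; [exact: exprn_ge0|exact: chordal_ge0| |exact: hK].
 by apply: ler_weXn2l => //; rewrite ltnW // ltn_mod.
rewrite ltr_pdivlMr // in h1; rewrite mulrA; apply: le_lt_trans h1.
by have := chordal_ge0 x y; move: (M ^+ q * K) => t; lra.
Qed.

(** On a disc whose radius [rho] keeps the quadratic error below 1 - |l|, the local map does not
    increase distances and preserves the disc, so all returns are uniformly Lipschitz. *)
Lemma expands_attracting d (f : Ratd R d) q z l A : (0 < q)%N -> expands (iter q (ratfun f)) z z l 0 A -> normR l < 1 ->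
 Defs.fatou (ratfun f) z.
move=> q0 [A1 lA [G [g1 g2 g3]]] l1; have A0 : 0 < A by exact: lt_le_trans A1.
pose rho := (1 - normR l) / (2 * A); have rho0 : 0 < rho by rewrite divr_gt0 ?mulr_gt0 // subr_gt0.
have Ar : A * rho = (1 - normR l) / 2 by rewrite /rho; field; exact: lt0r_neq0.
have ln0 := normR_ge0 l.
have rA : rho <= A^-1 by rewrite -[A^-1]mulr1 ler_pdivlMl; lra.
have r1 : rho <= 1 / 2 by have := ler_wpM2r (ltW rho0) A1; lra.
have G0 : G 0 = 0 by apply/eqP; rewrite -normR_eq0 eq_le g2 normR_ge0.
have lip u v : normR u <= rho -> normR v <= rho -> normR (G u - G v) <= normR (u - v).
 move=> hu hv; have h := g3 u v (le_trans hu rA) (le_trans hv rA).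
 have h1 := normRD (G u - G v - l * (u - v)) (l * (u - v)); rewrite subrK normRM in h1.
 have h2 : normR u + normR v <= 2 * rho by lra.
 have h3 := ler_wpM2l (mulr_ge0 (ltW A0) (normR_ge0 (u - v))) h2.
 have e : A * normR (u - v) * (2 * rho) = 2 * (A * rho) * normR (u - v) by ring.
 rewrite e Ar in h3; lra.
have self u : normR u <= rho -> normR (G u) <= rho.
 move=> hu; have := lip u 0 hu; rewrite G0 !subr0 normR0 => h; apply: le_trans (h _) hu; exact: ltW.
have orb k u : normR u <= rho -> iter (k * q) (ratfun f) (fchart z u) = fchart z (iter k G u) /\ normR (iter k G u) <= rho.
 move=> hu; elim: k => [//|k [h1 h2]]; rewrite mulSn iterD h1 g1 ?(le_trans h2) //; split=> //.
 exact: self.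
pose U : set Ch := [set x | chordal z x < rho].
have Uex x : U x -> exists2 u, x = fchart z u & normR u <= rho.
 move=> hx; rewrite /U /= in hx; have [y hy] : exists y, x = mobius (rot z) y.
  exists (mobius (inv2 (rot z)) x); rewrite -mobiusM; last exact/SL2_inv2/rot_SL2.
  by rewrite mul_inv2r ?mobius1 //; exact: rot_SL2.
 have hc : chordal (Some (0 : C) : Ch) y < rho.
  by rewrite -(mobius_su2_chordal _ _ (rot_su2 z)) -hy -/(fchart z 0) fchart0.
 have : chordal (Some (0 : C) : Ch) y ^+ 2 < rho ^+ 2 by rewrite ltr_sqr ?nnegrE // ltW.
 have r2 : rho ^+ 2 <= 1 / 4.
  have := ler_pM (ltW rho0) (ltW rho0) r1 r1; rewrite -expr2; lra.
 case: y hy {hc} => [u hu|_]; last by rewrite chordal_some_none nsq0 addr0; lra.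
 rewrite chordal_some sub0r nsqN nsq0 addr0 mul1r => h; exists u => //.
 rewrite -ler_sqr ?nnegrE ?normR_ge0 ?ltW // normR_sqr; have n0 := nsq_ge0 u.
 rewrite ltr_pdivrMr in h; last by lra.
 by have := ler_wpM2r n0 r2; have := sqr_ge0 rho; move: h; clear; lra.
have oU : open U.
 rewrite openE => x hx; apply/nbhs_chordal; exists (rho - chordal z x); first by rewrite subr_gt0.
 by move=> y hy; rewrite /U; apply: le_lt_trans (chordal_triangle z x y) _; rewrite -ltrBrDl.
have two : 0 <= 2 :> R by [].
apply: (@fatou_of_lipschitz d f q U 2 q0 oU two) => [x y /Uex[u -> hu] /Uex[v -> hv] k|]; last first.
 by rewrite /U /= chordalxx.
have [-> _] := orb k u hu; have [-> _] := orb k v hv; rewrite !chordal_fchart.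
have lk : normR (iter k G u - iter k G v) <= normR (u - v).
 elim: k => [//|k IH]; apply: le_trans IH; apply: lip; [exact: (orb k u hu).2|exact: (orb k v hv).2].
apply: le_trans (chordal_some_le _ _) _; rewrite ler_wpM2l //; apply: le_trans lk _.
by apply: chordal_some_ge; lra.
Qed.

Lemma near_dnbhs0 (P : C -> Prop) (e : R) : 0 < e -> (forall h, h != 0 -> normR h < e -> P h) -> \forall h \near (0 : C)^', P h.
move=> e0 hP; rewrite /dnbhs /within; apply/nbhsC_P; exists e => // h; rewrite subr0 => he h0.
exact: hP.
Qed.

Lemma derive1_cvg (F : C -> C) (a l : C) : (fun h => h^-1 * (F (h + a) - F a)) @ (0 : C)^' --> l -> derive1 F a = l.
by move=> h; apply: (cvg_lim (@hausdorffC)); exact: h. Qed.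

Lemma ratio_cvg (G v : C -> C) (l : C) (A : R) : 1 <= A -> (forall u, normR u <= A^-1 -> normR (G u - l * u) <= A * normR u ^+ 2) ->
 v @ (0 : C)^' --> 0 -> (\forall h \near (0 : C)^', v h != 0) -> (fun h => G (v h) / v h) @ (0 : C)^' --> l.
move=> A1 hG hv nv; have A0 : 0 < A by exact: lt_le_trans A1.
apply/cvgC_P => e e0; move/cvgC_P: hv => hv.
have m0 : 0 < Num.min A^-1 (e / A) by rewrite lt_min invr_gt0 A0 divr_gt0.
apply: filterS2 nv (hv _ m0) => h v0; rewrite subr0 lt_min => /andP[h1 h2].
have -> : G (v h) / v h - l = (G (v h) - l * v h) / v h by rewrite mulrBl mulfK.
have n0 : 0 < normR (v h) by rewrite normR_gt0.
rewrite normR_div ltr_pdivrMr //; apply: le_lt_trans (hG _ (ltW h1)) _.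
by rewrite mulrA ltr_pM2r // mulrC -ltr_pdivlMr.
Qed.

(** The multiplier is defined in the charts z and 1/z, the expansion in a rotated chart. The
    transition between them is linear when the point is infinity and a Möbius map otherwise; as [p]
    is fixed, its derivative cancels. *)
Lemma expands_deriv (g : Ch -> Ch) p l A : expands g p p l 0 A -> sphere_deriv g p = l.
move=> [A1 lA [G [g1 g2 g3]]]; have A0 : 0 < A by exact: lt_le_trans A1.
have G0 : G 0 = 0 by apply/eqP; rewrite -normR_eq0 eq_le g2 normR_ge0.
have hG u : normR u <= A^-1 -> normR (G u - l * u) <= A * normR u ^+ 2.
 move=> hu; have := g3 u 0 hu; rewrite normR0 invr_ge0 (ltW A0) => /(_ isT).
 by rewrite G0 !subr0 addr0 -mulrA.
have gp : g p = p.
 by have := g1 0; rewrite normR0 invr_ge0 (ltW A0) G0 fchart0 => /(_ isT).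
have id0 : (fun h : C => h) @ (0 : C)^' --> (0 : C) by apply: cvg_within.
have nz0 : \forall h \near (0 : C)^', h != 0 by apply: (@near_dnbhs0 _ 1).
rewrite /sphere_deriv gp; apply: derive1_cvg.
have [[a b] eab ab] : exists2 ab : C * C, ab = ul p & nsq ab.1 + nsq ab.2 = 1 by exists (ul p) => //; exact: ul_unit.
have ab1 : a * a^* + b * b^* = 1 by rewrite !conj_mulC -[RHS]/(rC 1 : C) -ab; apply: complexP; rewrite //= addr0.
have hp := hquo_ul p; rewrite -eab /= in hp.
have fE u : fchart p u = hquo (b^* * u + a) (- a^* * u + b).
 by rewrite /fchart /rot -eab /= /uz !mk2E.
have [b0|b0] := eqVneq b 0.
 have pN : p = None by rewrite -hp b0 hquo_none.
 have a0 : a != 0 by apply: contra_eqN ab1 => /eqP ->; rewrite b0 !mul0r addr0 eq_sym.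
 rewrite b0 mul0r addr0 in ab1.
 have unE (u : C) : unchart p u = fchart p (- a ^+ 2 * u).
  rewrite fE b0 conjC0 mul0r add0r addr0 pN /unchart /sinv.
  have -> : - a^* * (- a ^+ 2 * u) = a * (a * a^* * u) by ring.
  by rewrite ab1 mul1r -{1}[a]mulr1 hquoZ.
 have chE (w : C) : chart p (fchart p w) = - a^* ^+ 2 * w.
  have -> : fchart p w = unchart p (- a^* ^+ 2 * w).
   rewrite unE; congr fchart; have -> : - a ^+ 2 * (- a^* ^+ 2 * w) = (a * a^*) ^+ 2 * w by ring.
   by rewrite ab1 expr1n mul1r.
  rewrite pN /chart /unchart /sinv /hquo; move: (- _ * w) => x.
  case: (eqVneq x 0) => [->|x0] //=; rewrite mul1r /hquo invr_eq0 (negbTE x0) /=.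
  by rewrite div1r invrK.
 have cpp : chart p p = 0 by rewrite pN.
 pose v (h : C) : C := - a ^+ 2 * h.
 have hv : v @ (0 : C)^' --> (- a ^+ 2 * 0 : C) by exact: (cvgM (cvg_cst _) id0).
 rewrite mulr0 in hv.
 have nv : \forall h \near (0 : C)^', v h != 0.
  by apply: filterS nz0 => h h0; rewrite /v mulf_neq0 // oppr_eq0 expf_neq0.
 have hr := ratio_cvg A1 hG hv nv; apply: cvg_trans hr; apply: near_eq_cvg.
 have m0 : 0 < A^-1 by pos.
 move/cvgC_P: hv => /(_ _ m0) sv; apply: filterS3 nv nz0 sv => h v0 h0; rewrite subr0 => /ltW hs.
 rewrite cpp addr0 !unE mulr0 fchart0 gp cpp subr0 g1 // chE -/(v h).
 have -> : h^-1 = - a ^+ 2 / v h by rewrite /v; field; rewrite h0.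
 transitivity ((a * a^*) ^+ 2 * (G (v h) / v h)); first by rewrite ab1 expr1n mul1r.
 by field.
have pS : p = Some (a / b) by rewrite -hp /hquo (negbTE b0).
have cb : b^* = (1 - a * a^*) / b by rewrite -ab1 addrC addKr mulrC mulKf.
set ca := a^* in cb fE ab1; rewrite cb in fE.
pose k1 (h : C) : C := 1 + ca * b * h; pose v (h : C) : C := b ^+ 2 * h / k1 h.
pose k2 (h : C) : C := b - ca * (G (v h) / v h * v h).
have hk1 : k1 @ (0 : C)^' --> (1 + ca * b * 0 : C) by exact: (cvgD (cvg_cst _) (cvgM (cvg_cst _) id0)).
rewrite mulr0 addr0 in hk1.
have hv : v @ (0 : C)^' --> (b ^+ 2 * 0 / 1 : C) by exact: (cvgM (cvgM (cvg_cst _) id0) (cvgV (oner_neq0 _) hk1)).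
rewrite mulr0 mul0r in hv.
have neq (F : C -> C) (y : C) : F @ (0 : C)^' --> y -> y != 0 -> \forall h \near (0 : C)^', F h != 0.
 move=> /cvgC_P hF y0; have := hF (normR y); rewrite normR_gt0 => /(_ y0); apply: filterS => h.
 by apply: contraTN => /eqP ->; rewrite sub0r normRN ltxx.
have nk1 := neq _ _ hk1 (oner_neq0 _).
have nv : \forall h \near (0 : C)^', v h != 0.
 by apply: filterS2 nk1 nz0 => h x1 x2; rewrite /v !mulf_neq0 ?invr_eq0.
have hr := ratio_cvg A1 hG hv nv.
have hk2 : k2 @ (0 : C)^' --> (b - ca * (l * 0) : C).
 by exact: (cvgB (cvg_cst _) (cvgM (cvg_cst _) (cvgM hr hv))).
rewrite !mulr0 subr0 in hk2.
have nk2 := neq _ _ hk2 b0.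
have hL : (fun h => G (v h) / v h * (b ^+ 2 / k1 h) * (b * k2 h)^-1) @ (0 : C)^' --> (l * (b ^+ 2 / 1) * (b * b)^-1 : C).
 have bb : b * b != 0 by rewrite mulf_neq0.
 exact: (cvgM (cvgM hr (cvgM (cvg_cst _) (cvgV (oner_neq0 _) hk1))) (cvgV bb (cvgM (cvg_cst _) hk2))).
have eL : l * (b ^+ 2 / 1) * (b * b)^-1 = l by field.
rewrite eL in hL.
apply: cvg_trans hL; apply: near_eq_cvg.
have m0 : 0 < A^-1 by pos.
move/cvgC_P: hv => /(_ _ m0) sv.
apply: filterS3 (filterI nk1 nk2) (filterI nv nz0) sv => h [x1 x2] [v0 h0]; rewrite subr0 => /ltW hs.
have cE (y : Ch) : chart p y = odflt 0 y by rewrite pS.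
have uE (u : C) : unchart p u = Some u by rewrite pS.
have cpp : chart p p = a / b by rewrite pS.
rewrite cpp !uE -pS gp cpp.
have -> : Some (h + a / b) = fchart p (v h) :> Ch.
 rewrite fE; have e : - ca * v h + b = b / k1 h by rewrite /v; move: x1; rewrite /k1 => x1; field.
 rewrite e /hquo mulf_eq0 invr_eq0 (negbTE b0) (negbTE x1); congr Some.
 by rewrite /v; move: x1; rewrite /k1 => x1; field; rewrite x1.
rewrite g1 // cE fE; have e2 : - ca * G (v h) + b = k2 h by rewrite /k2 divfK //; ring.
rewrite e2 /hquo (negbTE x2) /=.
have ev : v h = b ^+ 2 * h / k1 h by [].
move: e2 ev v0; move: (k1 h) (k2 h) x1 x2 (v h) (G (v h)) => y1 y2 x1 x2 v1 g0 e2 ev v0.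
have -> : ((1 - a * ca) / b * g0 + a) / y2 - a / b = g0 / (b * y2).
 by move: x2; rewrite -e2 => x2; field; rewrite x2.
by rewrite ev; field; rewrite x2 b0 h0.
Qed.

Fixpoint iter_pair d (P Q : {poly C}) (q : nat) : {poly C} * {poly C} :=
 if q is q'.+1 then let W := iter_pair d P Q q' in
  (\sum_(j < d.+1) P`_j *: (W.1 ^+ j * W.2 ^+ (d - j)), \sum_(j < d.+1) Q`_j *: (W.1 ^+ j * W.2 ^+ (d - j)))
 else ('X, 1).

Lemma iter_pairE d (f : Ratd R d) q (u : C) : let W := iter_pair d (rP f) (rQ f) q in
 (W.1.[u] != 0) || (W.2.[u] != 0) /\ iter q (ratfun f) (Some u) = hquo W.1.[u] W.2.[u].
elim: q => [|q [h1 h2]] /=; first by rewrite hornerX hornerC oner_eq0 orbT hquo_some.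
set W := iter_pair d (rP f) (rQ f) q in h1 h2 *.
have e (p : {poly C}) : (\sum_(j < d.+1) p`_j *: (W.1 ^+ j * W.2 ^+ (d - j))).[u] = hev d p W.1.[u] W.2.[u].
 by rewrite horner_sum /hev; apply: eq_bigr => j _; rewrite hornerZ hornerM !horner_exp mulrA.
by rewrite !e h2 ratfun_hquo //; split=> //; exact: rat_nz.
Qed.

(** Finite fixed points of the iterate are roots of one polynomial. If that polynomial vanishes
    identically, the iterate fixes every finite point, the finite plane lies in the Fatou set, and
    only infinity is left. *)
Lemma finite_julia_fixed d (f : Ratd R d) q : (0 < q)%N -> exists s : seq Ch,
 forall x, julia (ratfun f) x -> iter q (ratfun f) x = x -> x \in s.
move=> q0; pose W := iter_pair d (rP f) (rQ f) q; have [e0|n0] := eqVneq (W.1 - 'X * W.2) 0.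
 have fx (u : C) : iter q (ratfun f) (Some u) = Some u.
  have [h1 ->] := iter_pairE f q u; rewrite -/W in h1 *.
  have e : W.1.[u] = u * W.2.[u] by move/eqP: e0; rewrite subr_eq0 => /eqP ->; rewrite hornerM hornerX.
  rewrite e in h1 *; have q1 : W.2.[u] != 0 by apply: contraTN h1 => /eqP ->; rewrite mulr0 eqxx.
  by rewrite /hquo (negbTE q1) mulfK.
 exists [:: None] => x jx _; rewrite inE; apply/eqP; case: x jx => [u|//] jx; exfalso; apply: jx.
 have oU : open (~` [set (None : Ch)]).
  rewrite openE => y /= yN; apply/nbhs_chordal; exists (chordal y None) => [|w hw we].
   by rewrite lt_neqAle chordal_ge0 andbT eq_sym; apply/eqP => /chordal_eq0.
  by move: hw; rewrite we ltxx.
 have fk (v : C) k : iter (k * q) (ratfun f) (Some v) = Some v.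
  by elim: k => [//|k IH]; rewrite iterD IH.
 apply: (@fatou_of_lipschitz d f q (~` [set (None : Ch)]) 1 q0 oU) => //.
 by move=> [x|] [y|] nx ny k; rewrite ?fk ?mul1r //; [case: ny|case: nx|case: nx].
have [r hr] := closed_field_poly_normal (W.1 - 'X * W.2).
exists (None :: map Some r) => x _ fx; rewrite inE; case: x fx => [u|] fx; last by rewrite eqxx.
apply/orP; right; apply: map_f; have [h1] := iter_pairE f q u; rewrite -/W fx => h2.
have l0 : lead_coef (W.1 - 'X * W.2) != 0 by rewrite lead_coef_eq0.
rewrite -root_prod_XsubC -(rootZ u _ l0) -hr /root !hornerE; move: h2; rewrite /hquo; case: eqP => [//|/eqP q1 [e]].
by rewrite subr_eq0 -[eqbLHS](divfK q1) -e.
Qed.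

Lemma ultra_fmap (T S : Type) (f : T -> S) (F : set_system T) : UltraFilter F -> UltraFilter (f @ F).
move=> UF; split; first exact: fmap_proper_filter.
move=> G PG FG; apply/seteqP; split=> // A GA.
have [//|h] := in_ultra_setVsetC (f @^-1` A) UF; exfalso; apply: (@filter_not_empty _ G).
by have := FG (~` A) h => GnA; apply: filterS (filterI GA GnA) => x [].
Qed.

(** * The asymptotic cone: ultralimits, tree structure, rays and ends *)

Section AsymptoticCone.

(** Divergence is recorded along the cofinite filter, not just along [omega], because [admissible]
    bounds all indices: an eventual bound extends to all of them by [rl_eventually]. *)
Record scale (omega : set_system nat) (r : nat -> R) : Prop := Scale {
 scale_ultra : UltraFilter omega;
 scale_ge0 : forall n, 0 <= r n;
 scale_oo : forall B : R, \forall n \near \oo, B < r n;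
 scale_near : forall P : nat -> Prop, (\forall n \near \oo, P n) -> \forall n \near omega, P n }.

Variables (omega : set_system nat) (r : nat -> R).
Hypothesis hs : scale omega r.
Let UF := scale_ultra hs.
#[local] Existing Instance UF.
Local Notation es := (end_of_seq omega r).

(** Limits at scale [r n]; bounded errors are invisible, see [rl_close]. *)
Definition rl (u : nat -> R) (l : R) : Prop := (fun n => u n / r n) @ omega --> l.

Lemma near_r (B : R) : \forall n \near omega, B < r n.
by apply: (scale_near hs); exact: scale_oo hs B. Qed.

Lemma rl_ex u B : (\forall n \near omega, `|u n| <= B * r n) -> exists l, rl u l.
move=> h; have cS := @segment_compact R (- B) B; rewrite compact_ultra in cS.
have h1 : ((fun n => u n / r n) @ omega) `[- B, B]%classic; last first.
 have UG := @ultra_fmap _ _ (fun n => u n / r n) omega UF.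
 by have [l [_ hl]] := cS _ UG h1; exists l.
rewrite /nbhs; apply: filterS2 h (near_r 0) => n hn rn /=.
by rewrite in_itv -ler_norml normrM normfV (gtr0_norm rn) ler_pdivrMr.
Qed.

Lemma rl_cst k : rl (fun=> k) 0.
apply/cvgrPdist_lt => e e0; apply: filterS (near_r (`|k| / e)) => n hn.
have rn : 0 < r n by apply: le_lt_trans hn; rewrite divr_ge0 // ltW.
by rewrite sub0r normrN normrM normfV (gtr0_norm rn) ltr_pdivrMr // mulrC -ltr_pdivrMr.
Qed.

Lemma rl_r t : rl (fun n => t * r n) t.
apply/cvgrPdist_lt => e e0; apply: filterS (near_r 0) => n rn.
by rewrite mulfK ?gt_eqF // subrr normr0.
Qed.

Lemma rlD u v l m : rl u l -> rl v m -> rl (fun n => u n + v n) (l + m).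
by move=> h1 h2; rewrite /rl; under eq_fun do rewrite mulrDl; exact: cvgD h1 h2. Qed.

Lemma rlZ k u l : rl u l -> rl (fun n => k * u n) (k * l).
by move=> h; rewrite /rl; under eq_fun do rewrite -mulrA; exact: cvgM (cvg_cst k) h. Qed.

Lemma rlN u l : rl u l -> rl (fun n => - u n) (- l).
by move=> h; rewrite /rl; under eq_fun do rewrite mulNr; exact: cvgN h. Qed.

Lemma rl_le u v l m : (\forall n \near omega, u n <= v n) -> rl u l -> rl v m -> l <= m.
move=> h h1 h2; apply: (ler_cvg_to h1 h2); apply: filterS2 h (near_r 0) => n hn rn.
by rewrite ler_pM2r // invr_gt0.
Qed.

Lemma rl_lt u l t : rl u l -> l < t -> \forall n \near omega, u n < t * r n.
move=> h lt; have h1 : \forall n \near omega, u n / r n < t by apply: (cvgr_lt l).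
by apply: filterS2 h1 (near_r 0) => n; rewrite /= => hn rn; rewrite -ltr_pdivrMr.
Qed.

Lemma rl_gt u l t : rl u l -> t < l -> \forall n \near omega, t * r n < u n.
move=> h lt; have h1 : \forall n \near omega, t < u n / r n by apply: (cvgr_gt l).
by apply: filterS2 h1 (near_r 0) => n; rewrite /= => hn rn; rewrite -ltr_pdivlMr.
Qed.

Lemma rl0 u : (forall e, 0 < e -> \forall n \near omega, `|u n| <= e * r n) -> rl u 0.
move=> h; apply/cvgrPdist_le => e e0; apply: filterS2 (h e e0) (near_r 0) => n hn rn.
by rewrite sub0r normrN normrM normfV (gtr0_norm rn) ler_pdivrMr.
Qed.

Lemma rl0_le u v : (\forall n \near omega, `|u n| <= v n) -> rl v 0 -> rl u 0.
move=> h hv; apply: rl0 => e e0; have := rl_lt hv e0 => h1.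
by apply: filterS2 h h1 => n a b; apply: le_trans a (ltW b).
Qed.

Lemma rl_ext u v l : (\forall n \near omega, u n = v n) -> rl v l -> rl u l.
move=> h hv; have : rl (fun n => u n - v n) 0.
 apply: (rl0_le (v := fun=> 0)); last exact: rl_cst.
 by apply: filterS h => n ->; rewrite subrr normr0.
by move/rlD => /(_ _ _ hv); rewrite add0r /rl; under eq_fun do rewrite subrK.
Qed.

Lemma rl_close u v K l : (\forall n \near omega, `|u n - v n| <= K) -> rl v l -> rl u l.
move=> h hv; have : rl (fun n => u n - v n) 0 by apply: (rl0_le h); exact: rl_cst.
by move/rlD => /(_ _ _ hv); rewrite add0r /rl; under eq_fun do rewrite subrK.
Qed.

Lemma rl_eventually (u : nat -> R) (K : R) : (\forall n \near \oo, u n <= K) -> exists B, forall n, u n <= B.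
case=> N _ hN; have [m _ hm] := nat_argmax u N.
exists (Num.max K (u m)) => n; rewrite le_max; have [le|/ltnW lt] := leqP N n; first by rewrite hN.
by rewrite hm ?orbT.
Qed.

Definition near0 (x y : nat -> 'rV[R]_3) : Prop := rl (fun n => hdist (x n) (y n)) 0.

Lemma near0_sym x y : near0 x y -> near0 y x.
by rewrite /near0 /rl; under eq_fun do rewrite hdist_sym. Qed.

Lemma near0_refl x : near0 x x.
by rewrite /near0 /rl; under eq_fun do rewrite hdistxx mul0r; exact: cvg_cst. Qed.

Definition in_ball (x : nat -> 'rV[R]_3) : Prop := forall n, ball3 (x n).

Lemma near0_trans x y z : in_ball x -> in_ball y -> in_ball z -> near0 x y -> near0 y z -> near0 x z.
move=> bx by_ bz h1 h2; have := rlD (rlD h1 h2) (rl_cst (2 * ln 2)); rewrite !addr0.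
apply: rl0_le; apply: nearW => n; rewrite ger0_norm; first exact: hdist_triangle.
exact: hdist_ge0.
Qed.

Lemma cone_class_eq x y : in_ball x -> in_ball y -> near0 x y -> cone_class omega r x = cone_class omega r y.
move=> bx by_ h; apply/seteqP; split=> z [[bz az] hz]; split=> //.
 by apply: (@near0_trans y x z) => //; exact: near0_sym.
exact: (@near0_trans x y z).
Qed.

Lemma cone_class_inj x y : admissible r x -> admissible r y ->
 cone_class omega r x = cone_class omega r y -> near0 x y.
move=> ax ay e; have : cone_class omega r y y by split=> //; exact: near0_refl.
by rewrite -e => -[].
Qed.

Lemma cone_repr_class x : admissible r x ->
 admissible r (cone_repr (cone_class omega r x)) /\ near0 x (cone_repr (cone_class omega r x)).
move=> ax; have : cone_class omega r x (cone_repr (cone_class omega r x)) by apply: (xgetPex (fun=> 0)); exists x; split=> //; exact: near0_refl.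
by case.
Qed.

Lemma rl_near0 x x' y y' l : in_ball x -> in_ball x' -> in_ball y -> in_ball y' ->
 near0 x x' -> near0 y y' -> rl (fun n => hdist (x n) (y n)) l -> rl (fun n => hdist (x' n) (y' n)) l.
move=> bx bx' by_ by' h1 h2 h.
have h3 := rlD (rlD h1 h2) (rl_cst (4 * ln 2)); rewrite !addr0 in h3.
have : rl (fun n => hdist (x' n) (y' n) - hdist (x n) (y n)) 0.
 apply: rl0_le h3; apply: nearW => n.
 have t1 := hdist_triangle (bx n) (bx' n) (by_ n); have t2 := hdist_triangle (bx' n) (by' n) (by_ n).
 have t3 := hdist_triangle (bx' n) (bx n) (by' n); have t4 := hdist_triangle (bx n) (by_ n) (by' n).
 rewrite [hdist (x' n) (x n)]hdist_sym in t3; rewrite [hdist (y' n) (y n)]hdist_sym in t2.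
 by rewrite ler_norml; apply/andP; split; lra.
by move/rlD => /(_ _ _ h); rewrite add0r /rl; under eq_fun do rewrite subrK.
Qed.

Lemma rl_dist_ex x y : admissible r x -> admissible r y -> exists l, rl (fun n => hdist (x n) (y n)) l.
move=> [bx [B1 h1]] [by_ [B2 h2]]; apply: (@rl_ex _ (B1 + B2 + 1)).
apply: filterS (near_r (2 * ln 2 + 1)) => n rn; have l2 : 0 <= ln 2 :> R by rewrite ln_ge0 // ler1n.
have r0 : 0 < r n by lra.
have := h1 n; have := h2 n; rewrite !ler_pdivrMr // => a2 a1.
rewrite ger0_norm; last exact: hdist_ge0.
have := hdist_triangle (bx n) ball30 (by_ n); rewrite [hdist (x n) 0]hdist_sym !mulrDl mul1r; lra.
Qed.

(** The distance of classes is computed on chosen representatives; this replaces them by any given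
    ones and evaluates the limit. *)
Lemma cone_distP x y l : admissible r x -> admissible r y ->
 rl (fun n => hdist (x n) (y n)) l -> cone_dist omega r (cone_class omega r x) (cone_class omega r y) = l.
move=> ax ay h; have [ax' nx] := cone_repr_class ax; have [ay' ny] := cone_repr_class ay.
have [bx _] := ax; have [by_ _] := ay; have [bx' _] := ax'; have [by' _] := ay'.
have := rl_near0 bx bx' by_ by' nx ny h; rewrite /rl /cone_dist => h1.
by apply: cvg_lim h1; exact: Rhausdorff.
Qed.

Definition ray_pt (z : nat -> Ch) (t : R) : pt := cone_class omega r (fun n => hgeod (t * r n) (z n)).

Lemma adm_ray t z : 0 <= t -> admissible r (fun n => hgeod (t * r n) (z n)).
move=> t0; split=> [n|]; first exact: hgeod_ball.
apply: (@rl_eventually _ (t + ln 2)); apply: filterS (scale_oo hs 1) => n r1.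
have r0 : 0 < r n by lra.
have l2 : 0 <= ln 2 :> R by rewrite ln_ge0 // ler1n.
have tr : 0 <= t * r n by pos.
have /andP[_ h] := hdist0_hgeod (z n) tr; rewrite ler_pdivrMr // mulrDl.
have : ln 2 * 1 <= ln 2 * r n by rewrite ler_wpM2l // ltW.
lra.
Qed.

Lemma cone_ray t z : 0 <= t -> cone omega r (ray_pt z t).
by move=> t0; exists (fun n => hgeod (t * r n) (z n)) => //; exact: adm_ray. Qed.

(** The Gromov product of two points on radial geodesics, before rescaling. *)
Definition lgap s t (z w : nat -> Ch) n : R := - ln (gap (s * r n) (t * r n) (z n) (w n)).

Lemma rl_dist_gap s t z w g : 0 <= s -> 0 <= t -> rl (lgap s t z w) g ->
 rl (fun n => hdist (hgeod (s * r n) (z n)) (hgeod (t * r n) (w n))) (s + t - 2 * g).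
move=> s0 t0 hg; have := rlD (rlD (@rl_r s) (@rl_r t)) (@rlZ (- 2) _ _ hg).
rewrite (_ : s + t - 2 * g = s + t + - 2 * g); last by ring.
apply: (@rl_close _ _ (ln 8)); apply: nearW => n.
have := @hdist_hgeod (s * r n) (t * r n) (z n) (w n) (mulr_ge0 s0 (scale_ge0 hs n)) (mulr_ge0 t0 (scale_ge0 hs n)).
by rewrite /lgap mulrNN.
Qed.

Lemma gap_le2 s t (z w : Ch) : 0 <= s -> 0 <= t -> gap s t z w <= 2.
move=> s0 t0; rewrite /gap !ge_max chordal_le2 /=.
have h (x : R) : 0 <= x -> expR (- x) <= 2.
 by move=> x0; apply: (@le_trans _ _ 1); [rewrite -expR0 ler_expR oppr_le0|rewrite ler1n].
by rewrite !h.
Qed.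

Lemma lgap_bnd s t z w n : 0 <= s -> 0 <= t ->
 - ln 2 <= lgap s t z w n /\ lgap s t z w n <= s * r n /\ lgap s t z w n <= t * r n.
move=> s0 t0; have r0 := scale_ge0 hs n.
have g0 := gap_gt0 (s * r n) (t * r n) (z n) (w n).
have le : gap (s * r n) (t * r n) (z n) (w n) <= 2 by apply: gap_le2; exact: mulr_ge0.
have a1 : - (s * r n) <= ln (gap (s * r n) (t * r n) (z n) (w n)).
 by rewrite -[leLHS]expRK ler_ln ?posrE ?expR_gt0 // /gap !le_max lexx ?orbT.
have a2 : - (t * r n) <= ln (gap (s * r n) (t * r n) (z n) (w n)).
 by rewrite -[leLHS]expRK ler_ln ?posrE ?expR_gt0 // /gap !le_max lexx ?orbT.
have a3 : ln (gap (s * r n) (t * r n) (z n) (w n)) <= ln 2 by rewrite ler_ln ?posrE.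
have key (x y z' w' : R) : - y <= x -> - z' <= x -> x <= w' -> - w' <= - x /\ - x <= y /\ - x <= z'.
 by move=> *; split; [|split]; lra.
exact: key a1 a2 a3.
Qed.

Lemma lgap_ex s t z w : 0 <= s -> 0 <= t -> exists2 g, rl (lgap s t z w) g & [/\ 0 <= g, g <= s & g <= t].
move=> s0 t0; have [g hg] : exists g, rl (lgap s t z w) g.
 apply: (@rl_ex _ (s + 1)); apply: filterS (near_r (ln 2)) => n rn.
 have [a [b _]] := lgap_bnd z w n s0 t0; have := mulr_ge0 s0 (scale_ge0 hs n); have := scale_ge0 hs n.
 by rewrite ler_norml mulrDl; move: (s * r n) b => q b q0 r0; apply/andP; split; lra.
exists g => //; split.
- by apply: (rl_le _ (rl_cst (- ln 2)) hg); apply: nearW => n; case: (lgap_bnd z w n s0 t0).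
- by apply: (rl_le _ hg (@rl_r s)); apply: nearW => n; case: (lgap_bnd z w n s0 t0) => _ [].
- by apply: (rl_le _ hg (@rl_r t)); apply: nearW => n; case: (lgap_bnd z w n s0 t0) => _ [].
Qed.

Local Notation D := (cone_dist omega r).
Local Notation K := (cone omega r).
Local Notation o := (cone_base omega r).

Lemma dist_ray s t z w g : 0 <= s -> 0 <= t -> rl (lgap s t z w) g ->
 D (ray_pt z s) (ray_pt w t) = s + t - 2 * g.
by move=> s0 t0 hg; apply: cone_distP; [exact: adm_ray|exact: adm_ray|exact: rl_dist_gap]. Qed.

Lemma ray_pt0 z : ray_pt z 0 = o.
by rewrite /ray_pt /cone_base; congr cone_class; apply/funext => n; rewrite mul0r hgeod0. Qed.

Lemma lgap_same s t z : 0 <= s -> s <= t -> rl (lgap s t z z) s.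
move=> s0 st; apply: rl_ext (@rl_r s); apply: nearW => n; rewrite /lgap /gap chordalxx.
have e : expR (- (t * r n)) <= expR (- (s * r n)) by rewrite ler_expR lerN2 ler_wpM2r // (scale_ge0 hs).
by rewrite (max_idPl e) (max_idPr (expR_ge0 _)) expRK opprK.
Qed.

Lemma dist_same s t z : 0 <= s -> 0 <= t -> D (ray_pt z s) (ray_pt z t) = `|s - t|.
move=> s0 t0; have [st|/ltW ts] := leP s t.
 by rewrite (dist_ray s0 t0 (lgap_same z s0 st)) distrC ger0_norm ?subr_ge0 //; ring.
have h : rl (lgap s t z z) t.
 apply: rl_ext (lgap_same z t0 ts); apply: nearW => n; rewrite /lgap /gap; congr (- ln (Num.max _ _)).
 by rewrite maxC.
by rewrite (dist_ray s0 t0 h) ger0_norm ?subr_ge0 //; ring.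
Qed.

(** Every point of the cone lies on a radial ray: take the directions of a representing sequence and
    the ultralimit of its distances to the centre. *)
Lemma cone_rayP X : K X -> exists t z, 0 <= t /\ X = ray_pt z t.
case=> x [bx [B hB]] <-.
have [s hs1] := choice (fun n => ball_hgeod (bx n)); have [z hz] := choice hs1.
have [t ht] : exists t, rl s t.
 apply: (@rl_ex _ (B + 1)); apply: filterS (near_r (ln 2)) => n rn.
 have l2 : 0 <= ln 2 :> R by rewrite ln_ge0 // ler1n.
 have [sn xn] := hz n; have r0 : 0 < r n by lra.
 have := hB n; rewrite ler_pdivrMr // xn; have /andP[+ _] := hdist0_hgeod (z n) sn.
 by rewrite ger0_norm; lra.
have t0 : 0 <= t by apply: (rl_le _ (rl_cst 0) ht); apply: nearW => n; case: (hz n).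
exists t, z; split=> //; apply: cone_class_eq => //; first by move=> n; exact: hgeod_ball.
have : rl (fun n => s n - t * r n) 0.
 by have := rlD ht (rlN (@rl_r t)); rewrite subrr.
move/rl0_le : (rl_cst (ln 8)) => _ hd.
have key n : hdist (x n) (hgeod (t * r n) (z n)) <= `|s n - t * r n| + ln 8.
 have [sn ->] := hz n; have := @hdist_hgeod (s n) (t * r n) (z n) (z n) sn (mulr_ge0 t0 (scale_ge0 hs n)).
 rewrite ler_norml => /andP[_]; rewrite /gap chordalxx (max_idPr _); last by pos.
 have [le|/ltW le] := leP (expR (- s n)) (expR (- (t * r n))).
  rewrite expRK; move: le; rewrite ler_expR lerN2 => le; rewrite ger0_norm; lra.
 rewrite expRK; move: le; rewrite ler_expR lerN2 => le; rewrite distrC ger0_norm; lra.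
apply: rl0 => e e0; have e2 : 0 < e / 2 by pos.
have h1 : \forall n \near omega, `|s n - t * r n| < e / 2 * r n.
 have a1 := rl_lt hd e2; have e2' : - (e / 2) < 0 by rewrite oppr_lt0.
 have a2 := rl_gt hd e2'; apply: filterS2 a1 a2 => n b1 b2; rewrite ltr_norml b1 andbT.
 by rewrite -mulNr.
apply: filterS2 h1 (near_r (2 * ln 8 / e)) => n h2 h3; rewrite ger0_norm; last by apply: hdist_ge0 => //; exact: hgeod_ball.
apply: le_trans (key n) _; rewrite ltr_pdivrMr // in h3.
by move: h2 h3; move: (`|s n - t * r n|) (r n) (ln 8) => x1 x2 x3; lra.
Qed.

Definition ht X : R := D o X.

Lemma ht_ray t z : 0 <= t -> ht (ray_pt z t) = t.
by move=> t0; rewrite /ht -(ray_pt0 z) dist_same // sub0r normrN ger0_norm. Qed.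

Lemma cone_o : K o.
by rewrite -(ray_pt0 (fun=> None)); exact: cone_ray. Qed.

Lemma D_sym X Y : K X -> K Y -> D X Y = D Y X.
case=> x ax <- [y ay <-]; have [l hl] := rl_dist_ex ax ay.
rewrite (cone_distP ax ay hl); apply/esym/cone_distP => //.
by rewrite /rl; under eq_fun do rewrite hdist_sym.
Qed.

Lemma D_triangle X Y Z : K X -> K Y -> K Z -> D X Z <= D X Y + D Y Z.
case=> x ax <- [y ay <-] [z az <-]; have [l hl] := rl_dist_ex ax ay; have [m hm] := rl_dist_ex ay az.
have [k hk] := rl_dist_ex ax az; rewrite (cone_distP ax ay hl) (cone_distP ay az hm) (cone_distP ax az hk).
have := rlD (rlD hl hm) (rl_cst (2 * ln 2)); rewrite addr0; apply: rl_le hk.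
apply: nearW => n; have [bx _] := ax; have [by_ _] := ay; have [bz _] := az; exact: hdist_triangle.
Qed.

Lemma D_eq0 X Y : K X -> K Y -> D X Y <= 0 -> X = Y.
case=> x ax <- [y ay <-]; have [l hl] := rl_dist_ex ax ay; rewrite (cone_distP ax ay hl) => l0.
have [bx _] := ax; have [by_ _] := ay; apply: cone_class_eq => //; rewrite /near0.
suff <- : l = 0 by [].
apply/eqP; rewrite eq_le l0; apply: (rl_le _ (rl_cst 0) hl); apply: nearW => n; exact: hdist_ge0.
Qed.

Lemma D_ge0 X Y : K X -> K Y -> 0 <= D X Y.
case=> x ax <- [y ay <-]; have [l hl] := rl_dist_ex ax ay; rewrite (cone_distP ax ay hl).
have [bx _] := ax; have [by_ _] := ay; apply: (rl_le _ (rl_cst 0) hl); apply: nearW => n; exact: hdist_ge0.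
Qed.

(* The Gromov product satisfies the ultrametric inequality: the cone is 0-hyperbolic. *)
Definition gp X Y : R := (ht X + ht Y - D X Y) / 2.

Lemma gp_ray s t z w g : 0 <= s -> 0 <= t -> rl (lgap s t z w) g -> gp (ray_pt z s) (ray_pt w t) = g.
by move=> s0 t0 hg; rewrite /gp !ht_ray // (dist_ray s0 t0 hg); field. Qed.

(** The chordal triangle inequality bounds one gap by twice the larger of the two others; the factor
    2 disappears in the limit, and the ultrafilter decides which of the two is larger. *)
Lemma gp_ultra X Y Z : K X -> K Y -> K Z -> gp X Y <= gp X Z \/ gp Y Z <= gp X Z.
move=> /cone_rayP[s [z [s0 ->]]] /cone_rayP[t [w [t0 ->]]] /cone_rayP[u [v [u0 ->]]].
have [g1 h1 _] := lgap_ex z w s0 t0; have [g2 h2 _] := lgap_ex w v t0 u0; have [g3 h3 _] := lgap_ex z v s0 u0.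
rewrite (gp_ray s0 t0 h1) (gp_ray t0 u0 h2) (gp_ray s0 u0 h3).
pose G1 n := gap (s * r n) (t * r n) (z n) (w n); pose G2 n := gap (t * r n) (u * r n) (w n) (v n).
have key n m : 0 < m -> G1 n <= m -> G2 n <= m -> - ln m - ln 2 <= lgap s u z v n.
 move=> m0 a1 a2; rewrite -opprD lerN2 -lnM ?posrE // ler_ln ?posrE ?gap_gt0 ?mulr_gt0 //.
 move: a1 a2; rewrite /G1 /G2 /gap !ge_max => /andP[b1 /andP[b2 _]] /andP[c1 /andP[_ c3]].
 have := chordal_triangle (z n) (w n) (v n) => tr.
 by apply/andP; split; [lra|apply/andP; split; lra].
have [h|h] := in_ultra_setVsetC [set n | G1 n <= G2 n] UF.
 right; have := rlD h2 (rlN (rl_cst (ln 2))); rewrite subr0 => h4; apply: (rl_le _ h4 h3).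
 by apply: filterS h => n hn; apply: key => //; exact: gap_gt0.
left; have := rlD h1 (rlN (rl_cst (ln 2))); rewrite subr0 => h4; apply: (rl_le _ h4 h3).
apply: filterS h => n /negP; rewrite -ltNge => /ltW hn; apply: key => //; exact: gap_gt0.
Qed.

Lemma geod_uniq_real (h1 h2 h3 h4 p q u : R) :
 ((h1 + h3 - q) / 2 <= (h1 + h2 - p) / 2 \/ (h3 + h2 - q) / 2 <= (h1 + h2 - p) / 2) ->
 ((h1 + h4 - u) / 2 <= (h1 + h2 - p) / 2 \/ (h4 + h2 - u) / 2 <= (h1 + h2 - p) / 2) ->
 ((h3 + h2 - q) / 2 <= (h3 + h4 - (q + u)) / 2 \/ (h2 + h4 - u) / 2 <= (h3 + h4 - (q + u)) / 2) ->
 ((h3 + h1 - q) / 2 <= (h3 + h4 - (q + u)) / 2 \/ (h1 + h4 - u) / 2 <= (h3 + h4 - (q + u)) / 2) -> p <= 0.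
by case=> ?; case=> ?; case=> ?; case=> ?; lra. Qed.

(** In a tree a point of a geodesic is determined by its distances to the ends; four instances of
    the ultrametric inequality make this linear arithmetic. *)
Lemma geod_uniq x y P Q : K x -> K y -> K P -> K Q -> D x P = D y P -> D x Q = D y Q ->
 D P Q = D x P + D x Q -> x = y.
move=> kx ky kP kQ e1 e2 e3; apply: D_eq0 => //.
have g1 := gp_ultra kx kP ky; have g2 := gp_ultra kx kQ ky; have g3 := gp_ultra kP ky kQ; have g4 := gp_ultra kP kx kQ.
rewrite /gp ?[D P x]D_sym // ?[D P y]D_sym // ?[D Q y]D_sym // e3 -?e1 -?e2 in g1 g2 g3 g4.
exact: geod_uniq_real g1 g2 g3 g4.
Qed.

(** The point at height [s] below [Z] is unique: height equal to the Gromov product means lying on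
    the segment from the base point to [Z]. *)
Lemma below_uniq X Y Z s : K X -> K Y -> K Z -> ht X = s -> ht Y = s -> gp X Z = s -> gp Y Z = s -> X = Y.
move=> kX kY kZ hX hY gX gY; apply: D_eq0 => //; have := gp_ultra kX kZ kY.
have -> : gp Z Y = s by rewrite /gp [ht Z + _]addrC D_sym.
by rewrite gX; rewrite /gp hX hY; move: (D X Y) => q; clear; case=> ?; lra.
Qed.

Lemma ht_le X Y : K X -> K Y -> ht Y <= ht X + D X Y.
by move=> kX kY; apply: D_triangle => //; exact: cone_o. Qed.

Lemma is_ray_std z : is_ray omega r (ray_pt z).
by split=> [t t0|s t s0 t0]; [exact: cone_ray|exact: dist_same]. Qed.

Lemma ray_ht_real (h0 h1 h2 t u : R) : 0 <= h0 -> 0 <= h1 -> h0 + 1 <= t -> t <= u -> h2 <= h1 + (u - t) ->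
 ((h0 + h1 - t) / 2 <= (h0 + h2 - u) / 2 \/ (h1 + h2 - (u - t)) / 2 <= (h0 + h2 - u) / 2) -> h2 = h1 + (u - t).
by move=> ? ? ? ? ? [?|?]; [apply/eqP; rewrite eq_le; apply/andP; split|exfalso]; lra. Qed.

Lemma ray_ht a : is_ray omega r a -> exists t0, [/\ 0 <= t0,
 (forall t u, t0 <= t -> t <= u -> ht (a u) = ht (a t) + (u - t)) &
 forall t u, t0 <= t -> t <= u -> gp (a t) (a u) = ht (a t)].
move=> [ka da]; have h0 : 0 <= ht (a 0) by apply: D_ge0; [exact: cone_o|exact: ka].
(* A ray may first descend towards the base point, but for no longer than the height of its
   origin. *)
exists (ht (a 0) + 1).
have key t u : ht (a 0) + 1 <= t -> t <= u -> ht (a u) = ht (a t) + (u - t).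
 move=> ht0 tu; have t0 : 0 <= t by lra.
 have u0 : 0 <= u by lra.
 have g := gp_ultra (ka 0 (lexx 0)) (ka t t0) (ka u u0); have l := ht_le (ka t t0) (ka u u0).
 have h1 : 0 <= ht (a t) by apply: D_ge0; [exact: cone_o|exact: ka].
 rewrite /gp !da // in g l; rewrite distrC ger0_norm ?subr_ge0 // in l.
 have n1 : `|0 - t| = t by rewrite sub0r normrN ger0_norm.
 have n2 : `|0 - u| = u by rewrite sub0r normrN ger0_norm.
 have n3 : `|t - u| = u - t by rewrite distrC ger0_norm ?subr_ge0.
 rewrite n1 n2 n3 in g.
 exact: ray_ht_real h0 h1 ht0 tu l g.
split=> //; first by lra.
move=> t u ht0 tu; have t0 : 0 <= t by lra.
have u0 : 0 <= u by lra.
by rewrite /gp da // distrC ger0_norm ?subr_ge0 // (key t u) //; field.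
Qed.

(** Eventual equality up to a shift of time, equivalent to [ray_equiv] for rays but easier to
    compose. *)
Definition tail_eq (a b : R -> pt) : Prop := exists t0 c, forall t, t0 <= t -> [/\ 0 <= t, 0 <= t + c & b t = a (t + c)].

Lemma tail_refl a : tail_eq a a.
by exists 0, 0 => t t0; rewrite addr0. Qed.

Lemma tail_sym a b : tail_eq a b -> tail_eq b a.
move=> [t0 [c h]]; exists (t0 + c), (- c) => t ht0; have [h1 h2 h3] : [/\ 0 <= t - c, 0 <= t - c + c & b (t - c) = a (t - c + c)].
 by apply: h; lra.
by rewrite subrK in h2 h3; split.
Qed.

Lemma tail_trans a b c : tail_eq a b -> tail_eq b c -> tail_eq a c.
move=> [t0 [x h]] [t1 [y k]]; exists (Num.max t1 (t0 - y)), (y + x) => t; rewrite ge_max => /andP[h1 h2].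
have [k1 k2 ->] := k t h1; have [|h3 h4 ->] := h (t + y); first by lra.
by rewrite !addrA; split.
Qed.

(** [ray_equiv] requires the whole intersection of the images to be a ray, not just to contain one.
    Uniqueness of geodesics makes the set [S] of common times upward closed, and the intersection
    starts at its infimum. *)
Lemma tail_to_equiv a b : is_ray omega r a -> is_ray omega r b -> tail_eq a b -> ray_equiv omega r a b.
move=> [ka da] [kb db] [t0 [c hc]].
pose S : set R := [set t | 0 <= t /\ ray_image a (b t)].
have S1 t : S t -> 0 <= t + c /\ b t = a (t + c).
 move=> [tp [u u0 e]]; pose T := Num.max t0 (Num.max t (u - c)).
 have T0 : t0 <= T by rewrite /T le_max lexx.
 have T1 : t <= T by rewrite /T !le_max lexx orbT.
 have T2 : u - c <= T by rewrite /T !le_max lexx !orbT.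
 have [p1 p2 p3] := hc T T0.
 have : D (b t) (b T) = D (a u) (a (T + c)) by rewrite -e -p3.
 rewrite db // da // distrC ger0_norm ?subr_ge0 // distrC ger0_norm; last by lra.
 by move=> h; have <- : u = t + c by lra.
have S2 t t' : S t -> t <= t' -> S t'.
 move=> St tt; have [q1 q2] := S1 t St; have [tp _] := St; split; first by lra.
 exists (t' + c); first by rewrite /=; lra.
 pose T := Num.max t0 t'; have T0 : t0 <= T by rewrite /T le_max lexx.
 have T1 : t' <= T by rewrite /T !le_max lexx orbT.
 have [p1 p2 p3] := hc T T0.
 have x0 : 0 <= t' by lra.
 have x1 : 0 <= t' + c by lra.
 apply: (@geod_uniq _ _ (b t) (b T)); [exact: ka|exact: kb|exact: kb|exact: kb| | |].
 - by rewrite q2 da // -q2 db //; congr (`|_|); ring.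
 - by rewrite p3 da // -p3 db //; congr (`|_|); ring.
 - rewrite db // {1}q2 {1}p3 !da // distrC ger0_norm; last by lra.
  rewrite ger0_norm; last by lra.
  by rewrite distrC ger0_norm; [ring|lra].
have St0 : S t0.
 by have [p1 p2 p3] := hc t0 (lexx _); split=> //; exists (t0 + c).
have Slb : has_lbound S by exists 0 => t [].
have Sinf : has_inf S by split=> //; exists t0.
pose tau := inf S; have tau0 : 0 <= tau by apply: lb_le_inf; [exists t0|move=> t []].
have St t : tau < t -> S t.
 move=> lt; have e0 : 0 < t - tau by rewrite subr_gt0.
 have [s Ss hs'] := inf_adherent e0 Sinf; apply: (S2 s) => //.
 by rewrite ltW // (lt_le_trans hs') // /tau addrC subrK.
have tc : 0 <= tau + c.
 rewrite leNgt; apply/negP => lt; have [] := S1 ((tau - c) / 2); first by apply: St; lra.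
 by move=> hh _; lra.
have Stau : S tau.
 split=> //; exists (tau + c) => //; apply/esym/D_eq0; [exact: kb|exact: ka|].
 apply/ler_addgt0Pl => e e0; rewrite addr0.
 have e2 : 0 < e / 2 by pos.
 have [|q1 q2] := S1 (tau + e / 2); first by apply: St; lra.
 have y0 : 0 <= tau + e / 2 by lra.
 apply: le_trans (D_triangle (kb _ tau0) (kb _ y0) (ka _ tc)) _.
 rewrite db // {1}q2 da // distrC ger0_norm; last by lra.
 rewrite ger0_norm; last by lra.
 lra.
exists (fun s => b (tau + s)).
 split=> [t ht0|s t s0 t1]; first by apply: kb; lra.
 by rewrite db ?addr_ge0 //; congr (`|_|); ring.
apply/seteqP; split=> [_ [s s0 <-]|X [[u u0 e] [t t1 e2]]].
 rewrite /= in s0; have Ss : S (tau + s) by apply: (S2 tau) => //; rewrite lerDl.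
 by split; [case: Ss|exists (tau + s) => //; rewrite /= addr_ge0].
have Stt : S t by split=> //; rewrite e2; exists u.
exists (t - tau); last by rewrite addrC subrK.
by rewrite /= subr_ge0; apply: inf_lbound.
Qed.

(** The alternative f(u) = f(0) - u is negative once u > f(0). *)
Lemma isom_shift (f : R -> R) : (forall u, 0 <= u -> 0 <= f u) ->
 (forall u v, 0 <= u -> 0 <= v -> `|f u - f v| = `|u - v|) -> forall u, f 0 < u -> f u = f 0 + u.
move=> f0 fi u hu; have u0 : 0 <= u by apply: le_trans (f0 0 (lexx _)) (ltW hu).
have := fi u 0 u0 (lexx _); rewrite subr0 (ger0_norm u0); have := f0 u u0.
by have [h|h] := ler0P (f u - f 0) => *; lra.
Qed.

Lemma equiv_to_tail a b : is_ray omega r a -> is_ray omega r b -> ray_equiv omega r a b -> tail_eq a b.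
move=> [ka da] [kb db] [c [kc dc] hc].
have ca u : exists t, 0 <= u -> 0 <= t /\ a t = c u.
 have [u0|u0] := pselect (0 <= u); last by exists 0 => /u0.
 have : ray_image c (c u) by exists u.
 by rewrite hc => -[[t t0 e] _]; exists t.
have cb u : exists t, 0 <= u -> 0 <= t /\ b t = c u.
 have [u0|u0] := pselect (0 <= u); last by exists 0 => /u0.
 have : ray_image c (c u) by exists u.
 by rewrite hc => -[_ [t t0 e]]; exists t.
have [f hf] := choice ca; have [g hg] := choice cb.
have fi : forall u, f 0 < u -> f u = f 0 + u.
 apply: isom_shift => [u u0|u v u0 v0]; first by have [] := hf u u0.
 by have [f1 f2] := hf u u0; have [f3 f4] := hf v v0; rewrite -(da _ _ f1 f3) f2 f4 dc.
have gi : forall u, g 0 < u -> g u = g 0 + u.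
 apply: isom_shift => [u u0|u v u0 v0]; first by have [] := hg u u0.
 by have [f1 f2] := hg u u0; have [f3 f4] := hg v v0; rewrite -(db _ _ f1 f3) f2 f4 dc.
have [f0 _] := hf 0 (lexx _); have [g0 _] := hg 0 (lexx _).
exists (g 0 + (f 0 + g 0 + 1)), (f 0 - g 0) => t ht0; pose u := t - g 0.
have u0 : 0 <= u by rewrite /u; lra.
have fu : f u = t + (f 0 - g 0) by rewrite fi /u; [ring|lra].
have gu : g u = t by rewrite gi /u; [ring|lra].
have [p1 p2] := hf u u0; have [p3 p4] := hg u u0; rewrite fu in p1 p2; rewrite gu in p3 p4.
by rewrite p4.
Qed.

Lemma end_ofP a b : is_ray omega r a -> is_ray omega r b -> end_of omega r a = end_of omega r b <-> tail_eq a b.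
move=> ra rb; split=> [e|h].
 have : end_of omega r b b by split=> //; apply: tail_to_equiv => //; exact: tail_refl.
 by rewrite -e => -[_ /equiv_to_tail]; apply.
apply/seteqP; split=> c [rc hc]; split=> //; apply: tail_to_equiv => //.
 by apply: tail_trans (tail_sym h) _; exact: equiv_to_tail.
by apply: tail_trans h _; exact: equiv_to_tail.
Qed.

Lemma gp_same z s t : 0 <= s -> s <= t -> gp (ray_pt z s) (ray_pt z t) = s.
by move=> s0 st; apply: gp_ray => //; [exact: le_trans st|exact: lgap_same]. Qed.

Lemma end_std (z : nat -> Ch) : es z = end_of omega r (ray_pt z).
by []. Qed.

Lemma ray_ptE z t : ray_pt z t = cone_class omega r (fun n => hgeod (t * r n) (z n)).
by []. Qed.

Lemma htE X : D o X = ht X. by []. Qed.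

Lemma in_end_of a b : is_ray omega r a -> end_of omega r a b <-> is_ray omega r b /\ tail_eq a b.
by move=> ra; split=> -[rb h]; split=> //; [exact: equiv_to_tail|exact: tail_to_equiv]. Qed.

#[global] Opaque ray_pt cone_dist cone_class ht gp bary_ext hgeod.

Local Notation rp := ray_pt.

Lemma rp_lower z w s t : 0 <= s -> s <= t -> rp z t = rp w t -> rp z s = rp w s.
move=> s0 st e; have t0 := le_trans s0 st.
apply: (@below_uniq _ _ (rp z t) s); try exact: cone_ray; try exact: ht_ray.
 exact: gp_same.
by rewrite e; exact: gp_same.
Qed.

Lemma tail_std (z w : nat -> Ch) : tail_eq (rp z) (rp w) <-> forall t, 0 <= t -> rp z t = rp w t.
split=> [[t0 [c h]] t t1|h]; last by exists 0, 0 => t t0; rewrite addr0 h.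
have [h1 h2 h3] := h t0 (lexx _).
have c0 : c = 0 by have := congr1 ht h3; rewrite !ht_ray; lra.
pose u := Num.max t t0; have [u0 _ e] : [/\ 0 <= u, 0 <= u + c & rp w u = rp z (u + c)] by apply: h; rewrite le_max lexx orbT.
have tu : t <= u by rewrite le_max lexx.
have e' : rp z u = rp w u by rewrite e; congr (rp z _); rewrite c0 addr0.
exact: rp_lower t1 tu e'.
Qed.

Lemma std_end_eq (z w : nat -> Ch) : es z = es w <-> forall t, 0 <= t -> rp z t = rp w t.
by rewrite -tail_std; apply: end_ofP; exact: is_ray_std. Qed.

(** Two sequences of points of the sphere define the same end exactly when their distance decays
    faster than every exponential rate in [r n]. *)
Lemma std_end_chordal (z w : nat -> Ch) : es z = es w <->
 forall B : R, \forall n \near omega, chordal (z n) (w n) <= expR (- (B * r n)).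
rewrite std_end_eq; split=> [h B|h t t0].
 pose t := Num.max 0 B + 1; have t0 : 0 <= t by rewrite addr_ge0 // le_max lexx.
 have [g hg [_ g1 _]] := lgap_ex z w t0 t0; have := dist_ray t0 t0 hg.
 rewrite h // dist_same // subrr normr0 => e; have gt : g = t by lra.
 have Bg : B < g by rewrite gt; apply: (@le_lt_trans _ _ (Num.max 0 B)); [rewrite le_max lexx orbT|rewrite ltrDl].
 apply: filterS (rl_gt hg Bg) => n; rewrite /lgap => hn.
 have g0 := gap_gt0 (t * r n) (t * r n) (z n) (w n).
 apply: (@le_trans _ _ (gap (t * r n) (t * r n) (z n) (w n))); first by rewrite /gap le_max lexx.
 rewrite -[leLHS]lnK // ler_expR; lra.
have [g hg [_ g1 _]] := lgap_ex z w t0 t0; apply: D_eq0; [exact: cone_ray|exact: cone_ray|].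
rewrite (dist_ray t0 t0 hg); suff : t <= g by lra.
apply: (rl_le _ (@rl_r t) hg); apply: filterS (h t) => n hn; rewrite /lgap lerNr.
by rewrite -[leRHS]expRK ler_ln ?posrE ?gap_gt0 ?expR_gt0 // /gap !ge_max hn lexx.
Qed.

Lemma near_all (P : nat -> nat -> Prop) i : (forall j, (j <= i)%N -> \forall n \near omega, P j n) ->
 \forall n \near omega, forall j, (j <= i)%N -> P j n.
elim: i => [|i IH] h.
 by apply: filterS (h 0%N (leqnn _)) => n hn j; rewrite leqn0 => /eqP ->.
have h1 := IH (fun j ji => h j (leqW ji)); apply: filterS2 h1 (h i.+1 (leqnn _)) => n a b j.
by rewrite leq_eqVlt => /predU1P[->//|]; rewrite ltnS; exact: a.
Qed.

Lemma bounded_max (P : nat -> Prop) (N : nat) : exists i, (forall k, (k <= N)%N -> P k -> (k <= i)%N /\ P i).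
elim: N => [|N [i hi]]; first by exists 0%N => k; rewrite leqn0 => /eqP ->.
have [p|np] := pselect (P N.+1); first by exists N.+1 => k kN _.
by exists i => k; rewrite leq_eqVlt => /predU1P[->//|]; rewrite ltnS; exact: hi.
Qed.

(** Each point of the ray lies on a radial ray, with directions depending on the point; a diagonal
    choice of the directions serves all points at once. *)
Lemma ray_std a : is_ray omega r a -> exists z, tail_eq (rp z) a.
move=> ra; have [ka da] := ra; have [t0 [t00 hh hg]] := ray_ht ra.
pose H := ht (a t0); have H0 : 0 <= H by apply: D_ge0; [exact: cone_o|exact: ka].
have tj j : 0 <= t0 + j%:R by rewrite addr_ge0.
have htj j : ht (a (t0 + j%:R)) = H + j%:R.
 by rewrite (hh t0) ?lerDl // /H; congr (_ + _); ring.
have w_ex j : exists w, a (t0 + j%:R) = rp w (H + j%:R).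
 have [t [w [ht0 e]]] := cone_rayP (ka _ (tj j)); exists w.
 by have := htj j; rewrite {1}e (ht_ray w ht0) => h; rewrite -h; exact: e.
have [w hw] := choice w_ex.
have Hj j : 0 <= H + j%:R by rewrite addr_ge0.
have below i j : (j <= i)%N -> rp (w i) (H + j%:R) = rp (w j) (H + j%:R).
 move=> ji; have ji' : (j%:R : R) <= i%:R by rewrite ler_nat.
 rewrite -hw; apply: (@below_uniq _ _ (a (t0 + i%:R)) (H + j%:R)).
 - exact: cone_ray.
 - exact: ka.
 - exact: ka.
 - exact: ht_ray.
 - exact: htj.
 - by rewrite hw gp_same // lerD2l.
 - by rewrite hg ?htj // ?lerDl // lerD2l.
pose x j n := hgeod ((H + j%:R) * r n) (w j n).
(* At index n, the directions of the i-th point account for all earlier marked points up to 1 / (i +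
   1). *)
pose P i n := forall j, (j <= i)%N -> hdist (x j n) (hgeod ((H + j%:R) * r n) (w i n)) <= i.+1%:R^-1 * r n.
have nP i : \forall n \near omega, P i n.
 apply: near_all => j ji; have := below i j ji => e.
 have ax := adm_ray (w j) (Hj j); have ay := adm_ray (w i) (Hj j).
 have := cone_class_inj ax ay (esym e) => h.
 have e0 : 0 < i.+1%:R^-1 :> R by rewrite invr_gt0 ltr0n.
 by apply: filterS (rl_lt h e0) => n /ltW.
(* [k n] dominates every [i <= n] with [P i n] and satisfies [P] itself whenever such an [i] exists,
   so it tends to infinity along [omega]. *)
have [k hk] := choice (fun n => bounded_max (P^~ n) n).
pose z n := w (k n) n; exists z.
have key j : a (t0 + j%:R) = rp z (H + j%:R).
 rewrite hw; apply: cone_class_eq; try by move=> n; exact: hgeod_ball.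
 apply: rl0 => e e0; pose i := maxn j (Num.bound e^-1).
 have b1 : e^-1 < i.+1%:R :> R.
  have e1 : 0 <= e^-1 by rewrite invr_ge0 ltW.
  have := archi_boundP e1 => h; apply: lt_le_trans h _; rewrite ler_nat leqW // leq_max leqnn orbT.
  by [].
 have nN : \forall n \near omega, (i <= n)%N by apply: (scale_near hs); exists i.
 apply: filterS3 (nP i) nN (near_r 0) => n hP hn rn.
 have [ik hPk] := hk n i hn hP.
 have jk : (j <= k n)%N by apply: leq_trans ik; rewrite leq_max leqnn.
 rewrite ger0_norm; last by apply: hdist_ge0; exact: hgeod_ball.
 apply: le_trans (hPk j jk) _; rewrite ler_pM2r // invf_ple ?posrE ?ltr0n //.
 by apply: le_trans (ltW b1) _; rewrite ler_nat ltnS.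
exists (t0 + (Num.bound t0)%:R), (H - t0) => t lt.
have t1 : t0 <= t by apply: le_trans lt; rewrite lerDl.
have p1 : 0 <= t by apply: le_trans t1.
have p2 : 0 <= t + (H - t0) by lra.
split=> //; pose j := Num.bound t.
have jt : t <= t0 + j%:R by have := archi_boundP p1; rewrite -/j; lra.
have hat : ht (a t) = t + (H - t0) by rewrite (hh t0) // -/H; ring.
apply: (@below_uniq _ _ (a (t0 + j%:R)) (t + (H - t0))).
- exact: ka.
- exact: cone_ray.
- exact: ka.
- exact: hat.
- exact: ht_ray.
- by rewrite hg.
- by rewrite key gp_same //; lra.
Qed.

Lemma cone_end_std e : cone_end omega r e -> exists z, e = es z.
case=> a ra <-; have [z hz] := ray_std ra; exists z; rewrite end_std.
apply/end_ofP => //; first exact: is_ray_std.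
exact: tail_sym.
Qed.

Lemma std_end_in (z : nat -> Ch) b : es z b <-> is_ray omega r b /\ tail_eq (rp z) b.
by rewrite end_std; apply: in_end_of; exact: is_ray_std. Qed.

Lemma cvg_end_std (z : nat -> Ch) : cvg_end (fun i => rp z i%:R) (es z).
move=> b /std_end_in[rb [t0 [c h]]]; pose N := Num.bound (`|t0| + `|c|).
have b0 : 0 <= `|t0| + `|c| by rewrite addr_ge0.
have := archi_boundP b0; rewrite -/N => hN.
exists N => // i /= iN; have iR : (N%:R : R) <= i%:R by rewrite ler_nat.
have := ler_norm t0; have := ler_norm c => l1 l2.
have [|p1 p2 p3] := h (i%:R - c); first by lra.
by exists (i%:R - c); [exact: p1|rewrite p3; congr (rp z _); exact: subrK].
Qed.

Lemma cvg_end_far (z : nat -> Ch) x : cvg_end x (es z) ->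
 forall T, \forall i \near \oo, exists t, [/\ T <= t, 0 <= t & x i = rp z t].
move=> h T; pose T0 := Num.max 0 T; have T00 : 0 <= T0 by rewrite /T0 le_max lexx.
have rb : is_ray omega r (fun t => rp z (T0 + t)).
 split=> [t t0|s t s0 t0]; first by apply: cone_ray; rewrite addr_ge0.
 by rewrite dist_same ?addr_ge0 //; rewrite opprD addrACA subrr add0r.
have eb : es z (fun t => rp z (T0 + t)).
 apply/std_end_in; split; first exact: rb.
 by exists 0, T0 => t t0; split; [exact: t0|rewrite addr_ge0|rewrite addrC].
apply: filterS (h _ eb) => i [t /= t0 <-]; exists (T0 + t); split=> //; last by rewrite addr_ge0.
by apply: (@le_trans _ _ T0); rewrite ?lerDl // /T0 le_max lexx orbT.
Qed.

(** * Maps that are affine along a radial ray: image of the end and translation length *)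

Section RayMap.
Variables (F : pt -> pt) (z w : nat -> Ch) (k : nat) (c t0 : R).
Hypotheses (k0 : (0 < k)%N)
 (hF : forall t, t0 <= t -> [/\ 0 <= t, 0 <= k%:R * t + c & F (rp z t) = rp w (k%:R * t + c)]).

(** [end_map] is a choice, so any ray and any factor allowed by its definition must give the same
    end; comparing distances at two times identifies the factor with [k]. *)
Lemma end_map_std : end_map omega r F (es z) = es w.
have uniq e' : (exists a b, [/\ es z a, is_ray omega r b, e' = end_of omega r b &
  exists2 k, (0 < k)%N & forall t, 0 <= t -> F (a t) = b (k%:R * t)]) -> e' = es w.
 move=> [a [b [/std_end_in[ra [t1 [c1 h1]]] rb -> [l l0 hl]]]].
 rewrite end_std; apply/end_ofP => //; first exact: is_ray_std.
 apply: tail_sym; have [kb db] := rb.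
 pose T := Num.max t1 (t0 - c1).
 have big t : T <= t -> [/\ 0 <= t, 0 <= k%:R * (t + c1) + c & b (l%:R * t) = rp w (k%:R * (t + c1) + c)].
  rewrite ge_max => /andP[g1 g2]; have [p1 p2 p3] := h1 t g1.
  by have [|q1 q2 q3] := hF (t := t + c1); [lra|split=> //; rewrite -hl // p3 q3].
 have T0 : 0 <= T by have [] := big T (lexx _).
 have T1 : 0 <= T + 1 by lra.
 have TT1 : T <= T + 1 by rewrite lerDl.
 have [_ x1 x2] := big T (lexx _); have [_ y1 y2] := big (T + 1) TT1.
 have lk : (l%:R : R) = k%:R.
  have := db (l%:R * T) (l%:R * (T + 1)) (mulr_ge0 (ler0n _ _) T0) (mulr_ge0 (ler0n _ _) T1).
  rewrite x2 y2 dist_same //.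
  have -> : k%:R * (T + c1) + c - (k%:R * (T + 1 + c1) + c) = - k%:R by ring.
  have -> : l%:R * T - l%:R * (T + 1) = - l%:R by ring.
  by rewrite !normrN !ger0_norm.
 have kp : 0 < k%:R :> R by rewrite ltr0n.
 exists (k%:R * T), (k%:R * c1 + c) => u hu.
 have [|q1 q2 q3] := big (u / k%:R); first by rewrite ler_pdivlMr // mulrC.
 have e1 : k%:R * (u / k%:R) = u by rewrite mulrC divfK // gt_eqF.
 rewrite mulrDr e1 in q2 q3; rewrite lk e1 in q3; rewrite -addrA in q2 q3; split=> //.
 by apply: le_trans hu; exact: mulr_ge0 (ltW kp) T0.
rewrite /end_map; case: xgetP => [e' _ he'|noex]; first exact: uniq.
exfalso; pose T := Num.max 0 t0.
have T0 : 0 <= T by rewrite /T le_max lexx.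
have [q1 q2 q3] : [/\ 0 <= T, 0 <= k%:R * T + c & F (rp z T) = rp w (k%:R * T + c)] by apply: hF; rewrite le_max lexx orbT.
apply: (noex (end_of omega r (fun t => rp w (k%:R * T + c + t)))); exists (fun t => rp z (T + t)), (fun t => rp w (k%:R * T + c + t)).
split.
- apply/std_end_in; split.
  split=> [t h0|s t s0 h0]; first by apply: cone_ray; rewrite addr_ge0.
  by rewrite dist_same ?addr_ge0 //; rewrite opprD addrACA subrr add0r.
 by exists 0, T => t h0; split; [exact: h0|rewrite addr_ge0|rewrite addrC].
- split=> [t h0|s t s0 h0]; first by apply: cone_ray; rewrite addr_ge0.
 have s1 := addr_ge0 q2 s0; have t1 := addr_ge0 q2 h0.
 by rewrite (dist_same w s1 t1) opprD addrACA subrr add0r.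
- exact: erefl.
exists k; first exact: k0.
move=> t h0; have [|_ _ ->] := hF (t := T + t).
 by apply: (@le_trans _ _ T); rewrite ?lerDl // /T le_max lexx orbT.
by congr (rp w _); ring.
Qed.

Lemma ray_diff t : t0 <= t -> D (rp z t) (cone_base omega r) - D (F (rp z t)) (cone_base omega r) = t - (k%:R * t + c).
move=> h; have [q1 q2 ->] := hF h; have kz := cone_ray z q1; have kw := cone_ray w q2.
by rewrite (D_sym kz cone_o) (D_sym kw cone_o) !htE (ht_ray z q1) (ht_ray w q2).
Qed.

Lemma end_length_finite : k = 1%N -> is_end_length omega r F (es z) (- c)%:E.
move=> k1 x kx cx; apply: cvg_near_cst; apply: filterS (cvg_end_far cx t0) => i [t [h1 h2 ->]].
by rewrite ray_diff // k1; congr EFin; ring.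
Qed.

(** With slope at least 2 the image outruns the point, and the difference of heights tends to minus
    infinity. *)
Lemma end_length_infinite : (1 < k)%N -> is_end_length omega r F (es z) -oo%E.
move=> k1 x kx cx; apply/cvgeNyPle => A.
have hT := cvg_end_far cx (Num.max t0 (`|A| + `|c|)).
apply: filterS hT => i [t [h1 h2 ->]]; move: h1; rewrite ge_max => /andP[h1 h3].
rewrite ray_diff // lee_fin; have k2 : (2 : R) <= k%:R by rewrite ler_nat.
have : 2 * t <= k%:R * t by rewrite ler_wpM2r.
have := ler_norm c; have := ler_norm (- c); have := ler_norm (- A); rewrite !normrN.
have := normr_ge0 A; have := normr_ge0 c; lra.
Qed.

End RayMap.

Lemma end_length_uniq F (z : nat -> Ch) l m : is_end_length omega r F (es z) l ->
 is_end_length omega r F (es z) m -> l = m.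
move=> h1 h2; have kx i : K (rp z i%:R) by apply: cone_ray.
have c1 := h1 _ kx (@cvg_end_std z); have c2 := h2 _ kx (@cvg_end_std z).
by apply: cvg_unique c1 c2; exact: ereal_hausdorff.
Qed.

Lemma hdist_radial (s t : R) (z : Ch) : 0 <= s -> 0 <= t -> hdist (hgeod s z) (hgeod t z) <= `|s - t| + ln 8.
move=> s0 t0; have := @hdist_hgeod s t z z s0 t0.
rewrite ler_norml => /andP[_]; rewrite /gap chordalxx (max_idPr _); last by rewrite le_max expR_ge0.
have [le|/ltW le] := leP (expR (- s)) (expR (- t)); rewrite expRK.
 move: le; rewrite ler_expR lerN2 => le; rewrite ger0_norm ?subr_ge0 //; lra.
move: le; rewrite ler_expR lerN2 => le; rewrite distrC ger0_norm ?subr_ge0 //; lra.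
Qed.

Lemma rl_norm (u : nat -> R) l e : rl u l -> 0 < e -> \forall n \near omega, `|u n - l * r n| <= e * r n.
move=> h e0; have h1 : rl (fun n => u n - l * r n) 0.
 by have := rlD h (rlN (@rl_r l)); rewrite subrr.
have e1 : - e < 0 by rewrite oppr_lt0.
apply: filterS2 (rl_lt h1 e0) (rl_gt h1 e1) => n a b; rewrite ler_norml (ltW a) andbT.
by rewrite -mulNr ltW.
Qed.

Lemma near0_radial (S : nat -> R) (z : nat -> Ch) l : rl S l -> 0 <= l -> (\forall n \near omega, 0 <= S n) ->
 near0 (fun n => hgeod (S n) (z n)) (fun n => hgeod (l * r n) (z n)).
move=> h l0 S0; apply: rl0 => e e0; have e2 : 0 < e / 2 by rewrite divr_gt0.
apply: filterS3 (rl_norm h e2) S0 (near_r (2 * ln 8 / e)) => n a b c.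
rewrite ger0_norm; last by apply: hdist_ge0; exact: hgeod_ball.
have q : 0 <= l * r n by rewrite mulr_ge0 // (scale_ge0 hs).
apply: le_trans (hdist_radial (z n) b q) _; rewrite ltr_pdivrMr // in c.
by move: a c; move: (`|S n - l * r n|) (r n) (ln 8) => x1 x2 x3; lra.
Qed.

Lemma ultra_pigeon (P : nat -> nat -> Prop) (N : nat) : (\forall n \near omega, exists2 j, (j <= N)%N & P j n) ->
 exists2 j, (j <= N)%N & \forall n \near omega, P j n.
elim: N => [|N IH] h.
 by exists 0%N => //; apply: filterS h => n [j]; rewrite leqn0 => /eqP ->.
have [h1|h1] := in_ultra_setVsetC [set n | P N.+1 n] UF; first by exists N.+1.
have [|j jN hj] := IH; last by exists j; [exact: leqW|exact: hj].
apply: filterS2 h h1 => n [j]; rewrite leq_eqVlt => /predU1P[->//|jN] p _.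
by exists j.
Qed.

(** * The limiting map along radial rays: slope and offset from coefficients *)

Section LimitMapRays.
Variables (d : nat) (f : nat -> Ratd R d).
Hypothesis d0 : (0 < d)%N.
Local Notation F := (limit_map omega r (fun n => ratfun (f n))).
Local Notation N0 n := (cn2 d (rW (f n))).

(** The bound of [value_lower] at scale [r n]: lifts are exponentially non-degenerate, at an
    unspecified rate. *)
Definition tame : Prop := exists C0 : R, \forall n \near omega, forall a b, nsq a + nsq b = 1 ->
 expR (- (C0 * r n)) * N0 n <= nsq (hev d (rP (f n)) a b) + nsq (hev d (rQ (f n)) a b).

Definition fseq (z : nat -> Ch) : nat -> Ch := fun n => ratfun (f n) (z n).

Lemma cn2_rW_gt0 n : 0 < N0 n.
have nz := nz_rW (f n); have := lt_le_trans (n2_gt0 0 nz) (n2_le 0 nz).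
by rewrite nsq0 addr0 expr1n mulr1 pmulr_rgt0 // ltr0n.
Qed.

(** Independence of the representative follows from the coarse Lipschitz bound, whose additive
    constant disappears in the limit. *)
Lemma limit_map_class x : admissible r x ->
 F (cone_class omega r x) = cone_class omega r (fun n => bary_ext (ratfun (f n)) (x n)).
move=> ax; have [ax' h] := cone_repr_class ax; rewrite /limit_map; have [bx _] := ax; have [bx' _] := ax'.
have [k hk] := @bary_coarse d d0.
apply: cone_class_eq; try by move=> n; exact: bary_ext_ball.
have := rlD (@rlZ d%:R _ _ (near0_sym h)) (rl_cst k); rewrite mulr0 addr0.
apply: rl0_le; apply: nearW => n; rewrite ger0_norm; first exact: hk.
by apply: hdist_ge0; exact: bary_ext_ball.
Qed.

Lemma limit_map_ray z t : 0 <= t ->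
 F (rp z t) = cone_class omega r (fun n => bary_ext (ratfun (f n)) (hgeod (t * r n) (z n))).
by move=> t0; rewrite ray_ptE (limit_map_class (adm_ray z t0)). Qed.

Section Image.
Variables (z : nat -> Ch) (C0 : R).
Let W n := loc (f n) (z n) (ratfun (f n) (z n)).
Hypothesis tm : \forall n \near omega, forall a b, nsq a + nsq b = 1 ->
 expR (- (C0 * r n)) * N0 n <= nsq (hev d (rP (f n)) a b) + nsq (hev d (rQ (f n)) a b).

(** The j-th coefficient is not super-exponentially small. The least good positive index is the
    slope of the limiting map on the end: smaller indices vanish in the limit, larger ones are
    suppressed deep along the ray. *)
Definition good (j : nat) : Prop := exists B : R, \forall n \near omega, expR (- (B * r n)) * N0 n <= nsq (W n).1`_j.

Let C1 : R := chc d * 2 ^+ d.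

Let C1_gt0 : 0 < C1. by rewrite mulr_gt0 ?chc_gt0 // exprn_gt0. Qed.

Lemma loc_le n j : (j <= d)%N -> nsq (W n).1`_j <= C1 * N0 n /\ nsq (W n).2`_j <= C1 * N0 n.
move=> jd; have h := cn2_loc_le (f n) (z n) (ratfun (f n) (z n)); rewrite -/(W n) -/C1 in h.
have c1 := cn_ge0 d (W n).1; have c2 := cn_ge0 d (W n).2; have := nsq_le_cn (W n).1 jd; have := nsq_le_cn (W n).2 jd.
by move: h; rewrite /cn2; split; lra.
Qed.

Lemma near_const (c : R) : \forall n \near omega, c <= expR (r n).
have [c0|c0] := ltP 0 c; last by apply: nearW => n; apply: le_trans c0 (expR_ge0 _).
by apply: filterS (near_r (ln c)) => n h; rewrite -[leLHS]lnK ?posrE // ler_expR ltW.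
Qed.

(** For each n some coefficient of positive index is large by [loc_coef_ge]; the ultrafilter picks
    one index. *)
Lemma good_exists : exists j, (0 < j <= d)%N /\ good j.
have h1 : \forall n \near omega, exists2 j, (j <= d)%N & (0 < j)%N /\ expR (- ((C0 + 1) * r n)) * N0 n <= nsq (W n).1`_j.
 apply: filterS2 tm (near_const (d.+1%:R ^+ 2)) => n h c.
 have [_ [j /andP[j0 jd] hj]] := loc_coef_ge (z n) d0 h; exists j => //; split=> //.
 have D0 : 0 < d.+1%:R ^+ 2 :> R by rewrite exprn_gt0 // ltr0n.
 rewrite -(ler_pM2l D0); apply: le_trans hj; rewrite mulrA ler_pM2r ?cn2_rW_gt0 //.
 rewrite mulrDl mul1r opprD expRD mulrCA ler_piMr ?expR_ge0 // expRN ler_pdivrMr ?expR_gt0 // mul1r.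
 exact: c.
have [j jd hj] := ultra_pigeon h1; exists j; have [n [j0 _]] := @filter_ex _ omega _ _ hj.
by rewrite j0 jd; split=> //; exists (C0 + 1); apply: filterS hj => m [].
Qed.

Lemma not_good j (B : R) : ~ good j -> \forall n \near omega, nsq (W n).1`_j <= expR (- (B * r n)) * N0 n.
move=> ng; have [h|h] := in_ultra_setVsetC [set n | expR (- (B * r n)) * N0 n <= nsq (W n).1`_j] UF.
 by exfalso; apply: ng; exists B.
by apply: filterS h => n /= /negP; rewrite -ltNge => /ltW.
Qed.

Lemma q0_bnd : \forall n \near omega, expR (- (C0 * r n)) * N0 n <= nsq (W n).2`_0.
by apply: filterS tm => n h; have [] := loc_coef_ge (z n) d0 h. Qed.

Lemma least_good : exists k, [/\ (0 < k <= d)%N, good k & forall j, (0 < j < k)%N -> ~ good j].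
have [j [jd gj]] := good_exists.
have ex : exists j, `[< (0 < j <= d)%N /\ good j >] by exists j; apply/asboolP.
case: (ex_minnP ex) => k /asboolP[kd gk] mk; exists k; split=> // i /andP[i0 ik] gi.
suff : (k <= i)%N by rewrite leqNgt ik.
apply: mk; apply/asboolP; split=> //; rewrite i0 /=; case/andP: kd => _; apply: leq_trans; exact: ltnW.
Qed.

Lemma ln_ratio_bnd (x y u v : R) : 0 < x -> 0 < y -> u <= ln x <= v -> u <= ln y <= v -> `|ln (x / y)| <= v - u.
by move=> x0 y0 /andP[a b] /andP[c e]; rewrite ln_div ?posrE // ler_norml; apply/andP; split; lra. Qed.

Lemma half_gap_le (x y b m q : R) : x <= y -> y < q -> (b + x) / 2 - (b - m * q) / 2 <= (m + 1) / 2 * q.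
by move=> *; lra. Qed.

Lemma ln_normR (p : C) : p != 0 -> ln (nsq p) = 2 * ln (normR p).
by move=> p0; rewrite -normR_sqr lnXn ?normR_gt0 // mulr2n; ring. Qed.

Lemma ln_coef_bnd (p : C) n (B : R) : p != 0 -> expR (- (B * r n)) * N0 n <= nsq p -> nsq p <= C1 * N0 n ->
 (ln (N0 n) - B * r n) / 2 <= ln (normR p) <= (ln (N0 n) + ln C1) / 2.
move=> p0 h1 h2; have n0 := cn2_rW_gt0 n; have s0 : 0 < nsq p by rewrite nsq_gt0.
have e : ln (nsq p) = 2 * ln (normR p) := ln_normR p0.
have a1 : - (B * r n) + ln (N0 n) <= ln (nsq p).
 by rewrite -{1}[- (B * r n)]expRK -lnM ?posrE ?expR_gt0 // ler_ln ?posrE // mulr_gt0 ?expR_gt0.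
have a2 : ln (nsq p) <= ln C1 + ln (N0 n) by rewrite -lnM ?posrE // ler_ln ?posrE // mulr_gt0.
by move: e a1 a2; move: (ln _) (ln _) (ln _) (ln _) (B * _) => x1 x2 x3 x4 x5 e a1 a2; apply/andP; split; lra.
Qed.

Lemma coef_nz (p : C) n (B : R) : expR (- (B * r n)) * N0 n <= nsq p -> p != 0.
by move=> h; rewrite -nsq_gt0; apply: lt_le_trans h; rewrite mulr_gt0 ?expR_gt0 ?cn2_rW_gt0. Qed.

Lemma shift_ex k : (k <= d)%N -> good k -> exists c, rl (fun n => ln (normR (W n).2`_0 / normR (W n).1`_k)) c.
move=> kd [B hB]; pose M := Num.max B C0.
apply: (@rl_ex _ ((M + 1) / 2)); apply: filterS3 hB q0_bnd (near_r (`|ln C1|)) => n h1 h2 h3.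
have p0 := coef_nz h1; have q0 := coef_nz h2; have rn := scale_ge0 hs n.
have [l1 _] := loc_le n kd; have [_ l2] := loc_le n (leq0n d).
have /andP[a1 a2] := ln_coef_bnd p0 h1 l1; have /andP[b1 b2] := ln_coef_bnd q0 h2 l2.
have m1 : B * r n <= M * r n by rewrite ler_wpM2r // /M le_max lexx.
have m2 : C0 * r n <= M * r n by rewrite ler_wpM2r // /M le_max lexx orbT.
have le1 := ler_norm (ln C1).
apply: le_trans (@ln_ratio_bnd _ _ ((ln (N0 n) - M * r n) / 2) ((ln (N0 n) + ln C1) / 2) _ _ _ _) _.
- by rewrite normR_gt0.
- by rewrite normR_gt0.
- by apply/andP; split; lra.
- by apply/andP; split; lra.
exact: half_gap_le le1 h3.
Qed.

Lemma exp_step (a k c e m : R) : 0 < m -> c * expR (- a) <= e ->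
 expR (- (a * (k + 1))) * (c * m) <= expR (- (a * k)) * (e * m).
move=> m0 h; have -> : expR (- (a * (k + 1))) * (c * m) = expR (- (a * k)) * (c * expR (- a) * m).
 by rewrite mulrDr mulr1 opprD expRD; ring.
by rewrite ler_wpM2l ?expR_ge0 // ler_wpM2r // ltW.
Qed.

Lemma exp_absorb (a c x y : R) : c <= expR x -> x + y <= a -> c * expR (- a) <= expR (- y).
move=> h xya; apply: le_trans (ler_wpM2r (expR_ge0 _) h) _; rewrite -expRD ler_expR; lra.
Qed.

Lemma image_ray k c : (0 < k <= d)%N -> good k -> (forall j, (0 < j < k)%N -> ~ good j) ->
 rl (fun n => ln (normR (W n).2`_0 / normR (W n).1`_k)) c ->
 exists t0, forall t, t0 <= t -> [/\ 0 <= t, 0 <= k%:R * t + c &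
  F (rp z t) = rp (fseq z) (k%:R * t + c)].
(* Beyond |B| + |C0| the exponential decay along the ray beats the ratio between coefficients, and
   |c| makes the height of the image positive. *)
move=> /andP[k0 kd] [B hB] ng hc; pose T := `|B| + `|C0| + `|c| + 1.
have kR : 1 <= k%:R :> R by rewrite ler1n.
exists T => t tT.
have nB := normr_ge0 B; have nC := normr_ge0 C0; have nc := normr_ge0 c.
have lB := ler_norm B; have lC := ler_norm C0; have lc : - c <= `|c| by rewrite -normrN ler_norm.
have t0 : 0 <= t by rewrite /T in tT; lra.
have kt : t <= k%:R * t by rewrite ler_peMl.
have ktc : 0 < k%:R * t + c by rewrite /T in tT; lra.
split=> //; first exact: ltW.
rewrite limit_map_ray //; have [K1 hK] := @bary_ray d d0.
pose S n := t * r n * k%:R + ln (normR (W n).2`_0 / normR (W n).1`_k).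
have hS : rl S (k%:R * t + c).
 have := rlD (@rl_r (k%:R * t)) hc; apply: rl_ext; apply: nearW => n; rewrite /S.
 by congr (_ + _); ring.
have S0 : \forall n \near omega, 0 <= S n.
 by apply: filterS (rl_gt hS ktc) => n; rewrite mul0r => /ltW.
apply: cone_class_eq.
- by move=> n; apply: bary_ext_ball => //; exact: hgeod_ball.
- by move=> n; exact: hgeod_ball.
apply: (@near0_trans _ (fun n => hgeod (S n) (fseq z n))).
- by move=> n; apply: bary_ext_ball => //; exact: hgeod_ball.
- by move=> n; exact: hgeod_ball.
- by move=> n; exact: hgeod_ball.
- apply: rl0_le (rl_cst (ln d.+1%:R + K1)).
 (* Indices below [k] are not good, so they fall below any prescribed rate; this rate depends on the
    time [t], which is fixed here. *)
 have small : \forall n \near omega, forall j, (j <= d)%N -> (0 < j < k)%N -> nsq (W n).1`_j <= expR (- ((2 * t * k%:R + B) * r n)) * N0 n.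
  apply: near_all => j jd; have [jk|jk] := boolP ((0 < j < k)%N); last by apply: nearW => n h; case/negP: jk.
  by apply: filterS (not_good (2 * t * k%:R + B) (ng j jk)) => n.
 apply: filterS2 (filterI hB q0_bnd) (filterI small (near_const C1)) => n [h1 h2] [h3 h4].
 have rn := scale_ge0 hs n; have n0 := cn2_rW_gt0 n.
 have p0 := coef_nz h1; have q0 := coef_nz h2.
 rewrite ger0_norm; last by apply: hdist_ge0; [apply: bary_ext_ball => //|]; exact: hgeod_ball.
 have hP j : (j <= d)%N -> expR (- (2 * (t * r n) * j%:R)) * nsq (W n).1`_j <= expR (- (2 * (t * r n) * k%:R)) * nsq (W n).1`_k.
  move=> jd; case: (ltngtP j k) => [jk|kj|->//].
   case: j jd jk => [|j] jd jk; first by rewrite /W loc_coef0 nsq0 mulr0 mulr_ge0 ?expR_ge0 ?nsq_ge0.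
   have b1 := h3 _ jd jk; apply: (@le_trans _ _ (1 * nsq (W n).1`_j.+1)).
    by rewrite ler_wpM2r ?nsq_ge0 // -expR0 ler_expR oppr_le0 !mulr_ge0.
   rewrite mul1r; apply: le_trans b1 _; have := ler_wpM2l (expR_ge0 (- (2 * (t * r n) * k%:R))) h1.
   apply: le_trans; rewrite [leRHS]mulrA -expRD ler_pM2r // ler_expR.
   by move: (r n) => x; lra.
  have [l1 _] := loc_le n jd.
  have jk1 : k%:R + 1 <= j%:R :> R by rewrite natr1 ler_nat.
  apply: (@le_trans _ _ (expR (- (2 * (t * r n) * (k%:R + 1))) * (C1 * N0 n))).
   apply: ler_pM; [exact: expR_ge0|exact: nsq_ge0| |exact: l1].
   by rewrite ler_expR lerN2 ler_wpM2l // !mulr_ge0.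
  apply: le_trans (_ : expR (- (2 * (t * r n) * k%:R)) * (expR (- (B * r n)) * N0 n) <= _); last by rewrite ler_wpM2l ?expR_ge0.
  apply: exp_step => //; apply: exp_absorb h4 _.
  have : (B + 1) * r n <= 2 * t * r n by rewrite ler_wpM2r //; rewrite /T in tT; lra.
  by move: (r n) => x; lra.
 have hQ j : (j <= d)%N -> expR (- (2 * (t * r n) * j%:R)) * nsq (W n).2`_j <= nsq (W n).2`_0.
  case: j => [|j] jd; first by rewrite mulr0 oppr0 expR0 mul1r.
  have [_ l1] := loc_le n jd.
  apply: (@le_trans _ _ (expR (- (2 * (t * r n) * 1)) * (C1 * N0 n))).
   apply: ler_pM; [exact: expR_ge0|exact: nsq_ge0| |exact: l1].
   by rewrite ler_expR lerN2 ler_wpM2l ?mulr_ge0 // ler1n.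
  apply: le_trans h2; have := @exp_step (2 * (t * r n)) 0 C1 (expR (- (C0 * r n))) (N0 n) n0.
  rewrite add0r mulr0 oppr0 expR0 mul1r; apply; apply: exp_absorb h4 _.
  have : (C0 + 1) * r n <= 2 * t * r n by rewrite ler_wpM2r //; rewrite /T in tT; lra.
  by move: (r n) => x; lra.
 have D1 : 1 <= d.+1%:R :> R by rewrite ler1n.
 have kk : (0 < k <= d)%N by rewrite k0.
 apply: (hK (f n) (z n) (t * r n) k d.+1%:R kk p0 D1).
  by rewrite [leRHS]sum_const_ord; apply: ler_sum => -[j jd] _; exact: hP.
 by rewrite [leRHS]sum_const_ord; apply: ler_sum => -[j jd] _; exact: hQ.
by apply: near0_radial hS _ S0; exact: ltW.
Qed.

Definition lam n : C := (W n).1`_1 / (W n).2`_0.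

(** Ties the slope to the derivative: an exponentially bounded derivative from below makes the index
    1 good, and for slope 1 the offset is minus the limit of its logarithm. *)
Lemma ray_map : exists k c t0, [/\ (0 < k)%N,
 forall t, t0 <= t -> [/\ 0 <= t, 0 <= k%:R * t + c &
  F (rp z t) = rp (fseq z) (k%:R * t + c)],
 (exists B : R, \forall n \near omega, expR (- (B * r n)) <= normR (lam n)) -> k = 1%N &
 k = 1%N -> rl (fun n => ln (normR (lam n))) (- c) /\ \forall n \near omega, lam n != 0].
have [k [kd gk ng]] := least_good; have /andP[k0 kd'] := kd.
have [c hc] := shift_ex kd' gk; have [t0 ht0] := image_ray kd gk ng hc.
exists k, c, t0; split=> //.
 move=> [B hB]; apply/eqP; rewrite eqn_leq k0 andbT leqNgt; apply/negP => k2; apply: (ng 1%N k2).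
 exists (2 * B + C0); apply: filterS2 hB q0_bnd => n h1 h2.
 have q0 := coef_nz h2; have e : nsq (W n).1`_1 = normR (lam n) ^+ 2 * nsq (W n).2`_0.
  by rewrite normR_sqr /lam -nsqM divfK.
 rewrite e; apply: (@le_trans _ _ (expR (- (B * r n)) ^+ 2 * (expR (- (C0 * r n)) * N0 n))).
  by rewrite mulrA expRX -expRD ler_pM2r ?cn2_rW_gt0 // ler_expR; lra.
 apply: ler_pM => //; rewrite ?exprn_ge0 ?expR_ge0 //; first by rewrite mulr_ge0 ?expR_ge0 // ltW // cn2_rW_gt0.
 by rewrite ler_sqr ?nnegrE ?expR_ge0 ?normR_ge0.
move=> k1; subst k; have [B hB] := gk; split.
 have := rlN hc; apply: rl_ext; apply: filterS2 hB q0_bnd => n h1 h2.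
 have p0 := coef_nz h1; have q0 := coef_nz h2.
 by rewrite /lam normR_div -lnV ?posrE ?divr_gt0 ?normR_gt0 // invf_div.
apply: filterS2 hB q0_bnd => n h1 h2.
by rewrite mulf_neq0 ?invr_eq0 //; [exact: coef_nz h1|exact: coef_nz h2].
Qed.

End Image.

End LimitMapRays.

(** * Chain rule along cycles of ends, and shadowing of repelling cycles *)

Section AsymptoticCycles.
Variables (d : nat) (f : nat -> Ratd R d).
Hypothesis d0 : (0 < d)%N.
Hypothesis tm : tame f.
Local Notation F := (limit_map omega r (fun n => ratfun (f n))).
Local Notation it i z := (fun n => iter i (ratfun (f n)) (z n)).

Lemma rate_le (c1 c2 : R) n : c1 <= c2 -> expR (c1 * r n) <= expR (c2 * r n).
by move=> h; rewrite ler_expR ler_wpM2r // (scale_ge0 hs). Qed.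

Lemma coef_rate (x y c1 m C0 rn : R) (p q : C) : 0 <= rn -> 0 < m -> nsq p <= c1 * m -> c1 <= expR rn ->
 expR (- (C0 * rn)) * m <= nsq q -> normR p <= expR ((`|C0| + 1) * rn) * normR q.
move=> rn0 m0 h1 h2 h3; rewrite -ler_sqr ?nnegrE ?mulr_ge0 ?expR_ge0 ?normR_ge0 // exprMn !normR_sqr.
have h4 := ler_wpM2r (ltW m0) h2; have h5 := le_trans h1 h4.
have h6 : m <= expR (C0 * rn) * nsq q by rewrite -ler_pdivrMl ?expR_gt0 // -expRN.
have h7 := ler_wpM2l (expR_ge0 rn) h6; apply: le_trans h5 (le_trans h7 _).
rewrite mulrA -expRD ler_wpM2r ?nsq_ge0 // expRX ler_expR.
have hC := ler_wpM2r rn0 (ler_norm C0); have hC' := mulr_ge0 (normr_ge0 C0) rn0.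
by move: hC hC'; move: (C0 * rn) => a; lra.
Qed.

Lemma rate_comp n (k c : R) : k <= expR (r n) -> k * expR (c * r n) ^+ 3 <= expR ((3 * c + 1) * r n).
move=> h; have -> : expR ((3 * c + 1) * r n) = expR (r n) * expR (c * r n) ^+ 3.
 by rewrite expRX -expRD; congr expR; ring.
by rewrite ler_wpM2r // exprn_ge0 ?expR_ge0.
Qed.

(** Every constant of the expansion is a ratio of coefficients, hence at most exponential in [r n]
    by tameness; factors depending on [d] alone are absorbed in the rate. *)
Lemma expands_rat_near (z : nat -> Ch) : exists C0, \forall n \near omega,
 expands (ratfun (f n)) (z n) (ratfun (f n) (z n)) (lamf (f n) (z n)) 0 (expR (C0 * r n)).
have [C0 h0] := tm; exists (3 * (`|C0| + 1) + 1).
apply: filterS3 (q0_bnd d0 z h0) (near_const (chc d * 2 ^+ d)) (near_const (48 * d.+1%:R ^+ 2)) => n h1 h2 h3.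
have rn := scale_ge0 hs n; have N0 := cn2_rW_gt0 f n.
have A1 : 1 <= expR ((`|C0| + 1) * r n) by rewrite -expR0 ler_expR mulr_ge0 // addr_ge0.
apply: expands_mono (expands_rat A1 _).
 exact: rate_comp.
move=> j jd; have [l1 l2] := loc_le f z n jd.
by split; [exact: (coef_rate 0 0 rn N0 l1 h2 h1)|exact: (coef_rate 0 0 rn N0 l2 h2 h1)].
Qed.

Lemma expands_iter_near (z : nat -> Ch) q : exists C0, \forall n \near omega,
 expands (iter q (ratfun (f n))) (z n) (iter q (ratfun (f n)) (z n)) (lamn (f n) (z n) q) 0 (expR (C0 * r n)).
elim: q => [|q [C1 IH]].
 exists 0; apply: nearW => n; rewrite mul0r expR0 /lamn big_ord0; exact: expands_id.
have [C2 h2] := expands_rat_near (it q z); exists (3 * Num.max C1 C2 + 1).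
apply: filterS3 IH h2 (near_const 10) => n h3 h4 h5.
apply: expands_mono (rate_comp _ h5) _; rewrite /lamn big_ord_recr /= mulrC.
apply: (@expands_comp (iter q (ratfun (f n))) (ratfun (f n))).
 by apply: expands_mono h3; apply: rate_le; rewrite le_max lexx.
by apply: expands_mono h4; apply: rate_le; rewrite le_max lexx orbT.
Qed.

Lemma lamn_upper (z : nat -> Ch) q : exists C0, \forall n \near omega, normR (lamn (f n) (z n) q) <= expR (C0 * r n).
by have [C0 h] := expands_iter_near z q; exists C0; apply: filterS h => n []. Qed.

Lemma end_map_seq (z : nat -> Ch) : end_map omega r F (es z) = es (fun n => ratfun (f n) (z n)).
have [C0 h0] := tm; have [k [c [t0 [k0 hF _ _]]]] := ray_map d0 z h0.
exact: (end_map_std k0 hF).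
Qed.

Lemma end_map_iter (z : nat -> Ch) i : iter i (end_map omega r F) (es z) = es (it i z).
by elim: i => [//|i IH] /=; rewrite IH end_map_seq. Qed.

Definition finite_length (z : nat -> Ch) (c : R) : Prop :=
 [/\ is_end_length omega r F (es z) c%:E, rl (fun n => ln (normR (lamf (f n) (z n)))) c &
  \forall n \near omega, lamf (f n) (z n) != 0].

Lemma end_length_cases (z : nat -> Ch) : (exists c, finite_length z c) \/ is_end_length omega r F (es z) -oo%E.
have [C0 h0] := tm; have [k [c [t0 [k0 hF _ h1]]]] := ray_map d0 z h0.
have [k1|k1] := eqVneq k 1%N; last by right; apply: (end_length_infinite hF); rewrite ltn_neqAle eq_sym k1.
by left; exists (- c); have [x1 x2] := h1 k1; split=> //; exact: (end_length_finite hF k1).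
Qed.

Lemma end_length_of_lower (z : nat -> Ch) (B : R) : (\forall n \near omega, expR (- (B * r n)) <= normR (lamf (f n) (z n))) ->
 exists c, finite_length z c.
move=> hB; have [C0 h0] := tm; have [k [c [t0 [k0 hF h2 h1]]]] := ray_map d0 z h0.
have k1 : k = 1%N by apply: h2; exists B.
by exists (- c); have [x1 x2] := h1 k1; split=> //; exact: (end_length_finite hF k1).
Qed.

Lemma rl_lamn (z : nat -> Ch) q (c : nat -> R) : (forall i, (i < q)%N -> finite_length (it i z) (c i)) ->
 rl (fun n => ln (normR (lamn (f n) (z n) q))) (\sum_(i < q) c i) /\ \forall n \near omega, lamn (f n) (z n) q != 0.
elim: q => [|q IH] h.
 rewrite big_ord0; split; last by apply: nearW => n; rewrite /lamn big_ord0 oner_neq0.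
 by apply: rl_ext (rl_cst 0); apply: nearW => n; rewrite /lamn big_ord0 normR1 ln1.
have [h1 h2] := IH (fun i iq => h i (leq_trans iq (leqnSn q))).
have [_ h3 h4] := h q (ltnSn q); rewrite big_ord_recr /=; split.
 apply: rl_ext (rlD h1 h3); apply: filterS2 h2 h4 => n x1 x2.
 by rewrite /lamn big_ord_recr /= normRM lnM ?posrE ?normR_gt0.
by apply: filterS2 h2 h4 => n x1 x2; rewrite /lamn big_ord_recr /= mulf_neq0.
Qed.

Lemma lamn_split (g : Ratd R d) x i q : (i < q)%N ->
 lamn g x q = lamn g x i * lamf g (iter i (ratfun g) x) * lamn g (iter i.+1 (ratfun g) x) (q - i.+1).
move=> iq; rewrite /lamn; move: (q - i.+1)%N (subnKC iq) => m <-; rewrite big_split_ord /= big_ord_recr /=.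
by congr (_ * _); apply: eq_bigr => j _; rewrite -[ratfun g (iter i _ _)]iterS -iterD addnS addnC.
Qed.

(** The product of the derivatives is at least 1 and the other factors are at most exponential, so
    no single factor is super-exponentially small. Every end of the cycle then has slope 1 and
    finite length. *)
Lemma factor_lower (z : nat -> Ch) q i : (i < q)%N -> (\forall n \near omega, 1 <= normR (lamn (f n) (z n) q)) ->
 exists c, finite_length (it i z) c.
move=> iq h; have [C1 h1] := lamn_upper z i; have [C2 h2] := lamn_upper (it i.+1 z) (q - i.+1).
apply: (@end_length_of_lower _ (C1 + C2)); apply: filterS3 h h1 h2 => n x0 x1 x2.
rewrite (lamn_split _ _ iq) 2!normRM in x0.
have x3 := ler_pM (normR_ge0 _) (normR_ge0 _) x1 x2; rewrite -expRD -mulrDl in x3.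
rewrite expRN -[leLHS]mul1r ler_pdivrMr ?expR_gt0 //; apply: le_trans x0 _.
by rewrite mulrAC mulrC ler_wpM2l ?normR_ge0.
Qed.

Lemma sum_traject (T : Type) (g : T -> T) (x : T) q (L : T -> \bar R) :
 (\sum_(e <- traject g x q) L e = \sum_(i < q) L (iter i g x))%E.
elim: q x => [|q IH] x; first by rewrite big_nil big_ord0.
rewrite big_cons big_ord_recl IH; congr (_ + _)%E; apply: eq_bigr => i _.
by rewrite -iterSr.
Qed.

Lemma total_length_finite (z : nat -> Ch) q (c : nat -> R) (A : seq (set (R -> set (nat -> 'rV[R]_3)))) :
 A = traject (end_map omega r F) (es z) q ->
 (forall i, (i < q)%N -> finite_length (it i z) (c i)) -> is_total_length omega r F A (\sum_(i < q) c i)%:E.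
move=> -> h; pose L e := xget 0%E [set l | is_end_length omega r F e l].
have hL i : (i < q)%N -> is_end_length omega r F (es (it i z)) (L (es (it i z))) /\ L (es (it i z)) = (c i)%:E.
 move=> iq; have [h1 _ _] := h i iq.
 have h2 : is_end_length omega r F (es (it i z)) (L (es (it i z))).
  by apply: (@xgetPex _ 0%E [set l | is_end_length omega r F (es (it i z)) l]); exists (c i)%:E.
 by split=> //; apply: (end_length_uniq h2 h1).
exists L; last first.
 rewrite sum_traject -sumEFin; apply: eq_bigr => i _.
 by rewrite end_map_iter (hL i (ltn_ord i)).2.
by move=> e /trajectP[i iq ->]; rewrite end_map_iter; exact: (hL i iq).1.
Qed.

(** In a sum of extended reals one term equal to minus infinity makes the total minus infinity; a
    positive total thus forces all lengths to be finite, and they are limits of logarithms of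
    derivatives. *)
Lemma total_length_pos (z : nat -> Ch) q l : is_total_length omega r F (traject (end_map omega r F) (es z) q) l -> (0 < l)%E ->
 exists2 s, 0 < s & rl (fun n => ln (normR (lamn (f n) (z n) q))) s.
move=> [L hL ->] l0; have h i : exists c, (i < q)%N -> finite_length (it i z) c /\ L (es (it i z)) = c%:E.
 have [iq|iq] := boolP (i < q)%N; last by exists 0.
 have Li : is_end_length omega r F (es (it i z)) (L (es (it i z))).
  by apply: hL; rewrite -end_map_iter; apply/trajectP; exists i.
 have [[c hc]|hN] := end_length_cases (it i z).
  by exists c => _; split=> //; have [x _ _] := hc; apply: (end_length_uniq Li x).
 exfalso; have e := end_length_uniq Li hN.
 have : (\sum_(e <- traject (end_map omega r F) (es z) q) L e = -oo)%E.
  apply/esum_eqNyP; exists (es (it i z)); split=> //.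
  by rewrite -end_map_iter; apply/trajectP; exists i.
 by move=> e'; rewrite e' in l0.
have [c hc] := choice h; exists (\sum_(i < q) c i).
 move: l0; rewrite sum_traject (eq_bigr (fun i : 'I_q => (c i)%:E)).
  by rewrite sumEFin lte_fin.
 by move=> i _; rewrite end_map_iter (hc i (ltn_ord i)).2.
by have [] := @rl_lamn z q c (fun i iq => (hc i iq).1).
Qed.

(** The q-th iterate of [z n] is super-exponentially close to [z n], while the local derivative is
    large and all constants are exponential. After returning to the chart at [z n],
    [expands_repelling] applies. *)
Lemma repelling_shadow (z : nat -> Ch) q (s : R) : 0 < s -> rl (fun n => ln (normR (lamn (f n) (z n) q))) s ->
 es (it q z) = es z ->
 \forall n \near omega, exists zeta, [/\ chordal zeta (z n) <= 4 * chordal (iter q (ratfun (f n)) (z n)) (z n),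
  iter q (ratfun (f n)) zeta = zeta & julia (ratfun (f n)) zeta].
move=> s0 hl /std_end_chordal hc; have [C0 hC] := expands_iter_near z q.
pose C1 := `|C0| + 1; have C10 : 0 <= C1 by rewrite addr_ge0.
have big : \forall n \near omega, 3 <= normR (lamn (f n) (z n) q).
 have s2 : s / 2 < s by lra.
 apply: filterS2 (rl_gt hl s2) (near_r (2 * ln 3 / s)) => n h1 h2.
 rewrite ltr_pdivrMr // in h2; have h3 : ln 3 < ln (normR (lamn (f n) (z n) q)).
  by apply: lt_trans h1; move: h2; move: (ln 3) (r n) => a b; lra.
 rewrite leNgt; apply/negP => l3; move: h3; rewrite ltNge => /negP; apply.
 have [e|l0] := eqVneq (lamn (f n) (z n) q) 0.
  by rewrite e normR0 ln0 // ln_ge0 // ler1n.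
 by rewrite ler_ln ?posrE ?normR_gt0 // ltW.
(* The rate [3 * C1 + 1] pays for the cube of exp(C1 r) produced by the composition and for the
   numerical constant 320 = 16 * 10 * 2. *)
apply: filterS3 (filterI big hC) (filterI (near_const 1536) (near_const 320)) (hc (3 * C1 + 1)) => n [b1 b2] [b3 b4] b5.
have rn := scale_ge0 hs n; set x := iter q (ratfun (f n)) (z n) in b2 b5 *.
have c1 : chordal x (z n) <= 1.
 apply: le_trans b5 _; rewrite -expR0 ler_expR oppr_le0 mulr_ge0 //.
 by rewrite addr_ge0 // mulr_ge0.
have [l1 [hl1 e1]] := expands_id_near c1.
have AC : expR (C0 * r n) <= expR (C1 * r n).
 by apply: rate_le; rewrite /C1; have := ler_norm C0; lra.
have A2 : 1536 <= expR (C1 * r n).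
 by apply: le_trans b3 _; rewrite ler_expR -[leLHS]mul1r ler_wpM2r // /C1 lerDr.
have e2 := expands_comp (expands_mono AC b2) (expands_mono A2 e1).
have [||zeta [z1 z2 z3]] := expands_repelling e2.
- rewrite normRM -[leLHS]mul1r; apply: ler_pM => //.
- have p0 : 0 < 16 * (10 * expR (C1 * r n) ^+ 3) by rewrite !mulr_gt0 ?exprn_gt0 ?expR_gt0.
 rewrite -[leRHS]mul1r ler_pdivlMr //.
 have : 320 * expR (C1 * r n) ^+ 3 * chordal x (z n) <= 1.
  rewrite expRX; apply: (@le_trans _ _ (expR (r n) * expR (C1 * r n * 3%:R) * expR (- ((3 * C1 + 1) * r n)))).
   apply: ler_pM; [|exact: chordal_ge0| |exact: b5].
    exact: mulr_ge0 (ler0n _ _) (expR_ge0 _).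
   by rewrite ler_wpM2r ?expR_ge0.
  by rewrite -!expRD -[leRHS]expR0 ler_expR; lra.
 by move: (expR _ ^+ 3) (chordal _ _) => a b; lra.
by exists zeta; split=> //; apply: le_trans z1 _; lra.
Qed.

End AsymptoticCycles.

End AsymptoticCone.

(** * Cycles, non-negativity of the radius, and marked periodic points *)

Section Cycles.
Context {T : eqType}.
Implicit Types (g : T -> T) (x : T).

Lemma fcycle_traject g x p : fcycle g (x :: p) -> x :: p = traject g x (size p).+1 /\ iter (size p).+1 g x = x.
move=> /fpathP[n e]; have sn : (size p).+1 = n by rewrite -(size_traject g (g x) n) -e size_rcons.
move: e; rewrite -sn trajectSr => /rcons_inj[e1 e2]; split; first by rewrite /= -e1.
by rewrite iterSr.
Qed.

Lemma traject_fcycle g x q : iter q g x = x -> fcycle g (traject g x q).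
case: q => [//|q] e; rewrite [traject _ _ _]/= /cycle.
have -> : rcons (traject g (g x) q) x = traject g (g x) q.+1 by rewrite trajectSr -iterSr e.
exact: fpath_traject.
Qed.

Lemma map_traject (S : Type) (g : T -> T) (h : S -> S) (k : T -> S) x q : (forall y, k (g y) = h (k y)) ->
 map k (traject g x q) = traject h (k x) q.
by move=> e; elim: q x => [//|q IH] x /=; rewrite IH e. Qed.

End Cycles.

Lemma sup_ge0 (S : set R) : (forall x, S x -> 0 <= x) -> 0 <= sup S.
move=> h; have [hs|/sup_out -> //] := pselect (has_sup S).
by have [[x Sx] _] := hs; apply: le_trans (h x Sx) _; exact: sup_upper_bound.
Qed.

Lemma rescaling_ge0 (g : Ch -> Ch) : 0 <= rescaling g.
apply: lb_le_inf; first by exists (preim_radius g 0), 0 => //; exact: ball30.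
by move=> _ [x bx <-]; apply: sup_ge0 => _ [y [yb _] <-]; exact: hdist_ge0.
Qed.

(** The normalization at the origin feeds [value_lower] with radius [r n + 1]; the extra unit costs
    a constant, absorbed by one more unit in the rate. *)
Lemma tame_of_radius (omega : set_system nat) (r : nat -> R) d (f : nat -> Ratd R d) : scale omega r -> (0 < d)%N ->
 (forall n, preim_radius (ratfun (f n)) 0 <= r n + 1) -> tame omega r f.
move=> hs d0 h; have [c c0 hc] := @value_lower d d0; have UF := scale_ultra hs.
exists (2 * d%:R + 1); apply: filterS (near_const hs (c^-1 * expR (2 * d%:R))) => n h1 a b ab.
have rn := scale_ge0 hs n; have r1 : 0 <= r n + 1 by rewrite addr_ge0.
apply: le_trans (hc (f n) _ r1 (h n) a b ab); rewrite ler_wpM2r ?cn2_ge0 //.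
have -> : - ((2 * d%:R + 1) * r n) = - (r n) + - (2 * d%:R * r n) by ring.
have -> : - (2 * d%:R * (r n + 1)) = - (2 * d%:R) + - (2 * d%:R * r n) by ring.
rewrite !expRD mulrA ler_wpM2r ?expR_ge0 // !expRN ler_pdivlMr ?expR_gt0 // mulrC ler_pdivrMr ?expR_gt0 //.
by rewrite -ler_pdivrMl.
Qed.

Section Markings.
Context (J : topologicalType) (sigma : J -> J) (d : nat) (f : Ratd R d) (phi : J -> Chat R).
Hypothesis mk : marking sigma (ratfun f) phi.

Lemma marking_iter i t : phi (iter i sigma t) = iter i (ratfun f) (phi t).
by have [_ _ _ h] := mk; elim: i => [//|i IH] /=; rewrite h IH. Qed.

Lemma marking_julia t : julia (ratfun f) (phi t).
by have [_ <- _ _] := mk; exists t. Qed.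

Lemma marking_periodic q x : julia (ratfun f) x -> iter q (ratfun f) x = x -> exists2 t, phi t = x & iter q sigma t = t.
have [_ h [psi _ hK] _] := mk; rewrite -h => -[t _ <-] e; exists t => //.
by rewrite -[LHS]hK marking_iter e hK.
Qed.

(** A marked point is in the Julia set, and a periodic point whose multiplier has modulus below 1 is
    in the Fatou set. *)
Lemma periodic_multiplier q t : (0 < q)%N -> iter q sigma t = t ->
 sphere_deriv (iter q (ratfun f)) (phi t) = lamn f (phi t) q /\ 1 <= normR (lamn f (phi t) q).
move=> q0 e; have [A hA] := expands_iter f (phi t) q; rewrite -marking_iter e in hA.
split; first exact: expands_deriv hA.
rewrite leNgt; apply/negP => l1; apply: (marking_julia (t := t)).
exact: expands_attracting q0 hA l1.
Qed.

Lemma finite_periodic q : (0 < q)%N -> exists s : seq J, forall t, iter q sigma t = t -> t \in s.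
move=> q0; have [s hs] := finite_julia_fixed f q0; have [_ _ [psi _ hK] _] := mk.
exists (map psi s) => t e; rewrite -(hK t); apply: map_f; apply: hs; first exact: marking_julia.
by rewrite -marking_iter e.
Qed.

End Markings.

End LimitingMap.

Theorem theorem1p2 (R : realType) (d : nat) (hd : (2 <= d)%N)
  (omega : set_system nat) (ultra : UltraFilter omega)
  (nonprincipal : forall n : nat, ~ omega [set n])
  (H : set (Moduli R d)) (hypH : hyperbolic_component H)
  (J : topologicalType) (sigma : J -> J) (modelJ : topological_model H sigma)
  (f : nat -> Ratd R d) (fH : forall n, H (cls (f n)))
  (degf : degenerating (fun n => cls (f n)))
  (normf : forall n,
   preim_radius (ratfun (f n)) 0 <= rescaling (ratfun (f n)) + 1)
  (phi : nat -> J -> Chat R)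
  (markphi : forall n, marking sigma (ratfun (f n)) (phi n)) :
 let r := fun n => rescaling (ratfun (f n)) in
 let F := limit_map omega r (fun n => ratfun (f n)) in
 let phi_end := fun t : J => end_of_seq omega r (fun n => phi n t) in
 (forall C : seq J, periodic_cycle sigma C ->
   exists2 l : \bar R, is_total_length omega r F (map phi_end C) l &
    (fun n => (cycle_length (ratfun (f n)) (phi n) C / r n)%:E)
     @ omega --> l) /\
 (forall A, repelling_cycle omega r F A ->
   exists2 C : seq J, periodic_cycle sigma C &
    [set` A] = phi_end @` [set` C]).
Proof.
move=> r F phi_end; have d0 : (0 < d)%N by exact: ltnW.
have hs : scale omega r.
 split=> [//|n|B|P].
 - exact: rescaling_ge0.
 - exact: degenerating_rescaling d0 degf normf B.
 - exact: near_omega.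
have tm : tame omega r f by apply: tame_of_radius.
have step t : phi_end (sigma t) = end_map omega r F (phi_end t).
 rewrite /phi_end (end_map_seq hs d0 tm); congr (end_of_seq _ _ _); apply/funext => n.
 by have [_ _ _ h] := markphi n.
have iterE i t : (fun n => phi n (iter i sigma t)) = (fun n => iter i (ratfun (f n)) (phi n t)).
 by apply/funext => n; exact: marking_iter.
split=> [[|t p] [] // _ _ /fcycle_traject[eC]|A [[endA [A0 uA cA]] [l hl l0]]].
 set q := (size p).+1 in eC * => ht; pose z n := phi n t.
 (* The multiplier along a marked cycle has modulus at least 1 for every n, which is the hypothesis
    of [factor_lower]. *)
 have lam1 : \forall n \near omega, 1 <= normR (lamn (f n) (z n) q).
  by apply: nearW => n; have [] := periodic_multiplier (markphi n) (ltn0Sn _) ht.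
 have ex i : exists c, (i < q)%N -> finite_length omega r f (fun n => iter i (ratfun (f n)) (z n)) c.
  have [iq|] := boolP (i < q)%N; last by exists 0.
  by have [c hc] := factor_lower hs d0 tm iq lam1; exists c.
 have [c hc] := choice ex; exists (\sum_(i < q) c i)%:E.
  by apply: (total_length_finite hs d0 tm _ hc); rewrite eC; exact: map_traject.
 have [hrl _] := rl_lamn hs hc; apply: cvg_EFin; first exact: nearW.
 suff -> : fine \o (fun n => (cycle_length (ratfun (f n)) (phi n) (t :: p) / r n)%:E) =
  (fun n => ln (normR (lamn (f n) (z n) q)) / r n) by exact: hrl.
 by apply/funext => n /=; rewrite -/q (periodic_multiplier (markphi n) (ltn0Sn _) ht).1.
case: A A0 uA cA endA hl => [//|e p] _ uA /fcycle_traject[eA he] endA hl; set q := (size p).+1 in eA he; set A' := e :: p in eA uA hl *.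
have [z ez] : exists z, e = end_of_seq omega r z by apply: (cone_end_std hs); apply: endA; exact: mem_head.
rewrite eA ez in hl; have [s s0 hrl] := total_length_pos hs d0 tm hl l0.
have cyc : end_of_seq omega r (fun n => iter q (ratfun (f n)) (z n)) = end_of_seq omega r z.
 by rewrite -(end_map_iter hs d0 tm) -ez.
(* The marking at index 0 is used for finiteness, but the resulting list lives in [J] and serves
   every n. *)
have [S hS] := finite_periodic (markphi 0%N) (ltn0Sn (size p)); rewrite -/q in hS.
pose P t n := iter q sigma t = t /\ chordal (phi n t) (z n) <= 4 * chordal (iter q (ratfun (f n)) (z n)) (z n).
have near1 : \forall n \near omega, exists2 t, t \in S & P t n.
 apply: filterS (repelling_shadow hs d0 tm s0 hrl cyc) => n [zeta [h1 h2 h3]].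
 by have [t et ht] := marking_periodic (markphi n) h3 h2; exists t; rewrite ?hS // /P et.
have [_ [t1 _ _]] := @filter_ex _ omega _ _ near1.
have near2 : \forall n \near omega, exists2 j, (j <= size S)%N & P (nth t1 S j) n.
 apply: filterS near1 => n [t tS Pt]; exists (index t S); first exact: index_size.
 by rewrite nth_index.
(* The shadowing point may correspond to a different element of [J] for each n; only finitely many
   are possible, so one of them occurs along [omega]. *)
have [j _] := ultra_pigeon hs near2; set t := nth t1 S j => ht.
have [_ [fixt _]] := @filter_ex _ omega _ _ ht.
(* The marked point is within 4 times a super-exponentially small distance of [z n], hence defines
   the same end; one extra unit in the rate absorbs the 4. *)
have et : phi_end t = e.
 rewrite ez; apply/(std_end_chordal hs) => B; move/(std_end_chordal hs): cyc => /(_ (B + 1)) cyc.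
 apply: filterS3 ht cyc (near_const hs 4) => n [_ h1] h2 h3; apply: le_trans h1 _.
 apply: le_trans (ler_pM _ (chordal_ge0 _ _) h3 h2) _ => //.
 by rewrite -expRD ler_expR; lra.
have eAC : A' = map phi_end (traject sigma t q) by rewrite eA -et; exact/esym/map_traject.
exists (traject sigma t q); last first.
 rewrite -/A' eAC; apply/seteqP; split=> [x xA|x [y yC <-]].
  by have /seq.mapP[y yC ->] : x \in map phi_end (traject sigma t q) := xA; exists y.
 by have : phi_end y \in map phi_end (traject sigma t q) by exact: (map_f phi_end yC).
split=> //; last exact: traject_fcycle.
(* The points of the trajectory are distinct because the ends they define are: [q] is the length of
   the cycle of ends, so it is also the exact period of [t]. *)
by apply: (map_uniq (f := phi_end)); rewrite -eAC.
Qed.
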